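(* Let $p\in(1,\infty)$, let $\Omega\subset\mathbb{R}^n$ be a connected bounded domain with boundary of class $C^2$, and let $c<0$ be a constant. Let $u\in C(\overline\Omega)$ be a viscosity solution of the overdetermined boundary value problem $$-\Delta_p^N u=1\ \text{ in }\Omega,\qquad u=0\ \text{ and }\ \frac{\partial u}{\partial\nu}=c\ \text{ on }\partial\Omega,$$ where $\Delta_p^N$ is the normalized $p$-Laplacian, $\nu$ is the outward unit normal, the equation is understood in the viscosity sense, the Dirichlet condition holds pointwise, and the Neumann condition is understood in the weak (test function) sense described in the context. Then $\Omega$ is a ball.
   Context: Normalized (game-theoretic) $p$-Laplacian: for $p\in(1,\infty)$ and where $\nabla u\neq0$, $$\Delta_p^N u=\frac1p|\nabla u|^{2-p}\,\mathrm{div}\left(|\nabla u|^{p-2}\nabla u\right)=\frac1p\,\mathrm{trace}(\nabla^2u)+\frac{p-2}{p}\,\frac{\langle\nabla^2u\,\nabla u,\nabla u\rangle}{|\nabla u|^2}.$$ Viscosity solutions of $-\Delta_p^Nu=1$: for $q\in\mathbb{R}^n\setminus\{0\}$ and $X$ a real symmetric $n\times n$ matrix put $$F(q,X)=-\frac{p-2}{p}|q|^{-2}\langle Xq,q\rangle-\frac1p\mathrm{trace}(X)-1.$$ Let $F_*$ and $F^*$ be the lower and upper semicontinuous hulls: $F_*(q,X)=F^*(q,X)=F(q,X)$ if $q\ne0$, and $F_*(0,X)=\inf_{a\in\mathbb{R}^n\setminus\{0\}}F(a,X)$, $F^*(0,X)=\sup_{a\in\mathbb{R}^n\setminus\{0\}}F(a,X)$.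 A function $u\in C(\Omega)$ is a viscosity subsolution if for every $x\in\Omega$ and every $C^2$ function $\varphi$ such that $\varphi-u$ has a (local) minimum at $x$ one has $F_*(\nabla\varphi(x),\nabla^2\varphi(x))\le0$. It is a viscosity supersolution if for every $x\in\Omega$ and every $C^2$ function $\psi$ such that $\psi-u$ has a (local) maximum at $x$ one has $F^*(\nabla\psi(x),\nabla^2\psi(x))\ge0$. It is a viscosity solution if it is both. Neumann condition: $\frac{\partial u}{\partial\nu}=c$ on $\partial\Omega$ means the following. Any $C^2$ function $\varphi$ such that $\varphi-u$ has a (local, relative to $\overline\Omega$) minimum at a point $x\in\partial\Omega$ satisfies $\frac{\partial\varphi}{\partial\nu}(x)\le c$; and any $C^2$ function $\psi$ such that $\psi-u$ has a (local, relative to $\overline\Omega$) maximum at a point $y\in\partial\Omega$ satisfies $\frac{\partial\psi}{\partial\nu}(y)\ge c$. *)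

(* Defs.v *)
From HB Require Import structures.
From mathcomp Require Import all_boot all_order all_algebra.
From mathcomp Require Import all_classical all_reals all_analysis.

Set Implicit Arguments.
Unset Strict Implicit.
Unset Printing Implicit Defensive.

Import Order.TTheory GRing.Theory Num.Theory.
Import numFieldNormedType.Exports.

Local Open Scope classical_set_scope.
Local Open Scope ring_scope.

(* R^n is 'rV[R]_n.  The library norm on it is the sup norm; it gives the usual
   topology and bounded sets, but lengths and balls below are Euclidean. *)
Section Euclidean.
Context {R : realType} {n : nat}.
Implicit Types (x y q e : 'rV[R]_n) (X : 'M[R]_n).

Definition dot x y : R := (x *m y^T) 0 0.
Definition enorm x : R := Num.sqrt (dot x x).
Definition quad X q : R := (q *m X *m q^T) 0 0.
Definition eball x (r : R) : set 'rV[R]_n := [set y | enorm (y - x) < r].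

End Euclidean.

Section Smooth.
Context {R : realType} {n : nat}.
Implicit Types (f : 'rV[R]_n -> R) (x e : 'rV[R]_n).

Definition partial (i : 'I_n) f : 'rV[R]_n -> R :=
  fun x => 'D_(delta_mx 0 i) f x.

Definition gradient f x : 'rV[R]_n := \row_i partial i f x.
Definition hessian f x : 'M[R]_n := \matrix_(i, j) partial i (partial j f) x.

Definition C2_at f x : Prop :=
  {for x, continuous f} /\
  forall i : 'I_n,
    [/\ derivable f x (delta_mx 0 i),
        {for x, continuous (partial i f)} &
        forall j : 'I_n,
          derivable (partial i f) x (delta_mx 0 j) /\
          {for x, continuous (partial j (partial i f))}].

Definition C2 f : Prop := forall x, C2_at f x.
Definition C2_near f x : Prop := \forall y \near x, C2_at f y.

Definition local_min (A : set 'rV[R]_n) f x : Prop :=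
  \forall y \near within A (nbhs x), f x <= f y.
Definition local_max (A : set 'rV[R]_n) f x : Prop :=
  \forall y \near within A (nbhs x), f y <= f x.

End Smooth.

Section Domain.
Context {R : realType} {n : nat}.
Implicit Types (Omega : set 'rV[R]_n) (gamma : 'rV[R]_n -> R).
Implicit Types (x e nu : 'rV[R]_n).

Definition boundary Omega : set 'rV[R]_n := closure Omega `\` Omega°.

Definition bounded_domain Omega : Prop :=
  [/\ open Omega, connected Omega, Omega !=set0 & bounded_set Omega].

(* Coordinates adapted to the unit vector e: y splits into its orthogonal
   projection y - <y, e> e on the hyperplane e^perp and its height <y, e>.
   [graph_gap e gamma y < 0] says that y lies strictly above the graph of the
   restriction of gamma to e^perp. *)
Definition graph_gap e gamma : 'rV[R]_n -> R :=
  fun y => gamma (y - dot y e *: e) - dot y e.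

Definition C2_chart Omega x e gamma : Prop :=
  [/\ enorm e = 1, C2 gamma &
      \forall y \near x, Omega y <-> graph_gap e gamma y < 0].

Definition C2_boundary Omega : Prop :=
  forall x, boundary Omega x -> exists e gamma, C2_chart Omega x e gamma.

(* Omega is a strict sublevel set of graph_gap near x, so the gradient of
   graph_gap (nonzero, its e-component being -1) points outwards; the normalized
   gradient does not depend on the chart. *)
Definition outward_unit_normal Omega x nu : Prop :=
  exists e gamma, C2_chart Omega x e gamma /\
    nu = (enorm (gradient (graph_gap e gamma) x))^-1
           *: gradient (graph_gap e gamma) x.

End Domain.

Section Viscosity.
Context {R : realType} {n : nat}.
Implicit Types (p c : R) (q : 'rV[R]_n) (X : 'M[R]_n).
Implicit Types (Omega : set 'rV[R]_n) (u phi psi : 'rV[R]_n -> R).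

Definition Fp p q X : R :=
  - ((p - 2) / p) * enorm q ^- 2 * quad X q - p^-1 * \tr X - 1.

(* For n > 0 the set of values of [Fp p ^~ X] off the origin is nonempty and
   bounded (the quotient is at most the operator norm of X in absolute value),
   so that inf and sup are the genuine bounds. *)
Definition Fp_lower p q X : R :=
  if q == 0 then inf [set Fp p a X | a in [set a | a != 0]] else Fp p q X.
Definition Fp_upper p q X : R :=
  if q == 0 then sup [set Fp p a X | a in [set a | a != 0]] else Fp p q X.

Definition viscosity_subsolution p Omega u : Prop :=
  forall x phi, Omega x -> C2_near phi x -> local_min Omega (phi - u) x ->
    Fp_lower p (gradient phi x) (hessian phi x) <= 0.

Definition viscosity_supersolution p Omega u : Prop :=
  forall x psi, Omega x -> C2_near psi x -> local_max Omega (psi - u) x ->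
    0 <= Fp_upper p (gradient psi x) (hessian psi x).

Definition viscosity_solution p Omega u : Prop :=
  viscosity_subsolution p Omega u /\ viscosity_supersolution p Omega u.

Definition dirichlet Omega u : Prop := forall x, boundary Omega x -> u x = 0.

Definition neumann c Omega u : Prop :=
  forall x nu, boundary Omega x -> outward_unit_normal Omega x nu ->
    (forall phi, C2_near phi x -> local_min (closure Omega) (phi - u) x ->
       'D_nu phi x <= c) /\
    (forall psi, C2_near psi x -> local_max (closure Omega) (psi - u) x ->
       c <= 'D_nu psi x).

End Viscosity.

(* Main.v *)
(** Moving planes, with regularity theory replaced by second-order jets.
    Viscosity touching is restated as [LA p q X = - p] at jets with gradient
    [q <> 0].  Doubling of variables makes [u] Lipschitz with constant [- c], and
    barriers on the two tangent balls trap [u] between [d - K d^2] and [d], up to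
    the factor [- c], where [d] is the distance to the boundary.  In a collar of
    the boundary [u] is thus, at scale [d], close to an affine function with
    nonzero gradient; an Ishii-Lions coupling gives compactness, and replacing [u] by harmonic
    polynomials at decreasing scales produces jets with bounded Hessian.  There
    the difference of [u] and its mirror image obeys the strong maximum principle
    and Hopf's lemma, at touching points and at corners, while in the
    whole cap only weak comparison is needed.  So the critical plane of every
    direction is a plane of symmetry; these planes share one point, the center. *)

Require Import Defs.
From HB Require Import structures.
From mathcomp Require Import all_boot all_order all_algebra.
From mathcomp Require Import all_classical all_reals all_analysis.
From mathcomp Require Import ring lra.

Set Implicit Arguments.
Unset Strict Implicit.
Unset Printing Implicit Defensive.

Import Order.TTheory GRing.Theory Num.Theory.
Import numFieldNormedType.Exports.

Local Open Scope classical_set_scope.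
Local Open Scope ring_scope.

(* [lra] and [nra] are slow in large contexts: drop what they cannot use. *)
Ltac lean := repeat match goal with
  | H : forall _, _ |- _ => clear H
  | H : ex _ |- _ => clear H
  | H : ex2 _ _ |- _ => clear H
  | x := _ |- _ => clearbody x
  end.
Tactic Notation "lra" := lean; lra.
Tactic Notation "nra" := lean; nra.
Ltac vec := apply/rowP => ?; rewrite !mxE; lean; ring.
Ltac pos := first
  [ assumption | by [] | solve [apply: ltW; assumption]
  | solve [rewrite divr_gt0; pos] | solve [rewrite divr_ge0; pos]
  | solve [apply: mulr_gt0; pos] | solve [apply: mulr_ge0; pos]
  | solve [rewrite invr_gt0; pos] | solve [rewrite invr_ge0; pos]
  | solve [rewrite sqr_ge0; done] | solve [rewrite exprn_gt0; pos] | solve [rewrite exprn_ge0; pos]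
  | solve [rewrite lt_min; apply/andP; split; pos] | solve [rewrite le_min; apply/andP; split; pos]
  | solve [rewrite sqrtr_gt0; pos] | solve [rewrite sqrtr_ge0; pos]
  | solve [apply: addr_gt0; pos] | solve [apply: ltr_wpDl; pos] | solve [apply: ltr_wpDr; pos]
  | solve [apply: addr_ge0; pos] | solve [rewrite powR_gt0; pos] | solve [rewrite powR_ge0; pos]
  | solve [rewrite ltr0n; done] ].
Ltac feed S := match type of S with ?P -> _ =>
  let h := fresh in have h : P; [|specialize (S h); clear h] end.

(** The operator is singular where the gradient vanishes, which does happen inside, and [u] is not
    known to be differentiable; so two solutions cannot be compared by linearizing their difference
    in a whole cap. The nonzero Neumann constant gives a usable gradient, but only near the
    boundary. Hence it is never shown that [u] equals its mirror image in the cap. What is shown is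
    that contact of the reflected cap with the boundary spreads along the boundary. As the boundary
    need not be connected, this is transferred to the domain: chords cut out by contact points fill
    a set that is open and closed in it. Harmonic polynomials serve three times: as comparison
    functions replacing twice differentiability of semiconvex functions in the theorem on sums,
    through their interior derivative bounds, and as models at every scale of the regularity
    iteration. They come from Bernstein approximation and Fischer's decomposition, so finitely many
    of them serve all data with a common modulus of continuity. Weak comparison is cheap because
    passing from [u] to [(1 - th) * u] makes the subsolution inequality strict. *)

Lemma eq_ler {R : realType} (a b : R) : a = b -> a <= b.
Proof. by move=> ->. Qed.

(** * Euclidean inner product, norm, and the topology in Euclidean terms *)

Section Euclid.
Context {R : realType} {n : nat}.
Implicit Types (x y z h : 'rV[R]_n) (X : 'M[R]_n) (a r : R).

Lemma dotE x y : dot x y = \sum_i x 0 i * y 0 i.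
Proof. by rewrite /dot mxE; apply: eq_bigr => i _; rewrite mxE. Qed.

Lemma dotC x y : dot x y = dot y x.
Proof. by rewrite !dotE; apply: eq_bigr => i _; rewrite mulrC. Qed.

Lemma dotDl x y z : dot (x + y) z = dot x z + dot y z.
Proof. by rewrite /dot mulmxDl mxE. Qed.

Lemma dotZl a x y : dot (a *: x) y = a * dot x y.
Proof. by rewrite /dot -scalemxAl mxE. Qed.

Lemma dotNl x y : dot (- x) y = - dot x y.
Proof. by rewrite -scaleN1r dotZl mulN1r. Qed.

Lemma dotBl x y z : dot (x - y) z = dot x z - dot y z.
Proof. by rewrite dotDl dotNl. Qed.

Lemma dotDr x y z : dot z (x + y) = dot z x + dot z y.
Proof. by rewrite dotC dotDl !(dotC z). Qed.

Lemma dotZr a x y : dot x (a *: y) = a * dot x y.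
Proof. by rewrite dotC dotZl dotC. Qed.

Lemma dotNr x y : dot x (- y) = - dot x y.
Proof. by rewrite dotC dotNl dotC. Qed.

Lemma dotBr x y z : dot z (x - y) = dot z x - dot z y.
Proof. by rewrite dotDr dotNr. Qed.

Lemma dot0l x : dot 0 x = 0.
Proof. by rewrite -(scale0r 0) dotZl mul0r. Qed.

Lemma dot0r x : dot x 0 = 0.
Proof. by rewrite dotC dot0l. Qed.

Definition dotL := (dotDl, dotNl, dotZl, dotDr, dotNr, dotZr, dot0l, dot0r).

Lemma dot_ge0 x : 0 <= dot x x.
Proof. by rewrite dotE sumr_ge0// => i _; rewrite -expr2 sqr_ge0. Qed.

Lemma dot_eq0 x : (dot x x == 0) = (x == 0).
Proof.
rewrite dotE psumr_eq0; last by move=> i _; rewrite -expr2 sqr_ge0.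
apply/allP/eqP => [h|->]; last by move=> i _; rewrite mxE mul0r eqxx.
apply/rowP => i; rewrite mxE.
by have := h i; rewrite mem_index_enum => /(_ isT); rewrite -expr2 sqrf_eq0 => /eqP.
Qed.

Lemma dot_gt0 x : (0 < dot x x) = (x != 0).
Proof. by rewrite lt0r dot_eq0 dot_ge0 andbT. Qed.

Lemma enorm_ge0 x : 0 <= enorm x.
Proof. exact: sqrtr_ge0. Qed.

Lemma enorm_sqr x : enorm x ^+ 2 = dot x x.
Proof. by rewrite sqr_sqrtr ?dot_ge0. Qed.

Lemma enorm_eq0 x : (enorm x == 0) = (x == 0).
Proof. by rewrite -sqrf_eq0 enorm_sqr dot_eq0. Qed.

Lemma enorm_gt0 x : (0 < enorm x) = (x != 0).
Proof. by rewrite lt0r enorm_eq0 enorm_ge0 andbT. Qed.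

Lemma enorm0 : enorm (0 : 'rV[R]_n) = 0.
Proof. by apply/eqP; rewrite enorm_eq0. Qed.

Lemma enormN x : enorm (- x) = enorm x.
Proof. by rewrite /enorm dotNl dotNr opprK. Qed.

Lemma enormC x y : enorm (x - y) = enorm (y - x).
Proof. by rewrite -opprB enormN. Qed.

Lemma enormZ a x : enorm (a *: x) = `|a| * enorm x.
Proof. by rewrite /enorm dotZl dotZr mulrA -expr2 sqrtrM ?sqr_ge0// sqrtr_sqr. Qed.

Lemma dot_le x y : dot x y <= enorm x * enorm y.
Proof.
have [->|y0] := eqVneq y 0; first by rewrite dot0r enorm0 mulr0.
have yy : 0 < dot y y by rewrite dot_gt0.
have h : dot x y ^+ 2 <= dot x x * dot y y.
  have := dot_ge0 (dot y y *: x - dot x y *: y).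
  rewrite [X in 0 <= X -> _](_ : _ = dot y y * (dot x x * dot y y - dot x y ^+ 2)).
    by rewrite pmulr_rge0// subr_ge0.
  by rewrite !dotL (dotC y x); ring.
have [d|d] := ltP (dot x y) 0.
  by apply: (le_trans (ltW d)); rewrite mulr_ge0 ?enorm_ge0.
rewrite -(@ler_pXn2r _ 2)// ?nnegrE ?mulr_ge0 ?enorm_ge0//.
by rewrite exprMn !enorm_sqr.
Qed.

Lemma ler_dot x y : `|dot x y| <= enorm x * enorm y.
Proof.
rewrite ler_norml dot_le andbT lerNl -dotNl.
by rewrite -(enormN x) dot_le.
Qed.

Lemma ler_enormD x y : enorm (x + y) <= enorm x + enorm y.
Proof.
rewrite -(@ler_pXn2r _ 2)// ?nnegrE ?addr_ge0 ?enorm_ge0//.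
rewrite enorm_sqr !dotL sqrrD !enorm_sqr (dotC y x).
have := dot_le x y; lra.
Qed.

Lemma ler_enormB x y : enorm (x - y) <= enorm x + enorm y.
Proof. by rewrite -(enormN y) ler_enormD. Qed.

Lemma enorm_tri x y z : enorm (x - z) <= enorm (x - y) + enorm (y - z).
Proof. by apply: le_trans (ler_enormD _ _); rewrite addrA subrK. Qed.

Lemma ler_dist_enorm x y : `|enorm x - enorm y| <= enorm (x - y).
Proof.
rewrite ler_norml; apply/andP; split.
  have := ler_enormD (y - x) x; rewrite subrK (enormC y x); lra.
have := ler_enormD (x - y) y; rewrite subrK; lra.
Qed.

Lemma coord_le_enorm x i : `|x 0 i| <= enorm x.
Proof.
rewrite -sqrtr_sqr ler_sqrt ?dot_ge0// dotE (bigD1 i)//= expr2 lerDl.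
by rewrite sumr_ge0// => j _; rewrite -expr2 sqr_ge0.
Qed.

Lemma norm_le_enorm x : `|x| <= enorm x.
Proof.
rewrite /Num.norm/= mx_normrE; apply/bigmax_leP; split => /=; first exact: enorm_ge0.
by move=> [i j] _ /=; rewrite ord1; exact: coord_le_enorm.
Qed.

Lemma enorm_le_norm x : enorm x <= n%:R * `|x|.
Proof.
rewrite -(@ler_pXn2r _ 2)// ?nnegrE ?mulr_ge0 ?enorm_ge0//.
rewrite enorm_sqr dotE.
apply: (@le_trans _ _ (\sum_(i < n) `|x| ^+ 2)).
  apply: ler_sum => i _; rewrite -expr2 -[leLHS]ger0_norm ?sqr_ge0// normrX.
  rewrite lerXn2r ?nnegrE//.
  rewrite [leRHS]/Num.norm/= mx_normrE.
  by apply/bigmax_geP; right; exists (0, i).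
rewrite sumr_const card_ord exprMn -[leLHS]mulr_natl.
rewrite ler_wpM2r ?sqr_ge0// -natrX ler_nat.
by case: (n) => // m; rewrite expnS expn1 leq_pmulr.
Qed.

(** The library topology is that of the sup norm; [norm_le_enorm] and [enorm_le_norm] compare the
    two norms, and from here on neighbourhoods, limits and continuity are handled with Euclidean
    radii. *)
Lemma nbhs_enorm x (P : set 'rV[R]_n) :
  nbhs x P <-> exists2 r, 0 < r & forall y, enorm (y - x) < r -> P y.
Proof.
rewrite nbhs_ballP; split.
  move=> [r/= r0 h]; exists r => // y yx; apply: h; rewrite -ball_normE /=.
  by rewrite distrC; apply: le_lt_trans yx; exact: norm_le_enorm.
(* The divisor is [n.+1] rather than [n], so that it is positive also for [n = 0]. *)
move=> [r r0 h]; exists (r / n.+1%:R) => /=.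
  by rewrite divr_gt0.
move=> y; rewrite -ball_normE /= distrC => yx; apply: h.
apply: le_lt_trans (enorm_le_norm _) _.
apply: (@le_lt_trans _ _ (n.+1%:R * `|y - x|)).
  by rewrite ler_wpM2r// ler_nat.
by rewrite mulrC -ltr_pdivlMr.
Qed.

Lemma within_enorm (A : set 'rV[R]_n) x (P : set 'rV[R]_n) :
  (\forall y \near within A (nbhs x), P y) <->
  exists2 r, 0 < r & forall y, enorm (y - x) < r -> A y -> P y.
Proof. exact: (nbhs_enorm x (fun y => A y -> P y)). Qed.

Lemma cont_enorm (f : 'rV[R]_n -> R) x : {for x, continuous f} <->
  forall e, 0 < e -> exists2 r, 0 < r &
    forall y, enorm (y - x) < r -> `|f y - f x| < e.
Proof.
split=> h.
  move=> e e0.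
  have /(@cvgrPdist_lt _ _ _ (nbhs x) (nbhs_filter x))/(_ _ e0)/nbhs_enorm[r r0 hr] := h.
  by exists r => // y /hr; rewrite distrC.
apply/(@cvgrPdist_lt _ _ _ (nbhs x) (nbhs_filter x)) => e e0; apply/nbhs_enorm.
by have [r r0 hr] := h e e0; exists r => // y /hr; rewrite distrC.
Qed.

Lemma within_cont_enorm (A : set 'rV[R]_n) (f : 'rV[R]_n -> R) :
  {within A, continuous f} <-> forall x, A x ->
  forall e, 0 < e -> exists2 r, 0 < r &
    forall y, A y -> enorm (y - x) < r -> `|f y - f x| < e.
Proof.
rewrite subspace_continuousP; split=> h.
  move=> x Ax e e0.
  have /cvgrPdist_lt/(_ _ e0)/within_enorm[r r0 hr] := h x Ax.
  by exists r => // y Ay /hr; rewrite distrC => /(_ Ay).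
move=> x Ax; apply/cvgrPdist_lt => e e0; apply/within_enorm.
have [r r0 hr] := h x Ax e e0.
by exists r => // y yx Ay; rewrite distrC; apply: hr.
Qed.

End Euclid.

(** * Quadratic forms, the operator [LA], and its dependence on the gradient *)

Section Forms.
Context {R : realType} {n : nat}.
Implicit Types (z h k q : 'rV[R]_n) (X Y M : 'M[R]_n) (a b t p : R).

Definition bil X h k : R := (h *m X *m k^T) 0 0.

Lemma quadbil X h : quad X h = bil X h h. Proof. by []. Qed.

Lemma bilE X h k : bil X h k = \sum_i \sum_j h 0 i * X i j * k 0 j.
Proof.
rewrite /bil mxE exchange_big/=; apply: eq_bigr => j _.
by rewrite !mxE mulr_suml; apply: eq_bigr => i _.
Qed.

Lemma bilDl X h k z : bil X (h + k) z = bil X h z + bil X k z.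
Proof. by rewrite /bil !mulmxDl mxE. Qed.

Lemma bilZl X a h z : bil X (a *: h) z = a * bil X h z.
Proof. by rewrite /bil -!scalemxAl mxE. Qed.

Lemma bilNl X h z : bil X (- h) z = - bil X h z.
Proof. by rewrite -scaleN1r bilZl mulN1r. Qed.

Lemma bilDr X h k z : bil X z (h + k) = bil X z h + bil X z k.
Proof. by rewrite /bil linearD/= mulmxDr mxE. Qed.

Lemma bilZr X a h z : bil X z (a *: h) = a * bil X z h.
Proof. by rewrite /bil linearZ/= -scalemxAr mxE. Qed.

Lemma bilNr X h z : bil X z (- h) = - bil X z h.
Proof. by rewrite -scaleN1r bilZr mulN1r. Qed.

Lemma bilMD X Y h k : bil (X + Y) h k = bil X h k + bil Y h k.
Proof. by rewrite /bil mulmxDr mulmxDl mxE. Qed.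

Lemma bilMZ a X h k : bil (a *: X) h k = a * bil X h k.
Proof. by rewrite /bil -scalemxAr -scalemxAl mxE. Qed.

Lemma bilMN X h k : bil (- X) h k = - bil X h k.
Proof. by rewrite -scaleN1r bilMZ mulN1r. Qed.

Lemma bilM0 h k : bil 0 h k = 0.
Proof. by rewrite /bil mulmx0 mul0mx mxE. Qed.

Lemma bil1 h k : bil 1%:M h k = dot h k.
Proof. by rewrite /bil mulmx1. Qed.

Lemma bilout q z h k : bil (q^T *m z) h k = dot h q * dot z k.
Proof.
rewrite /bil /dot mulmxA -mulmxA mxE big_ord1; congr (_ * _).
Qed.

Lemma bilT X h k : bil X^T h k = bil X k h.
Proof.
rewrite !bilE exchange_big/=; apply: eq_bigr => i _; apply: eq_bigr => j _.
by rewrite mxE; ring.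
Qed.

Lemma bil_mul M X h k : bil (M *m X *m M^T) h k = bil X (h *m M) (k *m M).
Proof. by rewrite /bil trmx_mul !mulmxA. Qed.

Lemma dot_mull h X k : dot (h *m X) k = bil X h k.
Proof. by []. Qed.

Lemma dot_mulr h X k : dot h (k *m X) = bil X k h.
Proof. by rewrite dotC. Qed.

Definition bilL := (bilDl, bilNl, bilZl, bilDr, bilNr, bilZr,
  bilMD, bilMN, bilMZ, bilM0, bil1, bilout).

Lemma quadZ X a h : quad X (a *: h) = a ^+ 2 * quad X h.
Proof. by rewrite !quadbil !bilL mulrA expr2. Qed.

Lemma quad0 X : quad X 0 = 0.
Proof. by rewrite -(scale0r 0) quadZ expr0n mul0r. Qed.

Lemma quadN X h : quad X (- h) = quad X h.
Proof. by rewrite !quadbil !bilL opprK. Qed.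

Lemma quadMD X Y h : quad (X + Y) h = quad X h + quad Y h.
Proof. by rewrite !quadbil !bilL. Qed.

Lemma quadMN X h : quad (- X) h = - quad X h.
Proof. by rewrite !quadbil !bilL. Qed.

Lemma quadMZ a X h : quad (a *: X) h = a * quad X h.
Proof. by rewrite !quadbil !bilL. Qed.

Lemma quadM1 a h : quad a%:M h = a * dot h h.
Proof. by rewrite -scalemx1 quadMZ quadbil bil1. Qed.

Lemma quadM0 h : quad 0 h = 0.
Proof. by rewrite quadbil bilM0. Qed.

Lemma quadT X h : quad X^T h = quad X h.
Proof. by rewrite !quadbil bilT. Qed.

Definition quadL := (quadMD, quadMN, quadMZ, quadM1, quadM0).

Definition mnorm X : R := \sum_i \sum_j `|X i j|.

Lemma mnorm_ge0 X : 0 <= mnorm X.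
Proof. by rewrite sumr_ge0// => i _; rewrite sumr_ge0. Qed.

Lemma mnormD X Y : mnorm (X + Y) <= mnorm X + mnorm Y.
Proof.
rewrite /mnorm -big_split/=; apply: ler_sum => i _.
by rewrite -big_split/=; apply: ler_sum => j _; rewrite mxE ler_normD.
Qed.

Lemma mnormZ a X : mnorm (a *: X) = `|a| * mnorm X.
Proof.
rewrite /mnorm mulr_sumr; apply: eq_bigr => i _; rewrite mulr_sumr.
by apply: eq_bigr => j _; rewrite mxE normrM.
Qed.

Lemma mnormN X : mnorm (- X) = mnorm X.
Proof. by rewrite -scaleN1r mnormZ normrN1 mul1r. Qed.

Lemma ler_bil X h k : `|bil X h k| <= mnorm X * (enorm h * enorm k).
Proof.
rewrite bilE /mnorm mulr_suml; apply: le_trans (ler_norm_sum _ _ _) _.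
apply: ler_sum => i _; rewrite mulr_suml; apply: le_trans (ler_norm_sum _ _ _) _.
apply: ler_sum => j _; rewrite !normrM mulrAC [leRHS]mulrC ler_wpM2r//.
by rewrite ler_pM// coord_le_enorm.
Qed.

Lemma ler_quad X h : `|quad X h| <= mnorm X * dot h h.
Proof. by rewrite -enorm_sqr expr2; exact: ler_bil. Qed.

Lemma mulmx_enorm_le X h : enorm (h *m X) <= mnorm X * enorm h.
Proof.
have [e|e] := leP (enorm (h *m X)) 0.
  by apply: le_trans e _; rewrite mulr_ge0 ?mnorm_ge0 ?enorm_ge0.
rewrite -(ler_pM2r e) -expr2 enorm_sqr dot_mull -mulrA.
by apply: le_trans (ler_norm _) _; exact: ler_bil.
Qed.

Lemma tr_quad M X : \tr (M *m X *m M^T) = \sum_i quad X (row i M).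
Proof.
apply: eq_bigr => i _; rewrite /quad -row_mul mxE [RHS]mxE.
by apply: eq_bigr => j _; rewrite !mxE.
Qed.

Lemma tr_psd M X : (forall h, 0 <= quad X h) -> 0 <= \tr (M *m X *m M^T).
Proof. by move=> h; rewrite tr_quad sumr_ge0. Qed.

Lemma tr_out q z X : \tr (q^T *m z *m X) = bil X z q.
Proof. by rewrite -mulmxA mxtrace_mulC /bil trace_mx11. Qed.

(** This is [p] times the normalized p-Laplacian, so the equation reads [LA p q X = - p]. At [q = 0]
    division by zero leaves the bare trace, a junk value; the equation is used with nonzero [q]
    only. *)
Definition LA p q X : R := \tr X + (p - 2) * (quad X q / dot q q).

Lemma LAD p q X Y : LA p q (X + Y) = LA p q X + LA p q Y.
Proof. by rewrite /LA linearD/= quadMD; ring. Qed.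

Lemma LAZ p q a X : LA p q (a *: X) = a * LA p q X.
Proof. by rewrite /LA linearZ/= quadMZ; ring. Qed.

Lemma LAN p q X : LA p q (- X) = - LA p q X.
Proof. by rewrite -scaleN1r LAZ mulN1r. Qed.

Lemma LAB p q X Y : LA p q (X - Y) = LA p q X - LA p q Y.
Proof. by rewrite LAD LAN. Qed.

Lemma LA1 p q a : q != 0 -> LA p q a%:M = a * (n%:R + p - 2).
Proof.
move=> q0; rewrite /LA mxtrace_scalar quadM1 -mulr_natr.
have : dot q q != 0 by rewrite dot_eq0.
by move=> h; field.
Qed.

Lemma LAqZ p q X a : a != 0 -> LA p (a *: q) X = LA p q X.
Proof.
move=> a0; rewrite /LA quadZ !dotL; congr (_ + _ * _).
have [->|q0] := eqVneq q 0; first by rewrite quad0 dot0l !mulr0 !invr0 !mulr0.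
have d : dot q q != 0 by rewrite dot_eq0.
by field; rewrite d a0.
Qed.

(** The linear map that multiplies the direction of [q] by [a] and fixes its orthogonal complement.
    The coefficient matrix of [LA p q] is [rt (p - 1) q], its square root is
    [rt (Num.sqrt (p - 1)) q], and [rt (-1) q] is the reflection in the hyperplane orthogonal to
    [q]. *)
Definition rt a q : 'M[R]_n := 1%:M + ((a - 1) / dot q q) *: (q^T *m q).

Lemma rtT a q : (rt a q)^T = rt a q.
Proof. by rewrite /rt linearD/= linearZ/= trmx_mul trmxK trmx1. Qed.

Lemma rt_mul a b q : q != 0 -> rt a q *m rt b q = rt (a * b) q.
Proof.
move=> q0; have d : dot q q != 0 by rewrite dot_eq0.
rewrite /rt mulmxDl mul1mx mulmxDr mulmx1 -scalemxAl -scalemxAr.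
rewrite -!mulmxA (mulmxA q) [q *m q^T]mx11_scalar -[_ 0 0]/(dot q q).
rewrite mul_scalar_mx -scalemxAr !scalerA -!addrA -!scalerDl.
by congr (_ + _ *: _); field.
Qed.

Lemma rt1 q : rt 1 q = 1%:M.
Proof. by rewrite /rt subrr mul0r scale0r addr0. Qed.

Lemma tr_rt a q X : q != 0 ->
  \tr (rt a q *m X *m (rt a q)^T) = \tr X + (a ^+ 2 - 1) * (quad X q / dot q q).
Proof.
move=> q0; rewrite mxtrace_mulC rtT mulmxA rt_mul// /rt mulmxDl mul1mx linearD/=.
by rewrite -scalemxAl linearZ/= tr_out quadbil; ring.
Qed.

(** Written as the trace of a congruence, the operator inherits positivity and monotonicity from the
    trace; this is where [1 < p] yields ellipticity. *)
Lemma LA_rt p q X : 1 < p -> q != 0 ->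
  LA p q X = \tr (rt (Num.sqrt (p - 1)) q *m X *m (rt (Num.sqrt (p - 1)) q)^T).
Proof.
move=> p1 q0; rewrite tr_rt// sqr_sqrtr; last by lra.
by rewrite /LA; congr (_ + _ * _); lra.
Qed.

Lemma LA_psd p q X : 1 < p -> q != 0 -> (forall h, 0 <= quad X h) -> 0 <= LA p q X.
Proof. by move=> p1 q0 h; rewrite LA_rt// tr_psd. Qed.

Lemma LA_le p q X Y : 1 < p -> q != 0 -> (forall h, quad X h <= quad Y h) ->
  LA p q X <= LA p q Y.
Proof.
move=> p1 q0 h; rewrite -subr_ge0 -LAB LA_psd// => k.
by rewrite quadMD quadMN subr_ge0.
Qed.

(** [rt 0 q] is the projection onto the complement of [q]; the compression of [X] by it is still
    nonnegative, and its trace is the difference of the two sides. *)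
Lemma tr_ge_quad q X : q != 0 -> (forall h, 0 <= quad X h) ->
  quad X q / dot q q <= \tr X.
Proof.
move=> q0 h; rewrite -subr_ge0.
have := tr_psd (rt 0 q) h; rewrite tr_rt// expr0n/= sub0r; lra.
Qed.

(** The eigenvalues of [rt (p - 1) q] are among [1] and [p - 1]; their minimum is the lower
    ellipticity constant. *)
Definition lmin p : R := Num.min 1 (p - 1).

Lemma lmin_gt0 p : 1 < p -> 0 < lmin p.
Proof. by move=> p1; rewrite /lmin lt_min ltr01 subr_gt0. Qed.

Lemma lmin_tr p q X : 1 < p -> q != 0 -> (forall h, 0 <= quad X h) ->
  lmin p * \tr X <= LA p q X.
Proof.
move=> p1 q0 h; have t := tr_ge_quad q0 h.
have qq : 0 <= quad X q / dot q q by rewrite divr_ge0 ?dot_ge0.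
by rewrite /lmin /LA /Num.min; case: ltP => ?; nra.
Qed.

Lemma lmin_LA_out p q z : 1 < p -> q != 0 -> lmin p * dot z z <= LA p q (z^T *m z).
Proof.
move=> p1 q0.
have h : forall k, 0 <= quad (z^T *m z) k.
  by move=> k; rewrite quadbil bilout (dotC z) -expr2 sqr_ge0.
have := lmin_tr p1 q0 h; suff -> : \tr (z^T *m z) = dot z z by [].
by rewrite -[z^T *m z]mulmx1 tr_out bil1.
Qed.

Lemma quad_diff X h k : quad X h - quad X k = bil X (h - k) h + bil X k (h - k).
Proof. by rewrite !quadbil !bilL; ring. Qed.

Lemma unit_enorm q : q != 0 -> enorm ((enorm q)^-1 *: q) = 1.
Proof.
move=> q0; rewrite enormZ ger0_norm ?invr_ge0 ?enorm_ge0// mulVf//.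
by rewrite enorm_eq0.
Qed.

Lemma unit_lip q k : q != 0 -> k != 0 ->
  enorm ((enorm q)^-1 *: q - (enorm k)^-1 *: k) <= 2 * (enorm q)^-1 * enorm (q - k).
Proof.
move=> q0 k0.
have eq : enorm q != 0 by rewrite enorm_eq0.
have ek : enorm k != 0 by rewrite enorm_eq0.
have -> : (enorm q)^-1 *: q - (enorm k)^-1 *: k =
    (enorm q)^-1 *: (q - k) + ((enorm q)^-1 * (enorm k - enorm q)) *: ((enorm k)^-1 *: k).
  rewrite scalerBr scalerA mulrBr mulrBl mulVf// mul1r scalerBl.
  by rewrite mulfK// addrA subrK.
apply: le_trans (ler_enormD _ _) _.
rewrite [X in _ + X]enormZ unit_enorm// mulr1 enormZ normrM.
rewrite ger0_norm ?invr_ge0 ?enorm_ge0//.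
have := ler_dist_enorm k q; rewrite (enormC k) => h.
have : 0 < (enorm q)^-1 by rewrite invr_gt0 enorm_gt0.
by nra.
Qed.

Lemma quad_unit X q : q != 0 -> quad X q / dot q q = quad X ((enorm q)^-1 *: q).
Proof.
by move=> q0; rewrite quadZ -enorm_sqr exprVn mulrC.
Qed.

(** The nonlinear part depends on [q] only through its direction, whose variation [unit_lip] bounds;
    the factor 4 is the factor 2 there times the two terms of [quad_diff]. The error is proportional
    to the size of the Hessian, hence useful only where that size is under control. *)
Lemma LA_lip p q k X : q != 0 -> k != 0 ->
  `|LA p q X - LA p k X| <= `|p - 2| * (4 * (enorm q)^-1 * enorm (q - k)) * mnorm X.
Proof.
move=> q0 k0.
have -> : LA p q X - LA p k X = (p - 2) * (quad X q / dot q q - quad X k / dot k k).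
  by rewrite /LA; ring.
rewrite normrM -mulrA ler_wpM2l// !quad_unit//.
set a := (_ *: q); set b := (_ *: k); rewrite quad_diff.
have := unit_lip q0 k0; rewrite -/a -/b => ab.
have ea : enorm a = 1 by exact: unit_enorm.
have eb : enorm b = 1 by exact: unit_enorm.
have h1 := ler_bil X (a - b) a; have h2 := ler_bil X b (a - b).
rewrite ea mulr1 in h1; rewrite eb mul1r in h2.
apply: le_trans (ler_normD _ _) _.
have := mnorm_ge0 X; nra.
Qed.

End Forms.

(** * Second-order jets and their calculus *)

Section Jets.
Context {R : realType} {n : nat}.
Implicit Types (f g : 'rV[R]_n -> R) (x y z h k q : 'rV[R]_n) (X Y M : 'M[R]_n).
Implicit Types (a r t e : R).

(** Second-order superjets and subjets, with the [o(|h|^2)] term in epsilon form. [X] may be any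
    matrix, since only its quadratic form enters; later Hessians therefore contain products such as
    [q^T *m k] without symmetrization. *)
Definition ujet f x q X := forall e, 0 < e -> exists2 r, 0 < r &
  forall h, enorm h < r ->
    f (x + h) <= f x + dot q h + 2^-1 * quad X h + e * dot h h.

Definition ljet f x q X := forall e, 0 < e -> exists2 r, 0 < r &
  forall h, enorm h < r ->
    f x + dot q h + 2^-1 * quad X h - e * dot h h <= f (x + h).

Definition jet f x q X := ujet f x q X /\ ljet f x q X.

Lemma jetP f x q X : jet f x q X <-> forall e, 0 < e -> exists2 r, 0 < r &
  forall h, enorm h < r ->
    `|f (x + h) - f x - dot q h - 2^-1 * quad X h| <= e * dot h h.
Proof.
split=> [[hu hl] e e0|H].
  have [r1 r10 h1] := hu e e0; have [r2 r20 h2] := hl e e0.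
  exists (Num.min r1 r2); first by rewrite lt_min r10.
  move=> h; rewrite lt_min => /andP[/h1 A /h2 B]; rewrite ler_norml; lra.
split=> e e0; have [r r0 hr] := H e e0; exists r => // h /hr;
  rewrite ler_norml => /andP[A B]; lra.
Qed.

Lemma ujetN f x q X : ljet f x q X -> ujet (\- f) x (- q) (- X).
Proof.
move=> H e e0; have [r r0 hr] := H e e0; exists r => // h /hr /=.
by rewrite dotNl quadMN; lra.
Qed.

Lemma ljetN f x q X : ujet f x q X -> ljet (\- f) x (- q) (- X).
Proof.
move=> H e e0; have [r r0 hr] := H e e0; exists r => // h /hr /=.
by rewrite dotNl quadMN; lra.
Qed.

Lemma jet_ext f g x q X : f =1 g -> jet f x q X -> jet g x q X.
Proof. by move=> /funext ->. Qed.

Lemma jet_cst a x : jet (fun=> a) x 0 0.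
Proof.
apply/jetP => e e0; exists 1 => // h _.
by rewrite dot0l quadM0 mulr0 !subr0 subrr normr0 mulr_ge0 ?dot_ge0// ltW.
Qed.

Lemma jet_dot q x : jet (dot q) x q 0.
Proof.
apply/jetP => e e0; exists 1 => // h _; rewrite dotDr quadM0.
rewrite [X in `|X|](_ : _ = 0) ?normr0 ?mulr_ge0 ?dot_ge0 1?ltW//; lra.
Qed.

Lemma jet_quad X x0 x :
  jet (fun y => quad X (y - x0)) x ((x - x0) *m (X + X^T)) (2 *: X).
Proof.
apply/jetP => e e0; exists 1 => // h _; rewrite addrAC dot_mull quadMZ.
rewrite !quadbil !bilL !bilT.
rewrite [X in `|X|](_ : _ = 0) ?normr0 ?mulr_ge0 ?dot_ge0 1?ltW//; lra.
Qed.

Lemma ujetD f g x q k X Y : ujet f x q X -> ujet g x k Y ->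
  ujet (fun y => f y + g y) x (q + k) (X + Y).
Proof.
move=> F G e e0.
have [r1 r10 h1] := F (e / 2) (divr_gt0 e0 (ltr0n _ 2)).
have [r2 r20 h2] := G (e / 2) (divr_gt0 e0 (ltr0n _ 2)).
exists (Num.min r1 r2); first by rewrite lt_min r10.
move=> h; rewrite lt_min => /andP[/h1 A /h2 B]; rewrite dotDl quadMD; nra.
Qed.

Lemma ljetD f g x q k X Y : ljet f x q X -> ljet g x k Y ->
  ljet (fun y => f y + g y) x (q + k) (X + Y).
Proof.
move=> /ujetN F /ujetN G; have := ljetN (ujetD F G); rewrite -!opprD !opprK.
by congr ljet; apply/funext => y /=; rewrite -opprD opprK.
Qed.

Lemma jetD f g x q k X Y : jet f x q X -> jet g x k Y ->
  jet (fun y => f y + g y) x (q + k) (X + Y).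
Proof. by move=> [A B] [C D]; split; [exact: ujetD|exact: ljetD]. Qed.

Lemma ujetZ f x q X a : 0 < a -> ujet f x q X ->
  ujet (fun y => a * f y) x (a *: q) (a *: X).
Proof.
move=> a0 F e e0; have [r r0 hr] := F (e / a) (divr_gt0 e0 a0).
exists r => // h /hr; rewrite dotZl quadMZ => H.
have := ler_wpM2l (ltW a0) H.
have -> : a * (f x + dot q h + 2^-1 * quad X h + e / a * dot h h) =
  a * f x + a * dot q h + 2^-1 * (a * quad X h) + e * dot h h.
  by field; rewrite gt_eqF.
by [].
Qed.

Lemma ljetZ f x q X a : 0 < a -> ljet f x q X ->
  ljet (fun y => a * f y) x (a *: q) (a *: X).
Proof.
move=> a0 /ujetN F; have := ljetN (ujetZ a0 F); rewrite -!scalerN !opprK.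
by congr ljet; apply/funext => y /=; rewrite mulrN opprK.
Qed.

Lemma jetN f x q X : jet f x q X -> jet (fun y => - f y) x (- q) (- X).
Proof. by move=> [A B]; split; [exact: ujetN|exact: ljetN]. Qed.

Lemma jetZ f x q X a : jet f x q X -> jet (fun y => a * f y) x (a *: q) (a *: X).
Proof.
move=> H; case: (ltgtP a 0) => a0.
- have [U L] : jet (fun y => - f y) x (- q) (- X) by exact: jetN.
  have na0 : 0 < - a by rewrite oppr_gt0.
  have U' := ujetZ na0 U; have L' := ljetZ na0 L.
  have E : (fun y => - a * - f y) = (fun y => a * f y).
    by apply/funext => y; rewrite mulrNN.
  by move: U' L'; rewrite !scalerN !scaleNr !opprK E; split.
- by case: H => U L; split; [exact: ujetZ|exact: ljetZ].
- by rewrite a0 !scale0r; apply: jet_ext (jet_cst 0 x) => y /=; rewrite mul0r.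
Qed.

Lemma jet_bound f x q X : jet f x q X -> exists C r, [/\ 0 <= C, 0 < r &
  forall h, enorm h < r -> `|f (x + h) - f x - dot q h| <= C * dot h h].
Proof.
move=> /jetP/(_ 1 ltr01)[r r0 hr]; exists (1 + mnorm X), r; split=> //.
  by rewrite addr_ge0 ?mnorm_ge0.
move=> h /hr; have := ler_quad X h; have := dot_ge0 h; have := mnorm_ge0 X.
rewrite !ler_norml; nra.
Qed.

Lemma jet_bound1 f x q X : jet f x q X -> exists C r, [/\ 0 <= C, 0 < r &
  forall h, enorm h < r -> `|f (x + h) - f x| <= C * enorm h].
Proof.
move=> /jet_bound[C [r [C0 r0 hr]]]; exists (C + enorm q), (Num.min r 1); split.
- by rewrite addr_ge0 ?enorm_ge0.
- by rewrite lt_min r0/=.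
move=> h; rewrite lt_min => /andP[/hr H h1]; rewrite -enorm_sqr in H.
rewrite -[X in `|X|](subrK (dot q h)); apply: le_trans (ler_normD _ _) _.
rewrite mulrDl lerD ?ler_dot//; apply: le_trans H _.
by rewrite ler_wpM2l// expr2 ler_piMr ?enorm_ge0// ltW.
Qed.

Lemma jet_cont f x q X : jet f x q X -> {for x, continuous f}.
Proof.
move=> /jet_bound1[C [r [C0 r0 hr]]]; apply/cont_enorm => e e0.
exists (Num.min r (e / (C + 1))).
  by rewrite lt_min r0 divr_gt0// ltr_wpDl.
move=> y; rewrite lt_min => /andP[yr ye].
have := hr _ yr; rewrite addrCA subrr addr0 => H; apply: le_lt_trans H _.
move: ye; rewrite ltr_pdivlMr; last by rewrite ltr_wpDl.
by have := enorm_ge0 (y - x); nra.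
Qed.

Lemma jetM f g x q k X Y : jet f x q X -> jet g x k Y ->
  jet (fun y => f y * g y) x (f x *: k + g x *: q)
    (f x *: Y + g x *: X + 2 *: (q^T *m k)).
Proof.
move=> F G.
have [Cf [rf [Cf0 rf0 hf]]] := jet_bound F.
have [Cg [rg [Cg0 rg0 hg]]] := jet_bound G.
move: F G => /jetP F /jetP G; apply/jetP => e e0.
pose m := 1 + `|f x| + `|g x|.
have m1 : 1 <= m by rewrite /m -addrA lerDl addr_ge0.
have e3 : 0 < e / (3 * m) by rewrite divr_gt0// mulr_gt0//; lra.
have [r1 r10 h1] := F _ e3; have [r2 r20 h2] := G _ e3.
pose K := Cf * Cg + Cf * enorm k + Cg * enorm q + 1.
have K0 : 0 < K.
  rewrite /K ltr_wpDl// !addr_ge0// mulr_ge0// ?enorm_ge0//.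
exists (Num.min 1 (Num.min (e / (3 * K)) (Num.min rf (Num.min rg (Num.min r1 r2))))).
  by rewrite !lt_min ltr01 rf0 rg0 r10 r20 divr_gt0// mulr_gt0.
move=> h; rewrite !lt_min => /and5P[hh1 hK hhf hhg /andP[hr1 hr2]].
have {}h1 := h1 _ hr1; have {}h2 := h2 _ hr2.
have {}hf := hf _ hhf; have {}hg := hg _ hhg.
rewrite !dotL !quadL [quad (_ *m _) _]quadbil bilout (dotC h q).
set s := enorm h in hh1 hK; have s0 : 0 <= s by exact: enorm_ge0.
have ss : dot h h = s ^+ 2 by rewrite enorm_sqr.
rewrite ss in h1 h2 hf hg *.
move: h1 h2 hf hg; set A := f (x + h) - f x - dot q h; set B := g (x + h) - g x - dot k h.
move=> h1 h2 hf hg.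
have -> : f (x + h) * g (x + h) - f x * g x - (f x * dot k h + g x * dot q h) -
   2^-1 * (f x * quad Y h + g x * quad X h + 2 * (dot q h * dot k h)) =
   f x * (B - 2^-1 * quad Y h) + g x * (A - 2^-1 * quad X h) +
   (A * dot k h + B * dot q h + A * B).
  by rewrite /A /B; field.
have hA : `|A * dot k h + B * dot q h + A * B| <= K * s * s ^+ 2.
  have dk := ler_dot k h; have dq := ler_dot q h; rewrite -/s in dk dq.
  apply: le_trans (ler_normD _ _) _; rewrite normrM.
  apply: (@le_trans _ _ (Cf * s ^+ 2 * (enorm k * s) + Cg * s ^+ 2 * (enorm q * s)
     + Cf * s ^+ 2 * (Cg * s ^+ 2))).
    rewrite lerD ?ler_pM//.
    by apply: le_trans (ler_normD _ _) _; rewrite !normrM lerD// ler_pM.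
  have -> : Cf * s ^+ 2 * (enorm k * s) + Cg * s ^+ 2 * (enorm q * s)
     + Cf * s ^+ 2 * (Cg * s ^+ 2) =
     (Cf * enorm k + Cg * enorm q + Cf * Cg * s) * (s * s ^+ 2) by ring.
  rewrite -[leRHS]mulrA ler_wpM2r ?mulr_ge0 ?sqr_ge0// /K.
  have : Cf * Cg * s <= Cf * Cg by rewrite ler_piMr ?mulr_ge0// ltW.
  by lra.
apply: le_trans (ler_normD _ _) _.
apply: le_trans (lerD (ler_normD _ _) (lexx _)) _; rewrite !normrM.
have Ks : K * s * s ^+ 2 <= e / 3 * s ^+ 2.
  rewrite ler_wpM2r ?sqr_ge0//; move: hK.
  rewrite ltr_pdivlMr ?mulr_gt0// => hK; nra.
have e3m : e / (3 * m) * m = e / 3 by field; rewrite gt_eqF//; lra.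
have H1 : `|f x| * `|B - 2^-1 * quad Y h| <= m * (e / (3 * m) * s ^+ 2).
  by rewrite ler_pM// /m; have := normr_ge0 (g x); lra.
have H2 : `|g x| * `|A - 2^-1 * quad X h| <= m * (e / (3 * m) * s ^+ 2).
  by rewrite ler_pM// /m; have := normr_ge0 (f x); lra.
have E : m * (e / (3 * m) * s ^+ 2) = e / 3 * s ^+ 2 by rewrite -e3m; ring.
rewrite E in H1 H2; lra.
Qed.

Lemma jet_affine f c (M : 'M[R]_n) z q X : jet f (c + z *m M) q X ->
  jet (fun z => f (c + z *m M)) z (q *m M^T) (M *m X *m M^T).
Proof.
move=> /jetP F; apply/jetP => e e0.
pose m := 1 + mnorm M; have m0 : 0 < m by rewrite ltr_wpDr ?mnorm_ge0.
have [|r r0 hr] := F (e / m ^+ 2); first by rewrite divr_gt0// exprn_gt0.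
exists (r / m); first by rewrite divr_gt0.
move=> h; rewrite ltr_pdivlMr// => hh.
have hM : enorm (h *m M) <= enorm h * m.
  apply: le_trans (mulmx_enorm_le _ _) _; rewrite mulrC ler_wpM2l ?enorm_ge0//.
  by rewrite /m lerDr.
have := hr (h *m M) (le_lt_trans hM hh).
rewrite mulmxDl addrA.
have -> : dot (q *m M^T) h = dot q (h *m M) by rewrite dot_mulr dot_mull bilT.
have -> : quad (M *m X *m M^T) h = quad X (h *m M) by rewrite !quadbil bil_mul.
move=> H; apply: le_trans H _.
rewrite mulrAC ler_pdivrMr ?exprn_gt0// -[leRHS]mulrA ler_wpM2l ?(ltW e0)//.
rewrite -!enorm_sqr -exprMn lerXn2r// nnegrE ?enorm_ge0// mulr_ge0 ?enorm_ge0//.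
exact: ltW.
Qed.

Lemma lin_ge0 q : (forall e h, 0 < e -> - e <= dot q h) -> q = 0.
Proof.
move=> H; apply/eqP; rewrite -dot_eq0 eq_le dot_ge0 andbT leNgt; apply/negP => q0.
by have := H (dot q q / 2) (- q) (divr_gt0 q0 (ltr0n _ 2)); rewrite dotNr; lra.
Qed.

(** First and second order conditions at a local minimum of [f - g], where [f] has only an expansion
    from above and [g] only one from below. Most comparison arguments below read off gradients and
    Hessians here. *)
Lemma jet_touch f g x q k X Y s : 0 < s ->
  (forall h, enorm h < s -> f x - g x <= f (x + h) - g (x + h)) ->
  ujet f x q X -> ljet g x k Y -> q = k /\ forall h, quad Y h <= quad X h.
Proof.
move=> s0 H F G.
have key e : 0 < e -> exists2 r, 0 < r & forall h, enorm h < r ->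
   0 <= dot (q - k) h + 2^-1 * quad (X - Y) h + e * dot h h.
  move=> e0.
  have [r1 r10 h1] := F (e / 2) (divr_gt0 e0 (ltr0n _ 2)).
  have [r2 r20 h2] := G (e / 2) (divr_gt0 e0 (ltr0n _ 2)).
  exists (Num.min s (Num.min r1 r2)); first by rewrite !lt_min s0 r10 r20.
  move=> h; rewrite !lt_min => /and3P[/H A /h1 B /h2 C].
  by rewrite dotBl quadMD quadMN; nra.
have qk : q - k = 0.
  apply: lin_ge0 => e h e0.
  have [r r0 hr] := key 1 ltr01.
  pose N := `|2^-1 * quad (X - Y) h| + dot h h + 1.
  have N0 : 0 < N by rewrite ltr_wpDl// addr_ge0// dot_ge0.
  (* The first bound keeps [t *: h] within reach of the expansion; the second makes the second-order
     part at most [e] after division by [t]. *)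
  pose t := Num.min (r / (2 * (enorm h + 1))) (e / N).
  have t0 : 0 < t.
    by rewrite /t lt_min !divr_gt0// mulr_gt0// ltr_wpDl ?enorm_ge0.
  have tr : enorm (t *: h) < r.
    rewrite enormZ gtr0_norm//.
    have : t <= r / (2 * (enorm h + 1)) by rewrite /t ge_min lexx.
    rewrite ler_pdivlMr; last by rewrite mulr_gt0// ltr_wpDl ?enorm_ge0.
    by have := enorm_ge0 h; nra.
  have := hr _ tr; rewrite quadZ !dotL => A.
  have tN : t * N <= e.
    have : t <= e / N by rewrite /t ge_min lexx orbT.
    by rewrite ler_pdivlMr.
  have B : 2^-1 * quad (X - Y) h + dot h h <= N.
    by rewrite /N; have := ler_norm (2^-1 * quad (X - Y) h); lra.
  have : 0 <= t * (dot (q - k) h + t * (2^-1 * quad (X - Y) h + dot h h)).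
    by rewrite dotBl; nra.
  rewrite pmulr_rge0// => C; nra.
split; first by apply/eqP; rewrite -subr_eq0 qk.
move=> h; rewrite -subr_ge0 -quadMN -quadMD leNgt; apply/negP => Q.
(* With this [e] the error term is at most half of the assumed negative second-order term, so the
   expansion along [h] becomes negative. *)
pose e := - quad (X - Y) h / (4 * (dot h h + 1)).
have d0 : 0 < dot h h + 1 by rewrite ltr_wpDl ?dot_ge0.
have e0 : 0 < e by rewrite /e divr_gt0 ?oppr_gt0// mulr_gt0.
have [r r0 hr] := key e e0.
pose t := r / (2 * (enorm h + 1)).
have t0 : 0 < t by rewrite /t divr_gt0// mulr_gt0// ltr_wpDl ?enorm_ge0.
have tr : enorm (t *: h) < r.
  rewrite enormZ gtr0_norm// /t mulrAC ltr_pdivrMr; last by rewrite mulr_gt0// ltr_wpDl ?enorm_ge0.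
  by have := enorm_ge0 h; nra.
have := hr _ tr; rewrite qk quadZ !dotL add0r.
have : e * dot h h <= - quad (X - Y) h / 4.
  rewrite /e; have : dot h h / (dot h h + 1) <= 1 by rewrite ler_pdivrMr// mul1r lerDl.
  have -> : - quad (X - Y) h / (4 * (dot h h + 1)) * dot h h =
    - quad (X - Y) h / 4 * (dot h h / (dot h h + 1)).
    by field; rewrite gt_eqF.
  by move=> A; rewrite ler_piMr// divr_ge0// oppr_ge0 ltW.
move=> A B; have : 0 <= t ^+ 2 * (2^-1 * quad (X - Y) h + e * dot h h).
  by nra.
rewrite pmulr_rge0 ?exprn_gt0//; lra.
Qed.

End Jets.

(** * From test functions to inequalities on jets *)

Section TestFunctions.
Context {R : realType} {n : nat}.
Implicit Types (f u : 'rV[R]_n -> R) (x y z h q v : 'rV[R]_n) (X M : 'M[R]_n).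
Implicit Types (a r t p e c d : R) (Omega : set 'rV[R]_n).

Lemma is_derive_sq f y v d C r : 0 < r ->
  (forall t, `|t| < r -> `|f (y + t *: v) - f y - t * d| <= C * t ^+ 2) ->
  is_derive y v f d.
Proof.
move=> r0 H.
have cv : (fun t => t^-1 *: ((f \o shift y) (t *: v) - f y)) @ 0^' --> d.
  apply/cvgrPdist_le => e e0; near=> t.
  have t0 : t != 0 by near: t; exact: nbhs_dnbhs_neq.
  have tr : `|t| < Num.min r (e / (`|C| + 1)).
    near: t; apply: dnbhs0_lt.
    by rewrite lt_min r0 divr_gt0// ltr_wpDl.
  move: tr; rewrite lt_min => /andP[tr te].
  have := H t tr; rewrite /= [y + _]addrC => A.
  rewrite distrC /GRing.scale/=.
  have -> : t^-1 * (f (t *: v + y) - f y) - d = t^-1 * (f (t *: v + y) - f y - t * d).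
    by field.
  rewrite normrM normfV ler_pdivrMl ?normr_gt0//; apply: le_trans A _.
  rewrite -real_normK ?num_real// expr2 mulrCA ler_wpM2l//.
  move: te; rewrite ltr_pdivlMr; last by rewrite ltr_wpDl.
  by have := ler_norm C; have := normr_ge0 t; nra.
by apply: DeriveDef; [exact: cvgP cv|exact: cvg_lim cv].
Unshelve. all: by end_near. Qed.

Lemma dval f x v d : is_derive x v f d -> 'D_v f x = d.
Proof. by case. Qed.

Lemma delta_neq0 i : (delta_mx 0 i : 'rV[R]_n) != 0.
Proof.
apply/eqP => /(congr1 (fun z : 'rV[R]_n => z 0 i)); rewrite !mxE !eqxx.
by apply/eqP; rewrite oner_eq0.
Qed.

(** Quadratic polynomials of this form are the only test functions that are ever inserted into the
    viscosity and Neumann conditions. *)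
Definition qt a q X x0 : 'rV[R]_n -> R :=
  fun y => a + dot q (y - x0) + 2^-1 * quad X (y - x0).

Lemma qt_line a q X x0 y v t : X^T = X ->
  qt a q X x0 (y + t *: v) - qt a q X x0 y - t * dot (q + (y - x0) *m X) v
  = t ^+ 2 * (2^-1 * quad X v).
Proof.
move=> XT; rewrite /qt addrAC !dotL dot_mull !quadbil !bilL.
have -> : bil X v y = bil X y v by rewrite -bilT XT.
have -> : bil X v x0 = bil X x0 v by rewrite -bilT XT.
by field.
Qed.

Lemma qt_derive a q X x0 y v : X^T = X ->
  is_derive y v (qt a q X x0) (dot (q + (y - x0) *m X) v).
Proof.
move=> XT; apply: (@is_derive_sq _ _ _ _ `|2^-1 * quad X v| 1) => // t _.
by rewrite qt_line// normrM ger0_norm ?sqr_ge0// mulrC.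
Qed.

Lemma dot_delta q i : dot q (delta_mx 0 i) = q 0 i.
Proof.
rewrite dotE (bigD1 i)//= mxE !eqxx mulr1 big1 ?addr0// => j ji.
by rewrite mxE eqxx/= (negPf ji) mulr0.
Qed.

Lemma qt_partial a q X x0 i : X^T = X ->
  partial i (qt a q X x0) = fun y => (q + (y - x0) *m X) 0 i.
Proof.
move=> XT; apply/funext => y.
rewrite /partial (dval (qt_derive a q x0 y (delta_mx 0 i) XT)).
by rewrite dot_delta.
Qed.

Lemma qt_partial2_line q X x0 y v i t :
  (q + (y + t *: v - x0) *m X) 0 i - (q + (y - x0) *m X) 0 i - t * (v *m X) 0 i = 0.
Proof.
by rewrite (addrAC y) mulmxDl -scalemxAl !mxE; ring.
Qed.

Lemma qt_partial2_derive q X x0 y v i :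
  is_derive y v (fun y => (q + (y - x0) *m X) 0 i) ((v *m X) 0 i).
Proof.
apply: (@is_derive_sq _ _ _ _ 0 1) => // t _.
by rewrite qt_partial2_line normr0 mul0r.
Qed.

Lemma delta_mulmx X i j : ((delta_mx 0 i : 'rV[R]_n) *m X) 0 j = X i j.
Proof. by rewrite -rowE mxE. Qed.

Lemma qt_C2 a q X x0 x : X^T = X -> C2_at (qt a q X x0) x.
Proof.
move=> XT.
have J : jet (qt a q X x0) x (0 + (0 + q) + 2^-1 *: ((x - x0) *m (X + X^T)))
   (0 + (0 + 0) + 2^-1 *: (2 *: X)).
  apply: jetD; last by apply: jetZ; exact: jet_quad.
  have H := jetD (jet_cst (a - dot q x0) x) (jetD (jet_cst 0 x) (jet_dot q x)).
  by apply: jet_ext H => y; rewrite dotBr /=; ring.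
split; first exact: jet_cont J.
move=> i; split.
- by case: (qt_derive a q x0 x (delta_mx 0 i) XT).
- rewrite qt_partial//.
  apply: (@jet_cont _ _ _ _ (delta_mx 0 i *m X^T) 0).
  have H := jetD (jet_cst (q 0 i - (x0 *m X) 0 i) x) (jet_dot (delta_mx 0 i *m X^T) x).
  rewrite !add0r in H; apply: jet_ext H => y /=.
  rewrite dot_mull bilT -dot_mull dot_delta mulmxBl !mxE; ring.
- move=> j; rewrite qt_partial//; split.
    by case: (qt_partial2_derive q X x0 x (delta_mx 0 j) i).
  have -> : partial j (fun y => (q + (y - x0) *m X) 0 i) = cst (X j i).
    apply/funext => y; rewrite /partial.
    by rewrite (dval (qt_partial2_derive q X x0 y (delta_mx 0 j) i)) delta_mulmx.
  exact: cst_continuous.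
Qed.

Lemma qt_gradient a q X x0 : X^T = X -> gradient (qt a q X x0) x0 = q.
Proof.
move=> XT; apply/rowP => i; rewrite mxE qt_partial//.
by rewrite subrr mul0mx addr0.
Qed.

Lemma qt_hessian a q X x0 : X^T = X -> hessian (qt a q X x0) x0 = X.
Proof.
move=> XT; apply/matrixP => i j; rewrite mxE qt_partial// /partial.
rewrite (dval (qt_partial2_derive q X x0 x0 (delta_mx 0 i) j)).
by rewrite delta_mulmx.
Qed.

(** [qt_hessian] asks for a symmetric matrix, while the matrix of a jet is arbitrary; symmetrizing
    changes neither the quadratic form nor the trace, hence not [LA]. *)
Definition msym X : 'M[R]_n := 2^-1 *: (X + X^T).

Lemma msymT X : (msym X)^T = msym X.
Proof. by rewrite /msym linearZ/= linearD/= trmxK addrC. Qed.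

Lemma quad_msym X h : quad (msym X) h = quad X h.
Proof. by rewrite /msym quadMZ quadMD quadT; field. Qed.

Lemma tr_msym X : \tr (msym X) = \tr X.
Proof. by rewrite /msym linearZ/= linearD/= mxtrace_tr; field. Qed.

Lemma LA_msym p q X : LA p q (msym X) = LA p q X.
Proof. by rewrite /LA tr_msym quad_msym. Qed.

Lemma Fp_LA p q X : 0 < p -> Fp p q X = - (LA p q X / p) - 1.
Proof.
move=> p0; rewrite /Fp /LA enorm_sqr; have : p != 0 by rewrite gt_eqF.
by set d := (dot q q)^-1 => h; field.
Qed.

Lemma np_gt0 p : 1 < p -> (0 < n)%N -> 0 < n%:R + p - 2.
Proof. by move=> p1 n0; have : 1 <= n%:R :> R by [rewrite ler1n]; lra. Qed.

Definition jtest u x q X e := qt (u x) q (msym X + (2 * e)%:M) x.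

Lemma jtest_sym X e : (msym X + (2 * e)%:M)^T = msym X + (2 * e)%:M.
Proof. by rewrite linearD/= msymT tr_scalar_mx. Qed.

Lemma jtestE u x q X e y : jtest u x q X e y =
  u x + dot q (y - x) + 2^-1 * quad X (y - x) + e * dot (y - x) (y - x).
Proof. by rewrite /jtest /qt quadMD quad_msym quadM1; field. Qed.

Lemma jtest_self u x q X e : jtest u x q X e x = u x.
Proof. by rewrite jtestE subrr dot0r quad0 dot0l !mulr0 !addr0. Qed.

(** Adding [e * dot h h] to the expansion turns the superjet into a genuine [C2] function touching
    from above; the price in the operator is [2 * e * (n%:R + p - 2)]. *)
Lemma visc_sub_jet p Omega u x q X : 1 < p -> (0 < n)%N -> open Omega ->
  viscosity_subsolution p Omega u -> Omega x -> q != 0 -> ujet u x q X ->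
  - p <= LA p q X.
Proof.
move=> p1 n0 oO su Ox q0 J.
have N0 := np_gt0 p1 n0.
rewrite leNgt; apply/negP => L.
(* With this [e] the price is half of the assumed violation of the inequality. *)
pose e := (- p - LA p q X) / (4 * (n%:R + p - 2)).
have e0 : 0 < e by rewrite /e divr_gt0 ?mulr_gt0//; lra.
have [r r0 hr] := J e e0.
have := su x (jtest u x q X e) Ox.
have XT := jtest_sym X e.
rewrite qt_gradient ?qt_hessian// /Fp_lower (negPf q0) Fp_LA ?LAD ?LA_msym ?LA1//; last lra.
move=> /(_ _ _)-H; have : - ((LA p q X + 2 * e * (n%:R + p - 2)) / p) - 1 <= 0.
  apply: H; first by near=> y; exact: qt_C2.
  apply/within_enorm; exists r => // y yr _.
  rewrite /= !fctE jtest_self subrr subr_ge0 jtestE.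
  by have := hr _ yr; rewrite addrCA subrr addr0.
have -> : 2 * e * (n%:R + p - 2) = (- p - LA p q X) / 2.
  by rewrite /e; field; rewrite gt_eqF.
have p0 : 0 < p by lra.
by rewrite subr_le0 lerNl ler_pdivlMr//; lra.
Unshelve. all: by end_near. Qed.

Lemma visc_sup_jet p Omega u x q X : 1 < p -> (0 < n)%N -> open Omega ->
  viscosity_supersolution p Omega u -> Omega x -> q != 0 -> ljet u x q X ->
  LA p q X <= - p.
Proof.
move=> p1 n0 oO su Ox q0 J.
have N0 := np_gt0 p1 n0.
rewrite leNgt; apply/negP => L.
pose e := (LA p q X + p) / (4 * (n%:R + p - 2)).
have e0 : 0 < e by rewrite /e divr_gt0 ?mulr_gt0//; lra.
have [r r0 hr] := J e e0.
have := su x (jtest u x q X (- e)) Ox.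
have XT := jtest_sym X (- e).
rewrite qt_gradient ?qt_hessian// /Fp_upper (negPf q0) Fp_LA ?LAD ?LA_msym ?LA1//; last lra.
move=> /(_ _ _)-H; have : 0 <= - ((LA p q X + 2 * - e * (n%:R + p - 2)) / p) - 1.
  apply: H; first by near=> y; exact: qt_C2.
  apply/within_enorm; exists r => // y yr _.
  rewrite /= !fctE jtest_self subrr subr_le0 jtestE.
  by have := hr _ yr; rewrite addrCA subrr addr0 mulNr.
have -> : 2 * - e * (n%:R + p - 2) = - (LA p q X + p) / 2.
  by rewrite /e; field; rewrite gt_eqF.
have p0 : 0 < p by lra.
by rewrite subr_ge0 lerNr ler_pdivrMr//; lra.
Unshelve. all: by end_near. Qed.

(** The only information kept at vanishing gradient. The Hessian of the test function is a multiple
    of the identity, for which [Fp] takes the same value at all nonzero gradients, so the supremum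
    in [Fp_upper] is over a single value. It excludes interior minima of [u], and it is what
    [weak_comparison] uses when the two doubled points coincide. *)
Lemma visc_sup_jet0 p Omega u x : 1 < p -> (0 < n)%N -> open Omega ->
  viscosity_supersolution p Omega u -> Omega x -> ~ ljet u x 0 0.
Proof.
move=> p1 n0 oO su Ox J.
have N0 := np_gt0 p1 n0.
(* Chosen so that [2 * e * (n%:R + p - 2)] is [p / 2], which makes [Fp] equal to [- 2^-1]. *)
pose e := p / (4 * (n%:R + p - 2)).
have e0 : 0 < e by rewrite /e divr_gt0 ?mulr_gt0//; lra.
have [r r0 hr] := J e e0.
have := su x (jtest u x 0 0 (- e)) Ox.
have XT := jtest_sym 0 (- e).
rewrite qt_gradient ?qt_hessian// /Fp_upper eqxx.
have -> : [set Fp p a (msym 0 + (2 * - e)%:M) | a in [set a : 'rV[R]_n | a != 0]] =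
    [set - 2^-1].
  have E (a : 'rV[R]_n) : a != 0 -> Fp p a (msym 0 + (2 * - e)%:M) = - 2^-1.
    move=> a0; rewrite Fp_LA ?LAD ?LA_msym ?LA1//; last lra.
    have -> : LA p a 0 = 0 by rewrite -(scale0r 0) LAZ mul0r.
    by rewrite /e; field; rewrite !gt_eqF//; lra.
  apply/seteqP; split=> [_ [a a0 <-]|_ ->]; first exact: E.
  by exists (delta_mx 0 (Ordinal n0)); [exact: delta_neq0|exact/E/delta_neq0].
rewrite sup1 => H; have : 0 <= - 2^-1 :> R.
  apply: H; first by near=> y; exact: qt_C2.
  apply/within_enorm; exists r => // y yr _.
  rewrite /= !fctE jtest_self subrr subr_le0 jtestE.
  by have := hr _ yr; rewrite addrCA subrr addr0 mulNr.
by lra.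
Unshelve. all: by end_near. Qed.

Lemma neumann_above c Omega u x nu q X : neumann c Omega u ->
  boundary Omega x -> outward_unit_normal Omega x nu ->
  (forall e, 0 < e -> exists2 r, 0 < r & forall h, enorm h < r -> closure Omega (x + h) ->
    u (x + h) <= u x + dot q h + 2^-1 * quad X h + e * dot h h) ->
  dot q nu <= c.
Proof.
move=> N bx nx J; have [r r0 hr] := J 1 ltr01.
have XT := jtest_sym X 1.
have [/(_ (jtest u x q X 1))H _] := N x nu bx nx.
have D := dval (qt_derive (u x) q x x nu XT).
rewrite subrr mul0mx addr0 in D; rewrite -D; apply: H.
  by near=> y; exact: qt_C2.
apply/within_enorm; exists r => // y yr cy.
rewrite /= !fctE jtest_self subrr subr_ge0 jtestE.
by have := hr _ yr; rewrite addrCA subrr addr0; apply.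
Unshelve. all: by end_near. Qed.

Lemma neumann_below c Omega u x nu q X : neumann c Omega u ->
  boundary Omega x -> outward_unit_normal Omega x nu ->
  (forall e, 0 < e -> exists2 r, 0 < r & forall h, enorm h < r -> closure Omega (x + h) ->
    u x + dot q h + 2^-1 * quad X h - e * dot h h <= u (x + h)) ->
  c <= dot q nu.
Proof.
move=> N bx nx J; have [r r0 hr] := J 1 ltr01.
have XT := jtest_sym X (- 1).
have [_ /(_ (jtest u x q X (- 1)))H] := N x nu bx nx.
have D := dval (qt_derive (u x) q x x nu XT).
rewrite subrr mul0mx addr0 in D; rewrite -D; apply: H.
  by near=> y; exact: qt_C2.
apply/within_enorm; exists r => // y yr cy.
rewrite /= !fctE jtest_self subrr subr_le0 jtestE.
by have := hr _ yr; rewrite addrCA subrr addr0 mulNr; apply.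
Unshelve. all: by end_near. Qed.

End TestFunctions.

(** * Polynomials as syntax, and harmonic polynomials with given values on a sphere *)

Section Polynomials.
Context {R : realType} {n : nat}.
Implicit Types (x y h k q : 'rV[R]_n) (X Y : 'M[R]_n) (i j : 'I_n).

(** Syntax trees make differentiation a structural recursion; [pjet] identifies the symbolic
    gradient and Hessian with those of the jet. *)
Inductive pexp := PC of R | PX of 'I_n | PA of pexp & pexp | PM of pexp & pexp.
Implicit Types (a b e : pexp).

Fixpoint pev e x : R := match e with
  | PC c => c | PX i => x 0 i
  | PA a b => pev a x + pev b x | PM a b => pev a x * pev b x end.

Fixpoint pder i e : pexp := match e with
  | PC c => PC 0 | PX j => PC (i == j)%:R
  | PA a b => PA (pder i a) (pder i b)
  | PM a b => PA (PM (pder i a) b) (PM a (pder i b)) end.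

Definition pgrad e x : 'rV[R]_n := \row_i pev (pder i e) x.
Definition phess e x : 'M[R]_n := \matrix_(i, j) pev (pder i (pder j e)) x.

Lemma jet_quad_eq (f : 'rV[R]_n -> R) x q X Y : (forall h, quad X h = quad Y h) ->
  jet f x q X -> jet f x q Y.
Proof.
move=> E [A B]; split=> d d0.
  by have [r r0 hr] := A d d0; exists r => // h /hr; rewrite E.
by have [r r0 hr] := B d d0; exists r => // h /hr; rewrite E.
Qed.

Lemma pjet e x : jet (pev e) x (pgrad e x) (phess e x).
Proof.
elim: e => [c|i|a IHa b IHb|a IHa b IHb].
- rewrite (_ : pgrad _ _ = 0); last by apply/rowP => i; rewrite !mxE.
  rewrite (_ : phess _ _ = 0); last by apply/matrixP => i j; rewrite !mxE.
  exact: jet_cst.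
- rewrite (_ : pgrad _ _ = delta_mx 0 i); last by apply/rowP => j; rewrite !mxE eqxx.
  rewrite (_ : phess _ _ = 0); last by apply/matrixP => k j; rewrite !mxE.
  by apply: jet_ext (jet_dot (delta_mx 0 i) x) => y /=; rewrite dotC dot_delta.
- rewrite (_ : pgrad _ _ = pgrad a x + pgrad b x); last by apply/rowP => i; rewrite !mxE.
  rewrite (_ : phess _ _ = phess a x + phess b x); last by apply/matrixP => i j; rewrite !mxE.
  exact: jetD.
- rewrite (_ : pgrad _ _ = pev a x *: pgrad b x + pev b x *: pgrad a x); last first.
    by apply/rowP => i; rewrite !mxE /=; ring.
  apply: jet_quad_eq (jetM IHa IHb) => h.
  rewrite (_ : phess (PM a b) x = pev a x *: phess b x + pev b x *: phess a x
    + ((pgrad a x)^T *m pgrad b x + (pgrad b x)^T *m pgrad a x)); last first.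
    apply/matrixP => i j; rewrite !mxE !big_ord1 !mxE /=; ring.
  by rewrite !quadL !quadbil !bilout (dotC h (pgrad b x)) (dotC h (pgrad a x)); ring.
Qed.

Lemma jet_uniq (f : 'rV[R]_n -> R) x q k X Y : jet f x q X -> jet f x k Y ->
  q = k /\ forall h, quad X h = quad Y h.
Proof.
move=> [A B] [C D].
have E h : enorm h < 1 -> f x - f x <= f (x + h) - f (x + h) by rewrite !subrr.
have [qk P] := jet_touch ltr01 E A D.
have [_ Q] := jet_touch ltr01 E C B.
by split=> // h; apply/eqP; rewrite eq_le P Q.
Qed.

(** The symbolic derivative is computed from the tree but depends only on the polynomial function,
    because [pjet] exhibits it as part of a jet and jets are unique. From here on trees can be
    exchanged for others with the same values. *)
Lemma pder_ext a b i : pev a =1 pev b -> pev (pder i a) =1 pev (pder i b).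
Proof.
move=> ab x; have [E _] := jet_uniq (jet_ext ab (pjet a x)) (pjet b x).
by move: E => /rowP/(_ i); rewrite !mxE.
Qed.

Lemma pder_comm a i j : pev (pder i (pder j a)) =1 pev (pder j (pder i a)).
Proof.
move=> x; elim: a => //= [a -> b -> //|a Ha b Hb].
by rewrite Ha Hb; ring.
Qed.

Definition psum (s : seq 'I_n) (f : 'I_n -> pexp) : pexp :=
  foldr (fun i e => PA (f i) e) (PC 0) s.

Lemma pev_psum s f x : pev (psum s f) x = \sum_(i <- s) pev (f i) x.
Proof. by elim: s => [|i s IH] /=; rewrite ?big_nil// big_cons IH. Qed.

Lemma pder_psum s f j : pder j (psum s f) = psum s (fun i => pder j (f i)).
Proof. by elim: s => [|i s IH] //=; rewrite IH. Qed.

Definition lape e : pexp := psum (index_enum 'I_n) (fun i => pder i (pder i e)).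

Lemma lapE e x : pev (lape e) x = \tr (phess e x).
Proof. by rewrite pev_psum; apply: eq_bigr => i _; rewrite mxE. Qed.

Lemma lap_add a b x : pev (lape (PA a b)) x = pev (lape a) x + pev (lape b) x.
Proof. by rewrite !pev_psum -big_split. Qed.

Lemma lap_mul a b x : pev (lape (PM a b)) x =
  pev (lape a) x * pev b x + pev a x * pev (lape b) x +
  2 * \sum_i pev (pder i a) x * pev (pder i b) x.
Proof.
rewrite !pev_psum mulr_suml !mulr_sumr -!big_split/=; apply: eq_bigr => i _.
ring.
Qed.

Lemma lap_scale c a x : pev (lape (PM (PC c) a)) x = c * pev (lape a) x.
Proof.
rewrite lap_mul /= pev_psum big1 ?mul0r ?add0r//.
by rewrite big1 ?mulr0 ?addr0// => i _; rewrite mul0r.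
Qed.

Lemma lap_pder a i x : pev (lape (pder i a)) x = pev (pder i (lape a)) x.
Proof.
rewrite /lape pder_psum !pev_psum; apply: eq_bigr => j _.
rewrite [RHS](pder_comm (pder j a) i j).
by apply: pder_ext; exact: pder_comm.
Qed.

(** A degree bound: all derivatives of order [m] vanish identically, so the degree is less than [m].
    By [vanish_ext] it does not depend on the tree. *)
Fixpoint vanish (m : nat) e : Prop := match m with
  | 0 => forall x, pev e x = 0
  | m.+1 => forall i, vanish m (pder i e) end.

Lemma vanish_ext m a b : pev a =1 pev b -> vanish m a -> vanish m b.
Proof.
elim: m a b => [|m IH] a b ab /= H; first by move=> x; rewrite -ab.
by move=> i; apply: IH (H i); exact: pder_ext.
Qed.

Lemma vanishS m a : vanish m a -> vanish m.+1 a.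
Proof.
elim: m a => [|m IH] a H; last by move=> i; apply: IH; exact: H.
by move=> i x; rewrite (pder_ext i (b := PC 0)).
Qed.

Lemma vanishD m a b : vanish m a -> vanish m b -> vanish m (PA a b).
Proof.
elim: m a b => [|m IH] a b /= A B; first by move=> x; rewrite A B addr0.
by move=> i; exact: IH.
Qed.

Lemma vanish0M m a b : vanish 0 a -> vanish m (PM a b).
Proof.
move=> A; elim: m => [|m IH]; first by move=> x /=; rewrite A mul0r.
exact: vanishS.
Qed.

Lemma vanishC m a b : vanish m (PM a b) -> vanish m (PM b a).
Proof. by apply: vanish_ext => x /=; rewrite mulrC. Qed.

(** Leibniz rule, by induction on the total order; a factor whose allowance is used up vanishes
    identically, and then so does the product, to any order. *)
Lemma vanishM (k l : nat) a b : vanish k.+1 a -> vanish l.+1 b -> vanish (k + l).+1 (PM a b).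
Proof.
move: {2}(k + l)%N (leqnn (k + l)) => m.
elim: m k l a b => [|m IH] k l a b klm A B i.
  move: klm; rewrite leqn0 addn_eq0 => /andP[/eqP k0 /eqP l0]; subst k l.
  change (vanish 0 (PA (PM (pder i a) b) (PM a (pder i b)))); apply: vanishD; first exact/vanish0M/A.
  exact/vanishC/vanish0M/B.
change (vanish (k + l) (PA (PM (pder i a) b) (PM a (pder i b)))); apply: vanishD.
  case: k klm A => [|k] klm A; first exact/vanish0M/A.
  by rewrite addSn; apply: IH; [rewrite addSn in klm|exact: A|exact: B].
case: l klm B => [|l] klm B; first exact/vanishC/vanish0M/B.
by rewrite addnS; apply: IH; [rewrite addnS in klm|exact: A|exact: B].
Qed.

(* Homogeneity of degree m through Euler's identity; [vanish m.+1] records that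
   the degree is at most m. *)
Definition hom m e := vanish m.+1 e /\
  forall x, \sum_i x 0 i * pev (pder i e) x = m%:R * pev e x.

Lemma homC c : hom 0 (PC c).
Proof. by split=> [i x//|x]; rewrite mul0r big1// => i _; rewrite mulr0. Qed.

Lemma homX i : hom 1 (PX i).
Proof.
split=> [j k x//|x]; rewrite mul1r (bigD1 i)//= eqxx mulr1 big1 ?addr0// => j ji.
by rewrite (negPf ji) mulr0.
Qed.

Lemma homD m a b : hom m a -> hom m b -> hom m (PA a b).
Proof.
move=> [A EA] [B EB]; split; first exact: vanishD.
by move=> x /=; rewrite mulrDr -EA -EB -big_split; apply: eq_bigr => i _; rewrite mulrDr.
Qed.

Lemma homM m l a b : hom m a -> hom l b -> hom (m + l) (PM a b).
Proof.
move=> [A EA] [B EB]; split; first exact: vanishM.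
move=> x /=; rewrite natrD mulrDl mulrA -EA mulrCA -EB mulr_suml mulr_sumr -big_split.
by apply: eq_bigr => i _ /=; ring.
Qed.

Lemma homZ m c a : hom m a -> hom m (PM (PC c) a).
Proof. exact: homM (homC c). Qed.

(** Differentiating Euler's identity along the i-th axis produces one extra copy of [pder i a],
    which lowers the factor [m.+1] to [m]. *)
Lemma hom_pder m a i : hom m.+1 a -> hom m (pder i a).
Proof.
move=> [A EA]; split; first exact: A.
move=> x.
have H : pev (psum (index_enum 'I_n) (fun j => PM (PX j) (pder j a))) =1
   pev (PM (PC m.+1%:R) a) by move=> y; rewrite pev_psum EA.
have := pder_ext i H x; rewrite pder_psum pev_psum /= mul0r add0r.
rewrite big_split/= (bigD1 i)//= eqxx mul1r big1 ?addr0; last first.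
  by move=> j ji; rewrite eq_sym (negPf ji) mul0r.
rewrite -natr1 mulrDl mul1r addrC => /(@addIr _ _ _ _) <-.
by apply: eq_bigr => j _; rewrite pder_comm.
Qed.

Lemma hom_lap m a : hom m.+2 a -> hom m (lape a).
Proof.
move=> H; rewrite /lape; elim: (index_enum 'I_n) => [|i s IH] /=.
  split; first by elim: (m) => [i x//|k IH i]; apply: vanishS.
  by move=> x; rewrite mulr0 big1// => i _; rewrite mulr0.
by apply: homD => //; do 2 apply: hom_pder.
Qed.

Lemma hom_lap0 m a x : (m < 2)%N -> hom m a -> pev (lape a) x = 0.
Proof.
move=> m2 [A _]; rewrite pev_psum big1// => i _.
by case: m m2 A => [|[|]]// _ A; [exact: (vanishS A)|exact: A].
Qed.

Definition pN2 : pexp := psum (index_enum 'I_n) (fun i => PM (PX i) (PX i)).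

Lemma pev_N2 x : pev pN2 x = dot x x.
Proof. by rewrite pev_psum dotE. Qed.

Lemma hom_N2 : hom 2 pN2.
Proof.
rewrite /pN2; elim: (index_enum 'I_n) => [|i s IH] /=; last first.
  by apply: homD => //; apply: (@homM 1 1); exact: homX.
by split=> [i j k x//|x]; rewrite mulr0 big1// => i _; rewrite mulr0.
Qed.

Lemma pder_N2 i x : pev (pder i pN2) x = 2 * x 0 i.
Proof.
rewrite pder_psum pev_psum (bigD1 i)//= eqxx mulr1n big1 => [|j ji]; first ring.
by rewrite eq_sym (negPf ji) mulr0n; ring.
Qed.

Lemma lap_N2 x : pev (lape pN2) x = 2 * n%:R.
Proof.
rewrite pev_psum (eq_bigr (fun=> 2)); last first.
  move=> i _; rewrite (pder_ext i (b := PM (PC 2) (PX i))); last exact: pder_N2.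
  by rewrite /= eqxx mulr1n; ring.
by rewrite sumr_const card_ord -[LHS]mulr_natr.
Qed.

Lemma lap_N2M m a x : hom m a ->
  pev (lape (PM pN2 a)) x = (2 * n%:R + 4 * m%:R) * pev a x + dot x x * pev (lape a) x.
Proof.
move=> [_ E]; rewrite lap_mul lap_N2 pev_N2.
rewrite (eq_bigr (fun i => 2 * (x 0 i * pev (pder i a) x))); last first.
  by move=> i _; rewrite pder_N2 mulrA.
by rewrite -mulr_sumr E; ring.
Qed.

(** Look for [q] as [a / al - |x|^2 q']. By [lap_N2M] the equation becomes one of the same kind for
    [q'], of degree [m - 2], with [al] replaced by [al + 2 n + 4 (m - 2)] and right-hand side
    [lape a / al]. The coefficient stays positive, and below degree 2 the Laplacian vanishes. *)
Lemma Fischer_solve m a (al : R) : 0 < al -> hom m a -> exists2 q, hom m q &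
  forall x, al * pev q x + dot x x * pev (lape q) x = pev a x.
Proof.
elim/ltn_ind: m a al => m IH a al al0 Ha.
have aln : al != 0 by rewrite gt_eqF.
have [m2|m2] := ltnP m 2.
  exists (PM (PC al^-1) a); first exact: homZ.
  by move=> x; rewrite lap_scale (hom_lap0 _ m2 Ha) /=; field.
have em : m = (m - 2).+2 by rewrite -addn2 subnK.
have Hl : hom (m - 2) (PM (PC al^-1) (lape a)).
  by apply: homZ; apply: hom_lap; rewrite -em.
have al'0 : 0 < al + (2 * n%:R + 4 * (m - 2)%:R).
  by rewrite ltr_wpDr// addr_ge0// mulr_ge0.
have [|q Hq E] := IH (m - 2)%N _ _ _ al'0 Hl; first by rewrite [ltnRHS]em.
exists (PA (PM (PC al^-1) a) (PM (PC (-1)) (PM pN2 q))).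
  apply: homD; first exact: homZ.
  apply: homZ; rewrite em -addn2 addnC; apply: homM => //; exact: hom_N2.
move=> x; have := E x; rewrite lap_add !lap_scale (lap_N2M _ Hq) /= pev_N2.
set l := pev (lape q) x => H.
have -> : al * (al^-1 * pev a x + - 1 * (dot x x * pev q x)) +
  dot x x * (al^-1 * pev (lape a) x + - 1 * ((2 * n%:R + 4 * (m - 2)%:R) * pev q x + dot x x * l))
  = pev a x - dot x x * ((al + (2 * n%:R + 4 * (m - 2)%:R)) * pev q x + dot x x * l
     - al^-1 * pev (lape a) x) by field.
by rewrite H subrr mulr0 subr0.
Qed.

Definition harmonic e := forall x, pev (lape e) x = 0.

Definition harm_on r e := exists2 h, harmonic h &
  forall x, dot x x = r -> pev h x = pev e x.

Lemma harm_onD r a b : harm_on r a -> harm_on r b -> harm_on r (PA a b).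
Proof.
move=> [h Hh E] [k Hk F]; exists (PA h k).
  by move=> x; rewrite lap_add Hh Hk addr0.
by move=> x xr /=; rewrite E// F.
Qed.

(** Choose [q] such that [|x|^2 q] has the Laplacian of [a]; then [a - |x|^2 q] is harmonic. On the
    sphere the subtracted term is [r * q], and [q], of lower degree, has a harmonic replacement by
    induction. Here [r] is the squared radius. *)
Lemma Fischer r m a : (0 < n)%N -> hom m a -> harm_on r a.
Proof.
move=> n0; elim/ltn_ind: m a => m IH a Ha.
have [m2|m2] := ltnP m 2.
  by exists a => // x; exact: hom_lap0 m2 Ha.
have em : m = (m - 2).+2 by rewrite -addn2 subnK.
have Hl : hom (m - 2) (lape a) by apply: hom_lap; rewrite -em.
have [|q Hq E] := @Fischer_solve _ _ (2 * n%:R + 4 * (m - 2)%:R) _ Hl.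
  by rewrite ltr_wpDr ?mulr_ge0// mulr_gt0// ltr0n.
have [|h Hh F] := IH (m - 2)%N _ q Hq; first by rewrite [ltnRHS]em.
exists (PA (PA a (PM (PC (-1)) (PM pN2 q))) (PM (PC r) h)).
  move=> x; rewrite !lap_add !lap_scale (lap_N2M _ Hq) E Hh; ring.
by move=> x xr /=; rewrite pev_N2 xr F//; ring.
Qed.

(** Sums of homogeneous polynomials up to equality of values; through this closure [Fischer] reaches
    an arbitrary tree. *)
Inductive sumh : pexp -> Prop :=
  | sumh_hom m a : hom m a -> sumh a
  | sumh_add a b : sumh a -> sumh b -> sumh (PA a b)
  | sumh_ext a b : pev a =1 pev b -> sumh a -> sumh b.

Lemma sumhM a b : sumh a -> sumh b -> sumh (PM a b).
Proof.
move=> A; elim: A b => {a} [m a Ha|a c _ IHa _ IHc|a c ac _ IH] b B.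
- elim: B => {b} [l b Hb|b c _ IHb _ IHc|b c bc _ IH].
  + exact/sumh_hom/(homM Ha Hb).
  + apply: sumh_ext (sumh_add IHb IHc) => x /=; ring.
  + by apply: sumh_ext IH => x /=; rewrite bc.
- by apply: sumh_ext (sumh_add (IHa b B) (IHc b B)) => x /=; ring.
- by apply: sumh_ext (IH b B) => x /=; rewrite ac.
Qed.

Lemma sumh_all a : sumh a.
Proof.
elim: a => [c|i|a A b B|a A b B].
- exact/sumh_hom/homC.
- exact/sumh_hom/homX.
- exact: sumh_add.
- exact: sumhM.
Qed.

Lemma harm_on_all r a : (0 < n)%N -> harm_on r a.
Proof.
move=> n0; elim: (sumh_all a) => {a} [m a Ha|a b _ A _ B|a b ab _ [h Hh E]].
- exact: Fischer Ha.
- exact: harm_onD.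
- by exists h => // x /E ->.
Qed.

End Polynomials.

HB.instance Definition _ (R : realType) (n : nat) := gen_eqMixin (@pexp R n).

(** * The Bernstein operator of a cube as an expectation over Bernoulli trials *)

Section Bernstein.
Context {R : realType} {n : nat}.
Implicit Types (x y a : 'rV[R]_n) (i j : 'I_n) (f : 'rV[R]_n -> R).
Notation pexp := (@pexp R n).
Notation blist := (seq ('rV[R]_n * pexp)).

Definition bE (L : blist) f x : R := \sum_(v <- L) pev v.2 x * f v.1.

Variables (s h : R).

Definition yv i : pexp := PM (PC (2 * s)^-1) (PA (PX i) (PC s)).

(* One Bernoulli trial in the direction of the i-th axis with success
   probability [yv i], so that after N trials in each direction [bE] is the
   Bernstein operator of the cube [-s, s]^n. *)
Definition bstep i (L : blist) : blist :=
  [seq (v.1 + h *: delta_mx 0 i, PM (yv i) v.2) | v <- L] ++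
  [seq (v.1, PM (PA (PC 1) (PM (PC (-1)) (yv i))) v.2) | v <- L].

Definition bL (l : seq 'I_n) : blist := foldr bstep [:: (const_mx (- s), PC 1)] l.

Lemma bE_step i L f x : bE (bstep i L) f x =
  pev (yv i) x * bE L (fun v => f (v + h *: delta_mx 0 i)) x +
  (1 - pev (yv i) x) * bE L f x.
Proof.
rewrite /bE big_cat/= !big_map !mulr_sumr; congr (_ + _).
  by apply: eq_bigr => v _; rewrite /= mulrA.
by apply: eq_bigr => v _ /=; ring.
Qed.

Lemma bE1 l x : bE (bL l) (fun=> 1) x = 1.
Proof.
elim: l => [|i l IH]; first by rewrite /bE /= big_seq1 /= mulr1.
by rewrite [bL _]/= bE_step IH; ring.
Qed.

(** [bM] and [bV] are the mean and the total variance of the random node after the trials in [l];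
    [bE_sq] splits the second moment into squared bias and variance. *)
Fixpoint bM (l : seq 'I_n) x : 'rV[R]_n := match l with
  | [::] => const_mx (- s)
  | i :: l => bM l x + (pev (yv i) x * h) *: delta_mx 0 i end.

Fixpoint bV (l : seq 'I_n) x : R := match l with
  | [::] => 0
  | i :: l => bV l x + h ^+ 2 * (pev (yv i) x * (1 - pev (yv i) x)) end.

Lemma bE_sq l x a : bE (bL l) (fun v => dot (v + a) (v + a)) x =
  dot (bM l x + a) (bM l x + a) + bV l x.
Proof.
elim: l a => [|i l IH] a; first by rewrite /bE /= big_seq1 /= mul1r addr0.
rewrite [bL _]/= bE_step IH.
have -> : (fun v => dot (v + h *: delta_mx 0 i + a) (v + h *: delta_mx 0 i + a)) =
   (fun v => dot (v + (h *: delta_mx 0 i + a)) (v + (h *: delta_mx 0 i + a))).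
  by apply/funext => v; rewrite addrA.
rewrite IH (_ : bM (i :: l) x = bM l x + (pev (yv i) x * h) *: delta_mx 0 i)//.
rewrite (_ : bV (i :: l) x = bV l x + h ^+ 2 * (pev (yv i) x * (1 - pev (yv i) x)))//.
set y := pev (yv i) x; set e := delta_mx 0 i; set M := bM l x.
have ee : dot e e = 1 by rewrite /e dot_delta mxE !eqxx.
rewrite !dotL ee (dotC e M) (dotC e a) (dotC a M); ring.
Qed.

Lemma bL_node l v j : 0 <= h -> v \in bL l ->
  - s <= v.1 0 j <= - s + (count_mem j l)%:R * h.
Proof.
move=> h0; elim: l v => [|i l IH] v.
  by rewrite /= inE => /eqP -> /=; rewrite mxE mul0r addr0 lexx.
rewrite [bL _]/= mem_cat => /orP[] /mapP[w /IH/andP[A B] ->] /=.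
  rewrite !mxE eqxx/= natrD mulrDl (eq_sym j); apply/andP; split.
    by rewrite (le_trans A)// lerDl mulr_ge0.
  by move: B; case: eqP => _ /= B; rewrite ?mulr1n ?mulr0n; nra.
rewrite A/= (le_trans B)// lerD2l ler_wpM2r// ler_nat leq_addl//.
Qed.

Definition cube : set 'rV[R]_n := [set x | forall j, `|x 0 j| <= s].

Hypothesis s_gt0 : 0 < s.

Lemma yv_itv i x : cube x -> 0 <= pev (yv i) x <= 1.
Proof.
move=> /(_ i); rewrite ler_norml => /andP[A B] /=.
have s2 : 0 < 2 * s by rewrite mulr_gt0.
rewrite mulrC divr_ge0/= ?(ltW s2)//; last by lra.
by rewrite ler_pdivrMr//; lra.
Qed.

Lemma bL_weight l v x : cube x -> v \in bL l -> 0 <= pev v.2 x.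
Proof.
move=> cx; elim: l v => [|i l IH] v; first by rewrite /= inE => /eqP ->.
have /andP[y0 y1] := yv_itv i cx.
rewrite [bL _]/= mem_cat => /orP[] /mapP[w /IH W ->]; rewrite [_.2]/=.
  by rewrite [pev _ _]/= mulr_ge0.
by rewrite [pev _ _]/= mulr_ge0//; move: y1; rewrite /=; lra.
Qed.

Lemma bM_coord l x j :
  bM l x 0 j = - s + (count_mem j l)%:R * (pev (yv j) x * h).
Proof.
elim: l => [|i l IH]; first by rewrite /= mxE mul0r addr0.
rewrite [bM _ _]/= mxE IH !mxE eqxx/= natrD mulrDl (eq_sym j).
by case: eqP => [->|_] /=; rewrite ?mulr1n ?mulr0n; ring.
Qed.

Lemma bV_le l x : cube x -> bV l x <= (size l)%:R * h ^+ 2.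
Proof.
move=> cx; elim: l => [|i l IH]; first by rewrite /= mul0r.
have /andP[y0 y1] := yv_itv i cx.
rewrite (_ : bV (i :: l) x = bV l x + h ^+ 2 * (pev (yv i) x * (1 - pev (yv i) x)))//.
rewrite (_ : size (i :: l) = (size l).+1)// -natr1 mulrDl mul1r lerD// -[leRHS]mulr1.
by rewrite ler_wpM2l ?sqr_ge0//; nra.
Qed.

End Bernstein.

(** * Uniform approximation with basis polynomials fixed in advance, and its harmonic version *)

Section Weierstrass.
Context {R : realType} {n : nat}.
Implicit Types (x y : 'rV[R]_n) (i j : 'I_n) (g : 'rV[R]_n -> R).

Definition bseq N : seq 'I_n := flatten [seq nseq N i | i <- enum 'I_n].

Lemma count_bseq N j : count_mem j (bseq N) = N.
Proof.
rewrite /bseq count_flatten -map_comp sumnE big_map big_enum/=.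
rewrite (bigD1 j)//= big1 ?addn0 ?count_nseq/= ?eqxx ?mul1n// => i ij.
by rewrite count_nseq /= (negPf ij).
Qed.

Lemma size_bseq N : size (bseq N) = (n * N)%N.
Proof.
rewrite /bseq size_flatten /shape -map_comp sumnE big_map big_enum/=.
rewrite (eq_bigr (fun=> N)); first by rewrite sum_nat_const card_ord.
by move=> i _; rewrite size_nseq.
Qed.

(* The nodes and the basis polynomials depend only on the modulus of continuity. *)
Lemma Weierstrass (s d w : R) : 0 < s -> 0 < d -> 0 < w ->
  exists L : seq ('rV[R]_n * @pexp R n), (forall v, v \in L -> cube s v.1) /\
  forall (M : R) g, 0 <= M -> (forall x, cube s x -> `|g x| <= M) ->
    (forall x y, cube s x -> cube s y -> enorm (x - y) < w -> `|g x - g y| <= d * M) ->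
    forall x, cube s x -> `|bE L g x - g x| <= 2 * d * M.
Proof.
move=> s0 d0 w0.
(* Chebyshev's argument: [N] trials per axis give variance at most [n (2 s)^2 / N], and taking [N]
   at least [K] makes this at most [d * w ^+ 2 / 2]. *)
pose K := 2 * n%:R * (2 * s) ^+ 2 / (w ^+ 2 * d).
have K0 : 0 <= K by rewrite /K divr_ge0 ?mulr_ge0 ?sqr_ge0 ?(ltW d0)// ltW.
pose N := (Num.trunc K).+1.
have KN : K <= N%:R by rewrite ltW// truncnS_gt.
have N0 : 0 < N%:R :> R by rewrite ltr0n.
pose h := 2 * s / N%:R.
have h0 : 0 < h by rewrite /h divr_gt0// mulr_gt0.
have cL v : v \in bL s h (bseq N) -> cube s v.1.
  move=> vL j; have := bL_node j (ltW h0) vL; rewrite count_bseq.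
  have -> : N%:R * h = 2 * s by rewrite /h; field; rewrite gt_eqF.
  by rewrite ler_norml => /andP[A B]; apply/andP; split; lra.
exists (bL s h (bseq N)); split=> // M g M0 gM gw x cx.
have E1 := bE1 s h (bseq N) x.
have E2 := bE_sq s h (bseq N) x (- x).
have bMx : bM s h (bseq N) x = x.
  apply/rowP => j; rewrite bM_coord count_bseq /= /h; field.
  by rewrite !gt_eqF.
rewrite bMx subrr dot0l add0r in E2.
have V : bV s h (bseq N) x <= d * w ^+ 2 / 2.
  apply: le_trans (bV_le h s0 (bseq N) cx) _; rewrite size_bseq natrM /h.
  have -> : n%:R * N%:R * (2 * s / N%:R) ^+ 2 = n%:R * (2 * s) ^+ 2 / N%:R.
    by field; rewrite gt_eqF.
  rewrite ler_pdivrMr//.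
  have : K * (w ^+ 2 * d) <= N%:R * (w ^+ 2 * d).
    by rewrite ler_wpM2r// mulr_ge0 ?sqr_ge0// ltW.
  rewrite /K divfK ?gt_eqF ?mulr_gt0 ?exprn_gt0//; nra.
have -> : bE (bL s h (bseq N)) g x - g x =
    bE (bL s h (bseq N)) (fun v => g v - g x) x.
  rewrite -[X in _ - X]mul1r -E1 /bE mulr_suml -sumrB; apply: eq_bigr => v _.
  by rewrite mulr1 mulrBr.
apply: le_trans (ler_norm_sum _ _ _) _.
(* Nodes closer than [w] are controlled by the modulus [d * M]; for the others [2 * M] is at most
   [2 * M / w ^+ 2] times the squared distance, whose mean is the variance. *)
apply: (@le_trans _ _ (\sum_(v <- bL s h (bseq N)) pev v.2 x *
    (d * M + 2 * M / w ^+ 2 * dot (v.1 - x) (v.1 - x)))).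
  rewrite big_seq [leRHS]big_seq; apply: ler_sum => v vL.
  have W := bL_weight s0 cx vL.
  rewrite normrM (ger0_norm W) ler_wpM2l//.
  have w2 : 0 < w ^+ 2 by rewrite exprn_gt0.
  have [vw|vw] := ltP (enorm (v.1 - x)) w.
    apply: le_trans (gw _ _ (cL _ vL) cx vw) _.
    by rewrite lerDl mulr_ge0 ?dot_ge0// divr_ge0 ?mulr_ge0// ltW.
  have Q : w ^+ 2 <= dot (v.1 - x) (v.1 - x).
    by rewrite -enorm_sqr lerXn2r// nnegrE ?enorm_ge0// ltW.
  apply: (@le_trans _ _ (2 * M)).
    apply: le_trans (ler_normB _ _) _; rewrite mulr_natl mulr2n lerD//; apply: gM => //.
    exact: cL.
  rewrite ler_wpDl ?mulr_ge0 ?(ltW d0)// mulrAC ler_pdivlMr// ler_wpM2l//.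
  by rewrite mulr_ge0.
under eq_bigr do rewrite mulrDr.
rewrite big_split/=.
have -> : \sum_(v <- bL s h (bseq N)) pev v.2 x * (d * M) = d * M.
  by rewrite -mulr_suml -[RHS]mul1r -[in RHS]E1 /bE; under [in RHS]eq_bigr do rewrite mulr1.
have -> : \sum_(v <- bL s h (bseq N)) pev v.2 x * (2 * M / w ^+ 2 * dot (v.1 - x) (v.1 - x))
   = 2 * M / w ^+ 2 * bV s h (bseq N) x.
  by rewrite -E2 /bE mulr_sumr; apply: eq_bigr => v _; rewrite mulrCA.
have : 2 * M / w ^+ 2 * bV s h (bseq N) x <= 2 * M / w ^+ 2 * (d * w ^+ 2 / 2).
  by rewrite ler_wpM2l// divr_ge0 ?sqr_ge0// mulr_ge0.
have -> : 2 * M / w ^+ 2 * (d * w ^+ 2 / 2) = d * M by field; rewrite gt_eqF.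
lra.
Qed.

(** Each basis polynomial of [Weierstrass] is replaced by a harmonic one with the same values on the
    sphere of radius [r]. The list [L] is fixed before [g], so derivative bounds for combinations of
    its members are uniform over all data with the given modulus; [Schauder_step] rests on this. *)
Lemma Dirichlet_net (s d w r : R) : (0 < n)%N -> 0 < s -> 0 < d -> 0 < w -> r <= s ->
  exists L : seq ('rV[R]_n * @pexp R n), (forall v, v \in L -> harmonic v.2 /\ cube s v.1) /\
  forall (M : R) g, 0 <= M -> (forall x, cube s x -> `|g x| <= M) ->
    (forall x y, cube s x -> cube s y -> enorm (x - y) < w -> `|g x - g y| <= d * M) ->
    forall x, enorm x = r -> `|bE L g x - g x| <= 2 * d * M.
Proof.
move=> n0 s0 d0 w0 rs; have [L [cL H]] := Weierstrass s0 d0 w0.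
have hs (b : @pexp R n) := harm_on_all (r ^+ 2) b n0.
have hs' (b : @pexp R n) : {h | harmonic h /\ forall x, dot x x = r ^+ 2 -> pev h x = pev b x}.
  by apply: cid; have [h A B] := hs b; exists h.
exists [seq (v.1, sval (hs' v.2)) | v <- L]; split.
  move=> v /mapP[w' wL ->] /=; case: hs' => h [A _] /=; split=> //; exact: cL.
move=> M g M0 gM gw x xr.
have cx : cube s x by move=> j; rewrite (le_trans (coord_le_enorm _ _))// xr.
suff -> : bE [seq (v.1, sval (hs' v.2)) | v <- L] g x = bE L g x by exact: H.
rewrite /bE big_map; apply: eq_bigr => v _ /=; congr (_ * _).
by case: hs' => h [_ E] /=; apply: E; rewrite -enorm_sqr xr.
Qed.

Definition lcomb (L : seq ('rV[R]_n * @pexp R n)) g : @pexp R n :=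
  foldr (fun v e => PA (PM (PC (g v.1)) v.2) e) (PC 0) L.

Lemma pev_lcomb L g x : pev (lcomb L g) x = bE L g x.
Proof.
rewrite /bE; elim: L => [|v L IH]; first by rewrite big_nil.
by rewrite big_cons /= IH mulrC.
Qed.

Lemma lcomb_harmonic L g : (forall v, v \in L -> harmonic v.2) -> harmonic (lcomb L g).
Proof.
elim: L => [|v L IH] H x /=; first by rewrite pev_psum big1.
rewrite lap_add lap_scale H ?inE ?eqxx// mulr0 add0r; apply: IH => w wL.
by apply: H; rewrite inE wL orbT.
Qed.

End Weierstrass.

(** * Compactness, extrema and uniformity in Euclidean terms *)

Section Compactness.
Context {R : realType} {n : nat}.
Implicit Types (x y z : 'rV[R]_n) (A K : set 'rV[R]_n) (f : 'rV[R]_n -> R).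

Lemma closure_enorm A x : closure A x <->
  forall r, 0 < r -> exists2 y, A y & enorm (y - x) < r.
Proof.
split=> [H r r0|H B].
  have [|y [Ay yr]] := H [set y | enorm (y - x) < r]; last by exists y.
  by apply/nbhs_enorm; exists r.
by move=> /nbhs_enorm[r r0 hr]; have [y Ay /hr] := H r r0; exists y.
Qed.

Lemma closed_enorm A : (forall x, (forall r, 0 < r -> exists2 y, A y & enorm (y - x) < r)
  -> A x) -> closed A.
Proof. by move=> H x /closure_enorm; exact: H. Qed.

Lemma open_enorm A x : open A -> A x -> exists2 r, 0 < r & forall y, enorm (y - x) < r -> A y.
Proof. by move=> oA Ax; apply/nbhs_enorm; exact: open_nbhs_nbhs. Qed.

Lemma compact_enorm A M : (forall x, A x -> enorm x <= M) -> closed A -> compact A.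
Proof.
move=> H cA; apply: bounded_closed_compact => //.
exists M; split; first exact: num_real.
move=> r Mr x /H xM; apply: le_trans (norm_le_enorm x) (le_trans xM (ltW Mr)).
Qed.

Definition cball x (r : R) : set 'rV[R]_n := [set y | enorm (y - x) <= r].

Lemma closed_le (f g : 'rV[R]_n -> R) : (forall x, {for x, continuous f}) ->
  (forall x, {for x, continuous g}) -> closed [set x | f x <= g x].
Proof.
move=> cf cg; apply: closed_enorm => x H /=; rewrite leNgt; apply/negP => lt.
have e0 : 0 < (f x - g x) / 2 by rewrite divr_gt0// subr_gt0.
have /cont_enorm/(_ _ e0)[r1 r10 h1] := cf x.
have /cont_enorm/(_ _ e0)[r2 r20 h2] := cg x.
have [|y /= Ay] := H (Num.min r1 r2); first by rewrite lt_min r10.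
by rewrite lt_min => /andP[/h1 + /h2]; rewrite !ltr_norml; lra.
Qed.

Lemma cont_of_lip f C : 0 <= C -> (forall x y, `|f x - f y| <= C * enorm (x - y)) ->
  forall x, {for x, continuous f}.
Proof.
move=> C0 H x; apply/cont_enorm => e e0; exists (e / (C + 1)).
  by rewrite divr_gt0// ltr_wpDl.
move=> y; rewrite ltr_pdivlMr ?ltr_wpDl// => yx.
apply: le_lt_trans (H _ _) _; apply: le_lt_trans yx.
by rewrite mulrC ler_wpM2l ?enorm_ge0// lerDl.
Qed.

Lemma cont_enormB x : forall y, {for y, continuous (fun y => enorm (y - x))}.
Proof.
apply: (@cont_of_lip _ 1) => // y z; rewrite mul1r.
by apply: le_trans (ler_dist_enorm _ _) _; rewrite opprB addrA subrK.
Qed.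

Lemma compact_cball x r : compact (cball x r).
Proof.
apply: (@compact_enorm _ (r + enorm x)).
  by move=> y /= yr; rewrite -[y](subrK x); apply: le_trans (ler_enormD _ _) _; rewrite lerD2r.
apply: closed_le => y; [exact: cont_enormB|exact: cst_continuous].
Qed.

Lemma closedI2 A (B : set 'rV[R]_n) : closed A -> closed B -> closed (A `&` B).
Proof. exact: closedI. Qed.

Definition cont_on K f := forall x, K x -> forall e, 0 < e -> exists2 r, 0 < r &
    forall y, K y -> enorm (y - x) < r -> `|f y - f x| < e.

Lemma cont_onW K f : (forall x, K x -> {for x, continuous f}) -> cont_on K f.
Proof.
move=> H x Kx e e0; have /cont_enorm/(_ _ e0)[r r0 hr] := H x Kx.
by exists r => // y _; exact: hr.
Qed.

Lemma cont_onS K A f : A `<=` K -> cont_on K f -> cont_on A f.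
Proof.
move=> AK H x Ax e e0; have [r r0 hr] := H x (AK _ Ax) e e0.
by exists r => // y /AK; exact: hr.
Qed.

Lemma cont_onD K f g : cont_on K f -> cont_on K g -> cont_on K (fun x => f x + g x).
Proof.
move=> F G x Kx e e0; have e2 : 0 < e / 2 by rewrite divr_gt0.
have [r1 r10 h1] := F x Kx _ e2; have [r2 r20 h2] := G x Kx _ e2.
exists (Num.min r1 r2); first by rewrite lt_min r10.
by move=> y Ky; rewrite lt_min => /andP[/(h1 y Ky) + /(h2 y Ky)]; rewrite !ltr_norml; lra.
Qed.

Lemma cont_onN K f : cont_on K f -> cont_on K (fun x => - f x).
Proof.
move=> F x Kx e e0; have [r r0 hr] := F x Kx e e0; exists r => // y Ky /(hr y Ky).
by rewrite -opprD normrN.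
Qed.

Lemma cont_onB K f g : cont_on K f -> cont_on K g -> cont_on K (fun x => f x - g x).
Proof. by move=> F G; apply: cont_onD => //; exact: cont_onN. Qed.

Lemma cont_onZ K f a : cont_on K f -> cont_on K (fun x => a * f x).
Proof.
move=> F x Kx e e0; have ea : 0 < e / (`|a| + 1) by rewrite divr_gt0// ltr_wpDl.
have [r r0 hr] := F x Kx _ ea; exists r => // y Ky /(hr y Ky).
rewrite ltr_pdivlMr ?ltr_wpDl// => H; rewrite -mulrBr normrM.
by have := normr_ge0 (f y - f x); nra.
Qed.

Lemma compact_max K f : compact K -> K !=set0 -> cont_on K f ->
  exists2 x, K x & forall y, K y -> f y <= f x.
Proof.
move=> cK K0 /within_cont_enorm cf.
have [x /set_mem Kx H] := compact_EVT_max K0 cK cf.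
by exists x => // y Ky; apply: H; exact/mem_set.
Qed.

Lemma compact_min K f : compact K -> K !=set0 -> cont_on K f ->
  exists2 x, K x & forall y, K y -> f x <= f y.
Proof.
move=> cK K0 /cont_onN cf; have [x Kx H] := compact_max cK K0 cf.
by exists x => // y /H; rewrite lerN2.
Qed.

(** A property of points and small scales that holds locally uniformly on a compact set holds below
    one common scale. It yields a uniform radius of tangent balls and the attainment of the critical
    plane. *)
Lemma compact_scale K (P : R -> 'rV[R]_n -> Prop) : compact K ->
  (forall x, K x -> exists2 r, 0 < r & forall w y, 0 < w -> w < r -> enorm (y - x) < r ->
     K y -> P w y) ->
  exists2 r, 0 < r & forall w x, 0 < w -> w < r -> K x -> P w x.
Proof.
move=> /compact_near_coveringP cK H.
have : \forall w \near (0 : R)^'+, K `<=` (fun x => K x -> P w x).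
  apply: (cK _ _ (fun w x => K x -> P w x)) => x Kx; have [r r0 hr] := H x Kx.
  exists ([set y | enorm (y - x) < r], [set w | 0 < w < r]) => /=.
    split; first by apply/nbhs_enorm; exists r.
    near=> w; apply/andP; split; first by near: w; exact: nbhs_right_gt.
    by near: w; exact: nbhs_right_lt.
  by move=> [y w] /= [yr /andP[w0 wr]] Ky; exact: hr.
rewrite near_withinE => /nbhs_ballP[r /= r0 hr]; exists r => // w x w0 wr Kx.
apply: (hr w) => //; rewrite -ball_normE /= sub0r normrN gtr0_norm//.
Unshelve. all: by end_near. Qed.

Lemma compact_unif K f : compact K -> cont_on K f -> forall e, 0 < e ->
  exists2 r, 0 < r & forall x y, K x -> K y -> enorm (x - y) < r -> `|f x - f y| < e.
Proof.
move=> cK cf e e0; have e2 : 0 < e / 2 by rewrite divr_gt0.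
have [|r r0 hr] := @compact_scale K
   (fun w x => forall y, K y -> enorm (y - x) < w -> `|f y - f x| < e) cK.
  move=> x Kx; have [r r0 hr] := cf x Kx _ e2.
  exists (r / 2); first by rewrite divr_gt0.
  move=> w y w0 wr yx Ky z Kz zy.
  have zx : enorm (z - x) < r by have := enorm_tri z y x; lra.
  have yx' : enorm (y - x) < r by lra.
  by have := hr z Kz zx; have := hr y Ky yx'; rewrite !ltr_norml; lra.
exists (r / 2); first by rewrite divr_gt0.
move=> x y Kx Ky; rewrite enormC => xy; rewrite distrC.
by apply: (hr (r / 2)) => //; lra.
Qed.

Lemma compact_bound K f : compact K -> cont_on K f ->
  exists2 M, 0 <= M & forall x, K x -> `|f x| <= M.
Proof.
move=> cK cf; have [K0|/set0P/negP/negPn/eqP K0] := pselect (K !=set0); last first.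
  by exists 0 => // x; rewrite K0.
have [x Kx Hx] := compact_max cK K0 cf; have [y Ky Hy] := compact_min cK K0 cf.
exists (`|f x| + `|f y|); first by rewrite addr_ge0.
move=> z Kz; have := Hx z Kz; have := Hy z Kz.
have := ler_norm (f x); have := ler_norm (- f y); rewrite normrN.
have := normr_ge0 (f x); have := normr_ge0 (f y); rewrite ler_norml; lra.
Qed.

Lemma compact_cube s : 0 <= s -> compact (@cube R n s).
Proof.
move=> s0; apply: bounded_closed_compact.
  exists s; split; first exact: num_real.
  move=> r sr x cx /=; apply: le_trans (ltW sr).
  rewrite /Num.norm/= mx_normrE; apply/bigmax_leP; split=> // -[i j] _ /=.
  by rewrite ord1; exact: cx.
apply: closed_enorm => x H j; rewrite leNgt; apply/negP => xs.
have [|y cy yx] := H (`|x 0 j| - s); first by rewrite subr_gt0.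
have := coord_le_enorm (y - x) j; rewrite !mxE => A.
have := cy j; have := ler_dist_dist (x 0 j) (y 0 j).
have := ler_norm (`|x 0 j| - `|y 0 j|); rewrite (distrC (x 0 j)); lra.
Qed.

End Compactness.

(** * Sub- and supersolutions of Poisson's equation at a contact point *)

Section LinearTouch.
Context {R : realType} {n : nat}.
Implicit Types (x y z q h : 'rV[R]_n) (S X : 'M[R]_n) (U V H f : 'rV[R]_n -> R).

Lemma ujet_touch f g z q X s : 0 < s ->
  (forall h, enorm h < s -> f (z + h) - f z <= g (z + h) - g z) ->
  ujet g z q X -> ujet f z q X.
Proof.
move=> s0 fg J e e0; have [r r0 hr] := J e e0.
exists (Num.min r s); first by rewrite lt_min r0.
by move=> h; rewrite lt_min => /andP[/hr A /fg B]; lra.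
Qed.

(** At an interior maximum of [U - H] the jet of [H] would be a superjet of [U], which [c < f]
    excludes; so the maximum lies on the sphere. *)
Lemma sub_le_smooth U H s (f c a : R) : 0 < s ->
  cont_on (cball 0 s) U -> (forall z, {for z, continuous H}) ->
  (forall z, enorm z < s -> exists q X, jet H z q X /\ \tr X <= c) -> c < f ->
  (forall z q X, enorm z < s -> ujet U z q X -> f <= \tr X) ->
  (forall z, enorm z = s -> U z <= H z - a) ->
  forall z, enorm z <= s -> U z <= H z - a.
Proof.
move=> s0 cU cH jH cf sU bd z zs.
have c0 : @cball R n 0 s !=set0 by exists 0; rewrite /cball /= subrr enorm0 ltW.
have [|x xs mx] := compact_max (@compact_cball R n 0 s) c0 (f := fun z => U z - H z).
  by apply: cont_onB => //; apply: cont_onW.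
have zK : cball 0 s z by rewrite /cball /= subr0.
have := mx z zK; move: xs; rewrite /cball /= subr0 le_eqVlt => /orP[/eqP xs|xs].
  by have := bd x xs; lra.
have [q [X [jX tX]]] := jH x xs.
have : f <= \tr X.
  apply: (sU x q X xs); case: jX => jX _.
  apply: (ujet_touch (s := s - enorm x) _ _ jX); first by rewrite subr_gt0.
  move=> h hs; have := mx (x + h); rewrite /cball /= subr0.
  have := ler_enormD x h; lra.
by lra.
Qed.

Lemma sup_ge_smooth V H s (g c a : R) : 0 < s ->
  cont_on (cball 0 s) V -> (forall z, {for z, continuous H}) ->
  (forall z, enorm z < s -> exists q X, jet H z q X /\ c <= \tr X) -> g < c ->
  (forall z q X, enorm z < s -> ljet V z q X -> \tr X <= g) ->
  (forall z, enorm z = s -> H z + a <= V z) ->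
  forall z, enorm z <= s -> H z + a <= V z.
Proof.
move=> s0 cV cH jH gc sV bd z zs.
suff : - V z <= - H z - a by lra.
apply: (@sub_le_smooth (fun z => - V z) (fun z => - H z) s (- g) (- c)) => //.
- exact: cont_onN.
- by move=> y; apply: continuousN; exact: cH.
- move=> y /jH[q [X [jX tX]]]; exists (- q), (- X); split; first exact: jetN.
  by rewrite linearN/=; lra.
- by rewrite ltrN2.
- move=> y q X ys J; have /(sV _ _ _ ys) : ljet V y (- q) (- X).
    have := ljetN J; rewrite (_ : (\- (fun z => - V z)) = V)//.
    by apply/funext => w /=; rewrite opprK.
  by rewrite linearN/=; lra.
- by move=> y /bd; lra.
Qed.

(** For the Laplacian this does the work of a second-order differentiation theorem for semiconvex
    functions. If the trace were too small, [S] could be enlarged so that a gap opens on a small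
    sphere, and a smooth function with Laplacian strictly between the two bounds could be put into
    that gap. Comparison keeps it there at the centre, with room [eta], although the two sides agree
    at the centre. *)
Lemma linear_touch U V S (f g r : R) : (0 < n)%N -> 0 < r ->
  (forall z, enorm z < r -> {for z, continuous U}) ->
  (forall z, enorm z < r -> {for z, continuous V}) ->
  (forall z q X, enorm z < r -> ujet U z q X -> f <= \tr X) ->
  (forall z q X, enorm z < r -> ljet V z q X -> \tr X <= g) ->
  (forall z, enorm z < r -> U z - V z <= 2^-1 * quad S z) -> U 0 = V 0 ->
  f - g <= \tr S.
Proof.
move=> n0 r0 cU cV sU sV touch UV0; rewrite leNgt; apply/negP => L.
have nR : 0 < n%:R :> R by rewrite ltr0n.
have nR0 : n%:R != 0 :> R by rewrite gt_eqF.
pose th := (f - g - \tr S) / (4 * n%:R).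
have th0 : 0 < th by rewrite /th divr_gt0 ?mulr_gt0// subr_gt0.
pose S' := S + (2 * th)%:M.
have tS' : \tr S' = (\tr S + (f - g)) / 2.
  by rewrite /S' linearD/= mxtrace_scalar -[_ *+ n]mulr_natr /th; field.
pose s := r / (2 * n%:R).
have s0 : 0 < s by rewrite /s divr_gt0 ?mulr_gt0.
have cr z : cube s z -> enorm z < r.
  move=> cz; apply: le_lt_trans (enorm_le_norm z) _.
  have : `|z| <= s.
    rewrite /Num.norm/= mx_normrE; apply/bigmax_leP; split; first exact: ltW.
    by move=> [i j] _ /=; rewrite ord1; exact: cz.
  move=> /(ler_wpM2l (ltW nR)) H; apply: le_lt_trans H _.
  by rewrite /s; have -> : n%:R * (r / (2 * n%:R)) = r / 2 by [field]; lra.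
have bc z : enorm z <= s -> cube s z.
  by move=> zs j; exact: le_trans (coord_le_enorm _ _) zs.
have cS z : {for z, continuous (fun z => 2^-1 * quad S' z)}.
  have J := jetZ 2^-1 (jet_quad S' 0 z); apply: jet_cont (jet_ext _ J) => y.
  by rewrite subr0.
have cUK : cont_on (cube s) U by apply: cont_onW => z /cr; exact: cU.
have cVK : cont_on (cube s) V by apply: cont_onW => z /cr; exact: cV.
(* The average of the two functions to be separated; any function within [eta], an eighth of the
   gap, of it on the sphere separates them. *)
pose g0 z := 2^-1 * (U z + (V z + 2^-1 * quad S' z)).
have cg0 : cont_on (cube s) g0.
  apply: (@cont_onZ _ _ _ (fun z => U z + (V z + 2^-1 * quad S' z))).
  by do 2 apply: cont_onD => //; apply: cont_onW => z _.
have [M M0 hM] := compact_bound (@compact_cube R n s (ltW s0)) cg0.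
pose eta := th * s ^+ 2 / 8.
have eta0 : 0 < eta by rewrite /eta divr_gt0// mulr_gt0// exprn_gt0.
pose d := eta / (2 * (M + 1)).
have M1 : 0 < M + 1 by lra.
have d0 : 0 < d by rewrite /d divr_gt0// mulr_gt0.
have [w w0 hw] := compact_unif (@compact_cube R n s (ltW s0)) cg0 (mulr_gt0 d0 M1).
have [L' [hL HL]] := Dirichlet_net n0 s0 d0 w0 (lexx s).
pose h := lcomb L' g0.
have hh : harmonic h by apply: lcomb_harmonic => v /hL[].
have hs z : enorm z = s -> `|pev h z - g0 z| <= eta.
  move=> zs; rewrite pev_lcomb.
  have := HL (M + 1) g0; have -> : 2 * d * (M + 1) = eta by rewrite /d; field; rewrite gt_eqF.
  apply=> //; [lra| |].
    by move=> x /hM; lra.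
  by move=> x y cx cy /(hw x y cx cy)/ltW.
(* Midway, hence strictly, between [g + \tr S'] and [f]. [H] is the harmonic [h] plus a radial
   quadratic with Laplacian [c] that vanishes on the sphere. *)
pose c := (f + g + \tr S') / 2.
pose H z := pev h z + c / (2 * n%:R) * (quad 1%:M (z - 0) - s ^+ 2).
have jH z : exists q X, jet H z q X /\ \tr X = c.
  have J := jetD (pjet h z) (jetZ (c / (2 * n%:R)) (jetD (jet_quad 1%:M 0 z) (jet_cst (- s ^+ 2) z))).
  do 2 eexists; split; first exact: J.
  rewrite addr0 linearD/= -lapE hh add0r !linearZ/= mxtrace1.
  by field.
have cH z : {for z, continuous H}.
  by have [q [X [J _]]] := jH z; exact: jet_cont J.
have Hs z : enorm z = s -> H z = pev h z.
  by move=> zs; rewrite /H subr0 quadM1 mul1r -enorm_sqr zs subrr mulr0 addr0.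
have sub (f' : 'rV[R]_n -> R) : cont_on (cube s) f' -> cont_on (cball 0 s) f'.
  by apply: cont_onS => z; rewrite /cball /= subr0; exact: bc.
have sr z : enorm z < s -> enorm z < r by move=> /ltW/bc/cr.
have gap z : enorm z = s -> U z + th * s ^+ 2 <= V z + 2^-1 * quad S' z.
  move=> zs; have := touch z (cr z (bc z _)); rewrite zs => /(_ (lexx _)).
  by rewrite /S' quadMD quadM1 -enorm_sqr zs; lra.
have A : U 0 <= H 0 - eta.
  apply: (@sub_le_smooth U H s f c) => //; first exact: sub.
  - by move=> z _; have [q [X [J E]]] := jH z; exists q, X; rewrite E.
  - by rewrite /c tS'; lra.
  - by move=> z q X /sr; exact: sU.
  - move=> z zs; rewrite (Hs _ zs); have := hs z zs; have := gap z zs.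
    by rewrite ler_norml /g0 /eta; lra.
  - by rewrite enorm0 ltW.
have B : H 0 + 0 <= V 0 + 2^-1 * quad S' 0.
  suff : H 0 - 2^-1 * quad S' 0 + 0 <= V 0 by lra.
  apply: (@sup_ge_smooth V (fun z => H z - 2^-1 * quad S' z) s g (c - \tr S')) => //.
  - exact: sub.
  - by move=> z; apply: continuousB; [exact: cH|exact: cS].
  - move=> z _; have [q [X [J E]]] := jH z.
    have J2 : jet (fun z => 2^-1 * quad S' z) z (2^-1 *: ((z - 0) *m (S' + S'^T))) (2^-1 *: (2 *: S')).
      by apply: jet_ext (jetZ 2^-1 (jet_quad S' 0 z)) => y; rewrite subr0.
    do 2 eexists; split; first exact: (jetD J (jetN J2)).
    by rewrite scalerA mulVf ?pnatr_eq0// scale1r linearB/= E.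
  - by rewrite /c tS'; lra.
  - by move=> z q X /sr; exact: sV.
  - move=> z zs; rewrite (Hs _ zs); have := hs z zs; have := gap z zs.
    by rewrite ler_norml /g0 /eta; lra.
  - by rewrite enorm0 ltW.
rewrite quad0 in B; lra.
Qed.

End LinearTouch.

(** * The theorem on sums: sup-convolutions with frozen coefficients *)

Section TheoremOnSums.
Context {R : realType} {n : nat}.
Implicit Types (x y z h k q b : 'rV[R]_n) (X Y Z W M : 'M[R]_n) (u v U : 'rV[R]_n -> R).
Implicit Types (p f g e c s r : R).

Lemma ujet_shift u U x y q X s : 0 < s ->
  (forall h, enorm h < s -> u (x + h) - u x <= U (y + h) - U y) ->
  ujet U y q X -> ujet u x q X.
Proof.
move=> s0 uU J e e0; have [r r0 hr] := J e e0.
exists (Num.min r s); first by rewrite lt_min r0.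
by move=> h; rewrite lt_min => /andP[/hr A /uU B]; lra.
Qed.

Lemma ujet_affine u (c : 'rV[R]_n) M z q X : ujet u (c + z *m M) q X ->
  ujet (fun z => u (c + z *m M)) z (q *m M^T) (M *m X *m M^T).
Proof.
move=> F e e0; pose m := 1 + mnorm M; have m0 : 0 < m by rewrite ltr_wpDr ?mnorm_ge0.
have [|r r0 hr] := F (e / m ^+ 2); first by rewrite divr_gt0// exprn_gt0.
exists (r / m); first by rewrite divr_gt0.
move=> h; rewrite ltr_pdivlMr// => hh.
have hM : enorm (h *m M) <= enorm h * m.
  apply: le_trans (mulmx_enorm_le _ _) _; rewrite mulrC ler_wpM2l ?enorm_ge0//.
  by rewrite /m lerDr.
have := hr (h *m M) (le_lt_trans hM hh); rewrite mulmxDl addrA.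
have -> : dot (q *m M^T) h = dot q (h *m M) by rewrite dot_mulr dot_mull bilT.
have -> : quad (M *m X *m M^T) h = quad X (h *m M) by rewrite !quadbil bil_mul.
move=> H; apply: le_trans H _; rewrite lerD2l.
rewrite mulrAC ler_pdivrMr ?exprn_gt0// -[leRHS]mulrA ler_wpM2l ?(ltW e0)//.
rewrite -!enorm_sqr -exprMn lerXn2r// nnegrE ?enorm_ge0// mulr_ge0 ?enorm_ge0//.
exact: ltW.
Qed.

Lemma LA_tr p q X : LA p q X = \tr (rt (p - 1) q *m X).
Proof.
rewrite /rt mulmxDl mul1mx linearD/= -scalemxAl linearZ/= tr_out /LA quadbil.
by set d := (dot q q)^-1; ring.
Qed.

(** Nonnegativity of the form at [t *: h - d], with [d = k - h] and [t] its norm, bounds the mixed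
    terms by the trace. *)
Lemma psd_perturb Y h k : (forall z, 0 <= quad Y z) -> enorm h = 1 ->
  quad Y k <= quad Y h + (2 * enorm (k - h) + enorm (k - h) ^+ 2) * \tr Y.
Proof.
move=> P h1; have [d dE] : exists d, d = k - h by exists (k - h).
have kE : k = h + d by rewrite dE addrC subrK.
rewrite -dE; set t := enorm d.
have tr_ge z : quad Y z <= \tr Y * dot z z.
  have [->|z0] := eqVneq z 0; first by rewrite quad0 dot0l mulr0.
  by rewrite -ler_pdivrMr ?dot_gt0//; exact: tr_ge_quad.
have hh : dot h h = 1 by rewrite -enorm_sqr h1 expr1n.
have dd : dot d d = t ^+ 2 by rewrite -enorm_sqr.
have t0 : 0 <= t by exact: enorm_ge0.
have qh := tr_ge h; have qd := tr_ge d; rewrite hh mulr1 in qh; rewrite dd in qd.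
have [t0'|t0'] := eqVneq t 0.
  have d0 : d = 0 by apply/eqP; rewrite -enorm_eq0 -/t; apply/eqP.
  by rewrite kE d0 addr0 t0'; lra.
have tp : 0 < t by rewrite lt_def t0'.
have := P (t *: h - d); rewrite kE !quadbil !bilL -!quadbil => H.
have C : t * (bil Y h d + bil Y d h) <= t * (2 * t * \tr Y).
  have : t ^+ 2 * quad Y h <= t ^+ 2 * \tr Y by rewrite ler_wpM2l ?sqr_ge0.
  by move: H qd; nra.
by rewrite ler_pM2l// in C; lra.
Qed.

(** The Hessian of a sup-convolution is bounded from below only, so the additive error of [LA_lip]
    is useless for it. Once a shift has made the form nonnegative, the trace is controlled by [LA]
    itself and the error becomes a factor. *)
Lemma freeze p b k Y : 1 < p -> b != 0 -> k != 0 -> (forall z, 0 <= quad Y z) ->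
  enorm (k - b) <= enorm b / 2 ->
  LA p k Y <= (1 + 8 * `|p - 2| / (lmin p * enorm b) * enorm (k - b)) * LA p b Y.
Proof.
move=> p1 b0 k0 P kb.
have eb : 0 < enorm b by rewrite enorm_gt0.
set bh := (enorm b)^-1 *: b; set kh := (enorm k)^-1 *: k.
have s1 : enorm (kh - bh) <= 2 * (enorm b)^-1 * enorm (k - b).
  by rewrite -(enormN (kh - bh)) opprB -(enormN (k - b)) opprB; exact: unit_lip.
set s := enorm (kh - bh) in s1.
have s0 : 0 <= s by exact: enorm_ge0.
have s1' : s <= 1.
  apply: le_trans s1 _; rewrite mulrAC ler_pdivrMr//; lra.
have tY : 0 <= \tr Y.
  apply: le_trans (tr_ge_quad b0 P); rewrite divr_ge0 ?dot_ge0//.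
have A : LA p k Y <= LA p b Y + `|p - 2| * (3 * s) * \tr Y.
  rewrite /LA !quad_unit// -/bh -/kh.
  have U1 : enorm bh = 1 by exact: unit_enorm.
  have U2 : enorm kh = 1 by exact: unit_enorm.
  have B1 := psd_perturb kh P U1; rewrite -/s in B1.
  have B2 := psd_perturb bh P U2; rewrite enormC -/s in B2.
  have B : `|quad Y kh - quad Y bh| <= 3 * s * \tr Y.
    have : (2 * s + s ^+ 2) * \tr Y <= 3 * s * \tr Y by rewrite ler_wpM2r//; nra.
    by rewrite ler_norml; lra.
  have : (p - 2) * (quad Y kh - quad Y bh) <= `|p - 2| * (3 * s * \tr Y).
    by apply: le_trans (ler_norm _) _; rewrite normrM ler_wpM2l.
  by lra.
apply: le_trans A _; rewrite [leRHS]mulrDl mul1r lerD2l.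
have L := lmin_tr p1 b0 P; have l0 := lmin_gt0 p1.
have T : \tr Y <= LA p b Y / lmin p by rewrite ler_pdivlMr// mulrC.
have LA0 : 0 <= LA p b Y by exact: LA_psd.
apply: (@le_trans _ _ (`|p - 2| * (3 * (2 * (enorm b)^-1 * enorm (k - b))) * (LA p b Y / lmin p))).
  by rewrite ler_pM// ?mulr_ge0// ?ler_wpM2l//.
have -> : `|p - 2| * (3 * (2 / enorm b * enorm (k - b))) * (LA p b Y / lmin p) =
   6 * (`|p - 2| / (lmin p * enorm b) * enorm (k - b) * LA p b Y).
  by field; rewrite !gt_eqF.
have -> : 8 * `|p - 2| / (lmin p * enorm b) * enorm (k - b) * LA p b Y =
   8 * (`|p - 2| / (lmin p * enorm b) * enorm (k - b) * LA p b Y) by ring.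
rewrite ler_wpM2r ?ler_nat//.
by rewrite !mulr_ge0 ?enorm_ge0// invr_ge0 mulr_ge0 ?enorm_ge0// ltW.
Qed.

Lemma sup_convolution u rho e : 0 < e -> 0 <= rho -> cont_on (cball 0 rho) u ->
  exists U : 'rV[R]_n -> R,
   (forall h, exists2 k, enorm k <= rho & U h = u k - (2 * e)^-1 * dot (k - h) (k - h)) /\
   (forall h k, enorm k <= rho -> u k - (2 * e)^-1 * dot (k - h) (k - h) <= U h).
Proof.
move=> e0 rho0 cu.
have H h : exists k, enorm k <= rho /\ forall z, enorm z <= rho ->
    u z - (2 * e)^-1 * dot (z - h) (z - h) <= u k - (2 * e)^-1 * dot (k - h) (k - h).
  have c0 : @cball R n 0 rho !=set0 by exists 0; rewrite /cball /= subrr enorm0.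
  have [|k kr mk] := compact_max (@compact_cball R n 0 rho) c0
     (f := fun z => u z - (2 * e)^-1 * quad 1%:M (z - h)).
    apply: cont_onB => //; apply: cont_onW => z _.
    exact: (jet_cont (jetZ (2 * e)^-1 (jet_quad 1%:M h z))).
  rewrite /cball /= subr0 in kr; exists k; split=> // z zr.
  by have := mk z; rewrite /cball /= subr0 !quadM1 !mul1r; apply.
have [F hF] := choice H.
exists (fun h => u (F h) - (2 * e)^-1 * dot (F h - h) (F h - h)); split=> h.
  by exists (F h) => //; have [] := hF h.
by move=> k kr; have [_] := hF h; exact.
Qed.

(** Since [u h <= C |h|^2] and the penalty constant [E = (2 e)^-1] is at least [4 C], the maximizer
    belonging to [h] stays within [3 |h|] of [h]: for [h] near the origin it is interior and the
    test gradient [q] is small. Then [X + 2 E] is nonnegative, and [freeze] moves the operator from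
    [b + q] to [b] at the cost of [d]. *)
Lemma regularize p u b f rho e C : 1 < p -> (0 < n)%N -> b != 0 -> 0 < rho ->
  0 < e -> 0 <= C -> 8 * C * e <= 1 -> cont_on (cball 0 rho) u ->
  (forall h, enorm h <= rho -> u h <= C * dot h h) -> u 0 = 0 ->
  (forall h q X, enorm h < rho -> b + q != 0 -> ujet u h q X -> f <= LA p (b + q) X) ->
  exists U : 'rV[R]_n -> R, [/\ (forall h, {for h, continuous U}), U 0 = 0,
    (forall h, exists2 k, enorm k <= rho & U h = u k - (2 * e)^-1 * dot (k - h) (k - h)) &
    forall d, 0 < d -> exists2 r, 0 < r & forall h q X, enorm h < r ->
      ujet U h q X -> f - d <= LA p b X].
Proof.
move=> p1 n0 b0 rho0 e0 C0 Ce cu uC u0 su.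
have [U [A B]] := sup_convolution e0 (ltW rho0) cu.
pose E := (2 * e)^-1; have E0 : 0 < E by rewrite /E invr_gt0 mulr_gt0.
have CE : 4 * C <= E.
  by rewrite /E -[leRHS]mul1r ler_pdivlMr ?mulr_gt0//; lra.
rewrite -/E in A B.
(* Semiconvexity: the point [k] that realizes the value at [h] is a competitor at [k'], which puts a
   paraboloid below [U] that touches it at [h]. *)
have below h k k' : enorm k <= rho -> U h = u k - E * dot (k - h) (k - h) ->
    U h + dot (2 * E *: (k - h)) (k' - h) - E * dot (k' - h) (k' - h) <= U k'.
  move=> kr ->; apply: le_trans (B k' k kr).
  have -> : k - k' = (k - h) - (k' - h) by rewrite opprB addrA subrK.
  by move: (k - h) (k' - h) => a c; rewrite !dotL (dotC c a); lra.
have near0 h k : enorm k <= rho -> U h = u k - E * dot (k - h) (k - h) ->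
    enorm (k - h) <= 3 * enorm h.
  move=> kr Uh; have U0 := B h 0; rewrite enorm0 u0 !sub0r dotNl dotNr opprK in U0.
  have {}U0 := U0 (ltW rho0).
  have uk := uC k kr.
  have kk : dot k k <= 2 * dot (k - h) (k - h) + 2 * dot h h.
    have := dot_ge0 (k - 2 *: h); rewrite !dotL (dotC h k); lra.
  rewrite -(@ler_pXn2r _ 2)// ?nnegrE ?mulr_ge0 ?enorm_ge0// exprMn !enorm_sqr.
  have a0 := dot_ge0 (k - h); have c0 := dot_ge0 h.
  have : C * dot k k <= E / 4 * (2 * dot (k - h) (k - h) + 2 * dot h h).
    by apply: ler_pM; rewrite ?dot_ge0//; lra.
  move=> H; have H2 : E * dot (k - h) (k - h) <= E * (3 * dot h h) by lra.
  by rewrite ler_pM2l// in H2; lra.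
have U0 : U 0 = 0.
  have [k kr Uk] := A 0; have := near0 0 k kr Uk; rewrite enorm0 mulr0 subr0 => k0.
  have /eqP : enorm k = 0 by apply/eqP; rewrite eq_le k0 enorm_ge0.
  by rewrite enorm_eq0 => /eqP k0'; rewrite Uk k0' u0 subrr dot0l mulr0 subrr.
exists U; split=> //.
- move=> h; apply/cont_enorm => d d0.
  pose K := 2 * E * (2 * rho + 2 * enorm h + 2) + E.
  have K0 : 0 < K by rewrite /K; have := enorm_ge0 h; nra.
  exists (Num.min 1 (d / K)); first by rewrite lt_min ltr01 divr_gt0.
  move=> y; rewrite lt_min => /andP[y1 yd].
  have [k kr Uk] := A h; have [k' kr' Uk'] := A y.
  have l1 := below h k y kr Uk; have l2 := below y k' h kr' Uk'.
  set t := enorm (y - h) in y1 yd; have t0 : 0 <= t by exact: enorm_ge0.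
  have tt : dot (y - h) (y - h) = t ^+ 2 by rewrite enorm_sqr.
  have tt' : dot (h - y) (h - y) = t ^+ 2 by rewrite -tt -opprB dotNl dotNr opprK.
  rewrite tt in l1; rewrite tt' in l2.
  have b1 : `|dot (2 * E *: (k - h)) (y - h)| <= 2 * E * (rho + enorm h) * t.
    apply: le_trans (ler_dot _ _) _; rewrite -/t enormZ ger0_norm ?mulr_ge0// ?(ltW E0)//.
    rewrite ler_wpM2r// ler_wpM2l ?mulr_ge0// ?(ltW E0)//.
    by apply: le_trans (ler_enormB _ _) _; rewrite lerD2r.
  have b2 : `|dot (2 * E *: (k' - y)) (h - y)| <= 2 * E * (rho + enorm h + 1) * t.
    apply: le_trans (ler_dot _ _) _; rewrite (enormC h) -/t enormZ ger0_norm ?mulr_ge0// ?(ltW E0)//.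
    rewrite ler_wpM2r// ler_wpM2l ?mulr_ge0// ?(ltW E0)//.
    apply: le_trans (ler_enormB _ _) _.
    have := ler_enormD (y - h) h; rewrite subrK -/t; lra.
  have tK : t * K < d by move: yd; rewrite ltr_pdivlMr.
  have t2 : t ^+ 2 <= t by rewrite expr2; nra.
  move: b1 b2; rewrite !ler_norml ltr_norml => /andP[b1 _] /andP[b2 _].
  have Et : E * t ^+ 2 <= E * t by rewrite ler_wpM2l// ltW.
  have := enorm_ge0 h; have := mulr_ge0 (ltW E0) t0; rewrite /K in tK.
  have Ert : 0 <= E * t * rho by rewrite !mulr_ge0// ltW.
  have Eht : 0 <= E * t * enorm h by rewrite !mulr_ge0 ?enorm_ge0// ltW.
  by move=> *; apply/andP; split; lra.
- move=> d d0.
  have eb : 0 < enorm b by rewrite enorm_gt0.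
  pose N := n%:R + p - 2; have N0 : 0 < N by exact: np_gt0.
  pose K := 8 * `|p - 2| / (lmin p * enorm b).
  have K0 : 0 <= K.
    by rewrite /K divr_ge0 ?mulr_ge0 ?enorm_ge0// ltW// lmin_gt0.
  pose F := `|f| + 2 * E * N; have F0 : 0 < F.
    by rewrite /F ltr_wpDl// !mulr_gt0.
  (* The first bound keeps [b + q] away from zero; the second makes the error of [freeze] at most
     [d]. *)
  pose s := Num.min (enorm b / 2) (d / ((K + 1) * F)).
  have s0 : 0 < s by rewrite /s lt_min !divr_gt0// mulr_gt0// ltr_wpDl.
  exists (Num.min (rho / 5) (s / (6 * E))).
    by rewrite lt_min !divr_gt0// mulr_gt0.
  move=> h q X; rewrite lt_min => /andP[h1 h2] J.
  have [k kr Uk] := A h.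
  have kh := near0 h k kr Uk.
  have krho : enorm k < rho.
    have := ler_enormD (k - h) h; rewrite subrK; have := enorm_ge0 h; lra.
  have L : ljet (fun y => dot (2 * E *: (k - h)) y + - E * quad 1%:M (y - h)) h
     (2 * E *: (k - h) + - E *: ((h - h) *m (1%:M + 1%:M^T))) (0 + - E *: (2 *: 1%:M)).
    by have [] := jetD (jet_dot (2 * E *: (k - h)) h) (jetZ (- E) (jet_quad 1%:M h h)).
  rewrite subrr mul0mx scaler0 addr0 add0r in L.
  have touch z : enorm z < 1 -> U h - (dot (2 * E *: (k - h)) h + - E * quad 1%:M (h - h)) <=
      U (h + z) - (dot (2 * E *: (k - h)) (h + z) + - E * quad 1%:M (h + z - h)).
    move=> _; have := below h k (h + z) kr Uk.
    by rewrite subrr quad0 !quadM1 [h + z]addrC addrK dotDr; lra.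
  have [qE XE] := jet_touch ltr01 touch J L.
  have qs : enorm q < s.
    rewrite qE enormZ ger0_norm ?mulr_ge0// ?(ltW E0)//.
    apply: (@le_lt_trans _ _ (2 * E * (3 * enorm h))).
      by rewrite ler_wpM2l// mulr_ge0// ltW.
    by move: h2; rewrite ltr_pdivlMr ?mulr_gt0//; lra.
  have qb : enorm q < enorm b / 2 by apply: lt_le_trans qs _; rewrite /s ge_min lexx.
  have bq0 : b + q != 0.
    apply/eqP => bq; have : enorm b <= enorm q.
      by rewrite -(enormN q) (_ : b = - q)//; apply/eqP; rewrite -subr_eq0 opprK bq.
    by lra.
  have Ju : ujet u k q X.
    apply: (@ujet_shift _ U _ h _ _ (rho - enorm k)) J; first by rewrite subr_gt0.
    move=> z zr; have := B (h + z) (k + z); rewrite Uk.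
    have -> : k + z - (h + z) = k - h by rewrite opprD addrACA subrr addr0.
    by have := ler_enormD k z => H /(_ _)-H2; have := H2; lra.
  have fL := su k q X krho bq0 Ju.
  pose Y := X + (2 * E)%:M.
  have PY z : 0 <= quad Y z.
    by have := XE z; rewrite /Y quadMD quadM1 !quadMZ quadM1; lra.
  have qkb : enorm (b + q - b) <= enorm b / 2 by rewrite addrC addKr ltW.
  have := freeze p1 b0 bq0 PY qkb.
  have -> : b + q - b = q by rewrite addrC addKr.
  rewrite /Y !LAD !LA1// -/K -/N => H.
  have Kq : K * enorm q * F <= d.
    have : enorm q * ((K + 1) * F) <= d.
      rewrite -ler_pdivlMr; last by rewrite mulr_gt0// ltr_wpDl.
      by apply: le_trans (ltW qs) _; rewrite /s ge_min lexx orbT.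
    by have := mulr_ge0 (enorm_ge0 q) (ltW F0); lra.
  set kap := K * enorm q in H Kq; have kap0 : 0 <= kap by rewrite mulr_ge0 ?enorm_ge0.
  rewrite leNgt; apply/negP => lt.
  have G0 : 0 <= LA p b X + 2 * E * N.
    by have := LA_psd p1 b0 PY; rewrite /Y LAD LA1.
  have fa := ler_norm f.
  have : kap * (LA p b X + 2 * E * N) <= kap * F by rewrite ler_wpM2l// /F; lra.
  by lra.
Qed.

Lemma quad_young X h k t : 0 < t -> quad X (h + k) <=
  quad X h + mnorm X * (t * dot h h + (1 + t^-1) * dot k k).
Proof.
move=> t0; rewrite !quadbil !bilL -!quadbil.
have A := ler_bil X h k; have B := ler_bil X k h; have C := ler_quad X k.
have D : enorm h * enorm k <= 2^-1 * (t * dot h h + t^-1 * dot k k).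
  have := sqr_ge0 (t * enorm h - enorm k); rewrite -!enorm_sqr => H.
  rewrite -(ler_pM2l t0).
  have -> : t * (2^-1 * (t * enorm h ^+ 2 + t^-1 * enorm k ^+ 2)) =
     2^-1 * (t ^+ 2 * enorm h ^+ 2 + enorm k ^+ 2) by field; rewrite gt_eqF.
  by nra.
have E := ler_wpM2l (mnorm_ge0 X) D.
have F : mnorm X * (enorm k * enorm h) = mnorm X * (enorm h * enorm k) by ring.
have a := ler_norm (bil X h k); have b := ler_norm (bil X k h); have c := ler_norm (quad X k).
by lra.
Qed.

Lemma mulmx_rt_unit p q M : 1 < p -> q != 0 -> M^T *m M = rt (p - 1) q -> M \in unitmx.
Proof.
move=> p1 q0 E; have : M^T *m M \in unitmx.
  rewrite E; have H : rt (p - 1) q *m rt (p - 1)^-1 q = 1%:M.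
    by rewrite rt_mul// divff ?rt1// gt_eqF// subr_gt0.
  by have [] := mulmx1_unit H.
by rewrite unitmx_mul => /andP[].
Qed.

Lemma LA_mul p q M X : M^T *m M = rt (p - 1) q -> \tr (M *m X *m M^T) = LA p q X.
Proof. by move=> E; rewrite LA_tr -E mxtrace_mulC mulmxA. Qed.

(** As [M^T *m M] is the coefficient matrix of [LA p q], the substitution [z *m M] turns the
    operator with frozen gradient into the Laplacian. Any such [M] is allowed; the coupling of
    [reflection_coupling] exploits this freedom. *)
Lemma jet_change p q M U d z (k : 'rV[R]_n) X f r : 1 < p -> q != 0 -> M^T *m M = rt (p - 1) q ->
  (forall h k X, enorm h < r -> ujet U h k X -> f - d <= LA p q X) ->
  enorm (z *m M) < r -> ujet (fun z => U (z *m M)) z k X -> f - d <= \tr X.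
Proof.
move=> p1 q0 E H zr J; have Mu := mulmx_rt_unit p1 q0 E.
have J2 : ujet (fun z => U (z *m M)) (0 + (z *m M) *m invmx M) k X by rewrite mulmxK// add0r.
have := ujet_affine J2.
rewrite (_ : (fun z => U ((0 + z *m invmx M) *m M)) = U); last first.
  by apply/funext => w; rewrite add0r mulmxKV.
move=> /(H _ _ _ zr); rewrite -(LA_mul _ E).
by rewrite !mulmxA mulmxV// mul1mx -mulmxA -trmx_mul mulmxV// trmx1 mulmx1.
Qed.

Lemma cont_mulmx U M : (forall h, {for h, continuous U}) ->
  forall z, {for z, continuous (fun z => U (z *m M))}.
Proof.
move=> cU z; apply/cont_enorm => e e0; have /cont_enorm/(_ e e0)[r r0 hr] := cU (z *m M).
exists (r / (1 + mnorm M)); first by rewrite divr_gt0// ltr_wpDr ?mnorm_ge0.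
move=> y; rewrite ltr_pdivlMr ?ltr_wpDr ?mnorm_ge0// => yz; apply: hr.
rewrite -mulmxBl; apply: le_lt_trans (mulmx_enorm_le _ _) _; apply: le_lt_trans yz.
by rewrite mulrC ler_wpM2l ?enorm_ge0// lerDr.
Qed.

Lemma sums_arith (A B z0 z1 a0 a1 b0 b1 mZ m1 m2 t i dh dk da db dhk dab dha dkb : R) :
  0 < t -> t <= 1 -> 1 <= i -> 0 <= mZ -> 0 <= m1 -> 0 <= m2 ->
  0 <= dh -> 0 <= dk -> 0 <= da -> 0 <= db ->
  z1 <= z0 + mZ * (t * dhk + i * dab) -> a1 <= a0 + m1 * (t * dh + i * da) ->
  - b1 <= - b0 + m2 * (t * dk + i * db) ->
  dha <= dh + (t * dh + i * da) -> dkb <= dk + (t * dk + i * db) ->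
  dhk <= 2 * dh + 2 * dk -> dab <= 2 * da + 2 * db ->
  A + B <= 2^-1 * (z1 + a1 - b1) + t * (dha + dkb) ->
  A - 4 * (2 * mZ + m1 + m2 + 2) * i * da + (B - 4 * (2 * mZ + m1 + m2 + 2) * i * db) <=
  2^-1 * (z0 + a0 - b0 + (2 * t + t * (2 * mZ + m1 + m2 + 2)) * (dh + dk)).
Proof.
move=> t0 t1 i1 Z0 M1 M2 h0 k0 a00 b00 H1 H2 H3 H4 H5 H6 H7 H8.
have [P PE] : exists P, P = t * dh + i * da by eexists.
have [Q QE] : exists Q, Q = t * dk + i * db by eexists.
rewrite -PE in H2 H4; rewrite -QE in H3 H5.
have i0 : 0 <= i by lra.
have P0 : 0 <= P by rewrite PE addr_ge0// mulr_ge0// ltW.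
have Q0 : 0 <= Q by rewrite QE addr_ge0// mulr_ge0// ltW.
have K1 : mZ * (t * dhk + i * dab) <= mZ * (2 * P + 2 * Q).
  rewrite ler_wpM2l//; have := ler_wpM2l (ltW t0) H6; have := ler_wpM2l i0 H7.
  by rewrite PE QE; clear; lra.
have K2 : t * P <= P by rewrite ler_piMl.
have K3 : t * Q <= Q by rewrite ler_piMl.
have K4 := ler_wpM2l (ltW t0) H4; have K5 := ler_wpM2l (ltW t0) H5.
pose mB := 2 * mZ + m1 + m2 + 2.
have mB0 : 0 <= mB by rewrite /mB; clear -Z0 M1 M2; lra.
have mia : 0 <= mB * (i * da) by rewrite !mulr_ge0.
have mib : 0 <= mB * (i * db) by rewrite !mulr_ge0.
have F : 2^-1 * (mZ * (2 * P + 2 * Q) + m1 * P + m2 * Q) + (P + Q) <= 2^-1 * mB * (P + Q).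
  by have := mulr_ge0 M1 Q0; have := mulr_ge0 M2 P0; rewrite /mB; clear; lra.
have G : 2^-1 * mB * (P + Q) = 2^-1 * mB * t * (dh + dk) +
     2^-1 * (mB * (i * da)) + 2^-1 * (mB * (i * db)) by rewrite PE QE; ring.
rewrite -/mB; clear -H1 H2 H3 K1 K2 K3 K4 K5 F G H8 mia mib; lra.
Qed.

(* The theorem on sums with frozen coefficients: near the contact point the
   sup-convolutions are semiconvex, so their test gradients are close to [q1] and
   [q2] and the equations become linear with constant coefficients; running both
   along [z |-> (x + z Mx, y + z My)] turns them into the Laplacian. *)
Lemma theorem_on_sums p u v x y q1 q2 Z W1 W2 f g (Mx My : 'M[R]_n) r :
  1 < p -> (0 < n)%N -> 0 < r ->
  (forall z, enorm (z - x) < r -> {for z, continuous u}) ->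
  (forall z, enorm (z - y) < r -> {for z, continuous v}) ->
  (forall z q X, enorm (z - x) < r -> q != 0 -> ujet u z q X -> f <= LA p q X) ->
  (forall z q X, enorm (z - y) < r -> q != 0 -> ljet v z q X -> LA p q X <= g) ->
  q1 != 0 -> q2 != 0 ->
  Mx^T *m Mx = rt (p - 1) q1 -> My^T *m My = rt (p - 1) q2 ->
  (forall e, 0 < e -> exists2 s, 0 < s & forall h k, enorm h < s -> enorm k < s ->
     u (x + h) - v (y + k) <= u x - v y + dot q1 h - dot q2 k +
       2^-1 * (quad Z (h - k) + quad W1 h - quad W2 k) + e * (dot h h + dot k k)) ->
  f - g <= \tr ((Mx - My) *m Z *m (Mx - My)^T) + LA p q1 W1 - LA p q2 W2.
Proof.
move=> p1 n0 r0 cu cv su sv q10 q20 Ex Ey touch; rewrite leNgt; apply/negP.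
set T := _ - LA p q2 W2 => lt.
pose gap := f - g - T; have gap0 : 0 < gap by rewrite /gap subr_gt0.
pose D := \tr (Mx *m Mx^T) + \tr (My *m My^T).
have D0 : 0 <= D.
  have tM M : 0 <= \tr (M *m M^T).
    have := @tr_psd _ _ M 1%:M; rewrite mulmx1; apply=> h.
    by rewrite quadM1 mul1r dot_ge0.
  by rewrite /D addr_ge0.
pose mB := 2 * mnorm Z + mnorm W1 + mnorm W2 + 2.
have mB0 : 2 <= mB.
  by rewrite /mB; have := mnorm_ge0 Z; have := mnorm_ge0 W1; have := mnorm_ge0 W2; lra.
(* The weight in Young's inequality; the second bound keeps the resulting enlargement of the trace
   below a quarter of [gap]. *)
pose t := Num.min 1 (gap / (4 * (mB + 2) * (D + 1))).
have t0 : 0 < t by rewrite /t lt_min ltr01 divr_gt0// !mulr_gt0//; lra.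
have t1 : t <= 1 by rewrite /t ge_min lexx.
have tD : (2 * t + t * mB) * D <= gap / 4.
  have : t * (4 * (mB + 2) * (D + 1)) <= gap.
    rewrite -ler_pdivlMr; last by rewrite !mulr_gt0//; lra.
    by rewrite /t ge_min lexx orbT.
  have : 0 <= t * (mB + 2) by rewrite mulr_ge0// ?(ltW t0)//; lra.
  by lra.
have [s s0 hs] := touch t t0.
pose rho := Num.min s r / 2; have rho0 : 0 < rho by rewrite /rho divr_gt0// lt_min s0.
have rhos : rho < s by have := ge_min s s r; rewrite lexx /= /rho; lra.
have rhor : rho < r by have := ge_min r s r; rewrite lexx orbT /rho; lra.
(* The penalty constant [(2 * e)^-1] becomes [4 * mB * (1 + t^-1)], which is what absorbs the terms
   left by Young's inequality in [sums_arith]. *)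
pose e := (8 * mB * (1 + t^-1))^-1.
have ti : 0 < t^-1 by rewrite invr_gt0.
have e0 : 0 < e by rewrite /e invr_gt0 !mulr_gt0//; lra.
have eE : e^-1 = 8 * mB * (1 + t^-1) by rewrite /e invrK.
have Ce : 8 * mB * e <= 1.
  rewrite /e ler_pdivrMr ?mul1r; last by rewrite !mulr_gt0//; lra.
  by rewrite ler_peMr//; lra.
(* Values and linear parts are removed, so both functions vanish at the origin and are at most
   [mB * dot h h]. The sign in [vb] turns the supersolution into a subsolution with frozen gradient
   [- q2]. *)
pose ub h := u (x + h) - u x - dot q1 h.
pose vb k := - (v (y + k) - v y - dot q2 k).
have qb X h : quad X h <= mnorm X * dot h h.
  by apply: le_trans (ler_norm _) (ler_quad _ _).
have tb h k : enorm h <= rho -> enorm k <= rho -> ub h + vb k <=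
    2^-1 * (quad Z (h - k) + quad W1 h - quad W2 k) + t * (dot h h + dot k k).
  move=> hr kr; have := hs h k (le_lt_trans hr rhos) (le_lt_trans kr rhos).
  by rewrite /ub /vb; lra.
have ub0 : ub 0 = 0 by rewrite /ub addr0 dot0r; lra.
have vb0 : vb 0 = 0 by rewrite /vb addr0 dot0r; lra.
have ubC h : enorm h <= rho -> ub h <= mB * dot h h.
  move=> hr; have := tb h 0 hr; rewrite enorm0 vb0 !subr0 quad0 dot0l !addr0 subr0.
  move=> /(_ (ltW rho0)); have := qb Z h; have := qb W1 h; have := dot_ge0 h.
  have := mulr_ge0 (mnorm_ge0 Z) (dot_ge0 h); have := mulr_ge0 (mnorm_ge0 W1) (dot_ge0 h).
  have := mulr_ge0 (mnorm_ge0 W2) (dot_ge0 h).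
  have := ler_wpM2r (dot_ge0 h) t1; rewrite /mB; lra.
have vbC h : enorm h <= rho -> vb h <= mB * dot h h.
  move=> hr; have := tb 0 h; rewrite enorm0 ub0 !sub0r quad0 quadN dot0l add0r.
  move=> /(_ (ltW rho0) hr); have := qb Z h; have := ler_norm (- quad W2 h).
  rewrite normrN => q2'; have := ler_quad W2 h; have := dot_ge0 h.
  have := mulr_ge0 (mnorm_ge0 Z) (dot_ge0 h); have := mulr_ge0 (mnorm_ge0 W1) (dot_ge0 h).
  have := mulr_ge0 (mnorm_ge0 W2) (dot_ge0 h).
  have := ler_wpM2r (dot_ge0 h) t1; rewrite /mB /vb; lra.
have cub : cont_on (cball 0 rho) ub.
  move=> h; rewrite /cball /= subr0 => hr; apply: cont_onB => //.
  + apply: cont_onB; last by move=> ? ? d d0; exists 1 => // *; rewrite subrr normr0.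
    move=> k; rewrite /cball /= subr0 => kr d d0.
    have /cont_enorm/(_ d d0)[a a0 ha] : {for x + k, continuous u}.
      by apply: cu; rewrite addrC addKr; exact: le_lt_trans rhor.
    exists a => // z _ za; apply: ha.
    by rewrite opprD addrACA subrr add0r.
  + by apply: cont_onW => k _; exact: (jet_cont (jet_dot q1 k)).
  + by rewrite /cball /= subr0.
have cvb : cont_on (cball 0 rho) vb.
  apply: cont_onN => h; rewrite /cball /= subr0 => hr; apply: cont_onB => //.
  + apply: cont_onB; last by move=> ? ? d d0; exists 1 => // *; rewrite subrr normr0.
    move=> k; rewrite /cball /= subr0 => kr d d0.
    have /cont_enorm/(_ d d0)[a a0 ha] : {for y + k, continuous v}.
      by apply: cv; rewrite addrC addKr; exact: le_lt_trans rhor.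
    exists a => // z _ za; apply: ha.
    by rewrite opprD addrACA subrr add0r.
  + by apply: cont_onW => k _; exact: (jet_cont (jet_dot q2 k)).
  + by rewrite /cball /= subr0.
have sub h q X : enorm h < rho -> q1 + q != 0 -> ujet ub h q X -> f <= LA p (q1 + q) X.
  move=> hr q0 J; apply: (su (x + h)) => //.
    by rewrite addrC addKr; exact: lt_trans rhor.
  have J2 := ujetD (proj1 (jet_dot q1 h)) J; rewrite add0r in J2.
  apply: (ujet_shift ltr01 _ J2) => k _; rewrite /ub (addrA x h k); lra.
have svb h q X : enorm h < rho -> - q2 + q != 0 -> ujet vb h q X -> - g <= LA p (- q2 + q) X.
  move=> hr q0 J.
  have nq : q2 - q != 0 by rewrite -oppr_eq0 opprB addrC.
  have E : - q2 + q = (-1) *: (q2 - q) by rewrite scaleN1r opprB addrC.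
  rewrite E LAqZ ?oppr_eq0 ?oner_eq0// lerNl -LAN.
  apply: (sv (y + h)) => //.
    by rewrite addrC addKr; exact: lt_trans rhor.
  have J2 := ljetN (ujetD (proj1 (jet_dot (- q2) h)) J); rewrite add0r opprD opprK in J2.
  have E2 : (\- (fun y => dot (- q2) y + vb y)) = (fun k => v (y + k) - v y).
    by apply/funext => k /=; rewrite /vb dotNl; lra.
  rewrite E2 in J2 => a a0; have [w w0 hw] := J2 a a0; exists w => // k kw.
  by have := hw k kw; rewrite (addrA y h k); lra.
have mB00 : 0 <= mB by lra.
have nq20 : - q2 != 0 by rewrite oppr_eq0.
have [U [cU U0 opU sU]] := regularize p1 n0 q10 rho0 e0 mB00 Ce cub ubC ub0 sub.
have [V [cV V0 opV sV]] := regularize p1 n0 nq20 rho0 e0 mB00 Ce cvb vbC vb0 svb.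
have d0 : 0 < gap / 8 by rewrite divr_gt0.
have [r1 r10 h1] := sU _ d0; have [r2 r20 h2] := sV _ d0.
pose S := (Mx - My) *m Z *m (Mx - My)^T + Mx *m W1 *m Mx^T - My *m W2 *m My^T
   + (2 * t + t * mB) *: (Mx *m Mx^T + My *m My^T).
have tS : \tr S = T + (2 * t + t * mB) * D.
  have E2 : \tr (My *m W2 *m My^T) = LA p q2 W2 by exact: LA_mul.
  have E1 : \tr (Mx *m W1 *m Mx^T) = LA p q1 W1 by exact: LA_mul.
  rewrite /S /T; set A := (Mx - My) *m Z *m _.
  by rewrite mxtraceD mxtraceZ (mxtraceD (Mx *m Mx^T)) raddfB/= mxtraceD E1 E2.
have quadS z : quad S z = quad Z (z *m Mx - z *m My) + quad W1 (z *m Mx) - quad W2 (z *m My)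
   + (2 * t + t * mB) * (dot (z *m Mx) (z *m Mx) + dot (z *m My) (z *m My)).
  have qMM M : quad (M *m M^T) z = dot (z *m M) (z *m M).
    by have := bil_mul M 1%:M z z; rewrite mulmx1 bil1.
  by rewrite /S !quadMD quadMN quadMZ quadMD !qMM !quadbil !bil_mul mulmxBr.
have key h k : U h + V k <= 2^-1 * (quad Z (h - k) + quad W1 h - quad W2 k
     + (2 * t + t * mB) * (dot h h + dot k k)).
  have [h' hr' ->] := opU h; have [k' kr' ->] := opV k.
  have := tb h' k' hr' kr'.
  have [a aE] : exists a, a = h' - h by exists (h' - h).
  have [b bE] : exists b, b = k' - k by exists (k' - k).
  rewrite -aE -bE; have -> : h' = h + a by rewrite aE addrC subrK.
  have -> : k' = k + b by rewrite bE addrC subrK.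
  have -> : h + a - (k + b) = (h - k) + (a - b) by rewrite opprD addrACA.
  have Y1 := quad_young Z (h - k) (a - b) t0.
  have Y2 := quad_young W1 h a t0.
  have Y3 := quad_young (- W2) k b t0; rewrite !quadMN mnormN in Y3.
  have yd (w w' : 'rV[R]_n) : dot (w + w') (w + w') <= dot w w + (t * dot w w + (1 + t^-1) * dot w' w').
    have H := dot_ge0 (t *: w - w'); rewrite !dotL (dotC w' w) in H *.
    have : t^-1 * (t * (t * dot w w) - t * dot w w' - (t * dot w w' - dot w' w')) =
       t * dot w w - 2 * dot w w' + t^-1 * dot w' w' by field; rewrite gt_eqF.
    have := mulr_ge0 (ltW ti) H; lra.
  have Y4 := yd h a; have Y5 := yd k b.
  have p2 (w w' : 'rV[R]_n) : dot (w - w') (w - w') <= 2 * dot w w + 2 * dot w' w'.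
    by have H := dot_ge0 (w + w'); rewrite !dotL (dotC w' w) in H *; lra.
  have P1 := p2 h k; have P2 := p2 a b.
  have Ei : (2 * e)^-1 = 4 * mB * (1 + t^-1) by rewrite invfM eE; lra.
  have H4 := ler_wpM2l (ltW t0) Y4; have H5 := ler_wpM2l (ltW t0) Y5.
  rewrite Ei => H; apply: le_trans (sums_arith t0 t1 _ (mnorm_ge0 Z) (mnorm_ge0 W1) (mnorm_ge0 W2)
    (dot_ge0 h) (dot_ge0 k) (dot_ge0 a) (dot_ge0 b) Y1 Y2 Y3 Y4 Y5 (p2 h k) (p2 a b) H) _.
    by lra.
  by rewrite -/mB lexx.
have D' : (2 * t + t * mB) * D <= gap / 4 by [].
pose m := 1 + mnorm Mx + mnorm My.
have m0 : 0 < m by rewrite /m; have := mnorm_ge0 Mx; have := mnorm_ge0 My; lra.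
pose r3 := Num.min r1 r2 / m; have r30 : 0 < r3 by rewrite /r3 divr_gt0// lt_min r10.
have rz z : enorm z < r3 -> enorm (z *m Mx) < r1 /\ enorm (z *m My) < r2.
  rewrite /r3 ltr_pdivlMr// lt_min => /andP[z1 z2].
  have zz := enorm_ge0 z; have mx := mnorm_ge0 Mx; have my := mnorm_ge0 My.
  split; first by apply: le_lt_trans (mulmx_enorm_le _ _) _; rewrite /m in z1; nra.
  by apply: le_lt_trans (mulmx_enorm_le _ _) _; rewrite /m in z2; nra.
have : (f - gap / 8) - - (- g - gap / 8) <= \tr S.
  apply: (@linear_touch _ _ (fun z => U (z *m Mx)) (fun z => - V (z *m My)) S _ _ r3) => //.
  - by move=> z _; exact: cont_mulmx.
  - by move=> z _; apply: continuousN; exact: cont_mulmx.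
  - move=> z q X /rz[z1 _]; exact: (jet_change p1 q10 Ex h1 z1).
  - move=> z q X /rz[_ z2] J; rewrite lerNr -linearN/=.
    apply: (jet_change p1 nq20 _ h2 z2 (k := - q)).
      rewrite Ey /rt !dotL opprK; congr (_ + _ *: _).
      by rewrite [(- q2)^T]raddfN/= mulNmx mulmxN opprK.
    by have := ujetN J; rewrite (_ : (\- _) = (fun z => V (z *m My)))//; apply/funext => w /=; rewrite opprK.
  - by move=> z _; rewrite opprK quadS; exact: key.
  - by rewrite !mul0mx U0 V0 oppr0.
rewrite tS; move: tD; rewrite /gap; lra.
Qed.

End TheoremOnSums.

(** * Mean value arguments and the second-order expansion of [C2] functions *)

Lemma mvt_origin {R : realType} (F d : R -> R) (t : R) :
  (forall s : R, `|s| <= `|t| -> is_derive s 1 F (d s)) ->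
  exists2 s : R, `|s| <= `|t| & F t - F 0 = t * d s.
Proof.
move=> dF.
have cF (a b : R) : (forall s, a <= s <= b -> `|s| <= `|t|) -> {within `[a, b], continuous F}.
  move=> ab; apply: continuous_in_subspaceT => s; rewrite inE/= in_itv/= => /ab st.
  by apply: differentiable_continuous; apply/derivable1_diffP; case: (dF s st).
have [t0|/ltW t0] := leP 0 t.
  have I (s : R) : 0 <= s <= t -> `|s| <= `|t|.
    by move=> /andP[a b]; rewrite !ger0_norm// (le_trans a).
  have [|c] := @MVT_segment R F d 0 t t0 _ (cF 0 t I).
    by move=> s; rewrite in_itv/= => /andP[a b]; apply/dF/I; rewrite !ltW.
  by rewrite in_itv/= => /I ct; rewrite subr0 mulrC => E; exists c.
have I (s : R) : t <= s <= 0 -> `|s| <= `|t|.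
  by move=> /andP[a b]; rewrite !ler0_norm ?lerN2// (le_trans a).
have [|c] := @MVT_segment R F d t 0 t0 _ (cF t 0 I).
  by move=> s; rewrite in_itv/= => /andP[a b]; apply/dF/I; rewrite !ltW.
rewrite in_itv/= => /I ct; rewrite sub0r => E; exists c => //.
by move: E; rewrite mulrN => /eqP; rewrite -opprB eqr_opp => /eqP ->; rewrite mulrC.
Qed.

Section C2Taylor.
Context {R : realType} {n : nat}.
Implicit Types (x y h k e v : 'rV[R]_n) (X : 'M[R]_n) (f g : 'rV[R]_n -> R).

Lemma is_derive_line f y v (s d : R) : is_derive (y + s *: v) v f d ->
  is_derive s 1 (fun t => f (y + t *: v)) d.
Proof.
case=> D E.
have Q : (fun h : R => h^-1 *: (((fun t => f (y + t *: v)) \o shift s) (h *: 1) - f (y + s *: v)))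
   = (fun h : R => h^-1 *: ((f \o shift (y + s *: v)) (h *: v) - f (y + s *: v))).
  apply/funext => h /=; congr (_ *: (f _ - _)).
  by rewrite [h%:A]mulr1 scalerDl addrCA.
by apply: DeriveDef; rewrite /derivable /derive Q.
Qed.

Lemma mvt_line f y v (d : R -> R) (t : R) :
  (forall s : R, `|s| <= `|t| -> is_derive (y + s *: v) v f (d s)) ->
  exists2 s : R, `|s| <= `|t| & f (y + t *: v) - f y = t * d s.
Proof.
move=> H; have [|s st] := @mvt_origin R (fun t => f (y + t *: v)) d t.
  by move=> s /H; exact: is_derive_line.
by rewrite scale0r addr0; exists s.
Qed.

Definition trunc h (k : nat) : 'rV[R]_n := \row_j (if (j < k)%N then h 0 j else 0).

Lemma enorm_coord_le h k : (forall j, `|h 0 j| <= `|k 0 j|) -> enorm h <= enorm k.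
Proof.
move=> H; rewrite ler_sqrt ?dot_ge0// !dotE; apply: ler_sum => j _.
rewrite -!expr2 -(real_normK (num_real (h 0 j))) -(real_normK (num_real (k 0 j))).
by rewrite lerXn2r// nnegrE.
Qed.

(** [C2] speaks of partial derivatives only, so the increment is split along the path that switches
    on one coordinate of [h] at a time ([trunc]), with the mean value theorem on each leg. *)
Lemma mvt_coord f : (forall y i, derivable f y (delta_mx 0 i)) ->
  forall y h, exists xi : 'I_n -> 'rV[R]_n, (forall i, enorm (xi i - y) <= enorm h) /\
    f (y + h) - f y = \sum_i h 0 i * partial i f (xi i).
Proof.
move=> D y h.
have step (i : 'I_n) : exists x, enorm (x - y) <= enorm h /\
    f (y + trunc h i.+1) - f (y + trunc h i) = h 0 i * partial i f x.
  have E : trunc h i.+1 = trunc h i + h 0 i *: delta_mx 0 i.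
    apply/rowP => j; rewrite !mxE eqxx/= ltnS leq_eqVlt.
    have [->|ij] := eqVneq j i; first by rewrite eqxx ltnn/= mulr1 add0r.
    by rewrite mulr0 addr0; move: ij; rewrite -val_eqE => /negPf ->.
  have [|s st] := @mvt_line f (y + trunc h i) (delta_mx 0 i)
      (fun s => partial i f (y + trunc h i + s *: delta_mx 0 i)) (h 0 i).
    by move=> s _; exact: derivableP.
  rewrite -addrA -E => E2; exists (y + trunc h i + s *: delta_mx 0 i); split=> //.
  rewrite -(addrA y) (addrC y) addrK; apply: enorm_coord_le => j.
  rewrite !mxE eqxx/=; have [->|ij] := eqVneq j i; first by rewrite ltnn add0r mulr1.
  by rewrite mulr0 addr0; case: ifP => //; rewrite normr0.
have [xi hxi] := choice step.
exists xi; split; first by move=> i; have [] := hxi i.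
have -> : \sum_i h 0 i * partial i f (xi i) =
   \sum_(i < n) (f (y + trunc h i.+1) - f (y + trunc h i)).
  by apply: eq_bigr => i _; have [_ ->] := hxi i.
rewrite -(big_mkord xpredT (fun i => f (y + trunc h i.+1) - f (y + trunc h i))).
rewrite telescope_sumr//; congr (f (y + _) - f _).
  by apply/rowP => j; rewrite mxE ltn_ord.
by rewrite -[LHS]addr0; congr (y + _); apply/rowP => j; rewrite !mxE ltn0.
Qed.

Lemma sum_coord_le h (c : 'I_n -> R) (C : R) : (forall i, `|c i| <= C) ->
  `|\sum_i h 0 i * c i| <= n%:R * C * enorm h.
Proof.
move=> H; apply: le_trans (ler_norm_sum _ _ _) _.
apply: (@le_trans _ _ (\sum_(i < n) C * enorm h)).
  by apply: ler_sum => i _; rewrite normrM mulrC ler_pM// coord_le_enorm.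
by rewrite sumr_const card_ord -mulrA [leRHS]mulr_natl.
Qed.

Lemma C2_unif f x (e : R) : C2 f -> 0 < e -> exists2 r, 0 < r & forall y, enorm (y - x) < r ->
  forall i j, `|partial j (partial i f) y - partial j (partial i f) x| < e.
Proof.
move=> f2 e0.
have : \forall y \near nbhs x, forall ij : 'I_n * 'I_n,
   `|partial ij.2 (partial ij.1 f) y - partial ij.2 (partial ij.1 f) x| < e.
  apply: filter_forall => -[i j] /=.
  have [_ /(_ i)[_ _ /(_ j)[_ /cont_enorm/(_ e e0)[r r0 hr]]]] := f2 x.
  by apply/nbhs_enorm; exists r.
by move=> /nbhs_enorm[r r0 hr]; exists r => // y /hr H i j; exact: (H (i, j)).
Qed.

Lemma C2_derivable f y i : C2 f -> derivable f y (delta_mx 0 i).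
Proof. by move=> f2; have [_ /(_ i)[]] := f2 y. Qed.

Lemma C2_derivable2 f y i j : C2 f -> derivable (partial i f) y (delta_mx 0 j).
Proof. by move=> f2; have [_ /(_ i)[_ _ /(_ j)[]]] := f2 y. Qed.

Lemma dot_grad f y h : dot (gradient f y) h = \sum_i h 0 i * partial i f y.
Proof. by rewrite dotE; apply: eq_bigr => i _; rewrite mxE mulrC. Qed.

Lemma C2_grad_diff f y h : C2 f -> exists xi : 'I_n -> 'I_n -> 'rV[R]_n,
  (forall j i, enorm (xi j i - y) <= enorm h) /\
  forall j, partial j f (y + h) - partial j f y = \sum_i h 0 i * partial i (partial j f) (xi j i).
Proof.
move=> f2; have H j := mvt_coord (fun y i => @C2_derivable2 f y j i f2) y h.
by have [xi hxi] := choice H; exists xi; split=> j; have [] := hxi j.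
Qed.

(** The constant is uniform over base points near [x], which the tangent balls at neighbouring
    boundary points require. *)
Lemma C2_taylor f x : C2 f -> exists C r, [/\ 0 <= C, 0 < r & forall y h,
  enorm (y - x) < r -> enorm h < r ->
  `|f (y + h) - f y - dot (gradient f y) h| <= C * dot h h].
Proof.
move=> f2; have [r r0 hr] := C2_unif x f2 ltr01.
pose B := \sum_i \sum_j `|partial j (partial i f) x| + 1.
have B0 : 0 <= B by rewrite addr_ge0// sumr_ge0// => i _; rewrite sumr_ge0.
have hB y i j : enorm (y - x) < r -> `|partial j (partial i f) y| <= B.
  move=> /hr/(_ i j) H; rewrite -[X in `|X|](subrK (partial j (partial i f) x)).
  apply: le_trans (ler_normD _ _) _; rewrite addrC lerD ?(ltW H)//.
  rewrite (bigD1 i)//= -[leLHS]addr0 lerD ?sumr_ge0//; last first.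
    by move=> k _; rewrite sumr_ge0.
  by rewrite (bigD1 j)//= lerDl sumr_ge0.
exists (n%:R * (n%:R * B)), (r / 3); split; rewrite ?mulr_ge0 ?divr_gt0//.
move=> y h yr hh.
have [xi [xir ->]] := mvt_coord (fun y i => @C2_derivable f y i f2) y h.
rewrite dot_grad -sumrB.
under eq_bigr do rewrite -mulrBr.
rewrite -enorm_sqr expr2 !mulrA; apply: le_trans (sum_coord_le (C := n%:R * B * enorm h) _ _) _.
  move=> i; have [et [etr]] := C2_grad_diff y (xi i - y) f2.
  move=> /(_ i); rewrite (addrC y) subrK => ->.
  apply: le_trans (sum_coord_le (C := B) _ _) _.
    move=> j; apply: hB; have := enorm_tri (et i j) y x; have := etr i j; have := xir i.
    lra.
  by rewrite ler_wpM2l// mulr_ge0.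
by rewrite !mulrA.
Qed.

(** The mean value theorem along the segment bounds the remainder [F] by its derivative, which
    [C2_grad_diff] expresses through differences of second partial derivatives, small by
    continuity. *)
Lemma C2_jet f x : C2 f -> jet f x (gradient f x) (hessian f x).
Proof.
move=> f2; apply/jetP => e e0.
have e1 : 0 < e / (n%:R * n%:R + 1) by rewrite divr_gt0// ltr_wpDl// mulr_ge0.
have [r r0 hr] := C2_unif x f2 e1.
exists r => // h hh.
pose g := gradient f x; pose H := hessian f x.
pose F y := f y - dot g (y - x) - 2^-1 * quad H (y - x).
pose d (s : R) := dot (gradient f (x + s *: h) - g) h - s * quad H h.
have [|s s1] := @mvt_line F x h d 1.
- move=> s _; have [C [t [C0 t0 ht]]] := C2_taylor (x + s *: h) f2.
  apply: (@is_derive_sq _ _ _ _ _ _ (C * dot h h + `|2^-1 * quad H h|) (t / (enorm h + 1))).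
    by rewrite divr_gt0// ltr_wpDl ?enorm_ge0.
  move=> a at'; have ah : enorm (a *: h) < t.
    rewrite enormZ; move: at'; rewrite ltr_pdivlMr ?ltr_wpDl ?enorm_ge0//.
    by have := normr_ge0 a; lra.
  have := ht (x + s *: h) (a *: h); rewrite subrr enorm0 => /(_ t0 ah).
  have -> : F (x + s *: h + a *: h) - F (x + s *: h) - a * d s =
    (f (x + s *: h + a *: h) - f (x + s *: h) - dot (gradient f (x + s *: h)) (a *: h))
    - a ^+ 2 * (2^-1 * quad H h).
    rewrite /F /d -[x + s *: h + a *: h]addrA -scalerDl ![x + _]addrC !addrK.
    by rewrite !dotL !quadZ; field.
  move=> B; apply: le_trans (ler_normB _ _) _; rewrite mulrDl lerD//.
    by apply: le_trans B _; rewrite dotZl dotZr mulrA -expr2; lra.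
  by rewrite normrM ger0_norm ?sqr_ge0// mulrC.
rewrite scale1r mul1r normr1 in s1 *.
rewrite /F subrr dot0r quad0 mulr0 !subr0 [x + h]addrC addrK => E.
have -> : f (h + x) - f x - dot g h - 2^-1 * quad H h = d s by rewrite -E; ring.
have [xi [xir hxi]] := C2_grad_diff x (s *: h) f2.
have -> : d s = s * \sum_j h 0 j * \sum_i h 0 i *
   (partial i (partial j f) (xi j i) - partial i (partial j f) x).
  rewrite /d dotBl !dot_grad -sumrB quadbil bilE exchange_big/= !mulr_sumr -sumrB.
  apply: eq_bigr => j _; rewrite -mulrBr hxi !mulr_sumr -sumrB; apply: eq_bigr => i _.
  rewrite !mxE. move: (partial i _ _) (partial i _ _) (h 0 i) (h 0 j) => a b c d'; clear; ring.
have sh : enorm (s *: h) < r.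
  by rewrite enormZ; apply: le_lt_trans hh; rewrite ler_piMl ?enorm_ge0.
rewrite normrM; apply: (@le_trans _ _ (1 * (n%:R * (n%:R * (e / (n%:R * n%:R + 1)) * enorm h) * enorm h))).
  rewrite ler_pM//; apply: sum_coord_le => j; apply: sum_coord_le => i.
  by apply: ltW; apply: hr; exact: le_lt_trans (xir j i) sh.
rewrite mul1r -enorm_sqr expr2.
have -> : n%:R * (n%:R * (e / (n%:R * n%:R + 1)) * enorm h) * enorm h =
  (n%:R * n%:R) / (n%:R * n%:R + 1) * (e * (enorm h * enorm h)).
  by field; rewrite gt_eqF// ltr_wpDl// mulr_ge0.
rewrite ler_piMl ?mulr_ge0 ?enorm_ge0 ?(ltW e0)//.
by rewrite ler_pdivrMr ?mul1r ?lerDl// ltr_wpDl// mulr_ge0.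
Qed.

End C2Taylor.

(** * Exit points, nearest points, tangent balls, and the boundary to second order *)

Section Geometry.
Context {R : realType} {n : nat}.
Implicit Types (x y z h k q e v w m : 'rV[R]_n) (X : 'M[R]_n) (Om : set 'rV[R]_n).
Implicit Types (gamma : 'rV[R]_n -> R) (r t s a d : R).

Lemma boundaryE Om x : open Om -> boundary Om x <-> closure Om x /\ ~ Om x.
Proof.
move=> oO; split=> -[cx Ix]; split=> // B; apply: Ix; last exact: interior_subset B.
by rewrite /interior; exact: open_nbhs_nbhs.
Qed.

Lemma closure_split Om x : open Om -> closure Om x -> Om x \/ boundary Om x.
Proof. by move=> oO cx; have [|B] := pselect (Om x); [left|right; apply/boundaryE]. Qed.

Lemma bounded_closure Om : bounded_set Om -> exists2 M, 0 < M & forall x, closure Om x -> enorm x <= M.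
Proof.
case=> M0 [_ hM]; pose M := `|M0| + 1; exists (n%:R * M + 1).
  by rewrite ltr_wpDl// mulr_ge0// addr_ge0.
have H x : Om x -> enorm x <= n%:R * M.
  move=> Ox; apply: le_trans (enorm_le_norm x) _; rewrite ler_wpM2l//.
  by apply: (hM M) => //; rewrite /M (le_lt_trans (ler_norm M0))// ltrDl.
move=> x /closure_enorm/(_ 1 ltr01)[y /H Oy yx].
by have := enorm_tri x y 0; rewrite !subr0 (enormC x y); lra.
Qed.

Lemma compact_boundary Om : bounded_set Om -> compact (boundary Om).
Proof.
move=> /bounded_closure[M _ hM]; apply: (@compact_enorm _ _ _ M).
  by move=> x [/hM].
rewrite /boundary setDE; apply: closedI; first exact: closed_closure.
by rewrite closedC; exact: open_interior.
Qed.

Lemma compact_closure Om : bounded_set Om -> compact (closure Om).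
Proof.
by move=> /bounded_closure[M _ hM]; apply: (@compact_enorm _ _ _ M) => //; exact: closed_closure.
Qed.

(** [t] is the infimum of the times at which the segment is outside [Om]. Openness of [Om] shows
    that it is positive and itself a time outside; earlier times give the approximation from
    inside. *)
Lemma exit_point Om x v : open Om -> Om x -> ~ Om (x + v) ->
  exists t, [/\ 0 < t, t <= 1, boundary Om (x + t *: v) & forall s, 0 <= s < t -> Om (x + s *: v)].
Proof.
move=> oO Ox nO; pose T := [set t : R | 0 <= t <= 1 /\ ~ Om (x + t *: v)].
have T1 : T 1 by split; rewrite ?scale1r// ler01 lexx.
have hT : has_inf T by split; [exists 1|exists 0 => t [/andP[]]].
pose t := inf T.
have t0 : 0 <= t by apply: lb_le_inf; [exists 1|move=> s [/andP[]]].
have t1 : t <= 1 by apply: ge_inf T1; exists 0 => s [/andP[]].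
have In s : 0 <= s < t -> Om (x + s *: v).
  move=> /andP[s0 st]; apply: contrapT => no; move: (st); rewrite ltNge => /negP; apply.
  apply: ge_inf; first by exists 0 => w [/andP[]].
  by split=> //; apply/andP; split; move: t1 st s0; rewrite -/t; clear; lra.
have nt : ~ Om (x + t *: v).
  move=> Ot; have [r r0 hr] := open_enorm oO Ot.
  have [s [s01 ns] st] := inf_adherent (divr_gt0 r0 (ltr_wpDl (enorm_ge0 v) ltr01)) hT.
  have ts : t <= s by apply: ge_inf; [exists 0 => w [/andP[]]|split].
  apply: ns.
  apply: hr; rewrite opprD addrACA subrr add0r -scalerBl enormZ ger0_norm ?subr_ge0//.
  move: st; rewrite -/t => st.
  have : (s - t) * (enorm v + 1) < r by rewrite -ltr_pdivlMr ?ltr_wpDl ?enorm_ge0//; lra.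
  by have := enorm_ge0 v; nra.
have tp : 0 < t.
  by rewrite lt_neqAle t0 andbT eq_sym; apply/eqP => t00; apply: nt; rewrite t00 scale0r addr0.
exists t; split=> //; apply/boundaryE => //; split=> //.
apply/closure_enorm => r r0.
have v1 : 0 < enorm v + 1 by rewrite ltr_wpDl ?enorm_ge0.
pose s := Num.max 0 (t - r / (enorm v + 1)).
have st : s < t by rewrite gt_max tp/= ltrBlDr ltrDl divr_gt0.
have s0 : 0 <= s by rewrite le_max lexx.
exists (x + s *: v); first by apply: In; rewrite s0.
rewrite opprD addrACA subrr add0r -scalerBl enormZ ler0_norm ?subr_le0 ?ltW// opprB.
have : t - s <= r / (enorm v + 1) by rewrite lerBlDr -lerBlDl le_max lexx orbT.
rewrite ler_pdivlMr// => H; have := enorm_ge0 v; nra.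
Qed.

Lemma nearest_boundary Om x : (0 < n)%N -> open Om -> bounded_set Om -> Om x ->
  exists z, [/\ boundary Om z, z != x, forall y, boundary Om y -> enorm (z - x) <= enorm (y - x) &
    forall y, enorm (y - x) < enorm (z - x) -> Om y].
Proof.
move=> n0 oO bO Ox.
have [M M0 hM] := bounded_closure bO.
have B0 : boundary Om !=set0.
  pose w : 'rV[R]_n := delta_mx 0 (Ordinal n0).
  have w1 : enorm w = 1 by rewrite /enorm dot_delta mxE !eqxx sqrtr1.
  have [|t [_ _ bt _]] := @exit_point Om x ((M + enorm x + 1) *: w) oO Ox; last by eexists; exact: bt.
  move=> /subset_closure/hM; have := ler_enormB (x + (M + enorm x + 1) *: w) x.
  rewrite addrC addKr enormZ w1 mulr1 ger0_norm ?addr_ge0 ?enorm_ge0 ?(ltW M0)//; lra.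
have [|z bz hz] := compact_min (compact_boundary bO) B0 (f := fun y => enorm (y - x)).
  by apply: cont_onW => y _; exact: cont_enormB.
have zx : z != x by apply/eqP => E; have [_] := (boundaryE z oO).1 bz; rewrite E.
exists z; split=> // y yx; apply: contrapT => ny.
have [|t [t0 t1 bt _]] := @exit_point Om x (y - x) oO Ox; first by rewrite addrC subrK.
have := hz _ bt; rewrite (addrC x) addrK enormZ ger0_norm ?(ltW t0)//.
by have := enorm_ge0 (y - x); nra.
Qed.

(** [m] is the inner unit normal. Apart from [boundary_expansion], the later geometry uses the [C2]
    boundary through this two-sided ball property. *)
Definition tball Om r z m := [/\ enorm m = 1,
  forall y, enorm (y - (z + r *: m)) < r -> Om y &
  forall y, enorm (y - (z - r *: m)) < r -> ~ Om y].

Lemma disjoint_balls x z a d : 0 < a -> 0 < d ->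
  (forall y, enorm (y - x) < a -> enorm (y - z) < d -> False) -> a + d <= enorm (x - z).
Proof.
move=> a0 d0 H; rewrite leNgt; apply/negP => lt; have ad : 0 < a + d by rewrite addr_gt0.
apply: (H (z + (d / (a + d)) *: (x - z))).
  have -> : z + (d / (a + d)) *: (x - z) - x = - (a / (a + d)) *: (x - z).
    rewrite addrAC -(opprB x) -[- (x - z)]scaleN1r -scalerDl; congr (_ *: _).
    by field; rewrite gt_eqF.
  rewrite enormZ normrN ger0_norm ?divr_ge0 ?ltW// mulrAC ltr_pdivrMr//.
  by rewrite ltr_pM2l.
rewrite [z + _]addrC addrK enormZ ger0_norm ?divr_ge0 ?ltW// mulrAC ltr_pdivrMr//.
by rewrite ltr_pM2l.
Qed.

Lemma dot1 m : enorm m = 1 -> dot m m = 1.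
Proof. by move=> m1; rewrite -enorm_sqr m1 expr1n. Qed.

Lemma enorm_le_sqr x a : 0 <= a -> (enorm x <= a) = (dot x x <= a ^+ 2).
Proof. by move=> a0; rewrite -enorm_sqr ler_sqr// nnegrE enorm_ge0. Qed.

Lemma enorm_lt_sqr x a : 0 <= a -> (enorm x < a) = (dot x x < a ^+ 2).
Proof. by move=> a0; rewrite -enorm_sqr ltr_sqr// nnegrE enorm_ge0. Qed.

Lemma enorm_ge_sqr x a : 0 <= a -> (a <= enorm x) = (a ^+ 2 <= dot x x).
Proof. by move=> a0; rewrite -enorm_sqr ler_sqr// nnegrE enorm_ge0. Qed.

(** The ball around [x] and the exterior tangent ball are disjoint, so their centres are at distance
    at least [enorm (z - x) + r]; equality in the triangle inequality forces [x - z] to point along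
    [m]. *)
Lemma tball_direction Om r z m x : 0 < r -> tball Om r z m -> z != x ->
  (forall y, enorm (y - x) < enorm (z - x) -> Om y) -> x = z + enorm (z - x) *: m.
Proof.
move=> r0 [m1 _ hE] zx hI; set d := enorm (z - x).
have d0 : 0 < d by rewrite enorm_gt0 subr_eq0.
have := disjoint_balls d0 r0 (fun y H1 H2 => hE y H2 (hI y H1)).
rewrite enorm_ge_sqr ?(addr_ge0 (ltW d0) (ltW r0))//.
have [h hE'] : exists h, h = x - z by exists (x - z).
have -> : x - (z - r *: m) = h + r *: m by rewrite hE'; vec.
have hd : dot h h = d ^+ 2 by rewrite enorm_sqr hE' -opprB dotNl dotNr opprK.
rewrite !dotL (dotC m h) hd (dot1 m1) => H.
have : dot (h - d *: m) (h - d *: m) <= 0.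
  rewrite !dotL (dotC m h) hd (dot1 m1); move: H; set D := dot h m => H.
  have : r * (d - D) <= 0 by nra.
  by rewrite pmulr_rle0// => L; nra.
have := dot_ge0 (h - d *: m) => A B; have /eqP : dot (h - d *: m) (h - d *: m) = 0 by lra.
by rewrite dot_eq0 subr_eq0 => /eqP <-; rewrite hE' addrC subrK.
Qed.

(** The inner ball at either point is disjoint from the exterior ball at the other; the two squared
    distance bounds together make the normal Lipschitz with constant [1 / r]. *)
Lemma tball_lip Om r z y m k : 0 < r -> tball Om r z m -> tball Om r y k ->
  r * enorm (m - k) <= enorm (z - y).
Proof.
move=> r0 [m1 zI zE] [k1 yI yE].
have H1 := disjoint_balls r0 r0 (fun w H1 H2 => yE w H2 (zI w H1)).
have H2 := disjoint_balls r0 r0 (fun w H1 H2 => zE w H1 (yI w H2)).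
have rr : 0 <= r + r by lra.
move=> {zI zE yI yE}.
move: H1 H2; have -> : z + r *: m - (y - r *: k) = (z - y) + (r *: m + r *: k).
  by vec.
have -> : z - r *: m - (y + r *: k) = (z - y) - (r *: m + r *: k).
  by rewrite !opprD addrACA.
have re : 0 <= r * enorm (m - k) by rewrite mulr_ge0 ?enorm_ge0 ?ltW.
rewrite !enorm_ge_sqr// exprMn enorm_sqr.
move: (z - y) => D; rewrite !dotL (dotC k m) (dotC m D) (dotC k D) (dot1 m1) (dot1 k1).
by clear; nra.
Qed.

Lemma tball_le Om r s z m : 0 < s -> s <= r -> tball Om r z m -> tball Om s z m.
Proof.
move=> s0 sr [m1 hI hE]; split=> // y ys; [apply: hI|apply: hE].
  have -> : y - (z + r *: m) = (y - (z + s *: m)) - (r - s) *: m.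
    by vec.
  by apply: le_lt_trans (ler_enormB _ _) _; rewrite enormZ m1 ger0_norm ?subr_ge0//; lra.
have -> : y - (z - r *: m) = (y - (z - s *: m)) + (r - s) *: m.
  by vec.
by apply: le_lt_trans (ler_enormD _ _) _; rewrite enormZ m1 ger0_norm ?subr_ge0//; lra.
Qed.

Lemma tball_in Om r z m a : tball Om r z m -> 0 < a -> a < 2 * r -> Om (z + a *: m).
Proof.
move=> [m1 hI _] a0 ar; apply: hI; rewrite opprD addrACA subrr add0r -scalerBl enormZ m1 mulr1.
by rewrite ltr_norml; lra.
Qed.

Definition gap_grad e gamma y : 'rV[R]_n :=
  let v := gradient gamma (y - dot y e *: e) in v - dot v e *: e - e.

Lemma gap_taylor e gamma x : enorm e = 1 -> C2 gamma -> exists C r, [/\ 0 <= C, 0 < r & forall y h,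
  enorm (y - x) < r -> enorm h < r ->
  `|graph_gap e gamma (y + h) - graph_gap e gamma y - dot (gap_grad e gamma y) h| <= C * dot h h].
Proof.
move=> e1 g2; have [C [r [C0 r0 hr]]] := C2_taylor (x - dot x e *: e) g2.
have P h : dot (h - dot h e *: e) (h - dot h e *: e) <= dot h h.
  by rewrite !dotL (dotC e h) (dot1 e1); have := sqr_ge0 (dot h e); lra.
have Pn h : enorm (h - dot h e *: e) <= enorm h.
  by rewrite enorm_le_sqr ?enorm_ge0// enorm_sqr.
have PB y z : y - dot y e *: e - (z - dot z e *: e) = (y - z) - dot (y - z) e *: e.
  by rewrite dotBl; vec.
exists C, r; split=> // y h yr hh.
have yr' : enorm (y - dot y e *: e - (x - dot x e *: e)) < r.
  by rewrite PB; exact: le_lt_trans yr.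
have H := hr _ _ yr' (le_lt_trans (Pn h) hh).
apply: le_trans (_ : C * dot (h - dot h e *: e) (h - dot h e *: e) <= _); last by rewrite ler_wpM2l.
apply: le_trans H; apply: eq_ler; congr `| _ |.
rewrite /graph_gap /gap_grad.
have -> : y + h - dot (y + h) e *: e = y - dot y e *: e + (h - dot h e *: e).
  by rewrite dotDl scalerDl opprD addrACA.
move: (gradient _ _) (gamma _) (gamma _) => v a b.
by rewrite !dotL (dotC e h); ring.
Qed.

Lemma gap_gradient e gamma x : enorm e = 1 -> C2 gamma ->
  gradient (graph_gap e gamma) x = gap_grad e gamma x.
Proof.
move=> e1 g2; have [C [r [C0 r0 hr]]] := gap_taylor x e1 g2.
apply/rowP => i; rewrite mxE; apply: dval.
apply: (@is_derive_sq _ _ _ _ _ _ C r r0) => t tr.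
have d1 : dot (delta_mx 0 i : 'rV[R]_n) (delta_mx 0 i) = 1 by rewrite dot_delta mxE !eqxx.
have := hr x (t *: delta_mx 0 i); rewrite subrr enorm0 => /(_ r0).
rewrite enormZ (_ : enorm (delta_mx 0 i) = 1) ?mulr1; last by rewrite /enorm d1 sqrtr1.
by move=> /(_ tr); rewrite dotZr dot_delta dotZl dotZr d1 mulr1 -expr2.
Qed.

Lemma gap_jet e gamma x : enorm e = 1 -> C2 gamma -> exists X,
  jet (graph_gap e gamma) x (gap_grad e gamma x) X.
Proof.
move=> e1 g2; pose P : 'M[R]_n := 1%:M - e^T *m e.
have yP y : y *m P = y - dot y e *: e.
  by rewrite mulmxBr mulmx1 mulmxA [y *m e^T]mx11_scalar mul_scalar_mx.
have PT : P^T = P by rewrite /P linearB/= trmx_mul trmxK trmx1.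
have J := jet_affine (c := 0) (z := x) (M := P) (C2_jet (0 + x *m P) g2).
eexists; have := jetD J (jetN (jet_dot e x)); rewrite PT yP add0r yP => J2.
by apply: jet_ext J2 => z; rewrite add0r yP /graph_gap dotC (dotC e z).
Qed.

Lemma gap_grad_ge1 e gamma x : enorm e = 1 -> 1 <= enorm (gap_grad e gamma x).
Proof.
move=> e1; have := ler_dot (gap_grad e gamma x) e.
rewrite e1 mulr1 /gap_grad !dotL (dot1 e1) mulr1 subrr sub0r normrN1; exact.
Qed.

Lemma chart_near Om x e gamma : C2_chart Om x e gamma -> exists2 r, 0 < r &
  forall z, enorm (z - x) < r -> C2_chart Om z e gamma.
Proof.
move=> [e1 g2 /nbhs_enorm[r r0 hr]]; exists (r / 2); first by rewrite divr_gt0.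
move=> z zx; split=> //; apply/nbhs_enorm; exists (r / 2); first by rewrite divr_gt0.
by move=> y yz; apply: hr; have := enorm_tri y z x; lra.
Qed.

Lemma gap_boundary Om z e gamma : open Om -> C2_chart Om z e gamma -> boundary Om z ->
  graph_gap e gamma z = 0.
Proof.
move=> oO [e1 g2 /nbhs_enorm[r r0 hr]] /(boundaryE z oO)[cz nz].
apply/eqP; rewrite eq_le; apply/andP; split; last first.
  by rewrite leNgt; apply/negP => /(hr z); rewrite subrr enorm0 => /(_ r0).
rewrite leNgt; apply/negP => lt.
have [X J] := gap_jet z e1 g2; have /cont_enorm/(_ _ lt)[s s0 hs] := jet_cont J.
have m0 : 0 < Num.min r s by rewrite lt_min r0.
have [y Oy] := (closure_enorm _ _).1 cz _ m0; rewrite lt_min => /andP[/hr yr /hs].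
by have /yr := Oy; rewrite ltr_norml; lra.
Qed.

(** With a Taylor constant [C] valid near [x], balls of radius [s] with [2 * s * C < 1] do the job:
    inside them the linear part of [graph_gap], at least [dot m h] in size because its gradient has
    norm at least 1, dominates the quadratic error. *)
Lemma chart_tball Om x e gamma : open Om -> C2_chart Om x e gamma ->
  exists2 r, 0 < r & forall z s, enorm (z - x) < r -> boundary Om z -> 0 < s -> s < r ->
    tball Om s z (- (enorm (gap_grad e gamma z))^-1 *: gap_grad e gamma z).
Proof.
move=> oO ch; have [r2 r20 hr2] := chart_near ch; move: (ch) => [e1 g2 /nbhs_enorm[r1 r10 hr1]].
have [C [r3 [C0 r30 hr3]]] := gap_taylor x e1 g2.
pose r := Num.min (Num.min (r1 / 4) (Num.min r2 (r3 / 4))) (4 * C + 4)^-1.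
have C4 : 0 < 4 * C + 4 by rewrite ltr_wpDl// mulr_ge0.
exists r; first by rewrite !lt_min r20 !divr_gt0//= invr_gt0.
move=> z s; rewrite !lt_min => /andP[/andP[zr1 /andP[zr2 zr3]] _] bz s0.
move=> /andP[/andP[sr1 /andP[sr2 sr3]] sC].
have G0 := gap_boundary oO (hr2 z zr2) bz; set g := gap_grad e gamma z; set G := graph_gap e gamma.
have g1 : 1 <= enorm g by exact: gap_grad_ge1.
have g0 : 0 < enorm g by lra.
set m := - (enorm g)^-1 *: g.
have m1 : enorm m = 1 by rewrite enormZ normrN ger0_norm ?invr_ge0 ?ltW// mulVf ?gt_eqF.
have gE : g = - enorm g *: m by rewrite scalerA mulrNN divff ?gt_eqF// scale1r.
have sC2 : 2 * s * C < 1.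
  by move: sC; rewrite -[_^-1]mul1r ltr_pdivlMr//; nra.
have near h : enorm h < 2 * s -> (Om (z + h) <-> G (z + h) < 0) /\
    `|G (z + h) + enorm g * dot m h| <= C * dot h h.
  move=> hs; split.
    apply: hr1; have := enorm_tri (z + h) z x; rewrite [z + h - z]addrC addKr; lra.
  have := hr3 z h; rewrite G0 -/g -/G subr0 {1}gE dotZl mulNr opprK; apply; lra.
clearbody m; split=> // y ys; rewrite -[y](subrK z) [_ + z]addrC.
  have ys' : enorm (y - z - s *: m) < s by move: ys; rewrite opprD addrA.
  move: (y - z) ys' => h ys'.
  have /near[E B] : enorm h < 2 * s.
    rewrite -[h](subrK (s *: m)); apply: le_lt_trans (ler_enormD _ _) _.
    by rewrite [enorm (s *: m)]enormZ m1 ger0_norm ?ltW//; lra.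
  apply/E; move: ys'; rewrite enorm_lt_sqr ?ltW// !dotL (dotC m h) (dot1 m1) => H.
  have hh := dot_ge0 h; move: B; rewrite ler_norml (dotC m h) => /andP[_ B].
  have hm : 0 < dot h m by rewrite -(pmulr_rgt0 _ s0); nra.
  have : C * dot h h <= C * (2 * s * dot h m) by rewrite ler_wpM2l//; nra.
  by move: B sC2 g1 hm; clear; nra.
have ys' : enorm (y - z + s *: m) < s by move: ys; rewrite opprB addrA addrAC.
move: (y - z) ys' => h ys'.
have /near[E B] : enorm h < 2 * s.
  rewrite -[h](addrK (s *: m)); apply: le_lt_trans (ler_enormB _ _) _.
  by rewrite [enorm (s *: m)]enormZ m1 ger0_norm ?ltW//; lra.
move=> /E; move: ys'; rewrite enorm_lt_sqr ?ltW// !dotL (dotC m h) (dot1 m1) => H.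
have hh := dot_ge0 h; move: B; rewrite ler_norml (dotC m h) => /andP[B _].
have hm : dot h m < 0 by rewrite -(pmulr_rlt0 _ s0); nra.
have : C * dot h h <= C * (2 * s * - dot h m) by rewrite ler_wpM2l//; nra.
by move: B sC2 g1 hm; clear; nra.
Qed.

Lemma C2_two_balls Om : open Om -> bounded_set Om -> C2_boundary Om ->
  exists2 r, 0 < r & forall z, boundary Om z -> exists2 m, tball Om r z m &
    outward_unit_normal Om z (- m).
Proof.
move=> oO bO C2O.
pose P r z := exists2 m, tball Om r z m & outward_unit_normal Om z (- m).
have [|r r0 hr] := @compact_scale R n (boundary Om) P (compact_boundary bO).
  move=> x /C2O[e [gamma ch]]; have [r r0 hr] := chart_tball oO ch.
  have [s s0 hs] := chart_near ch; have [e1 g2 _] := ch.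
  exists (Num.min r s); first by rewrite lt_min r0.
  move=> w y w0; rewrite !lt_min => /andP[wr ws] /andP[yr ys] by'.
  eexists; first exact: hr yr by' w0 wr.
  exists e, gamma; split; first exact: hs.
  by rewrite gap_gradient// scaleNr opprK.
by exists (r / 2) => [|z bz]; [rewrite divr_gt0|apply: hr; rewrite // ?divr_gt0//; lra].
Qed.

(** Over the tangent direction [e] the boundary lies at height [k s^2] up to [a s^2], with [k] half
    the normal curvature in that direction. The same [k] serves for [s] and [- s], which is what the
    reflection at a corner needs. *)
Lemma boundary_expansion Om r z m e : open Om -> C2_boundary Om -> 0 < r -> boundary Om z ->
  tball Om r z m -> enorm e = 1 -> dot e m = 0 -> exists k : R, forall a, 0 < a ->
  exists2 d, 0 < d & forall s : R, 0 < `|s| -> `|s| < d ->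
    Om (z + s *: e + ((k + a) * s ^+ 2) *: m) /\ ~ Om (z + s *: e + ((k - a) * s ^+ 2) *: m).
Proof.
move=> oO C2O r0 bz tb e1 em; have [e' [gamma ch]] := C2O z bz.
have [s s0 hs] := chart_tball oO ch; move: (ch) => [e1' g2 /nbhs_enorm[r1 r10 hr1]].
have [X J] := gap_jet z e1' g2; have G0 := gap_boundary oO ch bz.
have g1 : 1 <= enorm (gap_grad e' gamma z) by exact: gap_grad_ge1.
move: g1 J hs; set g := gap_grad e' gamma z; set G := graph_gap e' gamma => g1 J hs.
have g0 : 0 < enorm g by lra.
have m1 : enorm m = 1 by have [] := tb.
(* Two tangent balls of a common radius at the same point have the same normal, by [tball_lip] at
   distance zero; this identifies the direction of the chart gradient with [- m]. *)
have gE : g = - enorm g *: m.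
  pose t := Num.min r (s / 2).
  have t0 : 0 < t by rewrite lt_min r0 divr_gt0.
  have := hs z t; rewrite subrr enorm0 => /(_ s0 bz t0) T.
  have {}T : tball Om t z (- (enorm g)^-1 *: g).
    by apply: T; rewrite gt_min; apply/orP; right; lra.
  have tr : t <= r by rewrite ge_min lexx.
  have := tball_lip t0 (tball_le t0 tr tb) T; rewrite subrr enorm0 pmulr_rle0// => H.
  have /eqP : enorm (m - - (enorm g)^-1 *: g) = 0.
    by apply/eqP; rewrite eq_le H enorm_ge0.
  rewrite enorm_eq0 subr_eq0 => /eqP ->; rewrite scalerA mulrNN divff ?gt_eqF//.
  by rewrite scale1r.
(* Solves [- enorm g * k + 2^-1 * quad X e = 0], the second-order coefficient of [graph_gap] along
   [s *: e + (k * s ^+ 2) *: m]. *)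
exists (quad X e / (2 * enorm g)) => a a0; set k := _ / _.
have kE : quad X e = 2 * enorm g * k by rewrite /k mulrC divfK// gt_eqF// mulr_gt0.
pose K := `|k| + a; have K0 : 0 <= K by rewrite addr_ge0// ltW.
have q0 : 0 < enorm g * a / (4 * (1 + K) ^+ 2).
  by rewrite divr_gt0 ?mulr_gt0 ?exprn_gt0 ?ltr_wpDr.
have [r2 r20 hr2] := (jetP _ _ _ _).1 J _ q0.
pose B := mnorm X * K * (2 + K); have B0 : 0 <= B by rewrite !mulr_ge0 ?mnorm_ge0// addr_ge0.
pose d := Num.min (Num.min 1 (enorm g * a / (2 * (B + 1)))) (Num.min (r1 / (1 + K)) (r2 / (1 + K))).
have K1 : 0 < 1 + K by rewrite ltr_wpDr.
have B1 : 0 < 2 * (B + 1) by rewrite mulr_gt0// ltr_wpDl.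
exists d; first by rewrite !lt_min ltr01 !divr_gt0// mulr_gt0.
move=> t t0; rewrite !lt_min => /andP[/andP[t1 tB] /andP[tr1 tr2]].
move: tB tr1 tr2; rewrite !ltr_pdivlMr// => tB tr1 tr2.
have main b : `|b| = a -> let h := t *: e + ((k + b) * t ^+ 2) *: m in
   (Om (z + h) <-> G (z + h) < 0) /\ `|G (z + h) + enorm g * b * t ^+ 2| < enorm g * a * t ^+ 2.
  move=> ba h.
  have kb : `|k + b| <= K by rewrite /K -ba ler_normD.
  have t2 : t ^+ 2 = `|t| ^+ 2 by rewrite real_normK ?num_real.
  have d1 : enorm (((k + b) * t ^+ 2) *: m) <= K * `|t| ^+ 2.
    by rewrite enormZ m1 mulr1 normrM t2 (ger0_norm (exprn_ge0 _ (normr_ge0 t))) ler_wpM2r ?exprn_ge0.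
  have hn : enorm h <= (1 + K) * `|t|.
    apply: le_trans (ler_enormD _ _) _; rewrite enormZ e1 mulr1.
    have := mulr_ge0 (mulr_ge0 K0 (ltW t0)) (_ : 0 <= 1 - `|t|); rewrite subr_ge0 (ltW t1) => /(_ isT).
    by clear -d1; lra.
  split; first by apply: hr1; rewrite addrC addKr; apply: le_lt_trans hn _; lra.
  have gh : dot g h = - (enorm g * (k + b) * t ^+ 2).
    by rewrite {1}gE /h !dotL (dotC m e) em (dot1 m1); ring.
  have qh : `|quad X h - t ^+ 2 * quad X e| <= `|t| * `|t| ^+ 2 * B.
    rewrite -quadZ quad_diff.
    have -> : h - t *: e = ((k + b) * t ^+ 2) *: m by rewrite /h addrC addKr.
    apply: le_trans (ler_normD _ _) _.
    have I1 := ler_bil X (((k + b) * t ^+ 2) *: m) h.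
    have I2 := ler_bil X (t *: e) (((k + b) * t ^+ 2) *: m).
    rewrite [enorm (t *: e)]enormZ e1 mulr1 in I2.
    have X0 := mnorm_ge0 X.
    have I3 : mnorm X * (enorm (((k + b) * t ^+ 2) *: m) * enorm h) <=
      mnorm X * ((K * `|t| ^+ 2) * ((1 + K) * `|t|)) by rewrite ler_wpM2l// ler_pM ?enorm_ge0.
    have I4 : mnorm X * (`|t| * enorm (((k + b) * t ^+ 2) *: m)) <=
      mnorm X * (`|t| * (K * `|t| ^+ 2)) by rewrite ler_wpM2l// ler_wpM2l.
    have -> : `|t| * `|t| ^+ 2 * B = mnorm X * ((K * `|t| ^+ 2) * ((1 + K) * `|t|)) +
       mnorm X * (`|t| * (K * `|t| ^+ 2)) by rewrite /B; ring.
    by apply: lerD; [exact: le_trans I1 I3|exact: le_trans I2 I4].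
  have hh : enorm g * a / (4 * (1 + K) ^+ 2) * dot h h <= enorm g * a / 4 * `|t| ^+ 2.
    have -> : enorm g * a / 4 * `|t| ^+ 2 =
       enorm g * a / (4 * (1 + K) ^+ 2) * ((1 + K) * `|t|) ^+ 2.
      by field; rewrite gt_eqF.
    by rewrite ler_wpM2l ?(ltW q0)// -enorm_le_sqr// mulr_ge0 ?ltW.
  have {}H : `|G (z + h) - dot g h - 2^-1 * quad X h| <= enorm g * a / 4 * `|t| ^+ 2.
    by apply: le_trans hh; have := hr2 h; rewrite {2}/G G0 subr0; apply; apply: le_lt_trans hn _; lra.
  have tq : `|t| * `|t| ^+ 2 * B <= enorm g * a / 2 * `|t| ^+ 2.
    rewrite mulrAC ler_wpM2r ?exprn_ge0//; nra.
  have t20 : 0 < `|t| ^+ 2 by rewrite exprn_gt0.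
  rewrite t2 in qh gh *; move: H qh tq; rewrite gh kE; move: (G _) (quad X h) => A C.
  have := mulr_gt0 (mulr_gt0 g0 a0) t20; move: (enorm g) (`|t| ^+ 2) => c w P.
  move=> /ler_normlP[H1 H2] /ler_normlP[H3 H4] H5.
  by rewrite ltr_norml; apply/andP; split; clear -H1 H2 H3 H4 H5 P; lra.
have [E1 B1'] := main a (gtr0_norm a0).
have [E2 B2'] := main (- a) (etrans (normrN a) (gtr0_norm a0)).
rewrite -!addrA; split; first by apply/E1; move: B1'; rewrite ltr_norml => /andP[_]; lra.
by move=> /E2; move: B2'; rewrite ltr_norml => /andP[+ _]; lra.
Qed.

End Geometry.

(** * Expansions and jets of radial functions *)

Section Radial.
Context {R : realType}.
Implicit Types (F D : R -> R) (s t a b r e : R).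

Definition peano F s a b := forall e, 0 < e -> exists2 r, 0 < r & forall t, `|t| < r ->
  `|F (s + t) - F s - a * t - 2^-1 * b * t ^+ 2| <= e * t ^+ 2.

Lemma derive_bound D s b e : is_derive s 1 D b -> 0 < e -> exists2 r, 0 < r &
  forall t, `|t| < r -> `|D (s + t) - D s - b * t| <= e * `|t|.
Proof.
move=> [dD bE] e0; have : (fun t => t^-1 *: ((D \o shift s) (t *: 1) - D s)) @ 0^' --> b.
  by rewrite -bE; exact: dD.
move=> /cvgrPdist_le/(_ e e0)/nbhs_ballP[r r0 hr]; exists r => // t tr.
have [->|t0] := eqVneq t 0; first by rewrite addr0 subrr mulr0 subr0 normr0 mulr0.
have : `|b - t^-1 *: ((D \o shift s) (t *: 1) - D s)| <= e.
  by apply: (hr t) => //; rewrite -ball_normE /= sub0r normrN.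
rewrite /= [t%:A]mulr1 [t + s]addrC; set d := D _ - D s.
have -> : d - b * t = - (b - t^-1 *: d) * t by rewrite -[_ *: _]/(_ * _); field.
by move=> H; rewrite normrM normrN ler_wpM2r.
Qed.

Lemma peano_derive F D s b r : 0 < r ->
  (forall t, `|t| < r -> is_derive (s + t) 1 F (D (s + t))) ->
  is_derive s 1 D b -> peano F s (D s) b.
Proof.
move=> r0 dF dD e e0; have [q q0 hq] := derive_bound dD e0.
exists (Num.min r q); first by rewrite lt_min r0.
move=> t; rewrite lt_min => /andP[tr tq].
pose G t := F (s + t) - (D s * t + 2^-1 * b * t ^+ 2).
have [w wt|w wt] := @mvt_origin R G (fun t => D (s + t) - (D s + b * t)) t.
  apply: is_deriveB.
    have [d1 d2] := dF w (le_lt_trans wt tr).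
    have Q : (fun h : R => h^-1 *: (((fun t => F (s + t)) \o shift w) (h *: 1) - F (s + w)))
      = (fun h : R => h^-1 *: ((F \o shift (s + w)) (h *: 1) - F (s + w))).
      by apply/funext => h /=; congr (_ *: (F _ - _)); rewrite addrCA.
    by apply: DeriveDef; rewrite /derivable /derive Q.
  apply: is_derive_eq.
  by rewrite ![_%:A]mulr1 -[_ *: _]/(_ * _); field.
rewrite /G mulr0 expr0n/= mulr0 !addr0 subr0 => E.
have -> : F (s + t) - F s - D s * t - 2^-1 * b * t ^+ 2 = t * (D (s + w) - D s - b * w).
  by move: E; lra.
rewrite normrM -[t ^+ 2]real_normK ?num_real// expr2 mulrCA ler_wpM2l//.
by apply: le_trans (hq w (le_lt_trans wt tq)) _; rewrite ler_wpM2l// ltW.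
Qed.

Lemma peano_pow s a : 0 < s ->
  peano (fun t => t `^ a) s (a * s `^ (a - 1)) (a * (a - 1) * s `^ (a - 2)).
Proof.
move=> s0; apply: (@peano_derive _ (fun t => a * t `^ (a - 1)) _ _ _ s0).
  move=> t; rewrite ltr_norml => /andP[ts _]; apply: is_derive1_powR; lra.
have H := is_derive1_powR (a - 1) s0.
have E : (fun t : R => a * t `^ (a - 1)) = a \*: (fun t : R => t `^ (a - 1)) by [].
rewrite E; apply: is_derive_eq; rewrite -[_ *: _]/(_ * _) mulrA; congr (_ * _ * _ `^ _).
by ring.
Qed.

End Radial.

Section RadialJets.
Context {R : realType} {n : nat}.
Implicit Types (x y z h k q : 'rV[R]_n) (X : 'M[R]_n) (f g : 'rV[R]_n -> R).

Lemma jet_comp f x q X (F : R -> R) (a b : R) : jet f x q X -> peano F (f x) a b ->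
  jet (fun y => F (f y)) x (a *: q) (a *: X + b *: (q^T *m q)).
Proof.
move=> J P; apply/jetP => e e0.
have [C1 [r1 [C10 r10 h1]]] := jet_bound1 J.
have [C2 [r2 [C20 r20 h2]]] := jet_bound J.
have a1 : 0 < 4 * (`|a| + 1) by rewrite mulr_gt0// ltr_wpDl.
have c1 : 0 < 4 * (C1 ^+ 2 + 1) by rewrite mulr_gt0// ltr_wpDl// sqr_ge0.
have [r3 r30 h3] := (jetP _ _ _ _).1 J _ (divr_gt0 e0 a1).
have [r4 r40 h4] := P _ (divr_gt0 e0 c1).
pose B := `|b| * C2 * (C1 + enorm q) + 1.
have B0 : 0 < B by rewrite /B ltr_wpDl// !mulr_ge0// addr_ge0// enorm_ge0.
exists (Num.min (Num.min (Num.min r1 r2) (Num.min r3 (r4 / (C1 + 1)))) (e / B)).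
  by rewrite !lt_min r10 r20 r30 !divr_gt0// ltr_wpDl.
move=> h; rewrite !lt_min => /andP[/andP[/andP[/h1 H1 /h2 H2] /andP[/h3 H3 hr4]] hB].
move: hr4 hB; rewrite !ltr_pdivlMr// ?ltr_wpDl// => hr4 hB.
have nh := enorm_ge0 h.
have /h4 : `|f (x + h) - f x| < r4 by apply: le_lt_trans H1 _; nra.
rewrite [f x + _]addrC subrK; move: H1 H2 H3; set d := f (x + h) - f x => H1 H2 H3 H4.
have qd := ler_dot q h.
rewrite dotZl quadMD !quadMZ (quadbil (q^T *m q)) bilout (dotC h q).
have -> : F (f (x + h)) - F (f x) - a * dot q h - 2^-1 * (a * quad X h + b * (dot q h * dot q h)) =
  (F (f (x + h)) - F (f x) - a * d - 2^-1 * b * d ^+ 2) + a * (d - dot q h - 2^-1 * quad X h)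
  + 2^-1 * b * ((d - dot q h) * (d + dot q h)) by ring.
have hh : dot h h = enorm h ^+ 2 by rewrite enorm_sqr.
apply: le_trans (ler_normD _ _) _; apply: le_trans (lerD (ler_normD _ _) (lexx _)) _.
have T1 : e / (4 * (C1 ^+ 2 + 1)) * d ^+ 2 <= e / 4 * dot h h.
  have : d ^+ 2 <= C1 ^+ 2 * dot h h.
    by rewrite hh -exprMn -real_normK ?num_real// ler_sqr ?nnegrE ?mulr_ge0.
  move=> D; apply: (@le_trans _ _ (e / (4 * (C1 ^+ 2 + 1)) * (C1 ^+ 2 * dot h h))).
    by rewrite ler_wpM2l// ltW// divr_gt0.
  have -> : e / (4 * (C1 ^+ 2 + 1)) * (C1 ^+ 2 * dot h h) =
    e / 4 * dot h h * (C1 ^+ 2 / (C1 ^+ 2 + 1)).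
    by field; rewrite gt_eqF// ltr_wpDl// sqr_ge0.
  rewrite ler_piMr ?mulr_ge0 ?dot_ge0 ?divr_ge0 ?ltW//.
  by rewrite ltr_pdivrMr ?mul1r ?ltrDl// ltr_wpDl// sqr_ge0.
have T2 : `|a| * (e / (4 * (`|a| + 1)) * dot h h) <= e / 4 * dot h h.
  have -> : `|a| * (e / (4 * (`|a| + 1)) * dot h h) = e / 4 * dot h h * (`|a| / (`|a| + 1)).
    by field; rewrite gt_eqF// ltr_wpDl.
  rewrite ler_piMr ?mulr_ge0 ?dot_ge0 ?divr_ge0 ?ltW//.
  by rewrite ltr_pdivrMr ?mul1r ?ltrDl// ltr_wpDl.
have T3 : `|2^-1 * b * ((d - dot q h) * (d + dot q h))| <= e / 2 * dot h h.
  rewrite !normrM ger0_norm ?invr_ge0//.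
  have D2 : `|d + dot q h| <= (C1 + enorm q) * enorm h.
    by apply: le_trans (ler_normD _ _) _; rewrite mulrDl lerD.
  apply: (@le_trans _ _ (2^-1 * `|b| * ((C2 * dot h h) * ((C1 + enorm q) * enorm h)))).
    by rewrite ler_wpM2l ?mulr_ge0// ler_pM.
  have : enorm h * (B - 1) <= e by rewrite /B in hB *; nra.
  rewrite /B addrK => H5; have := ler_wpM2r (dot_ge0 h) H5; move: (dot h h) => w.
  by clear; lra.
have T4 : `|a * (d - dot q h - 2^-1 * quad X h)| <= e / 4 * dot h h.
  by apply: le_trans T2; rewrite normrM ler_wpM2l.
by move: (le_trans H4 T1) T3 T4; clear; lra.
Qed.

Lemma jet_sqr z x : jet (fun y => dot (y - z) (y - z)) x (2 *: (x - z)) (2 *: 1%:M).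
Proof.
have -> : 2 *: (x - z) = (x - z) *m (1%:M + 1%:M^T).
  by rewrite trmx1 mulmxDr mulmx1 -mulr2n scaler_nat.
by apply: jet_ext (jet_quad 1%:M z x) => y; rewrite quadM1 mul1r.
Qed.

Lemma jet_norm_pow z x (a : R) : x != z -> let s := dot (x - z) (x - z) in
  jet (fun y => dot (y - z) (y - z) `^ a) x ((2 * a * s `^ (a - 1)) *: (x - z))
   ((2 * a * s `^ (a - 1))%:M + (4 * a * (a - 1) * s `^ (a - 2)) *: ((x - z)^T *m (x - z))).
Proof.
move=> xz s; have s0 : 0 < s by rewrite dot_gt0 subr_eq0.
have := jet_comp (jet_sqr z x) (peano_pow a s0).
move: (s `^ (a - 1)) (s `^ (a - 2)) => A B.
have -> : (2 * a * A) *: (x - z) = (a * A) *: (2 *: (x - z)) by rewrite scalerA; congr (_ *: _); ring.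
have -> : (2 * a * A)%:M + (4 * a * (a - 1) * B) *: ((x - z)^T *m (x - z)) =
  (a * A) *: (2 *: 1%:M) + (a * (a - 1) * B) *: ((2 *: (x - z))^T *m (2 *: (x - z))) :> 'M[R]_n.
  rewrite [(2 *: _)^T]linearZ/= -scalemxAl -scalemxAr !scalerA scalemx1.
  by congr (_%:M + _ *: _); ring.
exact.
Qed.

Lemma jet_enorm z x : x != z -> exists Z,
  jet (fun y => enorm (y - z)) x ((enorm (x - z))^-1 *: (x - z)) Z.
Proof.
move=> xz; have := jet_norm_pow 2^-1 xz => /= J; eexists.
have s0 : 0 < dot (x - z) (x - z) by rewrite dot_gt0 subr_eq0.
have E y : dot (y - z) (y - z) `^ 2^-1 = enorm (y - z) by rewrite powR12_sqrt ?dot_ge0.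
have := jet_ext E J; rewrite mulfV// mul1r (_ : 2^-1 - 1 = - 2^-1); last by field.
by rewrite powRN E; apply.
Qed.

(** * Doubling of variables *)

Lemma compact_max2 (K1 K2 : set 'rV[R]_n) (f : 'rV[R]_n -> 'rV[R]_n -> R) :
  compact K1 -> compact K2 -> K1 !=set0 -> K2 !=set0 ->
  (forall x y, K1 x -> K2 y -> forall e, 0 < e -> exists2 r, 0 < r &
     forall x' y', K1 x' -> K2 y' -> enorm (x' - x) < r -> enorm (y' - y) < r ->
     `|f x' y' - f x y| < e) ->
  exists x y, [/\ K1 x, K2 y & forall x' y', K1 x' -> K2 y' -> f x' y' <= f x y].
Proof.
move=> c1 c2 [a Ka] [b Kb] H; pose F (z : 'rV[R]_n * 'rV[R]_n) := f z.1 z.2.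
have [|||[x y] /set_mem[/= Kx Ky] M] := @compact_EVT_max _ _ F (K1 `*` K2).
- by exists (a, b).
- exact: compact_setX.
- apply/subspace_continuousP => -[x y] [/= Kx Ky]; apply/cvgrPdist_lt => e e0.
  have [r r0 hr] := H x y Kx Ky e e0.
  have N z : nbhs z [set w | enorm (w - z) < r] by apply/nbhs_enorm; exists r.
  exists ([set w | enorm (w - x) < r], [set w | enorm (w - y) < r]).
    by split; exact: N.
  by move=> [x' y'] [/= xr yr] [/= Kx' Ky']; rewrite distrC; exact: hr.
exists x, y; split=> // x' y' Kx' Ky'; apply: (M (x', y')); exact/mem_set.
Qed.

Lemma doubling_max (K : set 'rV[R]_n) (a b phi : 'rV[R]_n -> R) : compact K -> K !=set0 ->
  cont_on K a -> cont_on K b -> (forall z, {for z, continuous phi}) ->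
  exists x y, [/\ K x, K y & forall x' y', K x' -> K y' ->
    a x' - b y' - phi (x' - y') <= a x - b y - phi (x - y)].
Proof.
move=> cK K0 ca cb cp; apply: (@compact_max2 K K (fun x y => a x - b y - phi (x - y))) => //.
move=> x y Kx Ky e e0; have e3 : 0 < e / 3 by rewrite divr_gt0.
have [r1 r10 h1] := ca x Kx _ e3; have [r2 r20 h2] := cb y Ky _ e3.
have /cont_enorm/(_ _ e3)[r3 r30 h3] := cp (x - y).
exists (Num.min (Num.min r1 r2) (r3 / 2)); first by rewrite !lt_min r10 r20 divr_gt0.
move=> x' y' Kx' Ky'; rewrite !lt_min => /andP[/andP[xr1 _] xr3] /andP[/andP[_ yr2] yr3].
have := h1 _ Kx' xr1; have := h2 _ Ky' yr2; have /h3 : enorm (x' - y' - (x - y)) < r3.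
  have -> : x' - y' - (x - y) = (x' - x) - (y' - y) by vec.
  by apply: le_lt_trans (ler_enormB _ _) _; lra.
by rewrite !ltr_norml => /andP[? ?] /andP[? ?] /andP[? ?]; apply/andP; split; lra.
Qed.

(** Both points carry the same gradient [q], so both variables can be moved by the same square root;
    the difference [Mx - My] that surrounds the Hessian of [phi] in [theorem_on_sums] is then zero,
    and [Z] disappears from the conclusion. *)
Lemma doubling p u v x y phi q Z (f g r : R) : 1 < p -> (0 < n)%N -> 0 < r ->
  (forall z, enorm (z - x) < r -> {for z, continuous u}) ->
  (forall z, enorm (z - y) < r -> {for z, continuous v}) ->
  (forall z q X, enorm (z - x) < r -> q != 0 -> ujet u z q X -> f <= LA p q X) ->
  (forall z q X, enorm (z - y) < r -> q != 0 -> ljet v z q X -> LA p q X <= g) ->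
  q != 0 -> ujet phi (x - y) q Z ->
  (forall h k, enorm h < r -> enorm k < r ->
     u (x + h) - v (y + k) - phi (x + h - (y + k)) <= u x - v y - phi (x - y)) ->
  f <= g.
Proof.
move=> p1 n0 r0 cu cv su sv q0 J M.
have rr : (rt (Num.sqrt (p - 1)) q)^T *m rt (Num.sqrt (p - 1)) q = rt (p - 1) q.
  by rewrite rtT rt_mul// -expr2 sqr_sqrtr// subr_ge0 ltW.
rewrite -subr_le0.
apply: le_trans (theorem_on_sums (Z := Z) (W1 := 0) (W2 := 0) p1 n0 r0 cu cv su sv q0 q0 rr rr _) _.
  move=> e e0; have [s s0 hs] := J _ (divr_gt0 e0 (ltr0n R 2)).
  exists (Num.min r (s / 2)); first by rewrite lt_min r0 divr_gt0.
  move=> h k; rewrite !lt_min => /andP[hr hs2] /andP[kr ks2].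
  have := M h k hr kr; have -> : x + h - (y + k) = x - y + (h - k) by vec.
  have /hs : enorm (h - k) < s by apply: le_lt_trans (ler_enormB _ _) _; lra.
  have : dot (h - k) (h - k) <= 2 * (dot h h + dot k k).
    by have := dot_ge0 (h + k); rewrite !dotL; lra.
  move=> D; have := ler_wpM2l (ltW e0) D; rewrite !quadM0 (dotBr h k q).
  by clear; lra.
by rewrite subrr mul0mx trmx0 mulmx0 mxtrace0 add0r subrr.
Qed.

End RadialJets.

(** The problem in terms of jets, with signs turned: [c] is minus the Neumann constant, hence
    positive, and [nu] is the inner unit normal. [r] is one tangent ball radius for all boundary
    points, and [ssup0] is the only statement about vanishing gradient. *)
Record serrin {R : realType} {n : nat} (p c r : R) (Om : set 'rV[R]_n) (u : 'rV[R]_n -> R)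
    (nu : 'rV[R]_n -> 'rV[R]_n) : Prop := Serrin {
  sp1 : 1 < p; sn0 : (0 < n)%N; sc0 : 0 < c; sr0 : 0 < r;
  sopen : open Om; sconn : connected Om; sne : Om !=set0; sbd : bounded_set Om;
  scont : cont_on (closure Om) u;
  sdir : forall x, boundary Om x -> u x = 0;
  ssub : forall x q X, Om x -> q != 0 -> ujet u x q X -> - p <= LA p q X;
  ssup : forall x q X, Om x -> q != 0 -> ljet u x q X -> LA p q X <= - p;
  ssup0 : forall x, Om x -> ~ ljet u x 0 0;
  sabove : forall x q X, boundary Om x ->
    (forall e, 0 < e -> exists2 r, 0 < r & forall h, enorm h < r -> closure Om (x + h) ->
      u (x + h) <= u x + dot q h + 2^-1 * quad X h + e * dot h h) -> c <= dot q (nu x);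
  sbelow : forall x q X, boundary Om x ->
    (forall e, 0 < e -> exists2 r, 0 < r & forall h, enorm h < r -> closure Om (x + h) ->
      u x + dot q h + 2^-1 * quad X h - e * dot h h <= u (x + h)) -> dot q (nu x) <= c;
  sball : forall x, boundary Om x -> tball Om r x (nu x);
  sC2 : C2_boundary Om }.

Lemma serrin_intro {R : realType} {n : nat} (p c : R) (Om : set 'rV[R]_n) u :
  (0 < n)%N -> 1 < p -> c < 0 -> bounded_domain Om -> C2_boundary Om ->
  {within closure Om, continuous u} -> viscosity_solution p Om u -> dirichlet Om u ->
  neumann c Om u -> exists r nu, serrin p (- c) r Om u nu.
Proof.
move=> n0 p1 c0 [oO cO neO bO] C2O uc [su sv] ud un.
have [r r0 hr] := C2_two_balls oO bO C2O.
have [nu hnu] : exists nu : 'rV[R]_n -> 'rV[R]_n, forall x, boundary Om x ->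
    tball Om r x (nu x) /\ outward_unit_normal Om x (- nu x).
  have /choice[nu hnu] : forall x, exists m, boundary Om x ->
      tball Om r x m /\ outward_unit_normal Om x (- m).
    move=> x; have [/hr[m a b]|N] := pselect (boundary Om x); first by exists m.
    by exists 0 => /N.
  by exists nu.
exists r, nu; split=> //; first by rewrite oppr_gt0.
- exact/within_cont_enorm.
- by move=> x q X Ox; exact: (visc_sub_jet p1 n0 oO su Ox).
- by move=> x q X Ox; exact: (visc_sup_jet p1 n0 oO sv Ox).
- by move=> x Ox; exact: (visc_sup_jet0 p1 n0 oO sv Ox).
- by move=> x q X bx J; have := neumann_above un bx (hnu x bx).2 J; rewrite dotNr lerNl.
- by move=> x q X bx J; have := neumann_below un bx (hnu x bx).2 J; rewrite dotNr lerNr.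
- by move=> x /hnu[].
Qed.

(** * Positivity and the global Lipschitz bound *)

Section Lipschitz.
Context {R : realType} {n : nat} {p c r : R} {Om : set 'rV[R]_n} {u : 'rV[R]_n -> R}.
Context {nu : 'rV[R]_n -> 'rV[R]_n} (H : serrin p c r Om u nu).
Implicit Types (x y z h k q : 'rV[R]_n).

Lemma sol_cont x : Om x -> {for x, continuous u}.
Proof.
move=> Ox; have [r1 r10 h1] := open_enorm (sopen H) Ox; apply/cont_enorm => e e0.
have [r2 r20 h2] := scont H (subset_closure Ox) e0.
exists (Num.min r1 r2); first by rewrite lt_min r10.
by move=> y; rewrite lt_min => /andP[/h1/subset_closure cy]; exact: h2.
Qed.

Lemma sol_inner x : (forall y, closure Om y -> u x <= u y) -> ~ Om x.
Proof.
move=> m Ox; apply: (ssup0 H Ox) => e e0.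
have [r1 r10 h1] := open_enorm (sopen H) Ox; exists r1 => // h hr.
rewrite dot0l quadM0 mulr0 !addr0; apply: (@le_trans _ _ (u x)).
  by rewrite gerBl mulr_ge0 ?dot_ge0// ltW.
by apply/m/subset_closure/h1; rewrite addrC addKr.
Qed.

Lemma closure_nonempty : closure Om !=set0.
Proof. by have [x Ox] := sne H; exists x; exact: subset_closure. Qed.

Lemma sol_ge0 x : closure Om x -> 0 <= u x.
Proof.
have [x0 c0 m] := compact_min (compact_closure (sbd H)) closure_nonempty (scont H).
have [/(sol_inner m)|b0] := closure_split (sopen H) c0; first by [].
by move=> /m; rewrite (sdir H b0).
Qed.

Lemma sol_gt0 x : Om x -> 0 < u x.
Proof.
move=> Ox; have cx := subset_closure Ox; rewrite lt_neqAle sol_ge0// andbT.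
apply/eqP => u0; by apply: (sol_inner _ Ox) => y /sol_ge0; rewrite -u0.
Qed.

Lemma nearest_ball x z : Om x -> (forall y, boundary Om y -> enorm (z - x) <= enorm (y - x)) ->
  forall y, enorm (y - x) < enorm (z - x) -> Om y.
Proof.
move=> Ox hz y yx; apply: contrapT => ny.
have [|t [t0 t1 bt _]] := @exit_point _ _ Om x (y - x) (sopen H) Ox; first by rewrite addrC subrK.
have := hz _ bt; rewrite (addrC x) addrK enormZ ger0_norm ?(ltW t0)//.
by have := enorm_ge0 (y - x); nra.
Qed.

(** A maximum point of [(1 - t) u(x) - u(y) - L |x - y|] with positive value has [x] inside, since
    [u] is nonnegative and vanishes on the boundary. If [y] is inside too, [doubling] gives
    [- p (1 - t) <= - p], which is absurd; if [y] is on the boundary, a cone of slope [L > c]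
    touches [u] from below there, against the Neumann condition. *)
Lemma lipschitz_strict (L : R) x0 y0 : c < L -> closure Om x0 -> closure Om y0 ->
  u x0 - u y0 <= L * enorm (x0 - y0).
Proof.
move=> cL cx0 cy0; rewrite leNgt; apply/negP => lt.
set m := u x0 - u y0 - L * enorm (x0 - y0); have m0 : 0 < m by rewrite subr_gt0.
have [M M0 hM] := compact_bound (compact_closure (sbd H)) (scont H).
have c0 := sc0 H; have L0 : 0 < L by lra.
(* The factor [1 - t] makes the subsolution inequality strict; [t * M < m] keeps the maximum
   positive. *)
pose t := Num.min 2^-1 (m / (2 * (M + 1))); have M1 : 0 < 2 * (M + 1) by rewrite mulr_gt0// ltr_wpDl.
have t0 : 0 < t by rewrite lt_min invr_gt0 ltr0n divr_gt0.
have t2 : t <= 2^-1 by rewrite ge_min lexx.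
have tM : t * M < m.
  have : t <= m / (2 * (M + 1)) by rewrite ge_min lexx orbT.
  by rewrite ler_pdivlMr//; nra.
have [||z|x [y [cx cy max]]] := @doubling_max R n (closure Om) (fun x => (1 - t) * u x) u
    (fun z => L * enorm (z - 0)) (compact_closure (sbd H)) closure_nonempty.
- exact: cont_onZ (scont H).
- exact: (scont H).
- apply/cont_enorm => e e0; have [s s0 hs] := (cont_enorm _ _).1 (@cont_enormB R n 0 z) _ (divr_gt0 e0 L0).
  by exists s => // w /hs; rewrite ltr_pdivlMr// => A; rewrite -mulrBr normrM gtr0_norm// mulrC.
have pos : 0 < (1 - t) * u x - u y - L * enorm (x - y).
  have := max _ _ cx0 cy0; rewrite !subr0; apply: lt_le_trans.
  have := hM x0 cx0; rewrite ler_norml => /andP[_ b].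
  have : t * u x0 <= t * M by rewrite ler_wpM2l// ltW.
  by move: tM; rewrite /m; lra.
have ux := sol_ge0 cx; have uy := sol_ge0 cy; have d0 := enorm_ge0 (x - y).
have Ld0 : 0 <= L * enorm (x - y) by rewrite mulr_ge0// ltW.
have xy : x != y.
  by apply/eqP => E; move: pos; rewrite E subrr enorm0 => ?; have := sol_ge0 cy; nra.
have Ox : Om x.
  have [//|/(sdir H) E] := closure_split (sopen H) cx; exfalso.
  by move: pos; rewrite E; lra.
have [Z J] := jet_enorm xy.
have [Oy|by'] := closure_split (sopen H) cy.
  have [r1 r10 h1] := open_enorm (sopen H) Ox; have [r2 r20 h2] := open_enorm (sopen H) Oy.
  have t1 : 0 < 1 - t by lra.
  suff : - p * (1 - t) <= - p by have := sp1 H; nra.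
  pose q := L *: ((enorm (x - y - 0))^-1 *: (x - y - 0)).
  have [|Z' J'] := @jet_enorm R n 0 (x - y); first by rewrite subr_eq0.
  apply: (@doubling R n p (fun x => (1 - t) * u x) u x y (fun z => L * enorm (z - 0)) q (L *: Z')
     _ _ (Num.min r1 r2) (sp1 H) (sn0 H)).
  - by rewrite lt_min r10.
  - move=> z; rewrite lt_min => /andP[/h1 Oz _]; apply: continuousM; first exact: cst_continuous.
    exact: sol_cont.
  - by move=> z; rewrite lt_min => /andP[_ /h2 Oz]; exact: sol_cont.
  - move=> z k X; rewrite lt_min => /andP[/h1 Oz _] k0 Jz.
    have it : 0 < (1 - t)^-1 by rewrite invr_gt0.
    have := ujetZ it Jz; set f := (fun y => _); have -> : f = u.
      by apply/funext => w; rewrite /f mulKf// gt_eqF.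
    move=> /(ssub H Oz); rewrite LAqZ ?gt_eqF// LAZ; move=> /(_ _).
    rewrite scaler_eq0 (gt_eqF it) (negPf k0) => /(_ isT).
    by rewrite mulrC ler_pdivlMr.
  - by move=> z k X; rewrite lt_min => /andP[_ /h2 Oz]; exact: (ssup H Oz).
  - rewrite /q subr0 !scaler_eq0 subr_eq0 (negPf xy) (gt_eqF L0) invr_eq0 enorm_eq0 subr_eq0.
    by rewrite (negPf xy).
  - by have [] := jetZ L J'.
  - move=> h k; rewrite !lt_min => /andP[hr _] /andP[_ kr]; apply: max.
      by apply/subset_closure/h1; rewrite addrC addKr.
    by apply/subset_closure/h2; rewrite addrC addKr.
have uy0 := sdir H by'.
(* Maximality in the second variable, used twice: it makes [y] a nearest boundary point of [x], so
   that [x] lies on the inner normal at [y], and it puts the cone with vertex [x] below [u]. *)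
have near z : closure Om z -> L * enorm (y - x) <= u z + L * enorm (z - x).
  by move=> cz; have := max _ _ cx cz; rewrite !subr0 (enormC x y) (enormC x z) uy0; lra.
have yx : y != x by rewrite eq_sym.
have E : x = y + enorm (y - x) *: nu y.
  apply: (tball_direction (sr0 H) (sball H by') yx); apply: nearest_ball => // z bz.
  by have := near z bz.1; rewrite (sdir H bz) add0r ler_pM2l.
have [Z2 J2] := jet_enorm yx.
have d1 : 0 < enorm (y - x) by rewrite enorm_gt0 subr_eq0.
have J3 := jetZ (- L) J2.
have := sbelow H (q := (- L) *: ((enorm (y - x))^-1 *: (y - x))) (X := (- L) *: Z2) by'.
have nE : (enorm (y - x))^-1 *: (y - x) = - nu y.
  have dE : y - x = - (enorm (y - x) *: nu y).
    by move: E; move: (enorm (y - x) *: nu y) => v ->; vec.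
  by rewrite {2}dE scalerN scalerA mulVf ?gt_eqF// scale1r.
have [n1 _ _] := sball H by'.
rewrite nE scaleNr scalerN opprK dotZl (dot1 n1) mulr1 leNgt cL => /(_ _)/negP; apply=> //.
move=> e e0; have [s s0 hs] := J3.2 e e0; exists s => // h /hs + /near.
by rewrite nE scaleNr scalerN opprK uy0; lra.
Qed.

Lemma sol_lip x y : closure Om x -> closure Om y -> `|u x - u y| <= c * enorm (x - y).
Proof.
move=> cx cy; suff B a b : closure Om a -> closure Om b -> u a - u b <= c * enorm (a - b).
  by rewrite ler_norml lerNl opprB B// enormC B.
move=> ca cb; apply/ler_addgt0Pr => e e0.
have d1 : 0 < enorm (a - b) + 1 by rewrite ltr_wpDl ?enorm_ge0.
have := @lipschitz_strict (c + e / (enorm (a - b) + 1)) a b _ ca cb.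
rewrite ltrDl divr_gt0// => /(_ isT)/le_trans; apply; rewrite mulrDl lerD2l.
by rewrite mulrAC ler_pdivrMr// ler_wpM2l ?(ltW e0)// lerDl.
Qed.

End Lipschitz.

(** * Reflection coupling and the Ishii-Lions estimate *)

Section Coupling.
Context {R : realType} {n : nat}.
Implicit Types (x y z h k q s : 'rV[R]_n) (X E M Z : 'M[R]_n) (a p : R).

Lemma trmxZ (m1 m2 : nat) (b : R) (Y : 'M[R]_(m1, m2)) : (b *: Y)^T = b *: Y^T.
Proof. by apply/matrixP => i j; rewrite !mxE. Qed.

Lemma trmxD (m1 m2 : nat) (Y1 Y2 : 'M[R]_(m1, m2)) : (Y1 + Y2)^T = Y1^T + Y2^T.
Proof. by apply/matrixP => i j; rewrite !mxE. Qed.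

Lemma mnorm_out h k : mnorm (h^T *m k) <= n%:R ^+ 2 * (enorm h * enorm k).
Proof.
rewrite /mnorm; apply: (@le_trans _ _ (\sum_(i < n) \sum_(j < n) enorm h * enorm k)).
  apply: ler_sum => i _; apply: ler_sum => j _.
  by rewrite !mxE big_ord1 !mxE normrM ler_pM// coord_le_enorm.
by rewrite !sumr_const !card_ord -mulrnA -natrX mulr_natl mulnn.
Qed.

Lemma rt_lip a q k : q != 0 -> k != 0 -> mnorm (rt a q - rt a k) <=
  `|a - 1| * (4 * n%:R ^+ 2 * (enorm q)^-1 * enorm (q - k)).
Proof.
move=> q0 k0.
have rtE (v : 'rV[R]_n) : v != 0 -> rt a v = 1%:M + (a - 1) *: (((enorm v)^-1 *: v)^T *m ((enorm v)^-1 *: v)).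
  move=> v0; rewrite /rt trmxZ -scalemxAl -scalemxAr !scalerA; congr (_ + _ *: _).
  by rewrite -enorm_sqr expr2 invfM mulrA.
rewrite !rtE// opprD addrACA subrr add0r -scalerBr mnormZ ler_wpM2l//.
have U := unit_lip q0 k0; have q1 := unit_enorm q0; have k1 := unit_enorm k0.
move: U q1 k1; move: (_ *: q) (_ *: k) => v w U v1 w1.
have -> : v^T *m v - w^T *m w = v^T *m (v - w) + (v - w)^T *m w.
  by rewrite mulmxBr [(v - w)^T]linearB/= mulmxBl addrA subrK.
apply: le_trans (mnormD _ _) _.
apply: le_trans (lerD (mnorm_out _ _) (mnorm_out _ _)) _; rewrite v1 w1 mul1r mulr1.
have := ler_wpM2l (sqr_ge0 (n%:R : R)) U; lra.
Qed.

Lemma tr_sqr_le E : \tr (E *m E^T) <= n%:R * mnorm E ^+ 2.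
Proof.
have -> : E *m E^T = E *m 1%:M *m E^T by rewrite mulmx1.
rewrite tr_quad; apply: (@le_trans _ _ (\sum_(i < n) mnorm E ^+ 2)).
  apply: ler_sum => i _; rewrite quadM1 mul1r rowE -enorm_sqr ler_sqr ?nnegrE ?enorm_ge0 ?mnorm_ge0//.
  apply: le_trans (mulmx_enorm_le _ _) _; rewrite /enorm dot_delta mxE !eqxx sqrtr1 mulr1.
  exact: lexx.
by rewrite sumr_const card_ord mulr_natl.
Qed.

Lemma mulmx_rt a q h : h *m rt a q = h + ((a - 1) / dot q q * dot h q) *: q.
Proof.
rewrite mulmxDr mulmx1 -scalemxAr mulmxA [h *m q^T]mx11_scalar mul_scalar_mx scalerA.
by [].
Qed.

Lemma dot_rt a q h : q != 0 -> dot (h *m rt a q) (h *m rt a q) =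
  dot h h + (a ^+ 2 - 1) * (dot h q ^+ 2 / dot q q).
Proof.
move=> q0; rewrite mulmx_rt !dotL (dotC q h); field.
by rewrite gt_eqF// dot_gt0.
Qed.

Lemma dot_sqr_le h q : q != 0 -> dot h q ^+ 2 / dot q q <= dot h h.
Proof.
move=> q0; rewrite ler_pdivrMr ?dot_gt0// -[X in X ^+ 2]/(dot h q).
rewrite -real_normK ?num_real// -!enorm_sqr -exprMn ler_sqr ?nnegrE ?mulr_ge0 ?enorm_ge0//.
exact: ler_dot.
Qed.

(* Composing the square root of [rt (p - 1) q2] with the reflection that reverses [s] keeps its
   Gram matrix, while the difference with [rt (Num.sqrt (p - 1)) q1] has a large component along
   [s], the direction in which the Hessian of a concave power of the distance is negative. *)
Lemma reflection_coupling p q1 q2 s (A a : R) : 1 < p -> q1 != 0 -> q2 != 0 -> dot s s = 1 ->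
  (0 < n)%N -> 0 <= A -> 0 <= a -> a <= 8^-1 ->
  mnorm (rt (Num.sqrt (p - 1)) q1 - rt (Num.sqrt (p - 1)) q2) <= Num.sqrt (lmin p) / (8 * n%:R) ->
  exists M, M^T *m M = rt (p - 1) q2 /\
  \tr ((rt (Num.sqrt (p - 1)) q1 - M) *m (A%:M - (A * (2 - 2 * a)) *: (s^T *m s)) *m
    (rt (Num.sqrt (p - 1)) q1 - M)^T) <= - (2 * lmin p * A).
Proof.
move=> p1 q10 q20 s1 n0 A0 a0 a8; set E := rt _ q1 - rt _ q2 => hE.
have p10 : 0 < p - 1 by rewrite subr_gt0.
have k0 : 0 < Num.sqrt (p - 1) by rewrite sqrtr_gt0.
have l0 := lmin_gt0 p1.
set k := Num.sqrt (p - 1) in E hE k0 *.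
(* The vector that [rt k q2] maps to [s]; reflecting along [z] first sends it to [- s] instead. *)
pose z := s *m rt k^-1 q2.
have zM : z *m rt k q2 = s by rewrite -mulmxA rt_mul// mulVf ?gt_eqF// rt1 mulmx1.
have z0 : z != 0.
  by apply/eqP => z00; move: zM s1; rewrite z00 mul0mx => <-; rewrite dot0l => /eqP; rewrite eq_sym oner_eq0.
have zz : lmin p * dot z z <= 1.
  rewrite dot_rt// s1 exprVn sqr_sqrtr ?(ltW p10)//.
  have D := dot_sqr_le s q20; rewrite s1 in D.
  have D0 : 0 <= dot s q2 ^+ 2 / dot q2 q2 by rewrite divr_ge0 ?sqr_ge0 ?dot_ge0.
  move: D D0; move: (_ / dot q2 q2) => D D1 D0.
  have P : (p - 1) * (p - 1)^-1 = 1 by rewrite divff ?gt_eqF.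
  have I0 : 0 < (p - 1)^-1 by rewrite invr_gt0.
  have [L1 L2] : lmin p <= 1 /\ lmin p <= p - 1 by rewrite /lmin !ge_min !lexx orbT.
  have -> : lmin p * (1 + ((p - 1)^-1 - 1) * D) = lmin p * (1 - D) + (lmin p * (p - 1)^-1) * D by ring.
  have : lmin p * (p - 1)^-1 <= 1 by rewrite ler_pdivrMr// mul1r.
  by nra.
clearbody z.
exists (rt (-1) z *m rt k q2); split.
  rewrite trmx_mul !rtT mulmxA -[_ *m rt (-1) z *m rt (-1) z]mulmxA rt_mul// mulrNN mulr1 rt1 mulmx1.
  by rewrite rt_mul// -expr2 sqr_sqrtr// ltW.
have d0 : 0 < dot z z by rewrite dot_gt0.
pose c := 2 / dot z z.
have -> : rt k q1 - rt (-1) z *m rt k q2 = E + c *: (z^T *m s).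
  have -> : rt (-1) z *m rt k q2 = rt k q2 - c *: (z^T *m s).
    rewrite /rt -/(rt k q2) mulmxDl mul1mx -scalemxAl -mulmxA zM -scaleNr; congr (_ + _ *: _).
    by rewrite /c; field; rewrite gt_eqF.
  by rewrite opprB addrCA addrC.
set Z := _ - _.
have sZ : s *m Z = (- (A * (1 - 2 * a))) *: s.
  rewrite mulmxBr mul_mx_scalar -scalemxAr mulmxA [s *m s^T]mx11_scalar -/(dot s s) s1 mul1mx.
  by rewrite -scalerBl; congr (_ *: _); ring.
have ZT : Z^T = Z by rewrite linearB/= linearZ/= trmx_mul trmxK tr_scalar_mx.
have Zs : Z *m s^T = (- (A * (1 - 2 * a))) *: s^T by rewrite -{1}ZT -trmx_mul sZ linearZ.
have -> (E' Z' : 'M[R]_n) (b : R) : (E' + b *: (z^T *m s)) *m Z' *m (E' + b *: (z^T *m s))^T =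
  E' *m Z' *m E'^T + b *: (z^T *m (s *m Z') *m E'^T) + b *: (E' *m (Z' *m s^T) *m z)
   + (b * b) *: (z^T *m (s *m Z') *m s^T *m z).
  rewrite trmxD trmxZ trmx_mul trmxK !mulmxDl !mulmxDr -!scalemxAl -!scalemxAr !mulmxA.
  by rewrite !scalerA -!addrA; congr (_ + _); rewrite addrCA.
rewrite sZ Zs -!scalemxAr -!scalemxAl !scalerA !mxtraceD !mxtraceZ.
have t1 : \tr (z^T *m s *m E^T) = bil E z s by rewrite tr_out bilT.
have t2 : \tr (E *m s^T *m z) = bil E z s.
  by rewrite -mxtrace_tr !trmx_mul trmxK mulmxA tr_out bilT.
have t3 : \tr (z^T *m s *m s^T *m z) = dot z z.
  rewrite -[z^T *m s *m s^T]mulmxA [s *m s^T]mx11_scalar -/(dot s s) s1 mulmx1.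
  by rewrite mxtrace_mulC /mxtrace big_ord1.
rewrite t1 t2 t3.
have E0 := mnorm_ge0 E.
have tE : \tr (E *m Z *m E^T) <= A * (n%:R * mnorm E ^+ 2).
  rewrite /Z mulmxBr mulmxBl linearB/= mul_mx_scalar -!scalemxAl linearZ/=.
  rewrite -scalemxAr -scalemxAl linearZ/= lerBlDr.
  apply: (@le_trans _ _ (A * (n%:R * mnorm E ^+ 2))); first by rewrite ler_wpM2l// tr_sqr_le.
  rewrite lerDl mulr_ge0 ?mulr_ge0//; first by clear -a8; lra.
  by apply: tr_psd => h; rewrite quadbil bilout (dotC s) -expr2 sqr_ge0.
have bE : `|bil E z s| <= mnorm E * enorm z.
  by apply: le_trans (ler_bil _ _ _) _; rewrite /enorm s1 sqrtr1 mulr1.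
have n1 : 1 <= n%:R :> R by rewrite ler1n.
set e := mnorm E in hE E0 tE bE *; set w := enorm z in bE.
have w0 : 0 < w by rewrite enorm_gt0.
have wE : dot z z = w ^+ 2 by rewrite enorm_sqr.
have ew : 8 * n%:R * e * w <= 1.
  have sl : Num.sqrt (lmin p) * w <= 1.
    rewrite -ler_sqr ?nnegrE ?mulr_ge0 ?sqrtr_ge0 ?(ltW w0)// exprMn sqr_sqrtr ?(ltW l0)//.
    by rewrite expr1n -wE.
  move: hE; rewrite ler_pdivlMr ?mulr_gt0 ?ltr0n// => hE.
  by apply: le_trans sl; rewrite ler_pM2r// mulrC.
have lw : lmin p <= w ^- 2 by rewrite -[_^-1]mul1r ler_pdivlMr ?exprn_gt0// -wE.
have cE : c = 2 * w ^- 2 by rewrite /c wE.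
have c0 : 0 <= c by rewrite divr_ge0// ltW.
clearbody c.
have -> : c * c * - (A * (1 - 2 * a)) * dot z z = - (4 * A * (1 - 2 * a) * w ^- 2).
  by rewrite cE wE; field; rewrite gt_eqF.
have B1 : `|c * - (A * (1 - 2 * a)) * bil E z s| <= A * (1 - 2 * a) * (2 * w ^- 2 * (w * e)).
  have a2 : 0 <= 1 - 2 * a by clear -a8; lra.
  rewrite !normrM normrN normrM !(ger0_norm A0) (ger0_norm a2) (ger0_norm c0).
  rewrite -cE; have := ler_wpM2l (mulr_ge0 c0 (mulr_ge0 A0 a2)) bE.
  by move: (`|bil E z s|) => b'; clear; lra.
have V : w ^- 2 * (w * (8 * n%:R * e)) <= w ^- 2.
  by rewrite ler_piMr ?invr_ge0 ?exprn_ge0 ?(ltW w0)// mulrC.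
have V2 : n%:R * e ^+ 2 <= w ^- 2 / 64.
  rewrite ler_pdivlMr// -[_^-1]mul1r ler_pdivlMr ?exprn_gt0//.
  have P0 : 0 <= 8 * n%:R * e * w by rewrite !mulr_ge0// ltW.
  apply: (@le_trans _ _ ((8 * n%:R * e * w) ^+ 2)); last by rewrite expr_le1.
  have -> : (8 * n%:R * e * w) ^+ 2 = n%:R * (n%:R * e ^+ 2 * 64 * w ^+ 2) by ring.
  by rewrite ler_peMl// !mulr_ge0 ?exprn_ge0 ?(ltW w0).
have V3 : w ^- 2 * (w * (8 * e)) <= w ^- 2.
  apply: le_trans V; rewrite ler_wpM2l ?invr_ge0 ?exprn_ge0 ?(ltW w0)//.
  by rewrite ler_pM2l// -mulrA ler_pM2l// ler_peMl.
move: B1 tE V2 V3 lw; rewrite ler_norml => /andP[_].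
have : 0 <= w ^- 2 by rewrite invr_ge0 exprn_ge0 ?ltW.
move: (w ^- 2) (bil E z s) (\tr _) (c * _ * _) => W b T X W0 B1 tE V2 V3 lw.
have H1 : A * (n%:R * e ^+ 2) <= A * (W / 64) by rewrite ler_wpM2l.
have H2 : A * (1 - 2 * a) * (2 * W * (w * e)) <= A * (1 - 2 * a) * (W / 4).
  rewrite ler_wpM2l ?mulr_ge0//; first by clear -a8; lra.
  by clear -V3; lra.
have H3 : lmin p * A <= W * A by rewrite ler_wpM2r.
have H4 : A * W * a <= A * W * 8^-1 by rewrite ler_wpM2l// mulr_ge0.
have H5 : 0 <= A * W by rewrite mulr_ge0.
by clear -B1 tE H1 H2 H3 H4 H5; lra.
Qed.

Definition visc_ball p (f : R) x0 (r : R) (u : 'rV[R]_n -> R) := [/\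
  (forall z, enorm (z - x0) < r -> {for z, continuous u}),
  (forall z q X, enorm (z - x0) < r -> q != 0 -> ujet u z q X -> - f <= LA p q X) &
  (forall z q X, enorm (z - x0) < r -> q != 0 -> ljet u z q X -> LA p q X <= - f)].

Definition qpoly (a : R) q X x : R := a + dot q x + 2^-1 * quad X x.

Lemma qpoly_expand a q X x h : X^T = X ->
  qpoly a q X (x + h) = qpoly a q X x + dot (q + x *m X) h + 2^-1 * quad X h.
Proof.
move=> XT; rewrite /qpoly !dotL (_ : quad X (x + h) = quad X x + 2 * bil X x h + quad X h).
  by rewrite dot_mull; field.
by rewrite !quadbil !bilL -[bil X h x]bilT XT; ring.
Qed.

Lemma powR_succ (s a : R) : 0 < s -> s `^ a = s `^ (a - 1) * s.
Proof. by move=> s0; rewrite -{3}[s]powRr1 ?(ltW s0)// -powRD ?subrK// (gt_eqF s0) implybT. Qed.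

Lemma jet_pow (m a : R) z : z != 0 -> let T := dot z z `^ (a - 1) in
  let A := 2 * a * m * T in let s := (enorm z)^-1 *: z in
  jet (fun y => m * dot y y `^ a) z (A *: z) (A%:M - (A * (2 - 2 * a)) *: (s^T *m s)).
Proof.
move=> z0 T A s; have d0 : 0 < dot z z by rewrite dot_gt0.
have := @jet_norm_pow R n 0 z a z0; rewrite subr0 /= => J.
have {J} := jetZ m J; rewrite scalerA scalerDr.
have -> : m * (2 * a * dot z z `^ (a - 1)) = A by rewrite /A /T; ring.
have -> : m *: (2 * a * dot z z `^ (a - 1))%:M = A%:M :> 'M[R]_n.
  by rewrite scale_scalar_mx; congr (_%:M); rewrite /A /T; ring.
have -> : m *: ((4 * a * (a - 1) * dot z z `^ (a - 2)) *: (z^T *m z)) =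
   - ((A * (2 - 2 * a)) *: (s^T *m s)).
  rewrite /s trmxZ -scalemxAl -scalemxAr !scalerA -scaleNr; congr (_ *: _).
  rewrite /A /T (powR_succ (a - 1) d0) -enorm_sqr (_ : a - 1 - 1 = a - 2); last by ring.
  by field; rewrite enorm_eq0.
by apply: jet_ext => y; rewrite subr0.
Qed.

Lemma cont_pow (m a : R) z : 0 < a -> 0 <= m -> {for z, continuous (fun y : 'rV[R]_n => m * dot y y `^ a)}.
Proof.
move=> a0 m0; have [->|z0] := eqVneq z 0; last exact: jet_cont (jet_pow m a z0).
apply/cont_enorm => e e0; have m1 : 0 < m + 1 by rewrite ltr_wpDl.
have e1 : 0 < (e / (m + 1)) `^ a^-1 by rewrite powR_gt0// divr_gt0.
exists (Num.sqrt ((e / (m + 1)) `^ a^-1)); first by rewrite sqrtr_gt0.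
move=> y; rewrite subr0 ltr_sqrt// => yd.
have H : dot y y `^ a < e / (m + 1).
  have -> : e / (m + 1) = ((e / (m + 1)) `^ a^-1) `^ a.
    by rewrite -powRrM mulVf ?gt_eqF// powRr1// divr_ge0// ltW.
  by apply: gt0_ltr_powR; rewrite ?nnegrE ?dot_ge0// ltW.
rewrite dot0l powR0 ?gt_eqF// mulr0 subr0 ger0_norm ?mulr_ge0 ?powR_ge0//.
by move: H; rewrite ltr_pdivlMr//; have := powR_ge0 (dot y y) a; nra.
Qed.

(** The point is the factor [m] in the bound: the deviation of [u] from the quadratic polynomial,
    divided by its size [m], has a modulus of continuity that does not depend on [m]. This is the
    compactness behind [trap_step] and [Schauder_step]. The Lipschitz constant [C1] and a small
    exponent keep the gradient of the penalty small against [b0], so that the test gradients stay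
    near [b]. *)
Lemma Ishii_Lions p (b0 C1 : R) : 1 < p -> (0 < n)%N -> 0 < b0 -> b0 <= C1 ->
  exists a C t, [/\ 0 < a, a <= 8^-1, 0 < C & 0 < t /\
  forall u f m c b X, visc_ball p f 0 1 u -> b0 <= enorm b -> 0 < m -> m <= t ->
  mnorm X <= t -> mnorm X ^+ 2 <= m -> X^T = X ->
  (forall x, enorm x < 1 -> `|u x - qpoly c b X x| <= m) ->
  (forall x y, enorm x < 1 -> enorm y < 1 ->
    `|(u x - qpoly c b X x) - (u y - qpoly c b X y)| <= C1 * enorm (x - y)) ->
  forall x y, enorm x <= 2^-1 -> enorm y <= 2^-1 ->
    `|(u x - qpoly c b X x) - (u y - qpoly c b X y)| <= C * m * dot (x - y) (x - y) `^ a].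
Proof.
move=> p1 n0 b00 bC; have C10 : 0 < C1 by lra.
(* At distance [8^-1] the localization [K * m * dot v v] reaches [2 * m], the largest oscillation of
   the deviation; so the maximum point [x] stays within [8^-1] of [x1]. *)
pose k := Num.sqrt (p - 1); pose K : R := 128.
have l0 := lmin_gt0 p1; have np0 := np_gt0 p1 n0.
have n1 : 1 <= n%:R :> R by rewrite ler1n.
(* At the maximum the gradient of the penalty has norm at most [2 * a * C1]; this choice makes it at
   most [b0 / 16]. *)
pose a := Num.min 8^-1 (b0 / (32 * C1)).
have a0 : 0 < a by pos.
have a8 : a <= 8^-1 by rewrite ge_min lexx.
have aC : 32 * a * C1 <= b0.
  have : a <= b0 / (32 * C1) by rewrite ge_min lexx orbT.
  by rewrite ler_pdivlMr ?mulr_gt0//; lra.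
pose D := `|k - 1| + 1; have D0 : 0 < D by pos.
pose eta := Num.sqrt (lmin p) * b0 / (64 * n%:R ^+ 3 * D).
have nR : 0 < n%:R :> R by rewrite ltr0n.
have eta0 : 0 < eta by pos.
pose e1 := Num.min (eta / 2) (b0 / 8).
have e10 : 0 < e1 by pos.
have K0 : 0 < K by [].
pose t := Num.min (Num.min 1 e1) (e1 ^+ 2 / (4 * K * C1)).
have t0 : 0 < t by pos.
pose CB := `|p - 2| * (8 / b0) * (2 + 2 * K * C1) + 2 * K * (n%:R + p - 2).
have CB0 : 0 <= CB by pos.
pose s0 := (64^-1 : R) `^ a; have s00 : 0 < s0 by pos.
(* The first summand is the threshold at which the gain of the coupling matches the error [CB * m];
   the second provides strictness and makes the penalty exceed [2 * m] at distance [8^-1]. *)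
pose L := CB / (4 * a * lmin p) + 3 / s0.
have L1 : CB < 4 * a * lmin p * L.
  rewrite /L mulrDr mulrCA divff ?mulr1 ?gt_eqF ?mulr_gt0// ltrDl; pos.
have L2 : 2 < L * s0.
  rewrite /L mulrDl divfK ?gt_eqF//; apply: (@lt_le_trans _ _ 3); first by lra.
  by rewrite lerDr; pos.
have L0 : 0 < L by rewrite -(pmulr_lgt0 _ s00); lra.
exists a, L, t; split=> //; split=> // u f m c b X [cu su sv] bb m0 mt Xt Xm XT hm hL.
set w := fun x => u x - qpoly c b X x.
suff main x1 y1 : enorm x1 <= 2^-1 -> enorm y1 <= 2^-1 ->
    w x1 - w y1 <= L * m * dot (x1 - y1) (x1 - y1) `^ a.
  move=> x y hx hy; rewrite ler_norml main// andbT lerNl opprB.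
  by have := main _ _ hy hx; rewrite -(opprB x y) dotNl dotNr opprK.
move=> hx1 hy1; rewrite leNgt; apply/negP => pos1.
pose phi z := (L * m) * dot z z `^ a.
have Lm0 : 0 < L * m by rewrite mulr_gt0.
have wm x : enorm x < 1 -> `|w x| <= m by exact: hm.
have powL (z : 'rV[R]_n) : 8^-1 <= enorm z -> 2 * m < phi z.
  move=> z8; have : s0 <= dot z z `^ a.
    apply: ge0_ler_powR; rewrite ?nnegrE ?dot_ge0 ?(ltW a0)//.
    by move: z8; rewrite enorm_ge_sqr// (_ : 8^-1 ^+ 2 = 64^-1 :> R)//; field.
  by move=> H; rewrite /phi; have H1 := ler_wpM2l (ltW Lm0) H; have := ltr_pM2r m0 2 (L * s0); rewrite L2 => H2; clear -H1 H2; lra.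
have hK x : cball x1 4^-1 x -> enorm x < 1.
  by rewrite /cball /=; have := enorm_tri x x1 0; rewrite !subr0; clear -hx1; lra.
have x1K : cball x1 4^-1 x1 by rewrite /cball /= subrr enorm0.
have y1K : cball x1 4^-1 y1.
  rewrite /cball /= leNgt; apply/negP => far.
  have /powL : 8^-1 <= enorm (x1 - y1) by rewrite enormC; clear -far; lra.
  have /wm := hK _ x1K; have /wm : enorm y1 < 1 by clear -hy1; lra.
  move=> /ler_normlP[H1 H2] /ler_normlP[H3 H4]; rewrite /phi; clear -pos1 H1 H2 H3 H4; lra.
have cw : cont_on (cball x1 4^-1) w.
  apply: cont_onB; first by apply: cont_onW => z /hK zK; apply: cu; rewrite subr0.
  apply: cont_onW => z _; apply: (jet_cont (q := b + z *m X) (X := X)); apply/jetP => e e0.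
  exists 1 => // h _; rewrite qpoly_expand//.
  have -> (t1 t2 t3 : R) : t1 + t2 + t3 - t1 - t2 - t3 = 0 by clear; ring.
  by rewrite normr0 mulr_ge0 ?dot_ge0 ?(ltW e0).
have [||||x [y [Kx Ky max]]] := @doubling_max R n (cball x1 4^-1)
   (fun x => w x - K * m * dot (x - x1) (x - x1)) w phi (@compact_cball R n x1 4^-1); try by exists x1.
- by apply: cont_onB => //; apply: cont_onW => z _; exact: jet_cont (jetZ _ (jet_sqr x1 z)).
- exact: cw.
- by move=> z; apply: cont_pow => //; rewrite ltW.
have x1' := hK _ Kx; have y1' := hK _ Ky.
set v := x - x1 in max.
have pos : 0 < w x - K * m * dot v v - w y - phi (x - y).
  have := max _ _ x1K y1K; rewrite subrr dot0l mulr0 subr0; apply: lt_le_trans.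
  by move: pos1; rewrite /phi; clear; lra.
have phi0 z : 0 <= phi z by rewrite mulr_ge0 ?powR_ge0 ?ltW.
have Km0 : 0 < K * m by rewrite mulr_gt0.
have v0 := dot_ge0 v; have wx := wm _ x1'; have wy := wm _ y1'.
have v8 : enorm v < 8^-1.
  rewrite enorm_lt_sqr// -(ltr_pM2l Km0).
  move: wx wy => /ler_normlP[H1 H2] /ler_normlP[H3 H4].
  rewrite (_ : K * m * 8^-1 ^+ 2 = 2 * m); last by rewrite /K; clear; field.
  by move: (phi0 (x - y)) pos H1 H2 H3 H4; clear; lra.
have s8 : enorm (x - y) < 8^-1.
  rewrite ltNge; apply/negP => /powL.
  move: wx wy => /ler_normlP[H1 H2] /ler_normlP[H3 H4].
  by move: (mulr_ge0 (ltW Km0) v0) pos H1 H2 H3 H4; clear; lra.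
have z0 : x - y != 0.
  apply/eqP => E; move: pos; have -> : x = y by apply/eqP; rewrite -subr_eq0 E.
  by have := phi0 (y - y); have := mulr_ge0 (ltW Km0) v0; clear; lra.
have d0 : 0 < dot (x - y) (x - y) by rewrite dot_gt0.
have sg : 0 < enorm (x - y) by rewrite enorm_gt0.
have sE : dot (x - y) (x - y) = enorm (x - y) ^+ 2 by rewrite enorm_sqr.
have J := jet_pow (L * m) a z0; move: J => /=.
set T := dot (x - y) (x - y) `^ (a - 1); set A := 2 * a * (L * m) * T; set sg1 := _^-1 *: (x - y) => J.
have phiE : phi (x - y) = L * m * T * enorm (x - y) ^+ 2.
  by rewrite /phi (powR_succ a d0) -/T sE mulrA.
have T1 : 1 <= T.
  have : dot (x - y) (x - y) <= dot (x - y) (x - y) `^ a.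
    apply: ger1_powR; last by clear -a8; lra.
    by rewrite d0 sE expr_le1// ?(ltW sg)//; clear -s8; lra.
  by rewrite (powR_succ a d0) -/T ler_pMl.
have wC := hL _ _ x1' y1'; move: wC => /(le_trans (ler_norm _)) wC; rewrite -!/(w _) in wC.
have Ts : L * m * T * enorm (x - y) <= C1.
  rewrite -(ler_pM2r sg) -[_ * enorm _ * _]mulrA -[enorm _ * enorm _]expr2 -phiE; have := mulr_ge0 (ltW Km0) v0; clear -pos wC; lra.
have A0 : 0 <= A by rewrite !mulr_ge0 ?powR_ge0 ?(ltW a0) ?(ltW L0) ?(ltW m0).
have As : A * enorm (x - y) <= b0 / 16.
  rewrite (_ : A * _ = 2 * a * (L * m * T * enorm (x - y))); last by rewrite /A; clear; ring.
  apply: (@le_trans _ _ (2 * a * C1)); first by rewrite ler_wpM2l//; pos.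
  by clear -aC; lra.
pose tt := 2 * (K * m) * enorm v.
have tt0 : 0 <= tt by rewrite /tt mulr_ge0 ?enorm_ge0//; pos.
have ttm : tt ^+ 2 <= 4 * K * C1 * m.
  have -> : tt ^+ 2 = 4 * (K * m) * (K * m * dot v v) by rewrite /tt -enorm_sqr; ring.
  have H : K * m * dot v v <= C1 * 1.
    apply: (@le_trans _ _ (C1 * enorm (x - y))); first by have := phi0 (x - y); clear -pos wC; lra.
    by rewrite ler_wpM2l ?(ltW C10)//; clear -s8; lra.
  apply: (@le_trans _ _ (4 * (K * m) * (C1 * 1))); first by rewrite ler_wpM2l//; pos.
  by apply: eq_ler; ring.
have [t1 te t2] : [/\ t <= 1, t <= e1 & t <= e1 ^+ 2 / (4 * K * C1)].
  split; rewrite /t; [by rewrite 2!ge_min lexx|by rewrite 2!ge_min (lexx e1) !orbT|].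
  by rewrite ge_min lexx orbT.
have [ee eb] : e1 <= eta / 2 /\ e1 <= b0 / 8 by rewrite /e1 !ge_min !lexx orbT.
have tte : tt <= e1.
  rewrite -ler_sqr ?nnegrE ?(ltW e10)//; apply: le_trans ttm _.
  by rewrite mulrC -ler_pdivlMr ?mulr_gt0//; exact: le_trans mt t2.
pose q2 := b + y *m X + A *: (x - y); pose q1 := b + x *m X + A *: (x - y) + (2 * (K * m)) *: v.
have mX z : enorm z < 1 -> enorm (z *m X) <= t.
  move=> z1; apply: le_trans (mulmx_enorm_le _ _) _; apply: le_trans Xt.
  by rewrite ler_piMr ?mnorm_ge0 ?ltW.
have eA : enorm (A *: (x - y)) <= b0 / 16 by rewrite enormZ ger0_norm.
have ev : enorm ((2 * (K * m)) *: v) = tt by rewrite enormZ ger0_norm//; pos.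
have tri (z z' : 'rV[R]_n) : enorm z - enorm z' <= enorm (z + z').
  by have := ler_enormB (z + z') z'; rewrite addrK; clear; lra.
have q2n : b0 / 2 <= enorm q2.
  have := tri (b + y *m X) (A *: (x - y)); have := tri b (y *m X); have := mX _ y1'.
  by rewrite -/q2; clear -eA bb te eb b00; lra.
have q1n : b0 / 2 <= enorm q1.
  have := tri (b + x *m X + A *: (x - y)) ((2 * (K * m)) *: v).
  have := tri (b + x *m X) (A *: (x - y)); have := tri b (x *m X); have := mX _ x1'.
  by rewrite -/q1 ev; clear -eA bb te eb tte b00; lra.
have q20 : q2 != 0 by rewrite -enorm_gt0; clear -q2n b00; lra.
have q10 : q1 != 0 by rewrite -enorm_gt0; clear -q1n b00; lra.
have X0 := mnorm_ge0 X.
have dq : enorm (q1 - q2) <= mnorm X + tt.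
  have -> : q1 - q2 = (x - y) *m X + (2 * (K * m)) *: v.
    rewrite /q1 /q2 mulmxBl; move: (x *m X) (y *m X) (A *: _) (_ *: v) => *; vec.
  apply: le_trans (ler_enormD _ _) _; rewrite ev lerD2r.
  by apply: le_trans (mulmx_enorm_le _ _) _; rewrite ler_piMr//; clear -s8; lra.
have iq1 : (enorm q1)^-1 <= 2 / b0.
  rewrite -[leLHS]mul1r ler_pdivrMr ?enorm_gt0// mulrAC ler_pdivlMr// mul1r; clear -q1n; lra.
have iq0 : 0 <= (enorm q1)^-1 by rewrite invr_ge0 enorm_ge0.
have qe : enorm (q1 - q2) <= eta by clear -dq Xt te tte ee; lra.
have [||My [MyE Mtr]] := reflection_coupling p1 q10 q20 (_ : dot sg1 sg1 = 1) n0 A0 (ltW a0) a8.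
- by apply: dot1; exact: unit_enorm.
- apply: le_trans (rt_lip _ q10 q20) _.
  apply: (@le_trans _ _ (D * (4 * n%:R ^+ 2 * (2 / b0) * eta))).
    rewrite ler_pM ?mulr_ge0 ?enorm_ge0//; first by rewrite /D lerDl.
    by rewrite ler_pM ?mulr_ge0 ?enorm_ge0// ler_wpM2l// mulr_ge0// exprn_ge0.
  apply: eq_ler; rewrite /eta.
  by field; rewrite !gt_eqF.
have rr : (rt k q1)^T *m rt k q1 = rt (p - 1) q1.
  by rewrite rtT rt_mul// -expr2 sqr_sqrtr// subr_ge0 ltW.
have r4 : 0 < (4^-1 : R) by [].
have near (z x' : 'rV[R]_n) : enorm x' < 3 / 4 -> enorm (z - x') < 4^-1 -> enorm (z - 0) < 1.
  by move=> A1 A2; have := enorm_tri z x' 0; rewrite !subr0; clear -A1 A2; lra.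
have x34 : enorm x < 3 / 4 by have := enorm_tri x x1 0; rewrite !subr0 -/v; clear -hx1 v8; lra.
have yv : enorm (y - x1) < 4^-1 by have := enorm_tri y x x1; rewrite -/v (enormC y x); clear -v8 s8; lra.
have y34 : enorm y < 3 / 4 by have := enorm_tri y x1 0; rewrite !subr0; clear -yv hx1; lra.
have S := theorem_on_sums (u := u) (v := u) (x := x) (y := y) (Z := A%:M - (A * (2 - 2 * a)) *: (sg1^T *m sg1))
  (W1 := X + (2 * (K * m))%:M) (W2 := X) (f := - f) (g := - f)
  p1 n0 r4 (fun z zx => cu z (near z x x34 zx)) (fun z zx => cu z (near z y y34 zx))
  (fun z q Y zx => su z q Y (near z x x34 zx)) (fun z q Y zx => sv z q Y (near z y y34 zx))
  q10 q20 rr MyE.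
rewrite -/k in Mtr.
have LAb : LA p q1 (X + (2 * (K * m))%:M) - LA p q2 X <= CB * m.
  rewrite LAD LA1//; have := LA_lip p X q10 q20 => /(le_trans (ler_norm _)) H.
  have H2 : `|p - 2| * (4 * (enorm q1)^-1 * enorm (q1 - q2)) * mnorm X <=
     `|p - 2| * (8 / b0) * ((2 + 2 * K * C1) * m).
    apply: (@le_trans _ _ (`|p - 2| * (8 / b0) * ((mnorm X + tt) * mnorm X))).
      rewrite -!mulrA ler_wpM2l// !mulrA ler_wpM2r// ler_pM ?mulr_ge0 ?enorm_ge0//.
      by clear -iq1; lra.
    rewrite ler_wpM2l//; first by pos.
    by have := sqr_ge0 (mnorm X - tt); move: Xm ttm X0 tt0; clear; nra.
  by rewrite /CB mulrDl; clear -H H2; lra.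
have AT : CB * m < 2 * lmin p * A.
  apply: (@lt_le_trans _ _ (4 * a * lmin p * L * m)); first by rewrite ltr_pM2r.
  rewrite (_ : 2 * lmin p * A = 4 * a * lmin p * L * m * T); last by rewrite /A; ring.
  by rewrite ler_peMr// !mulr_ge0 ?(ltW a0) ?(ltW L0) ?(ltW m0) ?(ltW l0).
feed S; last by move: S; rewrite subrr; clear -Mtr LAb AT; lra.
move=> e e0; have [r2 r20 h2] := J.1 _ (divr_gt0 e0 (ltr0n R 2)).
exists (Num.min (r2 / 2) (8^-1 - enorm v)); first by rewrite lt_min subr_gt0 v8 divr_gt0.
move=> h h'; rewrite !lt_min => /andP[hr hv] /andP[kr kv].
have K1 : cball x1 4^-1 (x + h).
  rewrite /cball /= addrAC -/v; apply: le_trans (ler_enormD _ _) _; clear -hv v8; lra.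
have K2 : cball x1 4^-1 (y + h').
  rewrite /cball /= addrAC; apply: le_trans (ler_enormD _ _) _.
  by have := enorm_tri y x x1; rewrite -/v (enormC y x); clear -kv s8; lra.
have := max _ _ K1 K2; have -> : x + h - (y + h') = x - y + (h - h') by vec.
have /h2 : enorm (h - h') < r2 by apply: le_lt_trans (ler_enormB _ _) _; clear -hr kr; lra.
rewrite -!/(phi _) /w !qpoly_expand// (_ : x + h - x1 = v + h); last by rewrite addrAC.
have D2 : dot (h - h') (h - h') <= 2 * (dot h h + dot h' h').
  by have := dot_ge0 (h + h'); rewrite !dotL; clear; lra.
have := ler_wpM2l (ltW e0) D2; rewrite quadMD quadM1 /q1 /q2.
clearbody v; move: (dot (h - h') (h - h')) (quad (_ - _) (h - h')) (phi _) (phi _) => N1 N2 N3 N4.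
rewrite (dotDl v h) !(dotDr v h) (dotC h v) !(dotBr h h') !(dotDl _ _ h) !(dotDl _ _ h') !dotZl.
clear; lra.
Qed.

End Coupling.

(** * Barriers from powers of the distance, and scaling *)

Section PowerBarrier.
Context {R : realType} {n : nat}.
Implicit Types (x y z q s : 'rV[R]_n) (X E M : 'M[R]_n) (a p : R).

Definition pow_grad (N : R) z : 'rV[R]_n := (- (2 * N * dot z z `^ (- N - 1))) *: z.

(** The rank-one part of the Hessian grows like [N (N + 1)] and is bounded below through [lmin p],
    while the isotropic part grows like [N]; so a large exponent wins whatever nonzero [q] enters
    the operator. *)
Lemma jet_pow_neg (N : R) x z : z != x -> exists X,
  jet (fun y => dot (y - x) (y - x) `^ (- N)) z (pow_grad N (z - x)) X /\
  forall p q (L : R), 1 < p -> 0 <= N -> n%:R + p - 2 + L <= 2 * (N + 1) * lmin p -> q != 0 ->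
    L * (2 * N * dot (z - x) (z - x) `^ (- N - 1)) <= LA p q X.
Proof.
move=> zx; have := jet_norm_pow (- N) zx => /=; set s := dot (z - x) (z - x) => J.
have s0 : 0 < s by rewrite dot_gt0 subr_eq0.
eexists; split.
  by move: J; rewrite /pow_grad -/s mulrN mulNr; apply.
move=> p q L p1 N0 hN q0; rewrite LAD LA1// LAZ.
have T0 := powR_ge0 s (- N - 1).
have H := lmin_LA_out (z - x) p1 q0; rewrite -/s in H.
have E : s `^ (- N - 1) = s `^ (- N - 2) * s.
  by rewrite (powR_succ (- N - 1) s0) -addrA -opprD.
have -> : 4 * - N * (- N - 1) = 4 * N * (N + 1) by ring.
have T2 := powR_ge0 s (- N - 2).
have : 4 * N * (N + 1) * s `^ (- N - 2) * (lmin p * s) <=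
   4 * N * (N + 1) * s `^ (- N - 2) * LA p q ((z - x)^T *m (z - x)).
  by rewrite ler_wpM2l// !mulr_ge0// addr_ge0.
have -> : 4 * N * (N + 1) * s `^ (- N - 2) * (lmin p * s) =
   2 * N * s `^ (- N - 1) * (2 * (N + 1) * lmin p) by rewrite E; ring.
have := ler_wpM2l (mulr_ge0 (mulr_ge0 (ler0n R 2) N0) T0) hN.
by clear; lra.
Qed.

(** The rank-one part of the Hessian of the distance is nonpositive and is dropped; the isotropic
    part gives the bound, again for every [q]. *)
Lemma jet_enorm_LA x z : z != x -> exists X,
  jet (fun y => enorm (y - x)) z ((enorm (z - x))^-1 *: (z - x)) X /\
  forall p q, 1 < p -> q != 0 -> LA p q X <= (enorm (z - x))^-1 * (n%:R + p - 2).
Proof.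
move=> zx; have := jet_norm_pow 2^-1 zx => /=; set s := dot (z - x) (z - x) => J.
have s0 : 0 < s by rewrite dot_gt0 subr_eq0.
have E y : dot (y - x) (y - x) `^ 2^-1 = enorm (y - x) by rewrite powR12_sqrt ?dot_ge0.
have e1 : s `^ (2^-1 - 1) = (enorm (z - x))^-1.
  by rewrite (_ : 2^-1 - 1 = - 2^-1); [rewrite powRN E|field].
have {J} J := jet_ext E J; rewrite mulfV// mul1r in J; rewrite e1 in J.
eexists; split; first exact: J.
move=> p q p1 q0; rewrite LAD LA1// LAZ gerDl.
have l0 := lmin_gt0 p1; have H := lmin_LA_out (z - x) p1 q0.
have L0 : 0 <= LA p q ((z - x)^T *m (z - x)).
  by apply: le_trans H; rewrite mulr_ge0 ?dot_ge0 ?ltW.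
have -> (t l : R) : 4 / 2 * (2^-1 - 1) * t * l = - (t * l) by field.
by rewrite oppr_le0 mulr_ge0// powR_ge0.
Qed.

(** This scaling keeps gradients and multiplies Hessians and the right-hand side by [s]. *)
Lemma visc_scale p (f s r : R) x0 u : 0 < s -> visc_ball p f x0 (s * r) u ->
  visc_ball p (s * f) 0 r (fun z => s^-1 * u (x0 + s *: z)).
Proof.
move=> s0 [cu su sv].
have near z : enorm (z - 0) < r -> enorm (x0 + s *: z - x0) < s * r.
  by rewrite subr0 addrC addKr enormZ (gtr0_norm s0) ltr_pM2l.
have back : (fun y => s * (fun z => s^-1 * u (x0 + s *: z)) (- s^-1 *: x0 + y *m s^-1%:M)) = u.
  apply/funext => y; rewrite mulVKf ?gt_eqF//; congr (u _).
  by rewrite mul_mx_scalar scalerDr !scalerA mulrN divff ?gt_eqF// scaleN1r scale1r addNKr.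
have at_ z : - s^-1 *: x0 + (x0 + s *: z) *m s^-1%:M = z.
  rewrite mul_mx_scalar scalerDr scalerA mulVf ?gt_eqF// scale1r addrA -scalerDl addNr scale0r.
  by rewrite add0r.
have si : 0 < s^-1 by rewrite invr_gt0.
have conj X : s *: (s^-1%:M *m X *m (s^-1%:M)^T) = s^-1 *: X :> 'M[R]_n.
  by rewrite tr_scalar_mx mul_scalar_mx mul_mx_scalar !scalerA; congr (_ *: _); field; rewrite gt_eqF.
have conjq q : s *: (q *m (s^-1%:M)^T) = q :> 'rV[R]_n.
  by rewrite tr_scalar_mx mul_mx_scalar scalerA divff ?gt_eqF// scale1r.
split=> z.
- move=> /near /cu /cont_enorm H; apply/cont_enorm => e e0.
  have [d d0 hd] := H _ (mulr_gt0 s0 e0); exists (d / s); first by rewrite divr_gt0.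
  move=> y; rewrite ltr_pdivlMr// => yd; rewrite -mulrBr normrM (gtr0_norm si) -ltr_pdivlMl ?invr_gt0//.
  rewrite invrK; apply: hd.
  have -> : x0 + s *: y - (x0 + s *: z) = s *: (y - z) by vec.
  by rewrite enormZ (gtr0_norm s0) mulrC.
- move=> q X /near zr q0 J.
  have J1 := @ujet_affine _ _ _ (- s^-1 *: x0) s^-1%:M (x0 + s *: z) q X; rewrite at_ in J1.
  have := ujetZ s0 (J1 _ J); rewrite back conj conjq => /(su _ _ _ zr q0).
  by rewrite LAZ mulrC ler_pdivlMr// mulNr mulrC.
- move=> q X /near zr q0 J.
  have J2 := ujetN J.
  have J1 := @ujet_affine _ _ _ (- s^-1 *: x0) s^-1%:M (x0 + s *: z) (- q) (- X); rewrite at_ in J1.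
  have := ujetZ s0 (J1 _ J2); rewrite conj conjq scalerN.
  have -> : (fun y => s * (\- (fun z => s^-1 * u (x0 + s *: z))) (- s^-1 *: x0 + y *m s^-1%:M)) = \- u.
    by apply/funext => y /=; rewrite mulrN; congr (- _); exact: (congr1 (fun g => g y) back).
  move=> /ljetN; have -> : \- \- u = u by apply/funext => y /=; rewrite opprK.
  rewrite !opprK => /(sv _ _ _ zr q0).
  by rewrite LAZ mulrC ler_pdivrMr// mulNr mulrC.
Qed.

End PowerBarrier.

Lemma lerB_swap {R : realType} (a b c d : R) : a - b <= c - d -> a - c <= b - d.
Proof. by lra. Qed.

(** * Two-sided bounds by the distance to the boundary *)

Section Trap.
Context {R : realType} {n : nat} {p c r : R} {Om : set 'rV[R]_n} {u : 'rV[R]_n -> R}.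
Context {nu : 'rV[R]_n -> 'rV[R]_n} (H : serrin p c r Om u nu).
Implicit Types (x y z h k q : 'rV[R]_n).

Lemma sol_visc x s : (forall y, enorm (y - x) < s -> Om y) -> visc_ball p p x s u.
Proof.
move=> hO; split=> z; first by move=> /hO; exact: sol_cont H _.
  by move=> q X /hO Oz; exact: (ssub H Oz).
by move=> q X /hO Oz; exact: (ssup H Oz).
Qed.

Lemma nearest_choice : exists np : 'rV[R]_n -> 'rV[R]_n, forall x, Om x ->
  [/\ boundary Om (np x), np x != x & forall y, enorm (y - x) < enorm (np x - x) -> Om y].
Proof.
have /choice[np hnp] : forall x, exists z, Om x -> [/\ boundary Om z, z != x &
    forall y, enorm (y - x) < enorm (z - x) -> Om y].
  move=> x; have [Ox|nO] := pselect (Om x); last by exists 0.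
  by have [z [bz zx _ hz]] := nearest_boundary (sn0 H) (sopen H) (sbd H) Ox; exists z.
by exists np.
Qed.

Lemma boundary_out x : boundary Om x -> ~ Om x.
Proof. by move=> /(boundaryE _ (sopen H))[]. Qed.

Lemma ext_ball_le y z : boundary Om z -> closure Om y -> r <= enorm (y - (z - r *: nu z)).
Proof.
move=> bz cy; rewrite leNgt; apply/negP => lt.
have [_ _ hE] := sball H bz.
have e0 : 0 < r - enorm (y - (z - r *: nu z)) by rewrite subr_gt0.
have [w Ow wy] := (closure_enorm _ _).1 cy _ e0.
apply: (hE w) Ow; have := enorm_tri w y (z - r *: nu z); lra.
Qed.

Lemma sol_le_dist y w : closure Om y -> boundary Om w -> u y <= c * enorm (y - w).
Proof.
move=> cy bw; have := sol_lip H cy bw.1; rewrite (sdir H bw) subr0.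
exact: le_trans (ler_norm _).
Qed.

Lemma ball_dist_ext y s z : boundary Om z -> 0 < s -> (forall w, enorm (w - y) < s -> Om w) ->
  s + r <= enorm (y - (z - r *: nu z)).
Proof.
move=> bz s0 hs; have [_ _ hE] := sball H bz.
by apply: (disjoint_balls s0 (sr0 H)) => w /hs Ow /hE.
Qed.

Lemma sol_le_ext y z : boundary Om z -> closure Om y ->
  u y <= c * (enorm (y - (z - r *: nu z)) - r).
Proof.
move=> bz cy; have [Oy|by'] := closure_split (sopen H) cy; last first.
  by rewrite (sdir H by') mulr_ge0 ?subr_ge0 ?ext_ball_le ?ltW ?(sc0 H).
have [w [bw wy _ hw]] := nearest_boundary (sn0 H) (sopen H) (sbd H) Oy.
apply: le_trans (sol_le_dist cy bw) _; rewrite ler_wpM2l ?(ltW (sc0 H))// lerBrDr.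
by rewrite enormC; apply: ball_dist_ext => //; rewrite enorm_gt0 subr_eq0.
Qed.

(** If [u] lies [k] below the cone [c (|y - e| - r)] around the exterior centre [e] on a small
    sphere about [x], the barrier [phi] carries this deficit to [z]: it stays above [u] in the
    annulus, vanishes at [z], and has inner normal slope less than [c] there, against [sabove]. *)
Lemma trap_barrier x z (N k a : R) : Om x -> boundary Om z -> 0 < N ->
  n%:R + p - 1 <= 2 * (N + 1) * lmin p -> let d := enorm (z - x) in z != x ->
  (forall y, enorm (y - x) < d -> Om y) -> 0 < a -> a < 1 -> 0 < k ->
  (forall y, enorm (y - x) = a * d -> u y <= c * (enorm (y - (z - r *: nu z)) - r) - k) ->
  c * (n%:R + p - 2) / r + p < k * (2 * N) * (a ^+ 2) `^ N / d ^+ 2 ->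
  4 * N * k <= c * (a ^+ 2 * d) -> False.
Proof.
move=> Ox bz N0 hN d zx hb a0 a1 k0 h1 h2 h3.
have c0 := sc0 H; have r0 := sr0 H; have p1 := sp1 H; have n0 := sn0 H.
have d0 : 0 < d by rewrite enorm_gt0 subr_eq0.
set e := z - r *: nu z in h1 *.
pose D := d ^+ 2; pose r1 := (a * d) ^+ 2.
have D0 : 0 < D by rewrite exprn_gt0.
have r10 : 0 < r1 by rewrite exprn_gt0// mulr_gt0.
pose kk := k * r1 `^ N; have kk0 : 0 < kk by rewrite mulr_gt0// powR_gt0.
have powV (s : R) : 0 < s -> s `^ N * s `^ (- N) = 1.
  by move=> s0; rewrite -powRD ?subrr ?powRr0//; rewrite (gt_eqF s0) implybT.
pose phi y := c * (enorm (y - e) - r) - kk * (dot (y - x) (y - x) `^ (- N) - D `^ (- N)).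
have phiJ y : y != x -> y != e -> exists X,
    jet phi y (c *: ((enorm (y - e))^-1 *: (y - e)) + (- kk) *: pow_grad N (y - x)) X /\
    forall q, q != 0 -> LA p q X <= c * ((enorm (y - e))^-1 * (n%:R + p - 2))
      - kk * (2 * N * dot (y - x) (y - x) `^ (- N - 1)).
  move=> yx ye; have [X1 [J1 L1]] := jet_enorm_LA ye; have [X2 [J2 L2]] := jet_pow_neg N yx.
  exists (c *: X1 + (- kk) *: X2); split.
    have J3 := jetD (jetD (jetZ c J1) (jetZ (- kk) J2)) (jet_cst (- (c * r) + kk * D `^ (- N)) y).
    by move: J3; rewrite !addr0; apply: jet_ext => w; rewrite /phi; ring.
  move=> q q0; rewrite LAD !LAZ mulNr lerB ?ler_wpM2l ?(ltW c0) ?(ltW kk0) ?L1//.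
  by have := L2 p q 1; rewrite !mul1r; apply=> //; [rewrite ltW|move: hN; clear -H; lra].
have out y : closure Om y -> y != e.
  move=> cy; apply/eqP => ye; have := ext_ball_le bz cy; rewrite -/e ye subrr enorm0; lra.
have near y : d <= enorm (y - x) -> closure Om y -> u y <= phi y.
  move=> yd cy; apply: le_trans (sol_le_ext bz cy) _; rewrite -/e /phi -[leLHS]subr0 lerD2l lerN2.
  rewrite pmulr_rle0// subr_le0 !powRN lef_pV2 ?posrE ?powR_gt0//; last first.
    by rewrite -enorm_sqr exprn_gt0//; lra.
  apply: ge0_ler_powR; rewrite ?nnegrE ?(ltW N0) ?dot_ge0 ?(ltW D0)//.
  by rewrite -enorm_ge_sqr// ltW.
have cz : closure Om z := bz.1.
have xz : x = z + d *: nu z by apply: (tball_direction r0 (sball H bz) zx hb).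
have n1 : enorm (nu z) = 1 by have [] := sball H bz.
have ze : z - e = r *: nu z by rewrite /e opprB addrC subrK.
have ze1 : enorm (z - e) = r by rewrite ze enormZ n1 mulr1 gtr0_norm.
have inside y : enorm (y - x) < d -> closure Om y by move=> /hb; exact: subset_closure.
suff le y : closure Om y -> a * d <= enorm (y - x) -> u y <= phi y.
  have [X [[J _] _]] := phiJ z zx (out z cz).
  pose q := c *: ((enorm (z - e))^-1 *: (z - e)) + (- kk) *: pow_grad N (z - x).
  have S := sabove H (q := q) (X := X) bz.
  have zE : z - x = (- d) *: nu z by rewrite {1}xz opprD addrA subrr add0r scaleNr.
  have qn : dot q (nu z) = c - kk * (2 * N * D `^ (- N - 1) * d).
    have dd : dot (z - x) (z - x) = D by rewrite -enorm_sqr.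
    rewrite /q /pow_grad dd ze1 ze zE [_^-1 *: (_ *: _)]scalerA mulVf ?gt_eqF// scale1r dotDl !dotZl (dot1 n1).
    by ring.
  have P0 : 0 < kk * (2 * N * D `^ (- N - 1) * d) by rewrite !mulr_gt0// powR_gt0.
  feed S; last by move: S; rewrite qn; clear -H P0; lra.
  move=> e' /J[s s0 hs]; exists (Num.min s ((1 - a) * d)); first by rewrite lt_min s0 mulr_gt0// subr_gt0.
  move=> h; rewrite lt_min => /andP[/hs B hd] ch.
  have phz : phi z = 0.
    by rewrite /phi ze1 subrr mulr0 -enorm_sqr -/D subrr mulr0 subrr.
  rewrite (sdir H bz) -phz; apply: le_trans B; apply: le => //.
  have := enorm_tri z (z + h) x; rewrite opprD addrA subrr sub0r enormN -/d.
  by clear -H hd; lra.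
move=> cy ay; have [yd|yd] := leP d (enorm (y - x)); first exact: near.
rewrite -subr_le0 leNgt; apply/negP => pos.
pose A : set 'rV[R]_n := cball x d `&` [set w | a * d <= enorm (w - x)].
have cA : compact A.
  apply: (@compact_enorm _ _ _ (enorm x + d)).
    by move=> w [wd _]; rewrite /cball /= in wd; have := enorm_tri w x 0; rewrite !subr0; lra.
  apply: closedI2; first by apply: compact_closed; [exact: norm_hausdorff|exact: compact_cball].
  by apply: closed_le; [move=> w; exact: cst_continuous|exact: cont_enormB].
have AO w : A w -> closure Om w.
  move=> [/= wd _]; have [lt|ge] := ltP (enorm (w - x)) d; first exact: inside.
  apply/closure_enorm => s s0.
  have wE : enorm (w - x) = d by apply/eqP; rewrite eq_le wd.
  pose t := Num.min 1 (s / (2 * d)); have t0 : 0 < t by rewrite lt_min ltr01 divr_gt0// mulr_gt0.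
  exists (w - t *: (w - x)).
    apply: hb; have -> : w - t *: (w - x) - x = (1 - t) *: (w - x) by vec.
    rewrite enormZ wE ger0_norm; last by rewrite subr_ge0 ge_min lexx.
    by rewrite gtr_pMl// gtrBl.
  rewrite addrAC subrr add0r enormN enormZ wE gtr0_norm//.
  have : t <= s / (2 * d) by rewrite ge_min lexx orbT.
  by rewrite ler_pdivlMr ?mulr_gt0//; lra.
have Ax w : A w -> w != x.
  by move=> [_ /= aw]; apply/eqP => E; move: aw; rewrite E subrr enorm0; have := mulr_gt0 a0 d0; lra.
have [||w Aw max] := compact_max cA _ (f := fun w => u w - phi w).
- by exists y; split=> //=; rewrite /cball /= ltW.
- apply: cont_onB; first exact: cont_onS AO (scont H).
  apply: cont_onW => w Aw; have [X [J _]] := phiJ w (Ax w Aw) (out w (AO w Aw)).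
  exact: jet_cont J.
have posw : 0 < u w - phi w.
  by apply: lt_le_trans pos _; apply: max; split=> //=; rewrite /cball /= ltW.
have wx := Ax w Aw; have [wd1 wa1] := Aw; rewrite /cball /= in wd1 wa1.
have [wd|wd] := leP d (enorm (w - x)); first by move: posw; rewrite subr_gt0 ltNge (near w wd (AO w Aw)).
have DD0 : 0 < dot (w - x) (w - x) by rewrite dot_gt0 subr_eq0.
have r1w : r1 <= dot (w - x) (w - x) by rewrite -enorm_ge_sqr// mulr_ge0// ltW.
have wD : dot (w - x) (w - x) <= D by rewrite -enorm_le_sqr// ltW.
have [wa|wa] := eqVneq (enorm (w - x)) (a * d).
  have := h1 w wa; have : kk * (dot (w - x) (w - x) `^ (- N) - D `^ (- N)) <= k.
    rewrite -enorm_sqr wa -/r1 /kk -mulrA mulrBr powV//.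
    by rewrite ler_piMr ?(ltW k0)// gerBl mulr_ge0 ?powR_ge0.
  by move: posw; rewrite /phi; clear -H; lra.
have {}wa : a * d < enorm (w - x) by rewrite lt_neqAle eq_sym wa.
have Ow := hb w wd; have we := out w (AO w Aw).
have [X [[J _] LJ]] := phiJ w wx we.
move: J LJ; set q := _ + _ => J LJ.
(* The cone contributes a gradient of norm [c] and the power, by [h3], one of norm at most [c / 2];
   so the equation may be used at [w]. *)
have q0 : q != 0.
  rewrite -enorm_gt0 /q.
  have A1 : enorm (c *: ((enorm (w - e))^-1 *: (w - e))) = c.
    by rewrite enormZ unit_enorm ?subr_eq0// mulr1 gtr0_norm.
  have A2 : enorm (- kk *: pow_grad N (w - x)) <= c / 2.
    rewrite /pow_grad scalerA mulrNN enormZ ger0_norm; last by rewrite !mulr_ge0 ?powR_ge0// ltW.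
    have B1 : dot (w - x) (w - x) `^ (- N - 1) <= r1 `^ (- N - 1).
      rewrite -opprD !powRN lef_pV2 ?posrE ?powR_gt0//.
      by apply: ge0_ler_powR; rewrite ?nnegrE ?dot_ge0 ?(ltW r10)// addr_ge0// ltW.
    apply: (@le_trans _ _ (kk * (2 * N * r1 `^ (- N - 1)) * d)).
      rewrite ler_pM ?mulr_ge0 ?powR_ge0 ?enorm_ge0 ?(ltW k0) ?(ltW N0)//.
      by rewrite ler_wpM2l ?(ltW kk0)// ler_wpM2l// mulr_ge0// ltW.
    have -> : kk * (2 * N * r1 `^ (- N - 1)) * d = 2 * N * k * d / r1.
      rewrite /kk -opprD powRN powRD ?(gt_eqF r10) ?implybT// powRr1 ?(ltW r10)//.
      by field; rewrite !gt_eqF// powR_gt0.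
    rewrite ler_pdivrMr// /r1; move: (ler_wpM2r (ltW d0) h3); rewrite exprMn; clear -H; lra.
  have := ler_enormB (c *: ((enorm (w - e))^-1 *: (w - e)) + - kk *: pow_grad N (w - x)) (- kk *: pow_grad N (w - x)).
  by rewrite addrK A1; clear -H A2 c0; lra.
have [s1 s10 hs1] := open_enorm (sopen H) Ow.
have s20 : 0 < Num.min (d - enorm (w - x)) (enorm (w - x) - a * d) by rewrite lt_min !subr_gt0 wd.
have UJ : ujet u w q X.
  apply: (ujet_touch s20) J => h; rewrite lt_min => /andP[hd1 hd2].
  have Ah : A (w + h).
    have E : w + h - x = (w - x) + h by rewrite addrAC.
    split; rewrite /cball /= E.
      by apply: le_trans (ler_enormD _ _) _; clear -H hd1; lra.
    have := ler_enormB (w - x + h) h; rewrite addrK; clear -H hd2; lra.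
  by apply: lerB_swap; exact: max.
have := ssub H Ow q0 UJ; have := LJ q q0.
(* [h2] states that the negative contribution of the power outweighs the curvature term of the cone,
   largest at distance [r] from its vertex, plus [p]. *)
have E1 : (enorm (w - e))^-1 * (n%:R + p - 2) <= (n%:R + p - 2) / r.
  rewrite mulrC ler_wpM2l ?(ltW (np_gt0 p1 n0))// lef_pV2 ?posrE//; last by rewrite enorm_gt0 subr_eq0.
  by have := ext_ball_le bz (AO w Aw).
have E2 : k * (2 * N) * (a ^+ 2) `^ N / d ^+ 2 <= kk * (2 * N * dot (w - x) (w - x) `^ (- N - 1)).
  have B1 : D `^ (- N - 1) <= dot (w - x) (w - x) `^ (- N - 1).
    rewrite -opprD !powRN lef_pV2 ?posrE ?powR_gt0//.
    by apply: ge0_ler_powR; rewrite ?nnegrE ?dot_ge0 ?(ltW D0)// addr_ge0// ltW.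
  apply: (@le_trans _ _ (kk * (2 * N * D `^ (- N - 1)))); last first.
    by rewrite ler_wpM2l ?(ltW kk0)// ler_wpM2l// mulr_ge0// ltW.
  rewrite /kk /r1 exprMn -/D (@powRM _ (a ^+ 2) D) ?sqr_ge0 ?(ltW D0)//.
  rewrite -opprD powRN (powRD _ (s := 1)) ?(gt_eqF D0) ?implybT// powRr1 ?(ltW D0)//.
  apply: eq_ler.
  by field; rewrite !gt_eqF// powR_gt0.
by have := ler_wpM2l (ltW c0) E1; clear -H E2 h2; lra.
Qed.

Definition near_pair x z := [/\ Om x, boundary Om z, z != x &
  forall y, enorm (y - x) < enorm (z - x) -> Om y].

Lemma near_pair_dir x z : near_pair x z -> x = z + enorm (z - x) *: nu z.
Proof. by move=> [_ bz zx hb]; exact: (tball_direction (sr0 H) (sball H bz) zx hb). Qed.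

Lemma nu1 z : boundary Om z -> enorm (nu z) = 1.
Proof. by move=> /(sball H)[]. Qed.

Lemma near_pair_uniq x z w : near_pair x z -> near_pair x w -> enorm (z - x) = enorm (w - x).
Proof.
move=> [_ bz _ hz] [_ bw _ hw]; apply/eqP; rewrite eq_le !leNgt; apply/andP; split; apply/negP => lt.
  exact: (boundary_out bw (hz _ lt)).
exact: (boundary_out bz (hw _ lt)).
Qed.

Lemma near_pair_ext x z : near_pair x z -> enorm (x - (z - r *: nu z)) = enorm (z - x) + r.
Proof.
move=> xz; have [_ bz zx _] := xz; rewrite {1}(near_pair_dir xz).
have -> : z + enorm (z - x) *: nu z - (z - r *: nu z) = (enorm (z - x) + r) *: nu z by vec.
by rewrite enormZ nu1// mulr1 ger0_norm// addr_ge0 ?enorm_ge0// ltW// (sr0 H).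
Qed.

(** The inner tangent ball at [z] bounds the distance to the boundary from below and the exterior
    one from above; either sphere costs at most [|y - z|^2 / (2 r)] against the tangent plane. *)
Lemma dist_linear y w z : near_pair y w -> boundary Om z ->
  `|enorm (w - y) - dot (nu z) (y - z)| <= dot (y - z) (y - z) / (2 * r).
Proof.
move=> yw bz; have r0 := sr0 H; have n1 := nu1 bz.
have [Oy bw wy hw] := yw; have d0 : 0 < enorm (w - y) by rewrite enorm_gt0 subr_eq0.
have [_ hI _] := sball H bz.
set h := y - z; set t := dot (nu z) h; set b := dot h h / (2 * r).
have b0 : 0 <= b by rewrite divr_ge0 ?dot_ge0 ?mulr_ge0 ?(ltW r0).
have sq (e : R) : e ^+ 2 = 1 -> enorm (h + (e * r) *: nu z) <= r + e * t + b.
  move=> e2; have E : dot (h + (e * r) *: nu z) (h + (e * r) *: nu z) = dot h h + 2 * e * r * t + r ^+ 2.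
    rewrite (dotDl h) !(dotDr h) !dotZl !dotZr (dot1 n1) (dotC h) -/t.
    by rewrite (_ : e * r * (e * r * 1) = e ^+ 2 * r ^+ 2); [rewrite e2; ring|ring].
  have hb : dot h h = 2 * r * b by rewrite /b mulrC divfK// gt_eqF// mulr_gt0.
  have ge0 : 0 <= r + e * t + b.
    rewrite -(pmulr_rge0 _ r0); have := dot_ge0 (h + (e * r) *: nu z); rewrite E hb.
    by have := sqr_ge0 r; clear -H; nra.
  rewrite enorm_le_sqr// E hb -subr_ge0.
  rewrite (_ : _ - _ = (e * t + b) ^+ 2 + (1 - e ^+ 2) * (t ^+ 2) + (e ^+ 2 - 1) * t ^+ 2); first by rewrite e2 subrr !mul0r !addr0 sqr_ge0.
  by ring.
rewrite ler_norml; apply/andP; split.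
  rewrite lerNl opprB lerBlDr -lerBlDl.
  have [s0|s0] := leP (t - b) 0; first by apply: le_trans s0 (ltW d0).
  rewrite leNgt; apply/negP => lt; apply: (boundary_out bw); apply: hI.
  have B := sq (-1); rewrite sqrrN expr1n !mulN1r scaleNr in B; have {}B := B erefl.
  have -> : w - (z + r *: nu z) = (w - y) + (h - r *: nu z) by rewrite /h; vec.
  apply: le_lt_trans (ler_enormD _ _) _; clear -H B lt; lra.
have B := sq 1; rewrite expr1n !mul1r in B; have {}B := B erefl.
have := ball_dist_ext bz d0 hw.
have -> : y - (z - r *: nu z) = h + r *: nu z by rewrite /h; vec.
clear -H B; lra.
Qed.

(** By the Lipschitz bound, a deficit of [eta d] at [x] persists on a sphere whose radius is a small
    multiple of [d]. For small [d] this contradicts [trap_barrier], whose gain is of order [1 / d]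
    against a fixed constant. *)
Lemma gradient_limit (eta : R) : 0 < eta -> exists2 d0, 0 < d0 & forall x z, near_pair x z ->
  enorm (z - x) < d0 -> (c - eta) * enorm (z - x) <= u x.
Proof.
move=> e0; have c0 := sc0 H; have r0 := sr0 H; have p1 := sp1 H; have n0 := sn0 H.
have l0 := lmin_gt0 p1; have np := np_gt0 p1 n0.
pose N := (n%:R + p - 1) / (2 * lmin p).
have N0 : 0 < N by rewrite divr_gt0 ?mulr_gt0//; lra.
have hN : n%:R + p - 1 <= 2 * (N + 1) * lmin p.
  have -> : 2 * (N + 1) * lmin p = n%:R + p - 1 + 2 * lmin p by rewrite /N; field; rewrite gt_eqF.
  by rewrite lerDl mulr_ge0// ltW.
pose a := Num.min 2^-1 (eta / (4 * c)).
have a0 : 0 < a by rewrite lt_min invr_gt0 ltr0n divr_gt0 ?mulr_gt0.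
have a1 : a <= 2^-1 by rewrite ge_min lexx.
have ca : 4 * c * a <= eta.
  have : a <= eta / (4 * c) by rewrite ge_min lexx orbT.
  by rewrite ler_pdivlMr ?mulr_gt0// mulrC.
pose th := Num.min (eta / 2) (c * a ^+ 2 / (4 * N)).
have th0 : 0 < th by pos.
have t1 : th <= eta / 2 by rewrite ge_min lexx.
have t2 : 4 * N * th <= c * a ^+ 2.
  have : th <= c * a ^+ 2 / (4 * N) by rewrite ge_min lexx orbT.
  by rewrite ler_pdivlMr ?(mulr_gt0 (ltr0n R 4) N0)// => h; rewrite mulrC.
pose C0 := c * (n%:R + p - 2) / r + p.
have C00 : 0 < C0 by rewrite ltr_wpDl ?divr_ge0 ?mulr_ge0 ?(ltW c0) ?(ltW np) ?(ltW r0)//; lra.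
pose A := 2 * N * th * (a ^+ 2) `^ N.
have A0 : 0 < A by pos.
exists (A / C0); first by rewrite divr_gt0.
move=> x z xz; set d := enorm (z - x) => dA; rewrite leNgt; apply/negP => lt.
have [Ox bz zx hb] := xz; have d0 : 0 < d by rewrite enorm_gt0 subr_eq0.
apply: (trap_barrier (k := th * d) (a := a) Ox bz N0 hN zx hb a0 _ (mulr_gt0 th0 d0)).
- by lra.
- move=> y ya; have Oy : Om y by apply: hb; rewrite ya -/d gtr_pMl//; lra.
  have L := sol_lip H (subset_closure Oy) (subset_closure Ox).
  have {}L := le_trans (ler_norm _) L; rewrite ya -/d in L.
  have := enorm_tri x y (z - r *: nu z); rewrite (near_pair_ext xz) -/d (enormC x y) ya -/d => T.
  have := ler_wpM2l (ltW c0) T; have T1 := ler_wpM2r (ltW d0) ca; have T2 := ler_wpM2r (ltW d0) t1.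
  move: L lt T1 T2; clearbody a th d; clear -H; lra.
- rewrite -/d -/C0 (_ : th * d * (2 * N) * (a ^+ 2) `^ N / d ^+ 2 = A / d); last first.
    by rewrite /A; field; rewrite gt_eqF.
  by rewrite ltr_pdivlMr// mulrC -ltr_pdivlMr.
- by rewrite -/d; have := ler_wpM2r (ltW d0) t2; clear -H; lra.
Qed.

(** Scaled to unit size, [u] is within [10 g / d] of the affine function [L]. The Ishii-Lions
    modulus carries the deficit [g] at [x], halved, to a whole ball of radius [rho * d / 2], and
    [trap_barrier] applies. The factor [9 / 2] is [2 * (3 / 2)^2], as [trap] supplies it. *)
Lemma trap_step : exists K d0, [/\ 0 < K, 0 < d0 & forall x z, near_pair x z ->
  let d := enorm (z - x) in let g := c * d - u x in d < d0 -> K * d ^+ 2 < g ->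
  (forall y w, near_pair y w -> enorm (y - x) < d / 2 -> c * enorm (w - y) - u y <= 9 / 2 * g) -> False].
Proof.
have c0 := sc0 H; have r0 := sr0 H; have p1 := sp1 H; have n0 := sn0 H.
have l0 := lmin_gt0 p1; have np := np_gt0 p1 n0.
pose N := (n%:R + p - 1) / (2 * lmin p).
have N0 : 0 < N by rewrite divr_gt0 ?mulr_gt0//; lra.
have hN : n%:R + p - 1 <= 2 * (N + 1) * lmin p.
  have -> : 2 * (N + 1) * lmin p = n%:R + p - 1 + 2 * lmin p by rewrite /N; field; rewrite gt_eqF.
  by rewrite lerDl mulr_ge0// ltW.
have c2 : c <= 2 * c by lra.
have [al [C [t [al0 al8 C0 [t0 IL]]]]] := @Ishii_Lions R n p c (2 * c) p1 n0 c0 c2.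
pose rho := Num.min 2^-1 (Num.sqrt ((10 * C)^-1 `^ al^-1)).
have C10 : 0 < 10 * C by rewrite mulr_gt0.
have rho0 : 0 < rho by rewrite lt_min invr_gt0 ltr0n sqrtr_gt0 powR_gt0// invr_gt0.
have rho2 : rho <= 2^-1 by rewrite ge_min lexx.
have rhoP (y : 'rV[R]_n) : enorm y <= rho -> C * dot y y `^ al <= 10^-1.
  move=> yr; have : dot y y <= (10 * C)^-1 `^ al^-1.
    rewrite -[leRHS]sqr_sqrtr ?powR_ge0// -enorm_le_sqr ?sqrtr_ge0//.
    by apply: le_trans yr _; rewrite ge_min lexx orbT.
  move=> D; have : dot y y `^ al <= ((10 * C)^-1 `^ al^-1) `^ al.
    by apply: ge0_ler_powR; rewrite ?nnegrE ?dot_ge0 ?powR_ge0 ?(ltW al0).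
  rewrite -powRrM mulVf ?gt_eqF// powRr1 ?invr_ge0 ?(ltW C10)// => D2.
  have := ler_wpM2l (ltW C0) D2; rewrite invfM mulrCA divff ?gt_eqF// mulr1; exact.
pose a := rho / 2; have a0 : 0 < a by rewrite divr_gt0.
have a1 : a < 1 by rewrite /a; lra.
pose eta := Num.min (t / 10) (c * a ^+ 2 / (2 * N)).
have eta0 : 0 < eta by pos.
have [d0 d00 hd] := gradient_limit eta0.
pose C1 := c * (n%:R + p - 2) / r + p.
have C10' : 0 < C1 by rewrite ltr_wpDl ?divr_ge0 ?mulr_ge0 ?(ltW c0) ?(ltW np) ?(ltW r0)//; lra.
have P0 : 0 < N * (a ^+ 2) `^ N by rewrite mulr_gt0// powR_gt0// exprn_gt0.
exists (C1 / (N * (a ^+ 2) `^ N) + 4 * c / r), d0; split=> //.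
  by rewrite addr_gt0// divr_gt0// mulr_gt0.
move=> x z xz d g dd0 Kg hg.
have [Ox bz zx hb] := xz; have d1 : 0 < d by rewrite enorm_gt0 subr_eq0.
have dd1 : 0 < d ^+ 2 by rewrite exprn_gt0.
have g_eta : g <= eta * d by have := hd x z xz dd0; rewrite -/d /g; clear -H; lra.
have gK : C1 / (N * (a ^+ 2) `^ N) * d ^+ 2 < g.
  apply: le_lt_trans Kg; rewrite ler_wpM2r ?(ltW dd1)// lerDl.
  by rewrite divr_ge0 ?mulr_ge0 ?(ltW c0) ?(ltW r0).
have gr : 4 * c / r * d ^+ 2 < g.
  apply: le_lt_trans Kg; rewrite ler_wpM2r ?(ltW dd1)// lerDr.
  by rewrite divr_ge0 ?(ltW C10') ?(ltW P0).
have g0 : 0 < g by apply: le_lt_trans gr; rewrite mulr_ge0 ?(ltW dd1)// divr_ge0 ?mulr_ge0 ?(ltW c0) ?(ltW r0).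
have n1 := nu1 bz.
have xE := near_pair_dir xz; rewrite -/d in xE.
pose L y := c * dot (nu z) (y - z).
have LE h : L (x + h) = c * d + c * dot (nu z) h.
  have -> : L (x + h) = c * dot (nu z) (d *: nu z + h).
    by rewrite /L {1}xE; congr (c * dot _ _); vec.
  by rewrite dotDr dotZr (dot1 n1) mulr1 mulrDr.
have uL y : enorm (y - x) < d / 2 -> `|u y - L y| <= 5 * g.
  move=> yx; have Oy : Om y by apply: hb; rewrite -/d; lra.
  have [w [bw wy _ hw]] := nearest_boundary (sn0 H) (sopen H) (sbd H) Oy.
  have yw : near_pair y w by [].
  have D := dist_linear yw bz; have G := hg y w yw yx.
  have G0 : 0 <= c * enorm (w - y) - u y.
    by rewrite subr_ge0 enormC; apply: sol_le_dist => //; exact: subset_closure.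
  have hz : dot (y - z) (y - z) <= (3 / 2 * d) ^+ 2.
    rewrite -enorm_le_sqr; last by rewrite mulr_ge0// ltW.
    by have := enorm_tri y x z; rewrite (enormC x z) -/d; clear -H yx; lra.
  have D2 : dot (y - z) (y - z) / (2 * r) <= 2 / r * d ^+ 2.
    rewrite ler_pdivrMr ?mulr_gt0// (_ : 2 / r * d ^+ 2 * (2 * r) = 4 * d ^+ 2); last first.
      by field; rewrite gt_eqF.
    by apply: le_trans hz _; clear -H dd1; lra.
  have := ler_wpM2l (ltW c0) (le_trans D D2); rewrite -{1}(gtr0_norm c0) -normrM mulrBr -/(L y).
  have -> : c * (2 / r * d ^+ 2) = (4 * c / r * d ^+ 2) / 2 by field; rewrite gt_eqF.
  move: gr G G0; clearbody L g d; move: (4 * c / r * d ^+ 2) (c * enorm (w - y)) => e1 e2.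
  move=> I1 I2 I3 /ler_normlP[I4 I5]; apply/ler_normlP; move: I1 I2 I3 I4 I5; clear -H.
  by split; lra.
have dh : 0 < d / 2 by rewrite divr_gt0.
have V : visc_ball p (d / 2 * p) 0 1 (fun y => (d / 2)^-1 * u (x + (d / 2) *: y)).
  apply: visc_scale => //; rewrite mulr1; apply: sol_visc => y yx; apply: hb; rewrite -/d; lra.
have m0 : 0 < 10 * g / d by rewrite divr_gt0 ?mulr_gt0.
have mt : 10 * g / d <= t.
  have : eta <= t / 10 by rewrite ge_min lexx.
  rewrite ler_pdivlMr// => ?; rewrite ler_pdivrMr//; apply: le_trans (_ : 10 * (eta * d) <= _).
    by rewrite ler_pM2l.
  by rewrite mulrA ler_pM2r// mulrC.
have qE y : qpoly (2 * c) (c *: nu z) 0 y = (d / 2)^-1 * L (x + (d / 2) *: y).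
  by rewrite LE /qpoly quadM0 mulr0 addr0 dotZl dotZr; field; rewrite gt_eqF.
have mn0 : mnorm (0 : 'M[R]_n) = 0.
  by rewrite /mnorm big1// => i _; rewrite big1// => j _; rewrite mxE normr0.
have inb y : enorm y < 1 -> enorm (x + (d / 2) *: y - x) < d / 2.
  by move=> y1; rewrite addrC addKr enormZ (gtr0_norm dh) gtr_pMr.
have := IL _ _ _ (2 * c) (c *: nu z) 0 V _ m0 mt; rewrite mn0 expr0n/= trmx0.
rewrite enormZ n1 mulr1 gtr0_norm// => /(_ (lexx c) (ltW t0) (ltW m0) erefl) {}IL.
have {}IL y : enorm y <= rho -> u (x + (d / 2) *: y) <= L (x + (d / 2) *: y) - g / 2.
  move=> yr; have y2 : enorm y <= 2^-1 by exact: le_trans yr rho2.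
  have y0 : enorm (0 : 'rV[R]_n) <= 2^-1 by rewrite enorm0.
  have := IL _ _ y 0 y2 y0; rewrite scaler0 !qE !addr0 scaler0 subr0 addr0 => /(_ _ _) B.
  have {}B : `|(d / 2)^-1 * u (x + d / 2 *: y) - (d / 2)^-1 * L (x + d / 2 *: y) -
     ((d / 2)^-1 * u x - (d / 2)^-1 * L x)| <= C * (10 * g / d) * dot y y `^ al.
    apply: B.
      move=> w w1; rewrite qE -mulrBr normrM gtr0_norm ?invr_gt0// mulrC ler_pdivrMr//.
      by apply: le_trans (uL _ (inb w w1)) _; rewrite (_ : 10 * g / d * (d / 2) = 5 * g)//; field; rewrite gt_eqF.
    move=> w w' w1 w1'; rewrite !qE -!mulrBr normrM gtr0_norm ?invr_gt0// mulrC ler_pdivrMr//.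
    have O1 : closure Om (x + (d / 2) *: w) by apply/subset_closure/hb; have := inb w w1; rewrite -/d; lra.
    have O2 : closure Om (x + (d / 2) *: w') by apply/subset_closure/hb; have := inb w' w1'; rewrite -/d; lra.
    have := sol_lip H O1 O2.
    have -> : x + d / 2 *: w - (x + d / 2 *: w') = (d / 2) *: (w - w') by vec.
    rewrite enormZ (gtr0_norm dh) !LE.
    have := ler_dot (nu z) ((d / 2) *: (w - w')); rewrite n1 mul1r enormZ (gtr0_norm dh).
    rewrite !dotZr dotBr => B1; have := ler_wpM2l (ltW c0) B1; rewrite -{1}(gtr0_norm c0) -normrM.
    move: (u _) (u _) (dot _ w) (dot _ w') (enorm (w - w')) => e1 e2 e3 e4 e5.
    move=> /ler_normlP[I1 I2] /ler_normlP[I3 I4]; apply/ler_normlP.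
    by move: I1 I2 I3 I4; clear -H; split; lra.
  have Lx : L x = c * d by rewrite -[x]addr0 LE dot0r mulr0 addr0.
  have R1 : C * (10 * g / d) * dot y y `^ al <= g / d.
    rewrite mulrAC; apply: le_trans (ler_wpM2r (ltW m0) (rhoP y yr)) _.
    by apply: eq_ler; field; rewrite gt_eqF.
  have := le_trans (le_trans (ler_norm _) B) R1; rewrite Lx -!mulrBr -ler_pdivlMl ?invr_gt0// invrK.
  have -> : d / 2 * (g / d) = g / 2 by field; rewrite gt_eqF.
  by rewrite /g; clear -H; lra.
have k0 : 0 < g / 2 by rewrite divr_gt0.
apply: (trap_barrier (k := g / 2) (a := a) Ox bz N0 hN zx hb a0 a1 k0).
- move=> y ya; have yE : y = x + (d / 2) *: ((d / 2)^-1 *: (y - x)).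
    by rewrite scalerA divff ?gt_eqF// scale1r addrC subrK.
  have := IL ((d / 2)^-1 *: (y - x)); rewrite -yE enormZ gtr0_norm ?invr_gt0// ya -/d /a.
  have -> : (d / 2)^-1 * (rho / 2 * d) = rho by field; rewrite gt_eqF.
  move=> /(_ (lexx _))/le_trans; apply; rewrite lerD2r /L ler_wpM2l ?(ltW c0)//.
  rewrite lerBrDr; have := dot_le (nu z) (y - (z - r *: nu z)); rewrite n1 mul1r.
  have -> : y - (z - r *: nu z) = (y - z) + r *: nu z by vec.
  by rewrite dotDr dotZr (dot1 n1) mulr1.
- rewrite -/d -/C1 ltr_pdivlMr// (_ : g / 2 * (2 * N) * (a ^+ 2) `^ N = g * (N * (a ^+ 2) `^ N)); last by field.
  by rewrite -ltr_pdivrMr// mulrAC.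
- have : eta <= c * a ^+ 2 / (2 * N) by rewrite ge_min lexx orbT.
  rewrite ler_pdivlMr ?(mulr_gt0 (ltr0n R 2) N0)// => H2; rewrite -/d.
  have := ler_wpM2l (ltW N0) g_eta; have := ler_wpM2r (ltW d1) H2; clear -H; lra.
Qed.

(** The deficit [g] is measured against [d (d + e)], where [e > 0] keeps the quotient bounded before
    any bound by [d^2] is known. At a point where the quotient exceeds half its supremum, neighbours
    within [d / 2] have distance at most [3 d / 2], hence at most [9 / 2] of its deficit, as
    [trap_step] requires; then [e] tends to 0. *)
Lemma trap : exists K d0, [/\ 0 < K, 0 < d0 & forall x z, near_pair x z ->
  enorm (z - x) < d0 -> c * enorm (z - x) - K * enorm (z - x) ^+ 2 <= u x].
Proof.
have c0 := sc0 H; have [K1 [d0 [K10 d00 step]]] := trap_step.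
have [np hnp] := nearest_choice.
pose d x := enorm (np x - x); pose g x := c * d x - u x.
have npP x : Om x -> near_pair x (np x) by move=> Ox; have [] := hnp x Ox; split.
have dE x z : near_pair x z -> enorm (z - x) = d x.
  by move=> xz; have [Ox _ _ _] := xz; exact: near_pair_uniq xz (npP x Ox).
have dp x : Om x -> 0 < d x by move=> /hnp[_ ? _]; rewrite enorm_gt0 subr_eq0.
(* The second summand forces [d y < d0 / 2] at the selected point, so that its neighbours still
   belong to the set over which the supremum is taken. *)
pose K := K1 + 2 * c / d0; have K0 : 0 < K by rewrite addr_gt0// divr_gt0// mulr_gt0.
exists K, d0; split=> // x z xz; rewrite (dE _ _ xz) => xd; have [Ox _ _ _] := xz.
suff bound (e : R) : 0 < e -> g x <= K * (d x * (d x + e)).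
  have dx := dp x Ox; suff : g x <= K * (d x * d x) by rewrite /g expr2; clear -H; lra.
  apply/ler_addgt0Pr => e e0; have q0 : 0 < K * d x by rewrite mulr_gt0.
  have := bound _ (divr_gt0 e0 q0); have -> : K * (d x * (d x + e / (K * d x))) = K * (d x * d x) + e.
    by field; rewrite !gt_eqF.
  exact.
move=> e0; pose D y := d y * (d y + e).
have Dp y : Om y -> 0 < D y by move=> Oy; rewrite mulr_gt0 ?addr_gt0 ?dp.
pose T : set R := [set g y / D y | y in [set y | Om y /\ d y < d0]].
have gc y : Om y -> g y <= c * d y.
  by move=> Oy; rewrite gerBl; apply: (sol_ge0 H); exact: subset_closure.
have hT : has_sup T.
  split; first by exists (g x / D x), x.
  exists (c / e) => _ [y [Oy _] <-]; rewrite ler_pdivrMr ?Dp//; apply: le_trans (gc y Oy) _.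
  rewrite (_ : c / e * D y = c * d y + c / e * d y ^+ 2); last by rewrite /D; field; rewrite gt_eqF.
  by rewrite lerDl mulr_ge0 ?sqr_ge0// divr_ge0 ?(ltW c0) ?(ltW e0).
rewrite leNgt; apply/negP => lt; pose s := sup T.
have xs : g x / D x <= s by apply: ub_le_sup; [case: hT|exists x].
have Ks : K < s by apply: lt_le_trans xs; rewrite ltr_pdivlMr ?Dp.
have s0 : 0 < s by exact: lt_trans Ks.
have q0 : 0 < s - Num.max K (s / 2).
  by rewrite subr_gt0 gt_max Ks ltr_pdivrMr// mulr2n mulrDr mulr1 ltrDr.
have [_ [y [Oy yd] <-]] := sup_adherent q0 hT.
rewrite -/s opprB addrC subrK gt_max => /andP[].
rewrite !ltr_pdivlMr ?Dp// => Kg sg.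
have dy := dp y Oy; have Dy := Dp y Oy; have cd0 : 0 <= 2 * c / d0 by rewrite divr_ge0 ?mulr_ge0 ?ltW.
have dD : d y ^+ 2 <= D y by rewrite /D expr2 ler_pM2l// lerDl ltW.
have d2 : d y < d0 / 2.
  rewrite ltNge; apply/negP => ge; have H1 := le_trans (ltW Kg) (gc y Oy).
  have H2 : 2 * c / d0 * d y ^+ 2 <= c * d y.
    apply: le_trans H1; apply: (@le_trans _ _ (K * d y ^+ 2)).
      by rewrite ler_wpM2r ?sqr_ge0// /K lerDr ltW.
    by rewrite ler_wpM2l// ltW.
  have : K * D y < 2 * c / d0 * d y ^+ 2.
    apply: (lt_le_trans Kg); apply: le_trans (gc y Oy) _.
    rewrite expr2 mulrA ler_pM2r// mulrAC ler_pdivlMr//; move: ge c0; clear -H; nra.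
  rewrite ltNge => /negP; apply; apply: (@le_trans _ _ (K * d y ^+ 2)).
    by rewrite ler_wpM2r ?sqr_ge0// /K lerDr ltW.
  by rewrite ler_wpM2l// ltW.
apply: (step y (np y) (npP y Oy) yd).
  apply: le_lt_trans Kg; apply: (@le_trans _ _ (K * d y ^+ 2)).
    by rewrite ler_wpM2r ?sqr_ge0// /K lerDl.
  by rewrite ler_wpM2l// ltW.
move=> w v wv wy; rewrite -/(d y) in wy *; rewrite (dE _ _ wv) -/(g w) -/(g y).
have [Ow _ _ _] := wv; have dw := dp w Ow.
have dw2 : d w <= 3 / 2 * d y.
  have le1 : d w <= enorm (np y - w).
    have [_ _ hw] := hnp w Ow; have [by' _ _] := hnp y Oy.
    by rewrite leNgt; apply/negP => /hw; exact: boundary_out.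
  by apply: le_trans le1 _; have := enorm_tri (np y) y w; rewrite -/(d y) (enormC y w); clear -H wy; lra.
have ws : g w / D w <= s.
  by apply: ub_le_sup; [case: hT|exists w => //; split=> //; clear -H dw2 d2 dy; lra].
move: ws; rewrite ler_pdivrMr ?Dp// => /le_trans; apply.
have : s * D w <= s * (9 / 4 * D y).
  rewrite ler_pM2l// (_ : 9 / 4 * D y = (3 / 2 * d y) * (3 / 2 * d y + 3 / 2 * e)); last by rewrite /D; field.
  by rewrite ler_pM ?addr_ge0 ?(ltW dw) ?(ltW e0)// lerD//; clear -H e0; lra.
by clear -H sg; lra.
Qed.

End Trap.

(** * Interior derivative bounds for harmonic polynomials *)

Section HarmonicEstimates.
Context {R : realType} {n : nat}.
Implicit Types (x y z h q v : 'rV[R]_n) (X Y M : 'M[R]_n) (f : 'rV[R]_n -> R) (e : @pexp R n).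

Lemma jet_derive f y q X v : jet f y q X -> is_derive y v f (dot q v).
Proof.
move=> /jet_bound[C [r [C0 r0 hr]]]; have v1 : 0 < enorm v + 1 by rewrite ltr_wpDl ?enorm_ge0.
apply: (@is_derive_sq _ _ _ _ _ _ (C * dot v v) (r / (enorm v + 1))); first by rewrite divr_gt0.
move=> t; rewrite ltr_pdivlMr// => tr; have := hr (t *: v).
have -> : dot (t *: v) (t *: v) = dot v v * t ^+ 2 by rewrite dotZl dotZr; ring.
rewrite enormZ dotZr mulrA.
by apply; apply: le_lt_trans tr; rewrite ler_wpM2l// lerDl.
Qed.

Lemma jet_mvt f h (G : R) : (forall t : R, `|t| <= 1 -> exists q X, jet f (t *: h) q X /\
  `|dot q h| <= G) -> `|f h - f 0| <= G.
Proof.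
move=> H; have /choice[d hd] : forall t : R, exists d : R, `|t| <= 1 ->
    is_derive (0 + t *: h) h f d /\ `|d| <= G.
  move=> t; have [t1|t1] := leP `|t| 1; last by exists 0.
  have [q [X [J B]]] := H t t1; exists (dot q h) => _; rewrite add0r; split=> //.
  exact: jet_derive J.
have [|s s1] := @mvt_line R n f 0 h d 1.
  by move=> s; rewrite normr1 => /hd[].
by rewrite normr1 in s1; rewrite scale1r add0r mul1r => ->; have [] := hd s s1.
Qed.

(** Maximum principle: adding a tiny multiple of [dot z z] makes the trace of the Hessian strictly
    positive, which rules out an interior maximum. *)
Lemma harm_le0 (K : set 'rV[R]_n) f (s : R) : (0 < n)%N -> compact K -> cont_on K f ->
  (forall z, K z -> enorm z <= s) ->
  (forall z, K z -> f z <= 0 \/ exists2 r, 0 < r & (forall h, enorm h < r -> K (z + h)) /\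
     exists q X, jet f z q X /\ 0 <= \tr X) ->
  forall z, K z -> f z <= 0.
Proof.
move=> n0 cK cf Ks H z0 Kz0; rewrite leNgt; apply/negP => pos.
pose d := f z0 / (2 * (s ^+ 2 + 1)).
have s1 : 0 < 2 * (s ^+ 2 + 1) by rewrite mulr_gt0// ltr_wpDl// sqr_ge0.
have d0 : 0 < d by rewrite divr_gt0.
have [||z Kz max] := compact_max cK _ (f := fun z => f z + d * dot (z - 0) (z - 0)).
- by exists z0.
- by apply: cont_onD => //; apply: cont_onW => z _; exact: jet_cont (jetZ d (jet_sqr 0 z)).
have s0 : 0 <= s by apply: le_trans (Ks _ Kz0); exact: enorm_ge0.
have dz : d * dot z z < f z0.
  have : dot z z <= s ^+ 2 by rewrite -enorm_le_sqr ?Ks.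
  move=> D; apply: (@le_lt_trans _ _ (d * s ^+ 2)); first by rewrite ler_wpM2l// ltW.
  by rewrite /d mulrAC ltr_pdivrMr//; have := sqr_ge0 s; nra.
have := max _ Kz0; rewrite !subr0 => M.
have : 0 < f z by have := dot_ge0 z0; nra.
have [|[r r0 [rK [q [X [J tX]]]]]] := H z Kz; first by lra.
move=> _; have J2 := jetD J (jetZ d (jet_sqr 0 z)).
have [|_ Q] := jet_touch r0 _ (jet_cst 0 z).1 J2.2.
  by move=> h hr; rewrite !sub0r lerN2; exact: max (rK h hr).
have := @tr_psd _ _ 1%:M (- (X + d *: (2 *: 1%:M))); rewrite mul1mx trmx1 mulmx1.
rewrite -[- _]scaleN1r mxtraceZ mxtraceD !mxtraceZ mxtrace1 => /(_ _) T.
have {}T : 0 <= -1 * (\tr X + d * (2 * n%:R)).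
  by apply: T => h; rewrite quadMZ; have := Q h; rewrite quadM0; lra.
have : 0 < d * (2 * n%:R) by rewrite (mulr_gt0 d0)// mulr_gt0 ?ltr0n.
lra.
Qed.

Definition harmf f := forall z, exists q X, jet f z q X /\ \tr X = 0.

Lemma harmonic_harmf e : harmonic e -> harmf (pev e).
Proof. by move=> h z; exists (pgrad e z), (phess e z); split; [exact: pjet|rewrite -lapE]. Qed.

(** Brandt's method. Half the difference of [f] and its mirror image in the plane [z 0 i = 0]
    vanishes there and is compared in the half ball with [G * b]; [b] is harmonic, nonnegative on
    the plane and at least 1 on the half sphere, and its slope at the origin is [n / s]. *)
Lemma Brandt_half f i (s G : R) q X : (0 < n)%N -> 0 < s -> harmf f ->
  (forall z, enorm z <= s -> `|f z| <= G) -> jet f 0 q X -> q 0 i <= n%:R * G / s.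
Proof.
move=> n0 s0 hf hG J; pose e : 'rV[R]_n := delta_mx 0 i.
have e1 : dot e e = 1 by rewrite dot_delta mxE !eqxx.
have e0 : e != 0 by exact: delta_neq0.
have de z : dot z e = z 0 i by rewrite dot_delta.
have G0 : 0 <= G by apply: le_trans (hG 0 _); rewrite ?normr_ge0// enorm0 ltW.
pose M := rt (-1) e; have MT : M^T = M by exact: rtT.
have zM z : z *m M = z - (2 * z 0 i) *: e.
  by rewrite mulmx_rt e1 de divr1 -scaleNr; congr (_ + _ *: _); ring.
have MM : M *m M = 1%:M by rewrite rt_mul// mulrNN mulr1 rt1.
pose Y : 'M[R]_n := (s ^+ 2)^-1 *: (1%:M - n%:R *: (e^T *m e)).
have trY : \tr Y = 0.
  rewrite mxtraceZ linearB/= mxtraceZ mxtrace1 mxtrace_mulC.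
  by rewrite /mxtrace big_ord1 -/(dot e e) e1 mulr1 subrr mulr0.
pose b z := quad Y (z - 0) + dot ((n%:R / s) *: e) z.
have bE z : b z = (dot z z - n%:R * z 0 i ^+ 2) / s ^+ 2 + n%:R * z 0 i / s.
  rewrite /b subr0 /Y quadMZ quadMD quadM1 quadMN quadMZ quadbil bilout dotZl (dotC e) !de.
  by field; rewrite gt_eqF.
pose F z := 2^-1 * (f z - f (0 + z *m M)) - G * b z.
have hF z : exists q X, jet F z q X /\ \tr X = 0.
  have [q1 [X1 [J1 T1]]] := hf z; have [q2 [X2 [J2 T2]]] := hf (0 + z *m M).
  have J3 := jetN (jet_affine J2).
  have J4 := jetN (jetZ G (jetD (jet_quad Y 0 z) (jet_dot ((n%:R / s) *: e) z))).
  eexists; eexists; split; first exact: jetD (jetZ 2^-1 (jetD J1 J3)) J4.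
  have trN (A : 'M[R]_n) : \tr (- A) = - \tr A by rewrite linearN.
  have tM : \tr (M *m X2 *m M^T) = 0 by rewrite tr_rt// T2 sqrrN expr1n subrr mul0r addr0.
  move: trY tM; move: (Y) (M *m X2 *m M^T) => Y' X' tY tM.
  by rewrite mxtraceD mxtraceZ mxtraceD !trN tM T1 !mxtraceZ mxtraceD mxtraceZ tY mxtrace0 !(mulr0, addr0, oppr0).
pose K : set 'rV[R]_n := cball 0 s `&` [set z | dot 0 z <= dot e z].
have cK : compact K.
  apply: (@compact_enorm _ _ _ s); first by move=> z [+ _]; rewrite /cball /= subr0.
  apply: closedI2; first by apply: compact_closed; [exact: norm_hausdorff|exact: compact_cball].
  by apply: closed_le => z; apply: jet_cont; exact: jet_dot.
have KP z : K z <-> enorm z <= s /\ 0 <= z 0 i.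
  by rewrite /K /cball /setI /= subr0 dot0l dotC de.
have F0 z : K z -> F z <= 0.
  apply: (harm_le0 n0 cK _ (s := s)) z.
  - by apply: cont_onW => z _; have [q1 [X1 [J1 _]]] := hF z; exact: jet_cont J1.
  - by move=> z /KP[].
  move=> z Kz; have [zs zi] := (KP z).1 Kz.
  have [zs'|zs'] := leP s (enorm z); [left|].
    have zE : dot z z = s ^+ 2 by rewrite -enorm_sqr; congr (_ ^+ 2); apply/eqP; rewrite eq_le zs.
    have b1 : 1 <= b z.
      have zi1 : z 0 i <= s by apply: le_trans zs; apply: le_trans (coord_le_enorm z i); exact: ler_norm.
      rewrite bE zE mulrBl divff ?gt_eqF ?exprn_gt0// -addrA lerDl addrC.
      have -> : n%:R * z 0 i / s - n%:R * z 0 i ^+ 2 / s ^+ 2 = n%:R * z 0 i * (s - z 0 i) / s ^+ 2.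
        by field; rewrite gt_eqF.
      by rewrite divr_ge0 ?sqr_ge0// !mulr_ge0// subr_ge0.
    have zMs : enorm (0 + z *m M) <= s.
      rewrite add0r; apply: le_trans zs; rewrite enorm_le_sqr ?enorm_ge0// enorm_sqr zM.
      by rewrite !dotL (dotC e z) e1 de; lra.
    have := hG _ zs; have := hG _ zMs; have := ler_wpM2l G0 b1.
    by rewrite /F => ? /ler_normlP[? ?] /ler_normlP[? ?]; lra.
  have [zi'|zi'] := leP (z 0 i) 0; [left|right].
    have z00 : z 0 i = 0 by apply/eqP; rewrite eq_le zi zi'.
    rewrite /F zM z00 mulr0 scale0r subr0 add0r subrr mulr0 sub0r oppr_le0 mulr_ge0// bE z00.
    have -> (a : R) : (a - n%:R * 0 ^+ 2) / s ^+ 2 + n%:R * 0 / s = a / s ^+ 2 by ring.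
    by rewrite divr_ge0 ?dot_ge0 ?sqr_ge0.
  exists (Num.min (s - enorm z) (z 0 i)); first by rewrite lt_min subr_gt0 zs'.
  split; last by have [q1 [X1 [J1 T1]]] := hF z; exists q1, X1; rewrite T1.
  move=> h; rewrite lt_min => /andP[h1 h2]; apply/KP; split.
    by apply: le_trans (ler_enormD _ _) _; lra.
  rewrite mxE; have := coord_le_enorm h i; rewrite ler_norml => /andP[? _]; lra.
rewrite leNgt; apply/negP => lt; pose d := q 0 i - n%:R * G / s.
have d0 : 0 < d by rewrite subr_gt0.
have [C [r [C0 r0 hr]]] := jet_bound J.
pose t := Num.min (Num.min s (r / 2)) (d / (2 * (C + 1))).
have C1 : 0 < 2 * (C + 1) by rewrite mulr_gt0// ltr_wpDl.
have t0 : 0 < t by rewrite !lt_min s0 !divr_gt0.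
have [ts tr td] : [/\ t <= s, t <= r / 2 & t * (2 * (C + 1)) <= d].
  by rewrite -ler_pdivlMr//; split; rewrite /t !ge_min lexx ?orbT.
have te (a : R) : enorm (a *: e) = `|a| by rewrite enormZ /enorm e1 sqrtr1 mulr1.
have tei (a : R) : (a *: e) 0 i = a by rewrite !mxE !eqxx mulr1.
have Kt : K (t *: e) by apply/KP; rewrite te tei gtr0_norm//; split=> //; exact: ltW.
have := F0 _ Kt; rewrite /F bE zM tei add0r.
have -> : t *: e - (2 * t) *: e = (- t) *: e by rewrite -scalerBl; congr (_ *: _); ring.
have H1 := hr (t *: e); have H2 := hr (- t *: e).
rewrite !add0r !te !dotZl !dotZr e1 normrN (gtr0_norm t0) !de in H1 H2.
have {H1} := H1 _; have {H2} := H2 _.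
have tr' : t < r by lra.
move=> /(_ tr') /ler_normlP[A1 A2] /(_ tr') /ler_normlP[A3 A4].
rewrite dotZl dotZr e1 mulr1 => A5.
have n1 : 1 <= n%:R :> R by rewrite ler1n.
have A6 : G * ((t * t - n%:R * t ^+ 2) / s ^+ 2 + n%:R * t / s) <= t * (n%:R * G / s).
  rewrite (_ : t * (n%:R * G / s) = G * (n%:R * t / s)); last by ring.
  rewrite ler_wpM2l// gerDr mulr_le0_ge0 ?invr_ge0 ?sqr_ge0//.
  by have := sqr_ge0 t; nra.
have A7 : C * t * t < d * t.
  by rewrite ltr_pM2r//; have := mulr_ge0 C0 (ltW t0); lra.
by move: A1 A2 A3 A4 A5 A6 A7; rewrite /d; lra.
Qed.

Lemma harmf_aff f x : harmf f -> harmf (fun z => f (x + z *m 1%:M)).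
Proof.
move=> hf z; have [q [X [J T]]] := hf (x + z *m 1%:M).
by do 2 eexists; split; [exact: jet_affine J|rewrite mul1mx trmx1 mulmx1].
Qed.

Lemma harmfN f : harmf f -> harmf (fun z => - f z).
Proof.
move=> hf z; have [q [X [J T]]] := hf z.
by do 2 eexists; split; [exact: jetN J|rewrite -scaleN1r mxtraceZ T mulr0].
Qed.

Lemma Brandt f i (s G : R) x q X : (0 < n)%N -> 0 < s -> harmf f ->
  (forall z, enorm (z - x) <= s -> `|f z| <= G) -> jet f x q X -> `|q 0 i| <= n%:R * G / s.
Proof.
move=> n0 s0 hf hG J; pose F z := f (x + z *m 1%:M).
have hF : harmf F by exact: harmf_aff.
have FG z : enorm z <= s -> `|F z| <= G.
  by move=> zs; apply: hG; rewrite mulmx1 addrC addKr.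
have J0 : jet F 0 q (1%:M *m X *m (1%:M)^T).
  rewrite -[q](mulmx1) -[X in _ *m X]trmx1; apply: jet_affine.
  by rewrite mul0mx addr0.
rewrite ler_norml; apply/andP; split; last exact: (Brandt_half i n0 s0 hF FG J0).
rewrite lerNl; have := Brandt_half i n0 s0 (harmfN hF) _ (jetN J0); rewrite mxE; apply.
by move=> z zs; rewrite normrN FG.
Qed.

Lemma harmonic_pder e i : harmonic e -> harmonic (pder i e).
Proof.
move=> he x; rewrite lap_pder; have H : pev (lape e) =1 pev (PC 0) by move=> y; rewrite he.
by rewrite (pder_ext i H).
Qed.

Lemma harmonic_pder_le e i (s G : R) : (0 < n)%N -> 0 < s -> harmonic e ->
  (forall z, enorm z <= s -> `|pev e z| <= G) ->
  forall z, enorm z <= s / 2 -> `|pev (pder i e) z| <= 2 * n%:R / s * G.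
Proof.
move=> n0 s0 he hG z zs; have s2 : 0 < s / 2 by rewrite divr_gt0.
have := Brandt i n0 s2 (harmonic_harmf he) _ (pjet e z); rewrite mxE => /(_ G) H.
apply: le_trans (H _) _.
  by move=> w wz; apply: hG; have := enorm_tri w z 0; rewrite !subr0; lra.
by apply: eq_ler; field; rewrite gt_eqF.
Qed.

Lemma enorm_le_coord q (G : R) : (0 < n)%N -> (forall i, `|q 0 i| <= G) -> enorm q <= n%:R * G.
Proof.
move=> n0 H; have G0 : 0 <= G by apply: le_trans (H (Ordinal n0)).
rewrite enorm_le_sqr ?mulr_ge0// dotE; apply: (@le_trans _ _ (\sum_(i < n) G ^+ 2)).
  by apply: ler_sum => i _; rewrite -expr2 -real_normK ?num_real// ler_sqr ?nnegrE.
rewrite sumr_const card_ord -[leLHS]mulr_natl exprMn; apply: ler_wpM2r; first exact: sqr_ge0.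
by rewrite expr2 ler_peMl// ler1n.
Qed.

Lemma mnorm_le_coord X (G : R) : (forall i j, `|X i j| <= G) -> mnorm X <= n%:R ^+ 2 * G.
Proof.
move=> H; apply: (@le_trans _ _ (\sum_(i < n) \sum_(j < n) G)).
  by apply: ler_sum => i _; apply: ler_sum.
by rewrite !sumr_const !card_ord -mulrnA -natrX mulr_natl mulnn.
Qed.

(** Three successive derivatives, on balls of radius [s], [s / 2] and [s / 4], cost [2 n / s],
    [4 n / s] and [8 n / s]; the remaining [n^3] comes from passing three times from coordinates to
    the norm. *)
Lemma harmonic_taylor e (s G : R) : (0 < n)%N -> 0 < s -> harmonic e ->
  (forall z, enorm z <= s -> `|pev e z| <= G) ->
  [/\ `|pev e 0| <= G, enorm (pgrad e 0) <= n%:R * (2 * n%:R / s * G),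
    mnorm (phess e 0) <= n%:R ^+ 2 * (4 * n%:R / s * (2 * n%:R / s * G)) &
    forall z, enorm z <= s / 8 -> `|pev e z - qpoly (pev e 0) (pgrad e 0) (phess e 0) z| <=
      64 * n%:R ^+ 6 / s ^+ 3 * G * enorm z ^+ 3].
Proof.
move=> n0 s0 he hG.
have h1 i := harmonic_pder_le i n0 s0 he hG.
have s2 : 0 < s / 2 by rewrite divr_gt0.
have s4 : 0 < s / 2 / 2 by rewrite !divr_gt0.
have h2 i j := harmonic_pder_le j n0 s2 (harmonic_pder i he) (h1 i).
have h3 i j k := harmonic_pder_le k n0 s4 (harmonic_pder j (harmonic_pder i he)) (h2 i j).
have e4 : 2 * n%:R / (s / 2) = 4 * n%:R / s by field; rewrite gt_eqF.
have e8 : 2 * n%:R / (s / 2 / 2) = 8 * n%:R / s by field; rewrite gt_eqF.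
set G3 := 8 * n%:R / s * (4 * n%:R / s * (2 * n%:R / s * G)).
have z00 (a : R) : 0 <= a -> enorm (0 : 'rV[R]_n) <= a by rewrite enorm0.
split.
- by apply: hG; apply: z00; exact: ltW.
- by apply: (enorm_le_coord n0) => i; rewrite mxE; apply: h1; apply: z00; exact: ltW.
- apply: mnorm_le_coord => i j; rewrite mxE -e4; apply: h2; apply: z00; exact: ltW.
move=> z zs.
have zt (t : R) (w : 'rV[R]_n) : `|t| <= 1 -> enorm w <= enorm z -> enorm (t *: w) <= s / 2 / 2 / 2.
  move=> t1 wz; rewrite enormZ; have := enorm_ge0 w; nra.
have sc (t : R) (w : 'rV[R]_n) : `|t| <= 1 -> enorm (t *: w) <= enorm w.
  by move=> t1; rewrite enormZ ler_piMl ?enorm_ge0.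
have k2 i j w : enorm w <= enorm z -> `|pev (pder j (pder i e)) w - pev (pder j (pder i e)) 0| <=
    n%:R * G3 * enorm z.
  move=> wz; apply: jet_mvt => t t1; do 2 eexists; split; first exact: pjet.
  apply: le_trans (ler_dot _ _) _; rewrite ler_pM ?enorm_ge0//.
  apply: (enorm_le_coord n0) => k; rewrite mxE /G3 -e8 -e4; apply: h3; exact: zt.
have k1 i w : enorm w <= enorm z -> `|pev (pder i e) w - pev (pder i e) 0 -
    dot (pgrad (pder i e) 0) w| <= n%:R * (n%:R * G3 * enorm z) * enorm z.
  move=> wz; pose F y := pev (pder i e) y + dot (- pgrad (pder i e) 0) y.
  have := @jet_mvt F w (n%:R * (n%:R * G3 * enorm z) * enorm z) _.
  rewrite /F dot0r addr0 dotNl addrAC; apply=> t t1.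
  do 2 eexists; split; first exact: jetD (pjet _ _) (jet_dot _ _).
  apply: le_trans (ler_dot _ _) _; rewrite ler_pM ?enorm_ge0//.
  by apply: (enorm_le_coord n0) => k; rewrite !mxE; apply: k2; exact: le_trans (sc _ _ t1) wz.
pose F y := pev e y + (dot (- pgrad e 0) y + (- 2^-1) * quad (phess e 0) (y - 0)).
have -> : pev e z - qpoly (pev e 0) (pgrad e 0) (phess e 0) z = F z - F 0.
  by rewrite /F /qpoly !subr0 dot0r quad0 dotNl; ring.
have -> : 64 * n%:R ^+ 6 / s ^+ 3 * G * enorm z ^+ 3 =
    n%:R * (n%:R * (n%:R * G3 * enorm z) * enorm z) * enorm z by rewrite /G3; field; rewrite gt_eqF.
apply: jet_mvt => t t1; do 2 eexists; split.
  exact: jetD (pjet _ _) (jetD (jet_dot _ _) (jetZ _ (jet_quad _ 0 _))).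
apply: le_trans (ler_dot _ _) _; rewrite ler_pM ?enorm_ge0//.
apply: (enorm_le_coord n0) => k.
have := k1 k _ (sc t z t1); set w := t *: z; rewrite subr0.
have : (w *m (phess e 0 + (phess e 0)^T)) 0 k = 2 * dot (pgrad (pder k e) 0) w.
  rewrite mulmxDr mxE [X in _ + X]mxE [X in X + _]mxE -big_split/= dotE mulr_sumr.
  by apply: eq_bigr => j _; rewrite !mxE (pder_comm e j k); ring.
move: (w *m _) => V E; rewrite !mxE E; set a := dot _ w.
by have -> : - 2^-1 * (2 * a) = - a; [field|rewrite addrA].
Qed.

End HarmonicEstimates.

(** * One step of the regularity iteration *)

Section SchauderStep.
Context {R : realType} {n : nat}.
Implicit Types (x y z h q v b : 'rV[R]_n) (X Y M N : 'M[R]_n) (f g u : 'rV[R]_n -> R) (e : @pexp R n).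

Lemma mnormM X Y : mnorm (X *m Y) <= mnorm X * mnorm Y.
Proof.
rewrite /mnorm mulr_suml; apply: ler_sum => i _; rewrite mulr_suml.
apply: (@le_trans _ _ (\sum_j \sum_k `|X i k| * `|Y k j|)).
  by apply: ler_sum => j _; rewrite mxE; apply: le_trans (ler_norm_sum _ _ _) _; apply: ler_sum => k _; rewrite normrM.
rewrite exchange_big/=; apply: ler_sum => k _; rewrite -mulr_sumr ler_wpM2l//.
rewrite [leRHS](bigD1 k)//= lerDl; apply: sumr_ge0 => l _; exact: sumr_ge0.
Qed.

Lemma mnorm0 : mnorm (0 : 'M[R]_n) = 0.
Proof. by rewrite /mnorm big1// => i _; rewrite big1// => j _; rewrite mxE normr0. Qed.

Lemma mnorm_scalar (a : R) : mnorm (a%:M : 'M[R]_n) = n%:R * `|a|.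
Proof.
rewrite /mnorm -[n in RHS]card_ord mulr_natl -sumr_const; apply: eq_bigr => i _.
rewrite (bigD1 i)//= mxE eqxx mulr1n big1 ?addr0// => j ji.
by rewrite mxE eq_sym (negPf ji) mulr0n normr0.
Qed.

Lemma mnorm_rt (a : R) q : q != 0 -> mnorm (rt a q) <= n%:R + `|a - 1| * n%:R ^+ 2.
Proof.
move=> q0; rewrite /rt; apply: le_trans (mnormD _ _) _.
rewrite mnorm_scalar normr1 mulr1 lerD2l mnormZ normrM -mulrA ler_wpM2l//.
apply: (@le_trans _ _ (`|(dot q q)^-1| * (n%:R ^+ 2 * (enorm q * enorm q)))).
  by rewrite ler_wpM2l// mnorm_out.
rewrite -expr2 enorm_sqr ger0_norm ?invr_ge0 ?dot_ge0// mulrCA mulVf ?mulr1//.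
by rewrite gt_eqF// dot_gt0.
Qed.

Lemma pev_bound e (s : R) : 0 <= s -> exists2 B, 0 <= B & forall z, enorm z <= s -> `|pev e z| <= B.
Proof.
move=> s0; elim: e => [a|i|a [A A0 hA] b [B B0 hB]|a [A A0 hA] b [B B0 hB]] /=.
- by exists `|a|.
- by exists s => // z zs; apply: le_trans zs; exact: coord_le_enorm.
- exists (A + B); first exact: addr_ge0.
  by move=> z zs; apply: le_trans (ler_normD _ _) _; rewrite lerD ?hA ?hB.
- exists (A * B); first exact: mulr_ge0.
  by move=> z zs; rewrite normrM ler_pM ?hA ?hB.
Qed.

Lemma pgrad_bound e (s : R) : (0 < n)%N -> 0 <= s -> exists2 B, 0 <= B & forall z, enorm z <= s ->
  enorm (pgrad e z) <= B /\ mnorm (phess e z) <= B.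
Proof.
move=> n0 s0; have /choice[B1 hB1] : forall i, exists B, 0 <= B /\ forall z, enorm z <= s -> `|pev (pder i e) z| <= B.
  by move=> i; have [B B0 hB] := pev_bound (pder i e) s0; exists B.
have /choice[B2 hB2] : forall ij : 'I_n * 'I_n, exists B, 0 <= B /\ forall z, enorm z <= s ->
    `|pev (pder ij.1 (pder ij.2 e)) z| <= B.
  by move=> ij; have [B B0 hB] := pev_bound (pder ij.1 (pder ij.2 e)) s0; exists B.
pose G1 := \sum_i B1 i; pose G2 := \sum_ij B2 ij.
have G10 : 0 <= G1 by apply: sumr_ge0 => i _; have [] := hB1 i.
have G20 : 0 <= G2 by apply: sumr_ge0 => i _; have [] := hB2 i.
exists (n%:R * G1 + n%:R ^+ 2 * G2); first by rewrite addr_ge0 ?mulr_ge0 ?exprn_ge0.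
move=> z zs; split.
  apply: (@le_trans _ _ (n%:R * G1)); last by rewrite lerDl mulr_ge0// exprn_ge0.
  apply: (enorm_le_coord n0) => i; rewrite mxE; apply: le_trans ((hB1 i).2 z zs) _.
  by rewrite /G1 (bigD1 i)//= lerDl; apply: sumr_ge0 => j _; have [] := hB1 j.
apply: (@le_trans _ _ (n%:R ^+ 2 * G2)); last by rewrite lerDr mulr_ge0.
apply: mnorm_le_coord => i j; rewrite mxE; apply: le_trans ((hB2 (i, j)).2 z zs) _.
by rewrite /G2 (bigD1 (i, j))//= lerDl; apply: sumr_ge0 => k _; have [] := hB2 k.
Qed.

Lemma lcomb_bound (L : seq ('rV[R]_n * @pexp R n)) (s : R) : (0 < n)%N -> 0 <= s -> exists2 B, 0 <= B &
  forall g, (forall v : 'rV[R]_n * @pexp R n, v \in L -> `|g v.1| <= 1) -> forall z, enorm z <= s ->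
  enorm (pgrad (lcomb L g) z) <= B /\ mnorm (phess (lcomb L g) z) <= B.
Proof.
move=> n0 s0; elim: L => [|v L [B B0 hB]].
  exists 0 => // g _ z _; rewrite (_ : pgrad _ _ = 0); last by apply/rowP => i; rewrite !mxE.
  rewrite (_ : phess _ _ = 0); last by apply/matrixP => i j; rewrite !mxE.
  by rewrite enorm0 mnorm0.
have [A A0 hA] := pgrad_bound v.2 n0 s0; exists (A + B); first exact: addr_ge0.
move=> g hg z zs; have gv : `|g v.1| <= 1 by apply: hg; rewrite inE eqxx.
have [H1 H2] := hA z zs.
have [|H3 H4] := hB g _ z zs; first by move=> w wL; apply: hg; rewrite inE wL orbT.
have -> : pgrad (lcomb (v :: L) g) z = g v.1 *: pgrad v.2 z + pgrad (lcomb L g) z.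
  by apply/rowP => i; rewrite !mxE /= mul0r add0r.
have -> : phess (lcomb (v :: L) g) z = g v.1 *: phess v.2 z + phess (lcomb L g) z.
  by apply/matrixP => i j; rewrite !mxE /=; ring.
split; [apply: le_trans (ler_enormD _ _) _|apply: le_trans (mnormD _ _) _]; rewrite lerD//.
  by rewrite enormZ; apply: le_trans H1; rewrite ler_piMl ?enorm_ge0.
by rewrite mnormZ; apply: le_trans H2; rewrite ler_piMl ?mnorm_ge0.
Qed.

Lemma visc_ballN p (f r : R) x0 u : visc_ball p f x0 r u -> visc_ball p (- f) x0 r (fun z => - u z).
Proof.
move=> [cu su sv].
have LN q X : LA p (- q) (- X) = - LA p q X.
  by rewrite -[- q]scaleN1r LAqZ ?LAN// oppr_eq0 oner_eq0.
split=> z.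
- by move=> /cu; exact: continuousN.
- move=> q X zr q0 J; have := ljetN J.
  have -> : (\- (fun z => - u z)) = u by apply/funext => y /=; rewrite opprK.
  by move=> /(sv _ _ _ zr); rewrite oppr_eq0 => /(_ q0); rewrite LN opprK; lra.
- move=> q X zr q0 J; have := ujetN J.
  have -> : (\- (fun z => - u z)) = u by apply/funext => y /=; rewrite opprK.
  by move=> /(su _ _ _ zr); rewrite oppr_eq0 => /(_ q0); rewrite LN opprK; lra.
Qed.

Lemma qpoly_jet (a : R) b X x : X^T = X -> jet (qpoly a b X) x (b + x *m X) X.
Proof.
move=> XT; apply/jetP => e e0; exists 1 => // h _; rewrite qpoly_expand//.
have -> (t1 t2 t3 : R) : t1 + t2 + t3 - t1 - t2 - t3 = 0 by ring.
by rewrite normr0 mulr_ge0 ?dot_ge0 ?(ltW e0).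
Qed.

(** In the coordinates given by [rt (Num.sqrt (p - 1)) b] the operator frozen at [b] is the
    Laplacian. The term [d (s^2 - |z|^2)] gives a strict gain [2 d n m], while the varying gradient
    costs a multiple of [E ^+ 2], since [E] bounds both the deviation of the gradient from [b] and
    the Hessian; for small [m] the quadratic cost loses. *)
Lemma harmonic_upper p (f c m A B d s D : R) b X e u : 1 < p -> (0 < n)%N -> b != 0 ->
  visc_ball p f 0 1 u -> LA p b X = - f -> X^T = X -> 0 < m -> harmonic e -> 0 < s -> 0 < d ->
  1 <= A -> 0 <= B -> mnorm (rt (Num.sqrt (p - 1))^-1 b) <= A ->
  (forall z, enorm z <= s -> enorm (z *m rt (Num.sqrt (p - 1)) b) < 1) ->
  (forall z, enorm z <= s -> enorm (pgrad e z) <= B /\ mnorm (phess e z) <= B) ->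
  let E := mnorm X + A * A * (B + 2 * d * (n%:R + s)) * m in
  E < enorm b -> `|p - 2| * (4 * (enorm b)^-1) * E ^+ 2 < 2 * d * n%:R * m ->
  (forall z, enorm z = s -> u (z *m rt (Num.sqrt (p - 1)) b) - qpoly c b X (z *m rt (Num.sqrt (p - 1)) b)
     <= m * (pev e z + D)) ->
  forall z, enorm z <= s -> u (z *m rt (Num.sqrt (p - 1)) b) - qpoly c b X (z *m rt (Num.sqrt (p - 1)) b)
     <= m * (pev e z + D + d * (s ^+ 2 - dot z z)).
Proof.
move=> p1 n0 b0 [cu su _] LAb XT m0 he s0 d0 A1 B0.
set k := Num.sqrt (p - 1); have k0 : 0 < k by rewrite sqrtr_gt0 subr_gt0.
set M := rt k b; set N := rt k^-1 b => NA Ms hB E Eb Esm sph.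
have MN : M *m N = 1%:M by rewrite rt_mul// divff ?gt_eqF// rt1.
have NM : N *m M = 1%:M by rewrite rt_mul// mulVf ?gt_eqF// rt1.
have NT : N^T = N by exact: rtT.
have A0 : 0 <= A by lra.
move=> z0 z0s; rewrite leNgt; apply/negP => pos.
pose H z := m * (pev e z + (- d) * dot (z - 0) (z - 0)).
pose F z := u (0 + z *m M) - qpoly c b X (0 + z *m M) - H z.
have HJ z : jet H z (m *: (pgrad e z + (- d) *: (2 *: (z - 0)))) (m *: (phess e z + (- d) *: (2 *: 1%:M))).
  exact: jetZ (jetD (pjet e z) (jetZ _ (jet_sqr 0 z))).
have [||z zs max] := @compact_max R n (cball 0 s) F (@compact_cball R n 0 s).
- by exists z0; rewrite /cball /= subr0.
- apply: cont_onW => z; rewrite /cball /= subr0 => /Ms zM.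
  apply: continuousB; last exact: jet_cont (HJ z).
  apply: continuousB; last exact: jet_cont (jet_affine (qpoly_jet c b _ XT)).
  apply/cont_enorm => e' e'0; have /cu/cont_enorm/(_ _ e'0)[r r0 hr] : enorm (0 + z *m M - 0) < 1.
    by rewrite add0r subr0.
  have M1 : 0 < mnorm M + 1 by rewrite ltr_wpDl ?mnorm_ge0.
  exists (r / (mnorm M + 1)); first by rewrite divr_gt0.
  move=> y; rewrite ltr_pdivlMr// => yz; apply: hr.
  rewrite !add0r -mulmxBl; apply: le_lt_trans (mulmx_enorm_le _ _) _.
  by have := enorm_ge0 (y - z); lra.
rewrite /cball /= subr0 in zs.
have FE w : F w = u (w *m M) - qpoly c b X (w *m M) - m * (pev e w - d * dot w w).
  by rewrite /F /H add0r subr0 mulNr.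
have val : m * (D + d * s ^+ 2) < F z.
  have := max z0; rewrite /cball /= subr0 => /(_ z0s); apply: lt_le_trans.
  by rewrite FE; move: pos; lra.
have zs' : enorm z < s.
  rewrite lt_neqAle zs andbT; apply/eqP => E0; have := sph z E0.
  by move: val; rewrite FE -enorm_sqr E0; lra.
pose q := b + (z *m M) *m X + (m *: (pgrad e z + (- d) *: (2 *: z))) *m N^T.
pose Y := X + N *m (m *: (phess e z + (- d) *: (2 *: 1%:M))) *m N^T.
have zN : 0 + (z *m M) *m N = z by rewrite add0r -mulmxA MN mulmx1.
have J : ujet u (z *m M) q Y.
  have J1 := @jet_affine R n H 0 N (z *m M) _ _ _; rewrite zN in J1.
  have := jetD (qpoly_jet c b (z *m M) XT) (J1 _ _ (HJ z)); rewrite subr0 => -[J2 _].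
  have A2 : 0 < A + 1 by lra.
  have r0 : 0 < (s - enorm z) / (A + 1) by rewrite divr_gt0 ?subr_gt0.
  apply: (ujet_touch r0) J2 => h; rewrite ltr_pdivlMr// => hr.
  have := max (z + h *m N); rewrite /cball /= subr0 => /(_ _).
  rewrite /F zN !add0r mulmxDl -[h *m N *m M]mulmxA NM mulmx1.
  rewrite [(z *m M + h) *m N]mulmxDl -[z *m M *m N]mulmxA MN mulmx1 => max'.
  have {}max' := max' _; suff /max' : enorm (z + h *m N) <= s by lra.
  apply: le_trans (ler_enormD _ _) _; have := mulmx_enorm_le N h; have := ler_wpM2r (enorm_ge0 h) NA.
  by have := enorm_ge0 h; lra.
have zM1 : enorm (z *m M) < 1 by exact: Ms.
have [G1 G2] := hB z zs.
have NN h : enorm (h *m N^T) <= A * enorm h.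
  by rewrite NT; apply: le_trans (mulmx_enorm_le _ _) _; rewrite ler_wpM2r ?enorm_ge0.
have X0 := mnorm_ge0 X.
have AA : A <= A * A by rewrite ler_peMl.
have n1 : 1 <= n%:R :> R by rewrite ler1n.
have ds : 0 <= d * s by rewrite mulr_ge0 ?ltW.
have dn : 0 <= d * n%:R by rewrite mulr_ge0// ltW.
have qb : enorm (q - b) <= E.
  have -> : q - b = (z *m M) *m X + (m *: (pgrad e z + (- d) *: (2 *: z))) *m N^T.
    by rewrite /q; move: (z *m M *m X) (_ *m N^T) => V W; vec.
  apply: le_trans (ler_enormD _ _) _; rewrite /E lerD//.
    by apply: le_trans (mulmx_enorm_le _ _) _; rewrite ler_piMr// ltW.
  apply: le_trans (NN _) _; rewrite enormZ (gtr0_norm m0).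
  have : enorm (pgrad e z + - d *: (2 *: z)) <= B + 2 * d * (n%:R + s).
    apply: le_trans (ler_enormD _ _) _; rewrite !enormZ normrN (gtr0_norm d0) ger0_norm//.
    by have := ler_wpM2l (ltW d0) zs; lra.
  move=> h1; apply: (@le_trans _ _ (A * (m * (B + 2 * d * (n%:R + s))))).
    by rewrite ler_wpM2l// ler_pM2l.
  rewrite [m * _]mulrC mulrA ler_pM2r// ler_wpM2r//.
  by rewrite addr_ge0// mulrDr addr_ge0// -mulrA mulr_ge0.
have NY : mnorm (N *m (m *: (phess e z + (- d) *: (2 *: 1%:M))) *m N^T) <= A * A * (B + 2 * d * (n%:R + s)) * m.
  apply: le_trans (mnormM _ _) _; rewrite NT.
  apply: (@le_trans _ _ (A * ((B + 2 * d * (n%:R + s)) * m) * A)).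
    rewrite ler_pM ?mnorm_ge0//; apply: le_trans (mnormM _ _) _; rewrite ler_pM ?mnorm_ge0//.
    rewrite mnormZ (gtr0_norm m0) mulrC ler_pM2r//; apply: le_trans (mnormD _ _) _.
    rewrite !mnormZ mnorm_scalar normr1 mulr1 normrN (gtr0_norm d0) ger0_norm//; lra.
  by apply: eq_ler; ring.
have YE : mnorm Y <= E by apply: le_trans (mnormD _ _) _; rewrite lerD2l.
have q0 : q != 0.
  rewrite -enorm_gt0; have := ler_enormB q (q - b).
  have -> : q - (q - b) = b by rewrite opprB addrC subrK.
  lra.
have LY : LA p b Y = - f - 2 * d * n%:R * m.
  rewrite LAD LAb; congr (_ + _); rewrite LA_rt// -/k -/M !mulmxA MN mul1mx -mulmxA NT.
  have MT : M^T = M by exact: rtT.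
  rewrite MT NM mulmx1 mxtraceZ mxtraceD !mxtraceZ mxtrace1 -lapE he; ring.
have := su _ _ _ (_ : enorm (z *m M - 0) < 1) q0 J; rewrite subr0 => /(_ zM1).
have := LA_lip p Y b0 q0; rewrite LY (enormC b) => L1 L2.
have K0 : 0 <= `|p - 2| * (4 * (enorm b)^-1) by rewrite !mulr_ge0 ?invr_ge0 ?enorm_ge0.
have := ler_wpM2l K0 (ler_pM (enorm_ge0 _) (mnorm_ge0 _) qb YE).
move: L1; rewrite ler_norml => /andP[L1 _]; clear -L1 L2 Esm; lra.
Qed.

Lemma rtN (a : R) b : rt a (- b) = rt a b.
Proof.
rewrite /rt dotNl dotNr opprK; have -> : (- b)^T = - b^T by apply/matrixP => i j; rewrite !mxE.
by rewrite mulNmx mulmxN opprK.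
Qed.

Lemma qpolyN (c : R) b X x : qpoly (- c) (- b) (- X) x = - qpoly c b X x.
Proof. by rewrite /qpoly dotNl quadMN; ring. Qed.

(** The lower bound is [harmonic_upper] for [- u], which solves the equation with [- f], [- b] and
    [- X] in the same coordinates. *)
Lemma harmonic_approx p (f c m A B d s D : R) b X e u : 1 < p -> (0 < n)%N -> b != 0 ->
  visc_ball p f 0 1 u -> LA p b X = - f -> X^T = X -> 0 < m -> harmonic e -> 0 < s -> 0 < d ->
  1 <= A -> 0 <= B -> mnorm (rt (Num.sqrt (p - 1))^-1 b) <= A ->
  (forall z, enorm z <= s -> enorm (z *m rt (Num.sqrt (p - 1)) b) < 1) ->
  (forall z, enorm z <= s -> enorm (pgrad e z) <= B /\ mnorm (phess e z) <= B) ->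
  let E := mnorm X + A * A * (B + 2 * d * (n%:R + s)) * m in
  E < enorm b -> `|p - 2| * (4 * (enorm b)^-1) * E ^+ 2 < 2 * d * n%:R * m ->
  (forall z, enorm z = s -> `|u (z *m rt (Num.sqrt (p - 1)) b) - qpoly c b X (z *m rt (Num.sqrt (p - 1)) b)
     - m * pev e z| <= m * D) ->
  forall z, enorm z <= s -> `|u (z *m rt (Num.sqrt (p - 1)) b) - qpoly c b X (z *m rt (Num.sqrt (p - 1)) b)
     - m * pev e z| <= m * (D + d * s ^+ 2).
Proof.
move=> p1 n0 b0 V LAb XT m0 he s0 d0 A1 B0 NA Ms hB E Eb Esm sph z zs.
have dz : m * (d * (s ^+ 2 - dot z z)) <= m * (d * s ^+ 2).
  by rewrite ler_pM2l// ler_pM2l// gerBl dot_ge0.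
have U := harmonic_upper (c := c) (D := D) p1 n0 b0 V LAb XT m0 he s0 d0 A1 B0 NA Ms hB Eb Esm.
have {}U := U _ z zs.
pose e' : pexp := PM (PC (-1)) e.
have L := harmonic_upper (D := D) (c := - c) (e := e') p1 n0 (_ : - b != 0) (visc_ballN V) (X := - X) _ _ m0 _ s0 d0 A1 B0.
have LN : LA p (- b) (- X) = - - f by rewrite -[- b]scaleN1r LAqZ ?LAN ?LAb// oppr_eq0 oner_eq0.
have he' : harmonic e' by move=> y; rewrite lap_scale he mulr0.
have hB' w : enorm w <= s -> enorm (pgrad e' w) <= B /\ mnorm (phess e' w) <= B.
  move=> /hB[h1 h2]; have -> : pgrad e' w = - pgrad e w.
    by apply/rowP => i; rewrite !mxE /= mul0r add0r mulN1r.
  have -> : phess e' w = - phess e w.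
    by apply/matrixP => i j; rewrite !mxE /=; ring.
  by rewrite enormN mnormN.
have XT' : (- X)^T = - X by rewrite linearN/= XT.
have b0' : - b != 0 by rewrite oppr_eq0.
have {}L := L b0' LN XT' he'; rewrite !rtN mnormN enormN in L.
have {}L := L NA Ms hB' Eb Esm _ z zs; rewrite !qpolyN /= in L.
have [U1 L1] : u (z *m rt (Num.sqrt (p - 1)) b) - qpoly c b X (z *m rt (Num.sqrt (p - 1)) b)
     <= m * (pev e z + D + d * (s ^+ 2 - dot z z)) /\
   - u (z *m rt (Num.sqrt (p - 1)) b) - - qpoly c b X (z *m rt (Num.sqrt (p - 1)) b)
     <= m * (-1 * pev e z + D + d * (s ^+ 2 - dot z z)).
  split; [apply: U|apply: L] => w ws; have := sph w ws => /ler_normlP[h1 h2].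
    by clear -h2; lra.
  by rewrite qpolyN; clear -h1; lra.
by apply/ler_normlP; move: U1 L1 dz; clear; split; lra.
Qed.

Lemma phess_sym e z : (phess e z)^T = phess e z.
Proof. by apply/matrixP => i j; rewrite !mxE pder_comm. Qed.

Lemma pow_small (a t : R) z : 0 < a -> 0 <= t -> dot z z <= t `^ a^-1 -> dot z z `^ a <= t.
Proof.
move=> a0 t0 H; have : dot z z `^ a <= (t `^ a^-1) `^ a.
  by apply: ge0_ler_powR; rewrite ?nnegrE ?dot_ge0 ?powR_ge0 ?(ltW a0).
by rewrite -powRrM mulVf ?gt_eqF// powRr1.
Qed.

(** Divided by [m], the deviations have a common modulus of continuity by [Ishii_Lions]. On a sphere
    a finite harmonic net approximates them, [harmonic_approx] extends the approximation inwards,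
    and the second-order Taylor polynomial of the harmonic function brings the error from [m] down
    to [m * rho ^+ 2 / 2], half of what scaling alone would keep. *)
Lemma Schauder_step p (b0 C1 : R) : 1 < p -> (0 < n)%N -> 0 < b0 -> b0 <= C1 ->
  exists rho t C, [/\ 0 < rho, rho <= 4^-1, 0 < t, 0 < C &
  forall u (f m c : R) b X, visc_ball p f 0 1 u -> b0 <= enorm b -> 0 < m -> m <= t ->
  mnorm X <= t -> mnorm X ^+ 2 <= t * m -> X^T = X -> LA p b X = - f ->
  (forall x, enorm x < 1 -> `|u x - qpoly c b X x| <= m) ->
  (forall x y, enorm x < 1 -> enorm y < 1 ->
    `|(u x - qpoly c b X x) - (u y - qpoly c b X y)| <= C1 * enorm (x - y)) ->
  exists c' b' X', [/\ X'^T = X', LA p b' X' = - f, `|c' - c| <= C * m,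
    enorm (b' - b) <= C * m /\ mnorm (X' - X) <= C * m &
    forall x, enorm x <= rho -> `|u x - qpoly c' b' X' x| <= m * rho ^+ 2 / 2]].
Proof.
move=> p1 n0 b00 bC.
have [al [CI [tI [al0 _ CI0 [tI0 IL]]]]] := @Ishii_Lions R n p b0 C1 p1 n0 b00 bC.
have np0 := np_gt0 p1 n0; have nR : 0 < n%:R :> R by rewrite ltr0n.
have n1 : 1 <= n%:R :> R by rewrite ler1n.
pose k := Num.sqrt (p - 1).
have k0 : 0 < k by rewrite sqrtr_gt0 subr_gt0.
pose A := 1 + (n%:R + `|k - 1| * n%:R ^+ 2) + (n%:R + `|k^-1 - 1| * n%:R ^+ 2).
have P1 : 0 <= n%:R + `|k - 1| * n%:R ^+ 2 by rewrite addr_ge0 ?mulr_ge0 ?exprn_ge0.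
have P2 : 0 <= n%:R + `|k^-1 - 1| * n%:R ^+ 2 by rewrite addr_ge0 ?mulr_ge0 ?exprn_ge0.
have A1 : 1 <= A by rewrite /A; lra.
have A0 : 0 < A by lra.
have MA b : b != 0 -> mnorm (rt k b) <= A.
  by move=> h; apply: le_trans (mnorm_rt _ h) _; rewrite /A; lra.
have NA b : b != 0 -> mnorm (rt k^-1 b) <= A.
  by move=> h; apply: le_trans (mnorm_rt _ h) _; rewrite /A; lra.
clearbody A; clear P1 P2.
(* With this [s], and [A] bounding the norm of [M], the cube of half-width [s] is mapped into the
   ball of radius [2^-1]. *)
pose s := (2 * n%:R * A)^-1; have s0 : 0 < s by pos.
have As : A * n%:R * s = 2^-1 by rewrite /s; field; rewrite !gt_eqF.
pose C3 := 64 * n%:R ^+ 6 / s ^+ 3 * 2; have C30 : 0 < C3 by pos.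
pose D1 := n%:R * (2 * n%:R / s * 2); have D10 : 0 < D1 by pos.
pose D2 := n%:R ^+ 2 * (4 * n%:R / s * (2 * n%:R / s * 2)); have D20 : 0 < D2 by pos.
(* Besides [rho <= 4^-1]: points of norm at most [rho] have new coordinates of norm at most [s / 8],
   where the Taylor estimate holds, and the cubic remainder there is at most [rho ^+ 2 / 8]. *)
pose rho := Num.min (Num.min 4^-1 (s / (8 * A))) (8 * C3 * A ^+ 3)^-1.
have rho0 : 0 < rho by pos.
have [r4 rs rC] : [/\ rho <= 4^-1, A * rho <= s / 8 & C3 * A ^+ 3 * rho <= 8^-1].
  split; first by rewrite /rho !ge_min lexx.
    have : rho <= s / (8 * A) by rewrite /rho !ge_min lexx !orbT.
    by rewrite ler_pdivlMr ?mulr_gt0//; lra.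
  have : rho <= (8 * C3 * A ^+ 3)^-1 by rewrite /rho ge_min lexx orbT.
  have P0 : 0 < 8 * C3 * A ^+ 3 by rewrite mulr_gt0 ?exprn_gt0// mulr_gt0.
  rewrite -[X in rho <= X]div1r ler_pdivlMr//; clear; lra.
clearbody rho.
(* With [de] below, [2 * dd + de * s ^+ 2] is [rho ^+ 2 / 8]. Adding the cubic remainder and the
   correction by [ga], worth [rho ^+ 2 / 4], gives the final [rho ^+ 2 / 2], all times [m]. *)
pose dd := rho ^+ 2 / 32; have dd0 : 0 < dd by pos.
pose de := rho ^+ 2 / (16 * s ^+ 2); have de0 : 0 < de by pos.
pose om := A^-1 * Num.sqrt ((dd / CI) `^ al^-1).
have om0 : 0 < om by pos.
have [L [hL net]] := Dirichlet_net n0 s0 dd0 om0 (lexx s).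
have [B B0 hB] := lcomb_bound L n0 (ltW s0).
pose E0 := A * A * (B + 2 * de * (n%:R + s)).
have E00 : 0 <= E0 by pos.
pose C2 := `|p - 2| * (4 / b0); have C20 : 0 <= C2 by pos.
pose t := Num.min (Num.min (Num.min 1 tI) (Num.min (b0 / (2 * (1 + E0))) (de / (2 * (C2 + 1) * (1 + E0 ^+ 2)))))
  (Num.min ((n%:R + p - 2) / (2 * (C2 + 1) * (A * D1 + 1) * (1 + A ^+ 2 * D2))) (b0 / (2 * (A * D1 + 1)))).
have AD : 0 < A * D1 by rewrite mulr_gt0.
have AD2 : 0 < A ^+ 2 * D2 by pos.
have t0 : 0 < t by clearbody E0; pos.
have t1 : t <= 1 by rewrite /t !ge_min lexx.
have tI1 : t <= tI by rewrite /t !ge_min lexx !orbT.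
have tb : t * (2 * (1 + E0)) <= b0.
  by rewrite -ler_pdivlMr; [rewrite /t !ge_min lexx !orbT|pos].
have tc : t * (2 * (C2 + 1) * (1 + E0 ^+ 2)) <= de.
  by rewrite -ler_pdivlMr; [rewrite /t !ge_min lexx !orbT|pos].
have tg : t * (2 * (C2 + 1) * (A * D1 + 1) * (1 + A ^+ 2 * D2)) <= n%:R + p - 2.
  by rewrite -ler_pdivlMr; [rewrite /t !ge_min lexx !orbT|pos].
have tq : t * (2 * (A * D1 + 1)) <= b0.
  by rewrite -ler_pdivlMr; [rewrite /t !ge_min lexx !orbT|pos].
clearbody t.
exists rho, t, (2 + A * D1 + A ^+ 2 * D2 + n%:R); split=> //; first by pos.
move=> u f m c b X V bb m0 mt Xt Xm XT LAb hm hLip.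
have bn0 : b != 0 by rewrite -enorm_gt0; exact: lt_le_trans bb.
pose M := rt k b; pose N := rt k^-1 b.
have MN : M *m N = 1%:M by rewrite rt_mul// divff ?gt_eqF// rt1.
have NM : N *m M = 1%:M by rewrite rt_mul// mulVf ?gt_eqF// rt1.
have zM (z : 'rV[R]_n) (a : R) : enorm z <= a -> enorm (z *m M) <= A * a.
  move=> za; apply: le_trans (mulmx_enorm_le _ _) _; apply: ler_pM (mnorm_ge0 _) (enorm_ge0 _) (MA _ bn0) za.
have zN (z : 'rV[R]_n) (a : R) : enorm z <= a -> enorm (z *m N) <= A * a.
  move=> za; apply: le_trans (mulmx_enorm_le _ _) _; apply: ler_pM (mnorm_ge0 _) (enorm_ge0 _) (NA _ bn0) za.
pose w x := u x - qpoly c b X x.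
pose W z := m^-1 * w (z *m M).
have cubeM z : cube s z -> enorm (z *m M) <= 2^-1.
  by move=> /(enorm_le_coord n0)/zM; rewrite mulrA As.
have half1 (z : 'rV[R]_n) : enorm z <= 2^-1 -> enorm z < 1 by clear; lra.
have Wm z : m * W z = w (z *m M) by rewrite /W mulVKf ?gt_eqF.
have W1 z : cube s z -> `|W z| <= 1.
  move=> /cubeM/half1/hm h; rewrite normrM gtr0_norm ?invr_gt0// mulrC ler_pdivrMr// mul1r; exact: h.
have X2m : mnorm X ^+ 2 <= m by apply: le_trans Xm _; rewrite ler_piMl// ltW.
have Wmod z z' : cube s z -> cube s z' -> enorm (z - z') < om -> `|W z - W z'| <= dd * 1.
  move=> cz cz' zz; rewrite mulr1 -mulrBr normrM gtr0_norm ?invr_gt0// mulrC ler_pdivrMr//.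
  have := IL u f m c b X V bb m0 (le_trans mt tI1) (le_trans Xt tI1) X2m XT hm hLip _ _ (cubeM z cz) (cubeM z' cz').
  move=> /le_trans; apply; rewrite mulrAC ler_pM2r//.
  have : dot (z *m M - z' *m M) (z *m M - z' *m M) `^ al <= dd / CI.
    apply: pow_small => //; first by rewrite divr_ge0// ltW.
    rewrite -[leRHS]sqr_sqrtr ?powR_ge0// -enorm_le_sqr ?sqrtr_ge0// -mulmxBl.
    apply: le_trans (zM _ _ (ltW zz)) _; rewrite /om mulrA divff ?mul1r// gt_eqF//.
  by rewrite ler_pdivlMr// mulrC.
have netW := net 1 W ler01 W1 Wmod; rewrite mulr1 in netW.
pose e := lcomb L W.
have he : harmonic e by apply: lcomb_harmonic => v /hL[].
have hBe : forall z, enorm z <= s -> enorm (pgrad e z) <= B /\ mnorm (phess e z) <= B.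
  by apply: hB => v /hL[_]; exact: W1.
have sM z : enorm z <= s -> enorm (z *m M) < 1.
  by move=> /zM h; apply/half1; apply: le_trans h _; rewrite -As -mulrA ler_pM2l// ler_peMl// ltW.
have Em : mnorm X + E0 * m < enorm b.
  apply: (@lt_le_trans _ _ b0) => //.
  have : E0 * m <= E0 * t by rewrite ler_wpM2l.
  by clear -Xt tb t0 b00; lra.
have Esm : `|p - 2| * (4 * (enorm b)^-1) * (mnorm X + E0 * m) ^+ 2 < 2 * de * n%:R * m.
  have H1 : `|p - 2| * (4 * (enorm b)^-1) <= C2.
    by rewrite ler_wpM2l// ler_pM2l// lef_pV2 ?posrE//; exact: lt_le_trans bb.
  have H2 : (mnorm X + E0 * m) ^+ 2 <= 2 * (1 + E0 ^+ 2) * (t * m).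
    have : m ^+ 2 <= t * m by rewrite expr2 ler_pM2r.
    move=> h; have := ler_wpM2l (sqr_ge0 E0) h; have := sqr_ge0 (mnorm X - E0 * m).
    by move: Xm; clear; nra.
  apply: (@le_lt_trans _ _ (C2 * (2 * (1 + E0 ^+ 2) * (t * m)))).
    by apply: ler_pM H1 H2; [rewrite !mulr_ge0 ?invr_ge0 ?enorm_ge0|exact: sqr_ge0].
  apply: (@lt_le_trans _ _ (2 * de * m)); last by rewrite ler_pM2r// ler_peMr// mulr_ge0// ltW.
  rewrite (_ : C2 * _ = (t * (2 * C2 * (1 + E0 ^+ 2))) * m); last by ring.
  rewrite ltr_pM2r//; have := mulr_gt0 t0 (_ : 0 < 1 + E0 ^+ 2); rewrite ltr_wpDr ?sqr_ge0// => /(_ isT).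
  by clear -tc de0; lra.
have sph z : enorm z = s -> `|u (z *m M) - qpoly c b X (z *m M) - m * pev e z| <= m * (2 * dd).
  move=> zs; rewrite -/(w _) -Wm -mulrBr normrM gtr0_norm// ler_pM2l// pev_lcomb distrC.
  exact: netW.
have app := harmonic_approx p1 n0 bn0 V LAb XT m0 he s0 de0 A1 B0 (NA _ bn0) sM hBe Em Esm sph.
have dsE : 2 * dd + de * s ^+ 2 = rho ^+ 2 / 8 by rewrite /dd /de; field; rewrite gt_eqF.
rewrite dsE in app.
have rho1 : rho ^+ 2 <= 1 by rewrite expr_le1// ?(ltW rho0)//; clear -r4; lra.
have e2 z : enorm z <= s -> `|pev e z| <= 2.
  move=> zs; have := app z zs; have := hm _ (sM z zs); rewrite -/M.
  move=> /ler_normlP[h1 h2] /ler_normlP[h3 h4].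
  have h5 : m * (rho ^+ 2 / 8) <= m * 1 by rewrite ler_pM2l//; clear -rho1; lra.
  rewrite -(ler_pM2l m0) -[X in X * `|_|](gtr0_norm m0) -normrM.
  by apply/ler_normlP; move: h1 h2 h3 h4 h5; clear; split; lra.
have [T0 T1 T2 T3] := harmonic_taylor n0 s0 he e2.
rewrite -/C3 -/D1 -/D2 in T1 T2 T3.
move: T0 T1 T2 T3; set h0 := pev e 0; set g := pgrad e 0; set Hs := phess e 0 => T0 T1 T2 T3.
have NT : N^T = N by exact: rtT.
pose b' := b + m *: (g *m N); pose X1 := X + m *: (N *m Hs *m N).
have bb' : enorm (b' - b) <= m * (A * D1).
  by rewrite /b' addrC addKr enormZ gtr0_norm// ler_pM2l//; exact: zN.
have XX1 : mnorm (X1 - X) <= m * (A ^+ 2 * D2).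
  rewrite /X1 addrC addKr mnormZ gtr0_norm// ler_pM2l//.
  apply: le_trans (mnormM _ _) _; rewrite expr2 -mulrA mulrC.
  apply: ler_pM (mnorm_ge0 _) (mnorm_ge0 _) (NA _ bn0) _.
  apply: le_trans (mnormM _ _) _; exact: ler_pM (mnorm_ge0 _) (mnorm_ge0 _) (NA _ bn0) T2.
have X1T : X1^T = X1.
  by rewrite /X1 linearD/= linearZ/= XT !trmx_mul NT phess_sym mulmxA.
have b'0 : b' != 0.
  rewrite -enorm_gt0; have := ler_enormB b' (b' - b).
  have -> : b' - (b' - b) = b by rewrite opprB addrC subrK.
  have : m * (A * D1) <= t * (A * D1) by rewrite ler_pM2r.
  by move: bb' bb tq b00 AD t0; clear; nra.
have LX1 : LA p b X1 = - f.
  rewrite LAD LAZ LAb LA_rt// -/k -/M; have MT : M^T = M by exact: rtT.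
  rewrite MT !mulmxA MN mul1mx -mulmxA NM mulmx1 -lapE he mulr0 addr0; by [].
(* The Taylor polynomial satisfies the equation with gradient [b], not [b']. A multiple of the
   identity restores it; its size is at most [m / 2] because the mismatch is a product of two small
   quantities. *)
pose ga := - (LA p b' X1 + f) / (n%:R + p - 2).
have gam : `|ga| <= m / 2.
  rewrite /ga normrM normrN (gtr0_norm (_ : 0 < (n%:R + p - 2)^-1)) ?invr_gt0// ler_pdivrMr//.
  have := LA_lip p X1 bn0 b'0; rewrite LX1 (enormC b) => h.
  have -> : `|LA p b' X1 + f| = `|- f - LA p b' X1| by rewrite -opprD normrN addrC.
  apply: le_trans h _.
  have h1 : mnorm X1 <= t * (1 + A ^+ 2 * D2).
    have := mnormD X (X1 - X); rewrite addrC subrK => h1.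
    have : m * (A ^+ 2 * D2) <= t * (A ^+ 2 * D2) by rewrite ler_pM2r.
    by clear -h1 XX1 Xt; lra.
  have h2 : `|p - 2| * (4 * (enorm b)^-1) <= C2.
    by rewrite ler_wpM2l// ler_pM2l// lef_pV2 ?posrE//; exact: lt_le_trans bb.
  have h3 : `|p - 2| * (4 * (enorm b)^-1) * enorm (b' - b) <= C2 * (m * (A * D1)).
    by rewrite ler_pM ?mulr_ge0 ?invr_ge0 ?enorm_ge0.
  have h4 : `|p - 2| * (4 * (enorm b)^-1) * enorm (b' - b) * mnorm X1 <=
     C2 * (m * (A * D1)) * (t * (1 + A ^+ 2 * D2)).
    by rewrite ler_pM ?mulr_ge0 ?invr_ge0 ?enorm_ge0 ?mnorm_ge0.
  rewrite -[X in X * mnorm _ <= _]mulrA in h4 *; apply: le_trans h4 _.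
  have h5 : C2 * (A * D1) <= (C2 + 1) * (A * D1 + 1).
    by rewrite ler_pM ?(ltW AD)// lerDl.
  have q0 : 0 <= m * (t * (1 + A ^+ 2 * D2)) by rewrite !mulr_ge0 ?(ltW m0) ?(ltW t0)// addr_ge0// ltW.
  have := ler_wpM2r q0 h5; have := ler_wpM2l (ltW m0) tg; clear; lra.
exists (c + m * h0), b', (X1 + ga%:M); split.
- by rewrite linearD/= X1T tr_scalar_mx.
- by rewrite LAD LA1// /ga divfK ?gt_eqF//; ring.
- rewrite addrC addKr normrM gtr0_norm// mulrC ler_pM2r//; apply: le_trans T0 _.
  by clear -AD AD2 nR; lra.
- split.
    apply: le_trans bb' _; rewrite mulrC ler_pM2r//.
    by clear -AD2 nR; lra.
  rewrite addrAC; apply: le_trans (mnormD _ _) _; rewrite mnorm_scalar.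
  have := ler_wpM2l (ltW nR) gam; move: XX1 AD AD2 nR m0.
  move: (mnorm _) (A * D1) (A ^+ 2 * D2) => y1 y2 y3 h1 h2 h3 h4 h5 h6.
  have := mulr_gt0 h2 h5; have := mulr_gt0 h4 h5; clear -h1 h6 h5; lra.
move=> x xr; have xN := zN x _ xr; set z := x *m N in xN.
have zs8 : enorm z <= s / 8 by exact: le_trans xN rs.
have zs : enorm z <= s by apply: le_trans zs8 _; clear -s0; lra.
have zx : z *m M = x by rewrite /z -mulmxA NM mulmx1.
have := app z zs; rewrite -/M zx => a1; have a2 := T3 z zs8.
have qE : qpoly (c + m * h0) b' (X1 + ga%:M) x = qpoly c b X x + m * qpoly h0 g Hs z + ga / 2 * dot x x.
  rewrite /qpoly /b' /X1 !quadL dotDl dotZl.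
  have -> : dot (g *m N) x = dot g z by rewrite dot_mull -{1}NT bilT -dot_mulr.
  have -> : quad (N *m Hs *m N) x = quad Hs z by rewrite /quad /z trmx_mul NT !mulmxA.
  by field.
rewrite qE.
have xx : dot x x <= rho ^+ 2 by rewrite -enorm_le_sqr// ltW.
have g1 : `|ga / 2 * dot x x| <= m / 4 * rho ^+ 2.
  rewrite normrM (ger0_norm (dot_ge0 _)) ler_pM ?dot_ge0// normrM [`|2^-1|]ger0_norm ?invr_ge0//.
  by clear -gam; lra.
have a3 : C3 * enorm z ^+ 3 <= rho ^+ 2 / 8.
  apply: (@le_trans _ _ (C3 * (A * rho) ^+ 3)).
    by rewrite ler_pM2l// lerXn2r ?nnegrE ?enorm_ge0 ?mulr_ge0 ?(ltW A0) ?(ltW rho0).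
  rewrite (_ : C3 * (A * rho) ^+ 3 = (C3 * A ^+ 3 * rho) * rho ^+ 2); last by ring.
  by rewrite mulrC ler_pM2l ?exprn_gt0.
have := le_trans a2 a3 => {}a3; have a4 : `|m * (pev e z - qpoly h0 g Hs z)| <= m * (rho ^+ 2 / 8).
  by rewrite normrM gtr0_norm// ler_pM2l.
move: a1 a4 g1 => /ler_normlP[q1 q2] /ler_normlP[q3 q4] /ler_normlP[q5 q6].
by apply/ler_normlP; move: q1 q2 q3 q4 q5 q6; clear; split; lra.
Qed.

End SchauderStep.

(** * Iteration to a jet with controlled Hessian *)

Lemma half_pow {R : realType} (e : R) : 0 < e -> exists k, 2^-1 ^+ k < e.
Proof.
move=> e0; exists (Num.bound e^-1); set k := Num.bound _.
have k1 : e^-1 < k%:R by apply: archi_boundP; rewrite invr_ge0 ltW.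
have k2 : k%:R <= 2 ^+ k :> R by rewrite -natrX ler_nat ltnW// ltn_expl.
rewrite exprVn invf_plt ?posrE ?exprn_gt0//; exact: lt_le_trans k1 k2.
Qed.

(** The intervals of radius [2 * D * q ^+ k] around [a k] are nested because [q <= 2^-1]; the
    supremum of their left ends lies in all of them. *)
Lemma geometric_limit {R : realType} (a : nat -> R) (D q : R) : 0 <= q -> q <= 2^-1 -> 0 <= D ->
  (forall k, `|a k.+1 - a k| <= D * q ^+ k) -> exists l, forall k, `|a k - l| <= 2 * D * q ^+ k.
Proof.
move=> q0 q1 D0 hD.
have Dq k : 0 <= D * q ^+ k by rewrite mulr_ge0 ?exprn_ge0.
have Dq1 k : 2 * (D * q ^+ k.+1) <= D * q ^+ k.
  by rewrite exprS; have := Dq k; have := ler_wpM2r (Dq k) q1; clear; lra.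
have lo k j : a k - 2 * D * q ^+ k <= a (k + j)%N - 2 * D * q ^+ (k + j).
  elim: j => [|j IH]; first by rewrite addn0.
  apply: le_trans IH _; rewrite addnS; have := hD (k + j)%N; have := Dq1 (k + j)%N.
  by rewrite ler_norml => h1 /andP[h2 _]; clear -h1 h2; lra.
have hi k j : a (k + j)%N + 2 * D * q ^+ (k + j) <= a k + 2 * D * q ^+ k.
  elim: j => [|j IH]; first by rewrite addn0.
  apply: le_trans IH; rewrite addnS; have := hD (k + j)%N; have := Dq1 (k + j)%N.
  by rewrite ler_norml => h1 /andP[_ h2]; clear -h1 h2; lra.
have lohi k j : a k - 2 * D * q ^+ k <= a j + 2 * D * q ^+ j.
  have := lo k j; have := hi j k; rewrite addnC.
  by have := Dq (k + j)%N; clear; lra.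
pose S := [set a k - 2 * D * q ^+ k | k in [set: nat]].
have S0 : S !=set0 by exists (a 0%N - 2 * D * q ^+ 0); exists 0%N.
exists (sup S) => k.
have h1 : a k - 2 * D * q ^+ k <= sup S.
  by apply: ub_le_sup; [exists (a 0%N + 2 * D * q ^+ 0) => _ [j _ <-]; exact: lohi|exists k].
have h2 : sup S <= a k + 2 * D * q ^+ k by apply: ge_sup => // _ [j _ <-]; exact: lohi.
by apply/ler_normlP; move: h1 h2; clear; split; lra.
Qed.

Section SchauderIteration.
Context {R : realType} {n : nat}.
Implicit Types (x y z h q v b : 'rV[R]_n) (X N : 'M[R]_n) (f u : 'rV[R]_n -> R).

Lemma visc_ball_le p (f r s : R) x0 u : s <= r -> visc_ball p f x0 r u -> visc_ball p f x0 s u.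
Proof.
move=> sr [cu su sv]; split=> z.
- by move=> /lt_le_trans/(_ sr)/cu.
- by move=> q X /lt_le_trans/(_ sr)/su; apply.
- by move=> q X /lt_le_trans/(_ sr)/sv; apply.
Qed.

Lemma qpoly_scale (c a : R) b X z : a != 0 -> qpoly (a^-1 * c) b (a *: X) z = a^-1 * qpoly c b X (a *: z).
Proof. by move=> a0; rewrite /qpoly quadMZ quadZ dotZr; field. Qed.

Lemma qpoly_lip (c K : R) b X x y : X^T = X -> enorm x < 1 -> enorm y < 1 -> mnorm X <= K ->
  `|qpoly c b X x - qpoly c b X y| <= (enorm b + K) * enorm (x - y).
Proof.
move=> XT x1 y1 XK; rewrite /qpoly.
have -> : c + dot b x + 2^-1 * quad X x - (c + dot b y + 2^-1 * quad X y) =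
    dot b (x - y) + 2^-1 * (bil X (x - y) x + bil X y (x - y)).
  by rewrite -quad_diff dotBr; ring.
rewrite mulrDl; apply: le_trans (ler_normD _ _) _; rewrite lerD ?ler_dot//.
rewrite normrM ger0_norm ?invr_ge0//.
have h1 := ler_bil X (x - y) x; have h2 := ler_bil X y (x - y).
have e0 := enorm_ge0 (x - y).
have h3 : mnorm X * (enorm (x - y) * enorm x) <= K * enorm (x - y).
  by apply: ler_pM; rewrite ?mulr_ge0 ?enorm_ge0 ?mnorm_ge0// ler_piMr// ltW.
have h4 : mnorm X * (enorm y * enorm (x - y)) <= K * enorm (x - y).
  by apply: ler_pM; rewrite ?mulr_ge0 ?enorm_ge0 ?mnorm_ge0// ler_piMl// ltW.
have := ler_normD (bil X (x - y) x) (bil X y (x - y)); clear -h1 h2 h3 h4; lra.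
Qed.

(** At scale [rho^k] the error is [(rho^2 / 2)^k]; the surplus [2^-k] over the squared scale is what
    makes the remainder [o(|h|^2)]. For a given small [h] the index used satisfies
    [rho^(k+1) <= |h| < rho^k]. *)
Lemma iterated_expansion u (rho m D : R) (s : nat -> R * 'rV[R]_n * 'M[R]_n) b X :
  0 < rho -> rho <= 2^-1 -> 0 < m -> 0 <= D ->
  (forall k x, enorm x < rho ^+ k -> `|u x - qpoly (s k).1.1 (s k).1.2 (s k).2 x| <= m * (rho ^+ 2 / 2) ^+ k) ->
  (forall k, enorm ((s k).1.2 - b) <= D * (rho / 2) ^+ k) ->
  (forall k, mnorm ((s k).2 - X) <= D * 2^-1 ^+ k) -> jet u 0 b X.
Proof.
move=> r0 r2 m0 D0 hu hb hX; apply/jetP => e e0.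
pose G := (2 * m + 2 * D) / rho ^+ 2; have G0 : 0 < G by rewrite divr_gt0 ?exprn_gt0// ltr_wpDr ?mulr_ge0// mulr_gt0.
have [K hK] := half_pow (divr_gt0 e0 G0).
have r1 : rho <= 1 by apply: le_trans r2 _; clear; lra.
exists (rho ^+ K); first by rewrite exprn_gt0.
move=> h hr; rewrite add0r.
have [->|h0] := eqVneq h 0.
  by rewrite dot0r quad0 dot0l !mulr0 !subr0 subrr normr0.
rewrite -enorm_gt0 in h0.
have exP : exists k, rho ^+ k.+1 <= enorm h.
  have [j hj] := half_pow h0; exists j; apply: le_trans (ltW hj).
  apply: (@le_trans _ _ (rho ^+ j)); first by rewrite exprS ler_piMl// exprn_ge0// ltW.
  by rewrite lerXn2r// nnegrE ?invr_ge0// ltW.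
case: (ex_minnP exP) => k kP kmin.
have kK : (K <= k)%N.
  rewrite leqNgt; apply/negP => lt; move: hr; rewrite ltNge => /negP; apply.
  by apply: le_trans kP; apply: ler_wiXn2l => //; exact: ltW.
have hk : enorm h < rho ^+ k.
  case: k kP kmin {kK} => [|k] kP kmin.
    by apply: lt_le_trans hr _; rewrite expr0 exprn_ile1// ltW.
  by rewrite ltNge; apply/negP => /kmin; rewrite ltnn.
have u0 := hu k 0; rewrite enorm0 exprn_gt0// in u0; have {u0} := u0 isT.
have := hu k h hk; move: (hb k) (hX k); case: (s k) => -[c1 b1] X1 /= B1 XX1.
rewrite {2}/qpoly dot0r quad0 mulr0 !addr0 => U1 U2.
have e1 := enorm_ge0 h.
have q1 : `|dot (b1 - b) h| <= D * (rho / 2) ^+ k * rho ^+ k.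
  by apply: le_trans (ler_dot _ _) _; rewrite ler_pM ?enorm_ge0// ltW.
have q2 : `|quad (X1 - X) h| <= D * 2^-1 ^+ k * (rho ^+ k) ^+ 2.
  by apply: le_trans (ler_quad _ _) _; rewrite -enorm_sqr ler_pM ?mnorm_ge0 ?sqr_ge0// lerXn2r ?nnegrE ?exprn_ge0// ltW.
have E1 : D * (rho / 2) ^+ k * rho ^+ k = D * (rho ^+ 2 / 2) ^+ k.
  by rewrite -mulrA -exprMn; congr (_ * _ ^+ _); ring.
have E2 : D * 2^-1 ^+ k * (rho ^+ k) ^+ 2 = D * (rho ^+ 2 / 2) ^+ k.
  by rewrite -mulrA -exprM mulnC exprM -exprMn; congr (_ * _ ^+ _); ring.
rewrite E1 in q1; rewrite E2 in q2.
have P0 : 0 <= (rho ^+ 2 / 2) ^+ k by rewrite exprn_ge0// divr_ge0// sqr_ge0.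
have q3 : `|u h - u 0 - dot b h - 2^-1 * quad X h| <= (2 * m + 2 * D) * (rho ^+ 2 / 2) ^+ k.
  move: q1 q2 U1 U2; rewrite dotBl !quadL /qpoly; move: (_ ^+ k) P0 => P P0.
  move=> /ler_normlP[t1 t2] /ler_normlP[t3 t4] /ler_normlP[t5 t6] /ler_normlP[t7 t8].
  by apply/ler_normlP; have := mulr_ge0 D0 P0; move: t1 t2 t3 t4 t5 t6 t7 t8; clear; split; lra.
apply: le_trans q3 _.
apply: (@le_trans _ _ (G * 2^-1 ^+ k * dot h h)).
  have : (rho ^+ k.+1) ^+ 2 <= dot h h by rewrite -enorm_sqr lerXn2r ?nnegrE ?exprn_ge0// ltW.
  have G1 : 0 <= G * 2^-1 ^+ k by rewrite mulr_ge0 ?exprn_ge0 ?invr_ge0// ltW.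
  move=> /(ler_wpM2l G1); apply: le_trans; apply: eq_ler.
  rewrite exprAC [(rho ^+ 2) ^+ k.+1]exprS exprMn /G; field.
  by rewrite gt_eqF.
rewrite ler_wpM2r ?dot_ge0// mulrC -ler_pdivlMr//; apply: le_trans (ltW hK).
by apply: ler_wiXn2l => //; rewrite ?invr_ge0// invf_le1// ler1n.
Qed.

(** [Schauder_step] is applied to [u] rescaled by [rho^k], where the deviation is [m (rho / 2)^k]
    and the Hessian is multiplied by [rho^k], so that all smallness conditions persist. The
    corrections of gradient and Hessian form geometric series, whence [b'] and [X']. *)
Lemma Schauder_jet p (b0 L : R) : 1 < p -> (0 < n)%N -> 0 < b0 -> b0 <= L ->
  exists t C, [/\ 0 < t, 0 < C & forall u (f m c : R) b X, visc_ball p f 0 1 u ->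
  2 * b0 <= enorm b -> enorm b <= L -> 0 < m -> m <= t -> X^T = X -> LA p b X = - f ->
  (mnorm X + C * m) ^+ 2 <= t * m -> (forall x, enorm x < 1 -> `|u x - qpoly c b X x| <= m) ->
  (forall x y, enorm x < 1 -> enorm y < 1 -> `|u x - u y| <= L * enorm (x - y)) ->
  exists b' X', [/\ jet u 0 b' X', X'^T = X', enorm (b' - b) <= C * m & mnorm (X' - X) <= C * m]].
Proof.
move=> p1 n0 b00 bL.
have [|rho [t [C0 [r0 r4 t0 C00 step]]]] := @Schauder_step R n p b0 (3 * L + 1) p1 n0 b00; first by clear -b00 bL; lra.
have n1 : 1 <= n%:R :> R by rewrite ler1n.
have n2 : n%:R <= n%:R ^+ 2 :> R by rewrite expr2 ler_peMl// ltW// ltr0n.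
pose C := 4 * n%:R ^+ 2 * C0.
have CC0 : 4 * C0 <= C.
  by rewrite /C mulrAC ler_peMr ?(le_trans n1)// mulr_ge0// ltW.
have Cp : 0 < C by clear -CC0 C00; lra.
exists (Num.min (Num.min t 1) (b0 / C)), C; split=> //; first by rewrite !lt_min t0 ltr01 divr_gt0.
move=> u f m c b X V bb bL1 m0; rewrite !le_min => /andP[/andP[mt m1]]; rewrite ler_pdivlMr// => mC.
move=> XT LAb Xm hm hLip.
have r2 : rho <= 2^-1 by clear -r4; lra.
have r1 : rho <= 1 by clear -r4; lra.
have C0m : 0 < C0 * m by rewrite mulr_gt0.
have Xm' : (mnorm X + C * m) ^+ 2 <= t * m.
  by apply: le_trans Xm _; rewrite ler_pM2r// !ge_min lexx.
have Xm1 : mnorm X + C * m <= Num.min t 1.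
  have T0 : 0 <= Num.min t 1 by rewrite le_min (ltW t0) ler01.
  rewrite -(ler_pXn2r (_ : (0 < 2)%N)) ?nnegrE ?addr_ge0 ?mnorm_ge0 ?mulr_ge0 ?(ltW m0) ?(ltW Cp) ?(ltW C00)//.
  apply: le_trans Xm _; rewrite expr2; apply: ler_pM; rewrite ?(ltW m0)// ?le_min ?mt ?m1// ?ge_min ?lexx//.
  by rewrite (ltW t0) ler01 divr_ge0// ltW.
  by rewrite orbT.
have [Xt Xone] : mnorm X + C * m <= t /\ mnorm X + C * m <= 1.
  by move: Xm1; rewrite le_min => /andP.
(* [2 - 2 * 2^-1 ^+ k] is the partial sum of the geometric series that majorizes the corrections so
   far. *)
pose Q k (s : R * 'rV[R]_n * 'M[R]_n) := [/\ s.2^T = s.2, LA p s.1.2 s.2 = - f,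
  enorm (s.1.2 - b) <= C0 * m * (2 - 2 * 2^-1 ^+ k), mnorm (s.2 - X) <= C0 * m * (2 - 2 * 2^-1 ^+ k) &
  forall x, enorm x < rho ^+ k -> `|u x - qpoly s.1.1 s.1.2 s.2 x| <= m * (rho ^+ 2 / 2) ^+ k].
have stp : forall ks : nat * (R * 'rV[R]_n * 'M[R]_n), exists s', Q ks.1 ks.2 ->
   [/\ Q ks.1.+1 s', enorm (s'.1.2 - ks.2.1.2) <= C0 * m * (rho / 2) ^+ ks.1 &
   mnorm (s'.2 - ks.2.2) <= C0 * m * 2^-1 ^+ ks.1].
  move=> [k s] /=; have [Qs|nQ] := pselect (Q k s); last by exists s => /nQ.
  move: Qs; case: s => -[c1 b1] X1 [/= X1T LA1 B1 XX1 U1].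
  set a := rho ^+ k in U1.
  have a0 : 0 < a by rewrite exprn_gt0.
  have a1 : a <= 1 by rewrite exprn_ile1// ltW.
  have hk0 : 0 < 2^-1 ^+ k :> R by rewrite exprn_gt0// invr_gt0.
  have hk : C0 * m * (2 - 2 * 2^-1 ^+ k) <= C0 * m * 2 by rewrite ler_pM2l//; clear -hk0; lra.
  have Cm4 : 4 * (C0 * m) <= C * m by rewrite mulrA ler_pM2r.
  have Bk : enorm (b1 - b) <= C0 * m * 2 by exact: le_trans hk.
  have XX : mnorm X1 <= mnorm X + C * m.
    have := mnormD X (X1 - X); rewrite addrC subrK.
    by have := le_trans XX1 hk; clear -Cm4 C0m; lra.
  pose v z := a^-1 * u (0 + a *: z).
  have Vv : visc_ball p (a * f) 0 1 v.
    by apply: visc_scale => //; rewrite mulr1; exact: visc_ball_le V.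
  have aq : a * (rho / 2) ^+ k = (rho ^+ 2 / 2) ^+ k.
    by rewrite /a -exprMn; congr (_ ^+ _); ring.
  have aq' : (rho / 2) ^+ k = a * 2^-1 ^+ k by rewrite /a -exprMn.
  have mk0 : 0 < m * (rho / 2) ^+ k by rewrite mulr_gt0// exprn_gt0// divr_gt0.
  have mkm : m * (rho / 2) ^+ k <= m.
    rewrite ler_piMr ?(ltW m0)// exprn_ile1//; first by rewrite divr_ge0// ltW.
    by clear -r1; lra.
  have b1b : b0 <= enorm b1.
    have := ler_enormB b1 (b1 - b); have -> : b1 - (b1 - b) = b by rewrite opprB addrC subrK.
    by clear -Bk bb mC Cm4 C0m; lra.
  have b1L : enorm b1 <= 2 * L.
    have := ler_enormD (b1 - b) b; rewrite subrK.
    by clear -Bk bL1 bL mC Cm4 C0m; lra.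
  have aX : mnorm (a *: X1) <= mnorm X + C * m.
    by rewrite mnormZ gtr0_norm//; apply: le_trans XX; rewrite ler_piMl ?mnorm_ge0.
  have tm0 : 0 <= t * m by rewrite mulr_ge0// ltW.
  have aXm : mnorm (a *: X1) ^+ 2 <= t * (m * (rho / 2) ^+ k).
    rewrite mnormZ gtr0_norm// exprMn [leLHS]mulrC [leRHS]mulrA; apply: ler_pM; rewrite ?sqr_ge0//.
      apply: le_trans Xm'; rewrite lerXn2r ?nnegrE ?mnorm_ge0//.
      by apply: le_trans XX; rewrite mnorm_ge0.
    rewrite /a exprAC lerXn2r ?nnegrE ?sqr_ge0 ?divr_ge0 ?(ltW r0)//.
    by rewrite expr2 ler_pM2l.
  have S := step v (a * f) (m * (rho / 2) ^+ k) (a^-1 * c1) b1 (a *: X1) Vv b1b mk0 (le_trans mkm mt) (le_trans aX Xt) aXm.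
  feed S; first by rewrite linearZ/= X1T.
  feed S; first by rewrite LAZ LA1 mulrN.
  feed S.
    move=> x x1; rewrite /v add0r qpoly_scale ?gt_eqF// -mulrBr normrM gtr0_norm ?invr_gt0//.
    rewrite ler_pdivrMl// mulrCA aq; apply: U1.
    by rewrite enormZ gtr0_norm// -[ltRHS]mulr1 ltr_pM2l.
  feed S.
    move=> x y x1 y1.
    have -> : v x - qpoly (a^-1 * c1) b1 (a *: X1) x - (v y - qpoly (a^-1 * c1) b1 (a *: X1) y) =
      (v x - v y) - (qpoly (a^-1 * c1) b1 (a *: X1) x - qpoly (a^-1 * c1) b1 (a *: X1) y) by ring.
    apply: le_trans (ler_normB _ _) _.
    have h1 := @qpoly_lip (a^-1 * c1) 1 b1 (a *: X1) x y _ x1 y1 (le_trans aX Xone).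
    have {}h1 : `|qpoly (a^-1 * c1) b1 (a *: X1) x - qpoly (a^-1 * c1) b1 (a *: X1) y| <= (2 * L + 1) * enorm (x - y).
      apply: le_trans (h1 _) _; first by rewrite linearZ/= X1T.
      by rewrite ler_wpM2r ?enorm_ge0// lerD2r.
    have h2 : `|v x - v y| <= L * enorm (x - y).
      rewrite /v -mulrBr !add0r normrM gtr0_norm ?invr_gt0// ler_pdivrMl//.
      have sm z : enorm z < 1 -> enorm (a *: z) < 1.
        by move=> z1; rewrite enormZ gtr0_norm//; apply: le_lt_trans z1; rewrite ler_piMl ?enorm_ge0.
      apply: le_trans (hLip _ _ (sm _ x1) (sm _ y1)) _.
      by rewrite -scalerBr enormZ gtr0_norm// mulrCA.
    by clear -h1 h2; lra.
  move: S => [c' [b' [X' [X'T LA' _ [B' XX'] U']]]].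
  have Xd : mnorm (a^-1 *: X' - X1) <= C0 * m * 2^-1 ^+ k.
    have -> : a^-1 *: X' - X1 = a^-1 *: (X' - a *: X1).
      by rewrite scalerBr scalerA mulVf ?gt_eqF// scale1r.
    by rewrite mnormZ gtr0_norm ?invr_gt0// ler_pdivrMl//; move: XX'; rewrite aq'; clear; lra.
  have Bd : enorm (b' - b1) <= C0 * m * (rho / 2) ^+ k by move: B'; rewrite mulrA.
  have rk : (rho / 2) ^+ k <= 2^-1 ^+ k.
    by rewrite lerXn2r ?nnegrE ?divr_ge0 ?invr_ge0 ?(ltW r0)//; clear -r1; lra.
  exists (a * c', b', a^-1 *: X') => _; split=> //; split=> /=.
  - by rewrite linearZ/= X'T.
  - by rewrite LAZ LA' mulrN mulKf ?gt_eqF.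
  - have -> : b' - b = (b' - b1) + (b1 - b) by rewrite addrA subrK.
    apply: le_trans (ler_enormD _ _) _; rewrite exprS.
    have := ler_wpM2l (ltW C0m) rk; clear -Bd B1; lra.
  - have -> : a^-1 *: X' - X = (a^-1 *: X' - X1) + (X1 - X) by rewrite addrA subrK.
    apply: le_trans (mnormD _ _) _; rewrite exprS.
    by clear -Xd XX1; lra.
  - move=> x xk.
    have zr : enorm (a^-1 *: x) <= rho.
      by rewrite enormZ gtr0_norm ?invr_gt0// ler_pdivrMl//; move: xk; rewrite exprSr => /ltW.
    have := U' _ zr; rewrite /v add0r scalerA mulfV ?gt_eqF// scale1r => h.
    have := qpoly_scale (a * c') b' (a^-1 *: X') (a^-1 *: x) (lt0r_neq0 a0).
    rewrite mulKf ?gt_eqF// !scalerA mulfV ?gt_eqF// !scale1r => E.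
    rewrite E -mulrBr normrM gtr0_norm ?invr_gt0// ler_pdivrMl// in h.
    apply: le_trans h _; apply: eq_ler.
    by rewrite [in RHS]exprS -aq; field.
have [F hF] := choice stp.
pose s := fix s k := if k is j.+1 then F (j, s j) else (c, b, X).
have sQ k : Q k (s k).
  elim: k => [|k IH]; last by have [] := hF (k, s k) IH.
  split=> //=; rewrite ?expr0 ?mulr1 ?subrr ?mulr0 ?enorm0 ?mnorm0//.
have sd k := hF (k, s k) (sQ k).
have q2 : rho / 2 <= 2^-1 by clear -r1; lra.
have /choice[lb hlb] : forall i, exists l, forall k, `|(s k).1.2 0 i - l| <= 2 * (C0 * m) * (rho / 2) ^+ k.
  move=> i; apply: geometric_limit => //; rewrite ?divr_ge0 ?(ltW r0) ?(ltW C0m)// => k.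
  have [_ h _] := sd k; apply: le_trans h; have := coord_le_enorm ((s k.+1).1.2 - (s k).1.2) i.
  by rewrite !mxE.
have /choice[lX hlX] : forall ij : 'I_n * 'I_n, exists l, forall k,
    `|(s k).2 ij.1 ij.2 - l| <= 2 * (C0 * m) * 2^-1 ^+ k.
  move=> [i j]; apply: geometric_limit => //; rewrite ?invr_ge0 ?(ltW C0m)// => k.
  have [_ _ h] := sd k; apply: le_trans h; rewrite /mnorm (bigD1 i)//= (bigD1 j)//= !mxE -addrA lerDl.
  by rewrite addr_ge0// sumr_ge0// => *; rewrite sumr_ge0.
pose b' := \row_i lb i.
(* The limits are picked entry by entry; reading off one triangle makes [X'] symmetric by
   construction. *)
pose X' := \matrix_(i, j) if (i <= j)%N then lX (i, j) else lX (j, i).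
have X'T : X'^T = X'.
  by apply/matrixP => i j; rewrite !mxE; case: ltngtP => // /val_inj ->.
have sT k : (s k).2^T = (s k).2 by have [] := sQ k.
have Bk k : enorm ((s k).1.2 - b') <= C * m * (rho / 2) ^+ k.
  apply: le_trans (enorm_le_coord (G := 2 * (C0 * m) * (rho / 2) ^+ k) n0 _) _.
    by move=> i; rewrite !mxE.
  rewrite [leLHS]mulrA ler_wpM2r ?exprn_ge0 ?divr_ge0 ?(ltW r0)// /C.
  have := ler_wpM2r (ltW C0m) n2; have : 0 <= n%:R * (C0 * m) by rewrite mulr_ge0// ltW.
  by clear; lra.
have Xk k : mnorm ((s k).2 - X') <= C * m * 2^-1 ^+ k.
  apply: le_trans (mnorm_le_coord (G := 2 * (C0 * m) * 2^-1 ^+ k) _) _.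
    move=> i j; rewrite !mxE; case: ifP => _; first exact: (hlX (i, j)).
    by rewrite -sT mxE; exact: (hlX (j, i)).
  rewrite [leLHS]mulrA ler_wpM2r ?exprn_ge0 ?invr_ge0// /C.
  have : 0 <= n%:R ^+ 2 * (C0 * m) by rewrite mulr_ge0 ?sqr_ge0// ltW.
  by clear; lra.
exists b', X'; split=> //.
- apply: (iterated_expansion r0 r2 m0 _ _ Bk Xk); first by rewrite mulr_ge0// ltW.
  by move=> k; have [] := sQ k.
- by have := Bk 0%N; rewrite /= expr0 mulr1 enormC.
- by have := Xk 0%N; rewrite /= expr0 mulr1 -mnormN opprB.
Qed.

End SchauderIteration.

(** * Hopf's lemma and the strong maximum principle from pointwise jets *)

Section StrongMaximum.
Context {R : realType} {n : nat}.
Implicit Types (x y z h q b e : 'rV[R]_n) (X Y M N : 'M[R]_n) (f g w eta : 'rV[R]_n -> R).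

(** The substitute for [C2] regularity. Nothing relates the jets at different points; the uniform
    constants [b0] and [K] are enough for the maximum principles. *)
Definition reg p (b0 K : R) f x := exists b X, [/\ jet f x b X, LA p b X = - p, b0 <= enorm b & mnorm X <= K].

(* At a local minimum of [f - g - k eta] the gradients differ by [k q], so that
   the two frozen operators differ by [O(k |q|)]. *)
Lemma no_touch p (b0 K k s : R) f g eta y b1 X1 b2 X2 q Y : 1 < p -> 0 < b0 ->
  jet f y b1 X1 -> LA p b1 X1 = - p -> b0 <= enorm b1 -> mnorm X1 <= K ->
  jet g y b2 X2 -> LA p b2 X2 = - p -> b0 <= enorm b2 -> mnorm X2 <= K ->
  jet eta y q Y -> 0 < k -> 0 < s ->
  8 * `|p - 2| / b0 * K * enorm q < LA p b1 Y + LA p b2 Y ->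
  (forall h, enorm h < s -> f y - g y - k * eta y <= f (y + h) - g (y + h) - k * eta (y + h)) -> False.
Proof.
move=> p1 b00 J1 E1 B1 K1 J2 E2 B2 K2 J k0 s0 big min.
have [|E Q] := jet_touch (g := fun z => g z + k * eta z) s0 _ J1.1 (jetD J2 (jetZ k J)).2.
  by move=> h /min; clear; lra.
have z1 : b1 != 0 by rewrite -enorm_gt0; lra.
have z2 : b2 != 0 by rewrite -enorm_gt0; lra.
have L1 := LA_le p1 z1 Q; have L2 := LA_le p1 z2 Q.
rewrite LAD LAZ E1 in L1; rewrite LAD LAZ E2 in L2.
have bb : enorm (b1 - b2) = k * enorm q by rewrite E addrC addKr enormZ gtr0_norm.
have K0 : 0 <= K by apply: le_trans K1; exact: mnorm_ge0.
have lip b b' X : b != 0 -> b' != 0 -> b0 <= enorm b -> mnorm X <= K -> enorm (b - b') = k * enorm q ->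
    `|LA p b X - LA p b' X| <= 4 * `|p - 2| / b0 * K * (k * enorm q).
  move=> b_ b'_ bb0 XK bq; apply: le_trans (LA_lip _ _ b_ b'_) _; rewrite bq.
  have i0 : (enorm b)^-1 <= b0^-1 by rewrite lef_pV2// posrE//; lra.
  have q0 : 0 <= k * enorm q by rewrite mulr_ge0 ?enorm_ge0 ?ltW.
  have -> : 4 * `|p - 2| / b0 * K * (k * enorm q) = `|p - 2| * (4 * b0^-1 * (k * enorm q)) * K by ring.
  apply: ler_pM; rewrite ?mnorm_ge0// ?mulr_ge0 ?invr_ge0 ?enorm_ge0 ?(ltW k0)//.
  by rewrite ler_wpM2l// ler_wpM2r// ler_wpM2l.
have H1 := lip b1 b2 X2 z1 z2 B1 K2 bb; rewrite E2 in H1.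
have H2 := lip b2 b1 X1 z2 z1 B2 K1 (etrans (enormC _ _) bb); rewrite E1 in H2.
have := ltr_pM2l k0 (8 * `|p - 2| / b0 * K * enorm q) (LA p b1 Y + LA p b2 Y); rewrite big => H3.
have {}H3 : 2 * (4 * `|p - 2| / b0 * K * (k * enorm q)) < k * (LA p b1 Y + LA p b2 Y).
  by rewrite (_ : 2 * _ = k * (8 * `|p - 2| / b0 * K * enorm q)); [rewrite H3|ring].
move: H1 H2 => /ler_normlP[a1 a2] /ler_normlP[a3 a4].
by clear -H3 L1 L2 a1 a2 a3 a4; lra.
Qed.

Lemma compact_barrier (A : set 'rV[R]_n) w eta : compact A -> cont_on A w -> cont_on A eta ->
  (forall y, A y -> w y < eta y -> exists2 s, 0 < s & (forall h, enorm h < s -> A (y + h)) /\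
     ~ (forall h, enorm h < s -> w y - eta y <= w (y + h) - eta (y + h))) ->
  forall y, A y -> eta y <= w y.
Proof.
move=> cA cw ce H y0 Ay0; rewrite leNgt; apply/negP => lt.
have ex : A !=set0 by exists y0.
have [y Ay min] := compact_min cA ex (cont_onB cw ce).
have [|s s0 [As []]] := H y Ay; first by have := min y0 Ay0; clear -lt; lra.
by move=> h /As; exact: min.
Qed.

(** From [(b / a)^N >= b / a], which uses [N >= 1], and [b^2 >= a (2 b - a)]. *)
Lemma pow_gap (a b N : R) : 0 < a -> a <= b -> 1 <= N ->
  b `^ (- N - 1) * (b - a) <= a `^ (- N) - b `^ (- N).
Proof.
move=> a0 ab N1; have b0 : 0 < b by exact: lt_le_trans ab.
have T : b `^ (- N) = b `^ (- N - 1) * b.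
  by rewrite -[in LHS](subrK 1 (- N)) powRD ?(gt_eqF b0) ?implybT// powRr1// ltW.
have A0 : 0 < a `^ (- N) by rewrite powR_gt0.
have B0 : 0 < b `^ (- N) by rewrite powR_gt0.
have ba : 1 <= b / a by rewrite ler_pdivlMr// mul1r.
have E : a `^ (- N) = b `^ (- N) * (b / a) `^ N.
  have -> : b / a = b * a `^ (-1) by rewrite powR_inv1// ltW.
  rewrite powRM ?powR_ge0 ?(ltW b0)// -powRrM mulN1r mulrA -powRD ?(gt_eqF b0) ?implybT//.
  by rewrite addNr powRr0 mul1r.
have h : b / a <= (b / a) `^ N by rewrite -[leLHS]powRr1 ?ler_powR// (le_trans _ ba).
rewrite E; have := ler_wpM2l (ltW B0) h; rewrite T => h1.
have B1 : 0 < b `^ (- N - 1) by rewrite powR_gt0.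
have : b `^ (- N - 1) * (2 * b - a) <= b `^ (- N - 1) * b * (b / a).
  rewrite -mulrA ler_pM2l// mulrA ler_pdivlMr// -subr_ge0.
  by rewrite (_ : _ - _ = (b - a) ^+ 2) ?sqr_ge0//; ring.
by clear -h1; lra.
Qed.

Lemma pow_gap_annulus (D t N : R) : 0 < D -> D / 2 <= t -> t < D -> 1 <= N ->
  (D ^+ 2) `^ (- N - 1) * (D / 2 * (D - t)) <= (t ^+ 2) `^ (- N) - (((t + D) / 2) ^+ 2) `^ (- N).
Proof.
move=> D0 y1 y2 N1; set D' := (t + D) / 2.
have [tD' D'D] : t < D' /\ D' < D by rewrite /D'; move: y2; clear; split; lra.
have t0 : 0 < t by clear -D0 y1; lra.
have D'0 : 0 < D' by clear -t0 tD'; lra.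
have tt : t ^+ 2 <= D' ^+ 2 by rewrite lerXn2r ?nnegrE ?ltW.
have N0 : 0 <= N by clear -N1; lra.
apply: le_trans (pow_gap (exprn_gt0 2 t0) tt N1).
apply: ler_pM; rewrite ?powR_ge0//.
- by rewrite mulr_ge0 ?subr_ge0 ?(ltW y2)// divr_ge0// ltW.
- rewrite -opprD !powRN lef_pV2 ?posrE ?powR_gt0 ?exprn_gt0//.
  by apply: ge0_ler_powR; rewrite ?nnegrE ?sqr_ge0 ?lerXn2r ?nnegrE ?addr_ge0 ?(ltW D'0) ?(ltW D0) ?(ltW D'D) ?N0.
- by rewrite /D'; move: y1 y2; clear; nra.
Qed.

Lemma Hopf_exponent p (T : R) : 1 < p -> exists N : R, 1 <= N /\ T <= 2 * (N + 1) * lmin p.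
Proof.
move=> p1; have l0 := lmin_gt0 p1; exists (1 + `|T| / (2 * lmin p)).
split; first by rewrite lerDl divr_ge0 ?mulr_ge0// ltW.
rewrite (_ : 2 * _ * _ = `|T| + 4 * lmin p); last by field; rewrite gt_eqF.
by have := ler_norm T; clear -l0; lra.
Qed.

Lemma compact_annulus x (a d : R) : compact [set y | a <= enorm (y - x) <= d].
Proof.
have -> : [set y | a <= enorm (y - x) <= d] = [set y | a <= enorm (y - x)] `&` cball x d.
  by apply/seteqP; split=> y /=; [move=> /andP[]|move=> [-> ->]].
apply: (@compact_enorm _ _ _ (d + enorm x)).
  move=> y [_ /= yr]; rewrite -[y](subrK x); apply: le_trans (ler_enormD _ _) _; by rewrite lerD2r.
apply: closedI2; first by apply: closed_le; [move=> w; exact: cst_continuous|exact: cont_enormB].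
by apply: compact_closed; [exact: norm_hausdorff|exact: compact_cball].
Qed.

Lemma reg_cont p (b0 K : R) f x : reg p b0 K f x -> {for x, continuous f}.
Proof. by move=> [b [X [J _ _ _]]]; exact: jet_cont J. Qed.

(** [D0] is so small that the first-order error of [no_touch], [C] times the gradient of the
    barrier, is below its second-order gain from the two operators. The resulting [k] depends on
    neither the functions nor the centre, so it can be used for whole families of balls. *)
Lemma Hopf_ball p (b0 K : R) : 1 < p -> (0 < n)%N -> 0 < b0 -> 0 <= K -> exists2 D0, 0 < D0 &
  forall D m : R, 0 < D -> D <= D0 -> 0 < m -> exists2 k, 0 < k & forall f g x0,
  (forall y, enorm (y - x0) < D -> reg p b0 K f y /\ reg p b0 K g y) ->
  (forall y, enorm (y - x0) < D -> g y <= f y) ->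
  (forall y, enorm (y - x0) = D / 2 -> m <= f y - g y) ->
  forall y, D / 2 <= enorm (y - x0) -> enorm (y - x0) < D -> k * (D - enorm (y - x0)) <= f y - g y.
Proof.
move=> p1 n0 b00 K0; pose C := 8 * `|p - 2| / b0 * K.
have C0 : 0 <= C by rewrite !mulr_ge0// ?invr_ge0 ltW.
have [N [N1 hN]] := Hopf_exponent (n%:R + p - 1) p1; have N0 : 0 < N by lra.
exists (C + 1)^-1; first by rewrite invr_gt0 ltr_wpDl.
move=> D m D0 DC m0; have C1 : 0 < C + 1 by rewrite ltr_wpDl.
have CD : C * D < 2.
  have : D * (C + 1) <= 1 by rewrite -ler_pdivlMr// mul1r.
  by clear -D0; lra.
pose k0 := m * ((D / 2) ^+ 2) `^ N.
have D2 : 0 < D / 2 by rewrite divr_gt0.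
have k00 : 0 < k0 by rewrite mulr_gt0// powR_gt0// exprn_gt0.
have Dp : 0 < (D ^+ 2) `^ (- N - 1) by rewrite powR_gt0// exprn_gt0.
exists (k0 * (D ^+ 2) `^ (- N - 1) * (D / 2)); first by rewrite mulr_gt0// mulr_gt0.
move=> f g x0 rg fg hm y0 y1 y2.
(* Nothing is known on the sphere of radius [D], so the barrier is made to vanish at an intermediate
   radius [D'], where [g <= f] holds; [pow_gap_annulus] recovers the factor [D - t]. *)
set t := enorm (y0 - x0) in y1 y2 *; pose D' := (t + D) / 2.
have [tD' D'D] : t < D' /\ D' < D by rewrite /D'; move: y2; clear; split; lra.
have D'0 : 0 < D' by clear -D2 y1 tD'; lra.
pose eta y := dot (y - x0) (y - x0) `^ (- N) - (D' ^+ 2) `^ (- N).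
have etaJ y : y != x0 -> exists Y, jet eta y (pow_grad N (y - x0)) Y /\
    forall q, q != 0 -> 2 * N * dot (y - x0) (y - x0) `^ (- N - 1) <= LA p q Y.
  move=> yx; have [Y [J L]] := jet_pow_neg N yx; exists Y; split; last first.
    by move=> q q0; have := L p q 1; rewrite !mul1r; apply=> //; [exact: ltW|move: hN; clear; lra].
  by have := jetD J (jet_cst (- (D' ^+ 2) `^ (- N)) y); rewrite !addr0.
have ne y : D / 2 <= enorm (y - x0) -> y != x0.
  by move=> h; rewrite -subr_eq0 -enorm_gt0; exact: lt_le_trans h.
suff key y : D / 2 <= enorm (y - x0) <= D' -> k0 * eta y <= f y - g y.
  have := key y0; rewrite -/t y1 ltW// => /(_ isT); apply: le_trans.
  have -> : k0 * (D ^+ 2) `^ (- N - 1) * (D / 2) * (D - t) = k0 * ((D ^+ 2) `^ (- N - 1) * (D / 2 * (D - t))) by ring.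
  by rewrite ler_pM2l// /eta -enorm_sqr -/t pow_gap_annulus.
have inD z : D / 2 <= enorm (z - x0) <= D' -> enorm (z - x0) < D.
  by move=> /andP[_ h]; exact: le_lt_trans D'D.
move: y; apply: (@compact_barrier _ (fun y => f y - g y) (fun y => k0 * eta y) (@compact_annulus x0 (D / 2) D')).
- apply: cont_onW => z /inD/rg[r1 r2]; exact: continuousB (reg_cont r1) (reg_cont r2).
- by apply: cont_onW => z /andP[/ne/etaJ[Y [J _]] _]; exact: jet_cont (jetZ k0 J).
move=> z zA lt; have /andP[z1 z2] := zA; have zD := inD z zA.
have {}z1 : D / 2 < enorm (z - x0).
  rewrite lt_neqAle z1 andbT; apply/eqP => E; have := hm z (esym E).
  suff : k0 * eta z <= m by clear -lt; lra.
  rewrite /eta -enorm_sqr -E /k0 -mulrA ler_piMr ?(ltW m0)//.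
  have : ((D / 2) ^+ 2) `^ N * ((D / 2) ^+ 2) `^ (- N) = 1.
    by rewrite -powRD ?subrr ?powRr0// (gt_eqF (exprn_gt0 2 D2)) implybT.
  by rewrite mulrBr => ->; rewrite gerBl mulr_ge0 ?powR_ge0.
have {}z2 : enorm (z - x0) < D'.
  rewrite lt_neqAle z2 andbT; apply/eqP => E; have := fg z zD; move: lt.
  by rewrite /eta -enorm_sqr E subrr mulr0; clear; lra.
pose s := Num.min (enorm (z - x0) - D / 2) (D' - enorm (z - x0)).
have s0 : 0 < s by rewrite lt_min !subr_gt0 z1.
exists s => //; split.
  move=> h; rewrite /s lt_min => /andP[h1 h2] /=.
  have E : z + h - x0 = (z - x0) + h by rewrite addrAC.
  have := ler_enormD (z - x0) h; rewrite -E => e1.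
  have := ler_enormB (z + h - x0) h; rewrite {1}E addrK => e2.
  by apply/andP; split; clear -h1 h2 e1 e2; lra.
have [[b1 [X1 [J1 E1 B1 M1]]] [b2 [X2 [J2 E2 B2 M2]]]] := rg z zD.
have [Y [J L]] := etaJ z (ne z (ltW z1)).
apply: (no_touch p1 b00 J1 E1 B1 M1 J2 E2 B2 M2 J k00 s0).
have z1' : b1 != 0 by rewrite -enorm_gt0; lra.
have z2' : b2 != 0 by rewrite -enorm_gt0; lra.
have := L b1 z1'; have := L b2 z2'; rewrite -/C /pow_grad enormZ normrN.
have P0 : 0 < 2 * N * dot (z - x0) (z - x0) `^ (- N - 1).
  by rewrite !mulr_gt0// powR_gt0// dot_gt0 subr_eq0 ne// ltW.
rewrite (gtr0_norm P0); move: (2 * N * _) P0 => P P0.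
have : C * enorm (z - x0) < 2.
  by apply: le_lt_trans CD; rewrite ler_wpM2l// ltW.
by rewrite -(ltr_pM2l P0); clear; lra.
Qed.

Lemma enorm_open (A : set 'rV[R]_n) :
  (forall x, A x -> exists2 r, 0 < r & forall y, enorm (y - x) < r -> A y) -> open A.
Proof. by move=> H; rewrite openE => x /H[r r0 hr]; apply/nbhs_enorm; exists r. Qed.

(** Walk from [x2], where [g < f] is assumed, towards [x1] until the strict inequality first fails,
    and take the largest ball around a point just before in which it still holds. At a contact point
    [Hopf_ball] gives linear growth of [f - g] into the ball, while an interior minimum has equal
    gradients and at most quadratic growth. *)
Lemma strong_max p (b0 K : R) (U : set 'rV[R]_n) f g : 1 < p -> (0 < n)%N -> 0 < b0 -> 0 <= K -> open U ->
  (forall x y t, U x -> U y -> 0 <= t -> t <= 1 -> U (x + t *: (y - x))) ->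
  (forall y, U y -> reg p b0 K f y /\ reg p b0 K g y) -> (forall y, U y -> g y <= f y) ->
  forall x1 x2, U x1 -> f x1 = g x1 -> U x2 -> f x2 = g x2.
Proof.
move=> p1 n0 b00 K0 oU cU rg fg x1 x2 U1 E1 U2; apply/eqP; rewrite eq_le fg// andbT leNgt.
apply/negP => lt; have [D0 D00 hopf] := Hopf_ball p1 n0 b00 K0.
pose P := [set y | U y /\ g y < f y].
have cw y : U y -> {for y, continuous (fun z => f z - g z)}.
  by move=> /rg[r1 r2]; exact: continuousB (reg_cont r1) (reg_cont r2).
have oP : open P.
  apply: enorm_open => y [Uy yl]; have [r1 r10 h1] := open_enorm oU Uy.
  have /cont_enorm/(_ _ (_ : 0 < f y - g y))[|r2 r20 h2] := cw y Uy; first by rewrite subr_gt0.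
  exists (Num.min r1 r2); first by rewrite lt_min r10.
  move=> z; rewrite lt_min => /andP[/h1 Uz /h2 /ltr_normlP[a1 a2]]; split=> //.
  by clear -a1 a2; lra.
have [|t [t0 t1 bt inP]] := @exit_point _ _ P x2 (x1 - x2) oP (conj U2 lt).
  by rewrite addrC subrK => -[_]; rewrite E1 ltxx.
set xs := x2 + t *: (x1 - x2) in bt.
have Us : U xs by apply: cU => //; exact: ltW.
have ws : f xs - g xs = 0.
  have [_ nP] := (boundaryE _ oP).1 bt; have := fg _ Us; rewrite -subr_ge0 => ge.
  apply/eqP; rewrite eq_le ge andbT leNgt; apply/negP; rewrite subr_gt0 => l; exact: nP.
have [r r0 hr] := open_enorm oU Us.
have x12 : 0 < enorm (x1 - x2).
  by rewrite enorm_gt0 subr_eq0; apply/eqP => E; move: lt; rewrite -E E1 ltxx.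
(* The balls around [x3] stay in [U], have radius allowed by [Hopf_ball], and [x3] is still on the
   segment. *)
pose dl := Num.min (Num.min (r / 3) D0) (t * enorm (x1 - x2)).
have dl0 : 0 < dl by rewrite !lt_min divr_gt0// D00 mulr_gt0.
pose s := t - dl / enorm (x1 - x2); pose x3 := x2 + s *: (x1 - x2).
have x3s : enorm (xs - x3) = dl.
  have -> : xs - x3 = (dl / enorm (x1 - x2)) *: (x1 - x2).
    by rewrite /xs /x3 /s; move: (dl / _) => a; vec.
  by rewrite enormZ gtr0_norm ?divr_gt0// divfK// gt_eqF.
have P3 : P x3.
  apply: inP; rewrite /s subr_ge0 ler_pdivrMr// /dl ge_min lexx orbT/=.
  by rewrite ltrBlDr ltrDl divr_gt0.
have [dr dD] : 3 * dl <= r /\ dl <= D0.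
  split; last by rewrite /dl !ge_min lexx orbT.
  have : dl <= r / 3 by rewrite /dl !ge_min lexx.
  by clear; lra.
have in3 y : enorm (y - x3) <= dl -> U y.
  move=> yd; apply: hr; have := enorm_tri y x3 xs; rewrite (enormC x3) x3s.
  by clear -yd dr dl0; lra.
pose Z := cball x3 dl `&` [set y | f y - g y <= 0].
have cZ : compact Z.
  apply: (@compact_enorm _ _ _ (dl + enorm x3)).
    move=> y [/= yr _]; rewrite -[y](subrK x3); apply: le_trans (ler_enormD _ _) _; by rewrite lerD2r.
  apply: closed_enorm => y H; have yb : enorm (y - x3) <= dl.
    apply/ler_addgt0Pr => e e0; have [z [zd _] zy] := H e e0; have {}zd : enorm (z - x3) <= dl := zd.
    by have := enorm_tri y z x3; rewrite (enormC y z); clear -zd zy; lra.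
  split=> //=; rewrite leNgt; apply/negP => pos.
  have /cont_enorm/(_ _ pos)[r2 r20 h2] := cw y (in3 y yb).
  by have [z [_ /= z0] /h2 /ltr_normlP[a1 a2]] := H r2 r20; clear -z0 a1 a2; lra.
have Zs : Z xs by split; rewrite /cball /= ?x3s ?ws.
have [||y [yd y0] min] := compact_min cZ _ (f := fun y => enorm (y - x3)); first by exists xs.
  by apply: cont_onW => z _; exact: cont_enormB.
have Uy := in3 y yd; have wy : f y - g y = 0.
  by apply/eqP; rewrite eq_le y0/= subr_ge0 fg.
set D := enorm (y - x3) in yd min; have {}yd : D <= dl := yd.
have D_gt0 : 0 < D.
  rewrite enorm_gt0 subr_eq0; apply/eqP => E; move: P3 => [_]; rewrite -E -subr_gt0 wy ltxx.
  by [].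
have pos z : enorm (z - x3) < D -> 0 < f z - g z.
  move=> zD; rewrite ltNge; apply/negP => z0; have := min z; rewrite leNgt zD => /(_ _)/negP; apply=> //.
  by split=> //=; apply: le_trans yd; exact: ltW.
have [||z zD zmin] := @compact_min R n [set z | D / 2 <= enorm (z - x3) <= D / 2] (fun z => f z - g z)
    (@compact_annulus x3 _ _).
- exists (x3 + 2^-1 *: (y - x3)) => /=; rewrite addrC addKr enormZ gtr0_norm ?invr_gt0//.
  by rewrite mulrC lexx.
- apply: cont_onW => z /andP[_ zD]; apply: cw; apply: in3; clear -zD yd D_gt0; lra.
have m0 : 0 < f z - g z by apply: pos; move: zD => /andP[_]; clear -D_gt0; lra.
have [k k0 hk] := hopf D (f z - g z) D_gt0 (le_trans yd dD) m0.
have {}hk := hk f g x3 _ _ _.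
feed hk; first by move=> w /ltW wD; apply/rg/in3/(le_trans wD).
feed hk; first by move=> w /ltW wD; apply/fg/in3/(le_trans wD).
feed hk; first by move=> w wD; apply: zmin => /=; rewrite wD lexx.
have [[b1 [X1 [J1 _ _ _]]] [b2 [X2 [J2 _ _ _]]]] := rg y Uy.
have [r1 r10 h1] := open_enorm oU Uy.
have [|bE _] := jet_touch (g := g) r10 _ J1.1 J2.2.
  by move=> h hr1; rewrite wy subr_ge0; apply/fg/h1; rewrite addrC addKr.
have [C [r2 [C0 r20 h2]]] := jet_bound (jetD J1 (jetN J2)).
pose e := Num.min (Num.min 2^-1 (r2 / (2 * D))) (k / (2 * (C + 1) * D)).
have C1 : 0 < C + 1 by rewrite ltr_wpDl.
have e0 : 0 < e by rewrite !lt_min invr_gt0 ltr0n !divr_gt0 ?mulr_gt0.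
have [e2 er ek] : [/\ e <= 2^-1, e * (2 * D) <= r2 & e * (2 * (C + 1) * D) <= k].
  split; rewrite -?ler_pdivlMr ?mulr_gt0// ?(mulr_gt0 _ D_gt0) ?mulr_gt0//; rewrite /e !ge_min lexx ?orbT//.
have hD : enorm (e *: (x3 - y)) = e * D by rewrite enormZ gtr0_norm// (enormC x3).
have hw : f (y + e *: (x3 - y)) - g (y + e *: (x3 - y)) <= C * (e * D) ^+ 2.
  have := h2 (e *: (x3 - y)).
  have -> : f (y + e *: (x3 - y)) + - g (y + e *: (x3 - y)) - (f y + - g y) - dot (b1 + - b2) (e *: (x3 - y)) =
      f (y + e *: (x3 - y)) - g (y + e *: (x3 - y)).
    by rewrite wy bE subrr dot0l !subr0.
  rewrite -enorm_sqr hD => h3; apply: le_trans (ler_norm _) (h3 _).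
  by have := mulr_gt0 e0 D_gt0; clear -er; lra.
have E3 : enorm (y + e *: (x3 - y) - x3) = (1 - e) * D.
  have -> : y + e *: (x3 - y) - x3 = (1 - e) *: (y - x3) by vec.
  by rewrite enormZ ger0_norm// subr_ge0; clear -e2; lra.
have eD : 0 < e * D by rewrite mulr_gt0.
have {}hk := hk (y + e *: (x3 - y)); rewrite E3 in hk.
feed hk; first by have := ler_wpM2r (ltW D_gt0) e2; clear; lra.
feed hk; first by clear -eD; lra.
have {}hk : k * (e * D) <= C * (e * D) * (e * D) by move: hk hw; rewrite expr2; clear; lra.
rewrite ler_pM2r// in hk; have := mulr_ge0 C0 (ltW eD).
by clear -hk ek eD; lra.
Qed.

End StrongMaximum.

(** * Mirror images, and Taylor estimates from jets with bounded Hessian *)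

Section Mirror.
Context {R : realType} {n : nat}.
Implicit Types (x y z h q b e : 'rV[R]_n) (X Y M N : 'M[R]_n) (f g u : 'rV[R]_n -> R) (p lam : R).

Definition mir e lam x := x + (2 * (lam - dot x e)) *: e.

Lemma mirE e lam x : enorm e = 1 -> mir e lam x = (2 * lam) *: e + x *m rt (-1) e.
Proof. by move=> /dot1 e1; rewrite mulmx_rt e1 divr1 /mir; vec. Qed.

Lemma mir_dot e lam x : enorm e = 1 -> dot (mir e lam x) e = 2 * lam - dot x e.
Proof. by move=> /dot1 e1; rewrite /mir dotDl dotZl e1; ring. Qed.

Lemma mirror_enorm e h : enorm e = 1 -> enorm (h *m rt (-1) e) = enorm h.
Proof.
move=> e1; have e0 : e != 0 by rewrite -enorm_gt0 e1.
by rewrite /enorm dot_rt// sqrrN expr1n subrr mul0r addr0.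
Qed.

Lemma mir_isom e lam x y : enorm e = 1 -> enorm (mir e lam x - mir e lam y) = enorm (x - y).
Proof.
move=> e1; rewrite !mirE// opprD addrACA subrr add0r -mulmxBl; exact: mirror_enorm.
Qed.

Lemma mirror_dot e h k : enorm e = 1 -> dot (h *m rt (-1) e) k = dot h k - 2 * dot h e * dot k e.
Proof. by move=> /dot1 e1; rewrite mulmx_rt e1 divr1 dotDl dotZl (dotC e k); ring. Qed.

Lemma mirror_sqr e : enorm e = 1 -> rt (-1) e *m rt (-1) e = 1%:M.
Proof.
move=> e1; have e0 : e != 0 by rewrite -enorm_gt0 e1.
by rewrite rt_mul// mulrNN mulr1 rt1.
Qed.

Lemma mirror_LA p e b X : enorm e = 1 ->
  LA p (b *m rt (-1) e) (rt (-1) e *m X *m rt (-1) e) = LA p b X.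
Proof.
move=> e1; have S2 := mirror_sqr e1; rewrite /LA mxtrace_mulC mulmxA S2 mul1mx; congr (_ + _ * (_ / _)).
  by have := bil_mul (rt (-1) e) X (b *m rt (-1) e) (b *m rt (-1) e); rewrite rtT -[b *m _ *m _]mulmxA S2 mulmx1.
by rewrite -!enorm_sqr mirror_enorm.
Qed.

(** [mnorm] is an entrywise sum and not invariant under reflections; this factor is the price of
    mirroring a Hessian. *)
Definition mirror_bound : R := (n%:R + 2 * n%:R ^+ 2) ^+ 2.

Lemma mirror_mnorm e X : enorm e = 1 -> mnorm (rt (-1) e *m X *m rt (-1) e) <= mirror_bound * mnorm X.
Proof.
move=> e1; have e0 : e != 0 by rewrite -enorm_gt0 e1.
have H : mnorm (rt (-1) e) <= n%:R + 2 * n%:R ^+ 2.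
  by apply: le_trans (mnorm_rt _ e0) _; rewrite -opprD normrN ger0_norm ?addr_ge0.
apply: le_trans (mnormM _ _) _; rewrite /mirror_bound expr2 mulrAC.
apply: ler_pM; rewrite ?mnorm_ge0//; apply: le_trans (mnormM _ _) _.
by rewrite ler_wpM2r ?mnorm_ge0.
Qed.

Lemma mir_jet e lam u x b X : enorm e = 1 -> jet u (mir e lam x) b X ->
  jet (fun y => u (mir e lam y)) x (b *m rt (-1) e) (rt (-1) e *m X *m rt (-1) e).
Proof.
move=> e1; rewrite mirE// => /jet_affine; rewrite rtT; apply: jet_ext => y.
by rewrite mirE.
Qed.

Lemma mirror_bound_ge1 : (0 < n)%N -> 1 <= mirror_bound.
Proof.
move=> n0; have n1 : 1 <= n%:R :> R by rewrite ler1n.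
have : 1 <= n%:R + 2 * n%:R ^+ 2 :> R by rewrite (le_trans n1)// lerDl mulr_ge0// sqr_ge0.
move=> h; apply: (@le_trans _ _ (1 ^+ 2)); first by rewrite expr1n.
by rewrite /mirror_bound lerXn2r// nnegrE// (le_trans _ h).
Qed.

Lemma reg_le p (b0 K K' : R) f x : K <= K' -> reg p b0 K f x -> reg p b0 K' f x.
Proof. by move=> KK [b [X [J E B M]]]; exists b, X; split=> //; exact: le_trans KK. Qed.

Lemma reg_mir p (b0 K : R) e lam u x : enorm e = 1 -> reg p b0 K u (mir e lam x) ->
  reg p b0 (mirror_bound * K) (fun y => u (mir e lam y)) x.
Proof.
move=> e1 [b [X [J E B M]]]; exists (b *m rt (-1) e), (rt (-1) e *m X *m rt (-1) e); split.
- exact: mir_jet.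
- by rewrite mirror_LA.
- by rewrite mirror_enorm.
- by apply: le_trans (mirror_mnorm _ e1) _; rewrite ler_wpM2l ?sqr_ge0.
Qed.

(** Otherwise, subtracting the linear function through the excess at 1 gives [F] with
    [F 0 = F 1 = 0], negative just after 0, and with a strictly concave parabola above its graph at
    each point; such an [F] has no interior minimum. *)
Lemma taylor_upper f x h b X (K e : R) : 0 <= K -> 0 < e ->
  (forall t : R, 0 <= t -> t <= 1 -> exists b' X', jet f (x + t *: h) b' X' /\ mnorm X' <= K) ->
  jet f x b X -> mnorm X <= K -> f (x + h) <= f x + dot b h + (K / 2 + e) * dot h h.
Proof.
move=> K0 e0 H J XK; have [->|h0] := eqVneq h 0; first by rewrite !addr0 !dot0r mulr0 !addr0.
have hh : 0 < dot h h by rewrite dot_gt0.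
pose C := (K / 2 + e) * dot h h.
pose G (t : R) := f (x + t *: h) - f x - t * dot b h - C * t ^+ 2.
rewrite leNgt; apply/negP => lt.
have G1 : 0 < G 1 by rewrite /G scale1r /C; clear -lt; lra.
set g1 := G 1 in G1; pose F t := G t - t * g1.
pose ep := e / 2 * dot h h; have ep0 : 0 < ep by rewrite mulr_gt0// divr_gt0.
have loc t b1 X1 : jet f (x + t *: h) b1 X1 -> mnorm X1 <= K -> exists2 r, 0 < r &
    forall s, `|s| < r -> F (t + s) <= F t + s * (dot b1 h - dot b h - 2 * C * t - g1) - ep * s ^+ 2.
  move=> [U _] XK1; have [r r0 hr] := U (e / 2) (divr_gt0 e0 (ltr0n R 2)).
  have h1 : 0 < enorm h by rewrite enorm_gt0.
  exists (r / enorm h); first by rewrite divr_gt0.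
  move=> s; rewrite ltr_pdivlMr// => sr; have := hr (s *: h); rewrite enormZ => /(_ sr).
  rewrite -addrA -scalerDl quadZ dotZr dotZl dotZr /F /G.
  have := ler_quad X1 h; rewrite ler_norml => /andP[_ q1].
  have q2 : quad X1 h <= K * dot h h by apply: le_trans q1 _; rewrite ler_pM2r.
  have := ler_wpM2l (sqr_ge0 s) q2; rewrite /ep /C; move: (f _) (f _) (dot h h) => f1 f2 D.
  by clear; lra.
have [c cI cmin] : exists2 c, c \in `[0, 1] & forall t, t \in `[0, 1] -> F c <= F t.
  apply: EVT_min => //; apply: continuous_in_subspaceT => t; rewrite inE/= in_itv/= => /andP[t0 t1].
  have [b1 [X1 [J1 _]]] := H t t0 t1.
  have cf : {for t, continuous (fun t : R => f (x + t *: h))}.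
    apply: (@continuous_comp _ _ _ (fun t : R => x + t *: h) f); last exact: jet_cont J1.
    by apply: continuousD; [exact: cst_continuous|exact: continuousZl].
  apply: (@continuousB _ _ _ G (fun t : R => t * g1)); last first.
    by apply: continuousM; [exact: cvg_id|exact: cst_continuous].
  apply: (@continuousB _ _ _ (fun t : R => f (x + t *: h) - f x - t * dot b h) (fun t : R => C * t ^+ 2)); last first.
    by apply: continuousM; [exact: cst_continuous|exact: exprn_continuous].
  apply: (@continuousB _ _ _ (fun t : R => f (x + t *: h) - f x) (fun t : R => t * dot b h)); last first.
    by apply: continuousM; [exact: cvg_id|exact: cst_continuous].
  by apply: (@continuousB _ _ _ (fun t : R => f (x + t *: h)) (fun t : R => f x)) => //; exact: cst_continuous.
have F0 : F 0 = 0 by rewrite /F /G scale0r addr0; ring.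
have F1 : F 1 = 0 by rewrite /F -/g1; ring.
have Fneg : F c < 0.
  have [|r r0 hr] := loc 0 b X _ XK; first by rewrite scale0r addr0.
  pose s := Num.min (r / 2) 1.
  have s0 : 0 < s by rewrite lt_min divr_gt0/=.
  have s1 : s <= 1 by rewrite /s ge_min lexx orbT.
  have sr : s <= r / 2 by rewrite /s ge_min lexx.
  have := hr s; rewrite gtr0_norm// add0r F0 => /(_ _) h1.
  have {}h1 := h1 (le_lt_trans sr _).
  have {}h1 := h1 _; have /h1 h2 : r / 2 < r by clear -r0; lra.
  have := cmin s; rewrite in_itv/= (ltW s0) s1 => /(_ isT).
  by have := mulr_gt0 s0 G1; have := mulr_ge0 (ltW ep0) (sqr_ge0 s); clear -h2; lra.
move: (cI); rewrite in_itv/= => /andP[c0 c1].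
have {}c0 : 0 < c by rewrite lt_neqAle c0 andbT; apply/eqP => E; move: Fneg; rewrite -E F0 ltxx.
have {}c1 : c < 1 by rewrite lt_neqAle c1 andbT; apply/eqP => E; move: Fneg; rewrite E F1 ltxx.
have [b1 [X1 [J1 XK1]]] := H c (ltW c0) (ltW c1).
have [r r0 hr] := loc c b1 X1 J1 XK1; move: hr; set be := (_ - g1) => hr.
pose s := Num.min (r / 2) (Num.min c (1 - c)).
have s0 : 0 < s by rewrite !lt_min divr_gt0//= c0 subr_gt0.
have [sr sc sc'] : [/\ s < r, s <= c & s <= 1 - c].
  split; rewrite ?/s ?ge_min ?lexx ?orbT//; apply: (@le_lt_trans _ _ (r / 2)); first by rewrite ge_min lexx.
  by clear -r0; lra.
have H1 := hr s; rewrite gtr0_norm// in H1; have {}H1 := H1 sr.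
have H2 := hr (- s); rewrite normrN gtr0_norm// sqrrN in H2; have {}H2 := H2 sr.
have := cmin (c + s); rewrite in_itv/= => /(_ _) C1.
have {}C1 : F c <= F (c + s) by apply: C1; apply/andP; split; clear -s0 c0 sc'; lra.
have C2 : F c <= F (c - s) by apply: cmin; rewrite in_itv/=; apply/andP; split; clear -s0 c1 sc; lra.
have : 0 < ep * s ^+ 2 by rewrite mulr_gt0// exprn_gt0.
by clear -H1 H2 C1 C2; lra.
Qed.

Lemma taylor_bound f x h b X (K : R) : 0 <= K ->
  (forall t : R, 0 <= t -> t <= 1 -> exists b' X', jet f (x + t *: h) b' X' /\ mnorm X' <= K) ->
  jet f x b X -> mnorm X <= K -> `|f (x + h) - f x - dot b h| <= K / 2 * dot h h.
Proof.
move=> K0 H J XK; apply/ler_addgt0Pr => e e0.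
have d0 : 0 < e / (dot h h + 1) by rewrite divr_gt0// ltr_wpDl ?dot_ge0.
have de : e / (dot h h + 1) * dot h h <= e.
  by rewrite mulrAC ler_pdivrMr ?ltr_wpDl ?dot_ge0// ler_wpM2l ?(ltW e0)// lerDl.
have U := taylor_upper K0 d0 H J XK.
have L : - f (x + h) <= - f x + dot (- b) h + (K / 2 + e / (dot h h + 1)) * dot h h.
  apply: (@taylor_upper (fun y => - f y) x h (- b) (- X)) => //; last 2 first.
  - exact: jetN.
  - by rewrite mnormN.
  move=> t t0 t1; have [b' [X' [J' M']]] := H t t0 t1; exists (- b'), (- X'); split; first exact: jetN.
  by rewrite mnormN.
rewrite dotNl in L; apply/ler_normlP; move: U L de; clear; split; lra.
Qed.

Lemma ball_convex z x y (D t : R) : enorm (x - z) < D -> enorm (y - z) < D -> 0 <= t -> t <= 1 ->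
  enorm (x + t *: (y - x) - z) < D.
Proof.
move=> h1 h2 t0 t1; have -> : x + t *: (y - x) - z = (1 - t) *: (x - z) + t *: (y - z) by vec.
apply: le_lt_trans (ler_enormD _ _) _; rewrite !enormZ !ger0_norm ?subr_ge0//.
have [->|tn] := eqVneq t 1; first by rewrite subrr mul0r add0r mul1r.
have t2 : 0 < 1 - t by rewrite subr_gt0 lt_neqAle tn.
have := ler_wpM2l t0 (ltW h2); have : (1 - t) * enorm (x - z) < (1 - t) * D by rewrite ltr_pM2l.
by clear; lra.
Qed.

(** Expand from [x] and from [y] at two points that differ by [2 *: k], with [k] along [b - b']; in
    the combination only [2 * dot (b - b') k] and four remainders survive, the latter adding up to
    [5 * K * s ^+ 2]. Moving [y] by [th] towards the centre keeps both points in the ball. *)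
Lemma grad_lip f c0 (D K : R) x y b X b' X' : 0 < D -> 0 <= K ->
  (forall z, enorm (z - c0) < D -> exists q Y, jet f z q Y /\ mnorm Y <= K) ->
  enorm (x - c0) < D -> enorm (y - c0) < D -> jet f x b X -> mnorm X <= K ->
  jet f y b' X' -> mnorm X' <= K -> enorm (b - b') <= 5 * K * enorm (x - y).
Proof.
move=> D0 K0 H xD yD J XK J' XK'; have [->|bb] := eqVneq b b'.
  by rewrite subrr enorm0 !mulr_ge0 ?enorm_ge0.
have [xy|xy] := eqVneq x y.
  rewrite xy in J; have [|E _] := jet_touch (f := f) (g := f) ltr01 _ J.1 J'.2.
    by move=> h _; rewrite !subrr.
  by rewrite E eqxx in bb.
set s := enorm (x - y); have s0 : 0 < s by rewrite enorm_gt0 subr_eq0.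
have sD : s < 2 * D.
  by have := enorm_tri x c0 y; rewrite (enormC c0); move: xD yD; rewrite -/s; clear; lra.
have bb0 : 0 < enorm (b - b') by rewrite enorm_gt0 subr_eq0.
pose k := (s / (2 * enorm (b - b'))) *: (b - b').
have kE : enorm k = s / 2.
  by rewrite /k enormZ ger0_norm ?divr_ge0 ?mulr_ge0 ?(ltW s0) ?enorm_ge0//; field; rewrite gt_eqF.
pose th := s / (2 * D); have th0 : 0 < th by rewrite divr_gt0// mulr_gt0.
have thD : th * D = s / 2 by rewrite /th; field; rewrite gt_eqF.
have th1 : th < 1 by rewrite ltr_pdivrMr ?mulr_gt0// mul1r.
have ball d : enorm d = s / 2 -> enorm (y + th *: (c0 - y) + d - c0) < D.
  move=> dE; have -> : y + th *: (c0 - y) + d - c0 = (1 - th) *: (y - c0) + d by vec.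
  apply: le_lt_trans (ler_enormD _ _) _; rewrite dE -thD enormZ gtr0_norm ?subr_gt0//.
  have : (1 - th) * enorm (y - c0) < (1 - th) * D by rewrite ltr_pM2l ?subr_gt0.
  by clear; lra.
have T a a' q Y : enorm (a - c0) < D -> enorm (a' - c0) < D -> jet f a q Y -> mnorm Y <= K ->
    `|f a' - f a - dot q (a' - a)| <= K / 2 * dot (a' - a) (a' - a).
  move=> h1 h2 Jq YK; have := @taylor_bound f a (a' - a) q Y K K0 _ Jq YK.
  rewrite (addrC a) subrK; apply=> t t0 t1; apply: H; exact: ball_convex.
have near d : enorm d = s / 2 -> let z := y + th *: (c0 - y) + d in
    `|f z - f y - dot b' (z - y)| <= K / 2 * s ^+ 2 /\ `|f z - f x - dot b (z - x)| <= K / 2 * (2 * s) ^+ 2.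
  move=> dE z; have zD := ball d dE.
  have zy : enorm (z - y) <= s.
    have -> : z - y = th *: (c0 - y) + d by rewrite /z; vec.
    apply: le_trans (ler_enormD _ _) _; rewrite dE enormZ gtr0_norm// (enormC c0).
    by have := ler_wpM2l (ltW th0) (ltW yD); rewrite thD; clear; lra.
  have zx : enorm (z - x) <= 2 * s.
    by have := enorm_tri z y x; rewrite (enormC y x) -/s; clear -zy; lra.
  split; [apply: le_trans (T y z b' X' yD zD J' XK') _|apply: le_trans (T x z b X xD zD J XK) _];
    rewrite ler_wpM2l ?divr_ge0// -enorm_sqr lerXn2r ?nnegrE ?enorm_ge0 ?mulr_ge0 ?(ltW s0)//.
have [n1 n2] := near k kE; have [|n3 n4] := near (- k); first by rewrite enormN.
have E : dot (b - b') k = s / 2 * enorm (b - b').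
  by rewrite /k dotZr -enorm_sqr; field; rewrite gt_eqF.
suff : s * enorm (b - b') <= s * (5 * K * s) by rewrite ler_pM2l.
move: n1 n2 n3 n4 E; rewrite (dotBl b b' k).
have -> : dot b' (y + th *: (c0 - y) + k - y) = dot b' (th *: (c0 - y)) + dot b' k.
  by rewrite -dotDr; congr dot; vec.
have -> : dot b' (y + th *: (c0 - y) - k - y) = dot b' (th *: (c0 - y)) - dot b' k.
  by rewrite -dotBr; congr dot; vec.
have -> : dot b (y + th *: (c0 - y) + k - x) = dot b (y - x + th *: (c0 - y)) + dot b k.
  by rewrite -dotDr; congr dot; vec.
have -> : dot b (y + th *: (c0 - y) - k - x) = dot b (y - x + th *: (c0 - y)) - dot b k.
  by rewrite -dotBr; congr dot; vec.
move=> /ler_normlP[a1 a2] /ler_normlP[a3 a4] /ler_normlP[a5 a6] /ler_normlP[a7 a8] E.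
by clear -a1 a2 a3 a4 a5 a6 a7 a8 E; lra.
Qed.

End Mirror.

(** * Hopf's lemma at a plane and Serrin's corner lemma *)

Section Corner.
Context {R : realType} {n : nat}.
Implicit Types (x y z h q v b e : 'rV[R]_n) (X Y M N : 'M[R]_n) (f g u : 'rV[R]_n -> R) (p lam : R).

Lemma compact_halfball c0 e (a d D : R) :
  compact [set y | a <= enorm (y - c0) <= D /\ d <= dot (y - c0) e].
Proof.
have -> : [set y | a <= enorm (y - c0) <= D /\ d <= dot (y - c0) e] =
    [set y | d <= dot (y - c0) e] `&` [set y | a <= enorm (y - c0) <= D].
  by apply/seteqP; split=> y /= [? ?].
apply: (@compact_enorm _ _ _ (D + enorm c0)).
  move=> y [_ /= /andP[_ yr]]; rewrite -[y](subrK c0); apply: le_trans (ler_enormD _ _) _.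
  by rewrite lerD2r.
apply: closedI2.
  have J y : jet (fun y => dot (y - c0) e) y e 0.
    have := jetD (jet_dot e y) (jet_cst (- dot c0 e) y); rewrite !addr0; apply: jet_ext => z.
    by rewrite dotBl dotC.
  by apply: closed_le => y; [exact: cst_continuous|exact: jet_cont (J y)].
by apply: compact_closed; [exact: norm_hausdorff|exact: compact_annulus].
Qed.

(** A point close to the plane lies in a ball of radius [rho] tangent to the plane. On the part of
    the half ball at height at least [rho / 2] the difference has a positive minimum, so [Hopf_ball]
    applies to all these balls with one [k]. *)
Lemma Hopf_plane p (b0 K D : R) f g c0 e : 1 < p -> (0 < n)%N -> 0 < b0 -> 0 <= K -> 0 < D ->
  enorm e = 1 ->
  (forall y, enorm (y - c0) < D -> reg p b0 K f y /\ reg p b0 K g y) ->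
  (forall y, enorm (y - c0) < D -> 0 <= dot (y - c0) e -> g y <= f y) ->
  (forall y, enorm (y - c0) < D -> 0 < dot (y - c0) e -> g y < f y) ->
  exists2 k, 0 < k & forall y, enorm (y - c0) <= D / 2 -> 0 <= dot (y - c0) e ->
    k * dot (y - c0) e <= f y - g y.
Proof.
move=> p1 n0 b00 K0 D0 e1 rg fg fg'; have [D1 D10 hopf] := Hopf_ball p1 n0 b00 K0.
pose rho := Num.min (D / 8) D1; have rho0 : 0 < rho by rewrite lt_min divr_gt0.
have r8 : rho <= D / 8 by rewrite /rho ge_min lexx.
have rD1 : rho <= D1 by rewrite /rho ge_min lexx orbT.
pose A := [set y | 0 <= enorm (y - c0) <= 3 / 4 * D /\ rho / 2 <= dot (y - c0) e].
have AB y : A y -> enorm (y - c0) < D by move=> [/andP[_ h] _]; clear -h D0; lra.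
have [||z0 zA zmin] := @compact_min R n A (fun y => f y - g y) (@compact_halfball c0 e 0 (rho / 2) (3 / 4 * D)).
- exists (c0 + (rho / 2) *: e); split; rewrite addrC addKr.
    by rewrite enorm_ge0 enormZ e1 gtr0_norm ?divr_gt0//; clear -r8 D0; lra.
  by rewrite dotZl dot1// mulr1.
- apply: cont_onW => z /AB/rg[r1 r2]; exact: continuousB (reg_cont r1) (reg_cont r2).
have m0 : 0 < f z0 - g z0.
  rewrite subr_gt0 fg' ?AB//; have [_] := zA; apply: lt_le_trans; by rewrite divr_gt0.
set m := f z0 - g z0 in m0 zmin.
have [k k0 hk] := hopf rho m rho0 rD1 m0.
exists (Num.min k (m / D)); first by rewrite lt_min k0 divr_gt0.
move=> y yD; set xi := dot (y - c0) e => x0.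
have yB : enorm (y - c0) < D by clear -yD D0; lra.
have xiD : xi <= D.
  have := dot_le (y - c0) e; rewrite e1 mulr1 -/xi; clear -yB; lra.
have [xr|xr] := leP (rho / 2) xi.
  apply: (@le_trans _ _ m); last by apply: zmin; split=> //; rewrite enorm_ge0; clear -yD D0; lra.
  apply: (@le_trans _ _ (m / D * xi)); first by rewrite ler_wpM2r// ge_min lexx orbT.
  by rewrite mulrAC ler_pdivrMr// ler_pM2l.
have [E|xn] := eqVneq xi 0; first by rewrite E mulr0 subr_ge0 fg// -/xi E.
have x1 : 0 < xi by rewrite lt_neqAle eq_sym xn.
pose c1 := y + (rho - xi) *: e.
have rx : 0 < rho - xi by clear -xr rho0; lra.
have yc1 : enorm (y - c1) = rho - xi.
  have -> : y - c1 = - ((rho - xi) *: e) by rewrite /c1; vec.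
  by rewrite enormN enormZ e1 mulr1 gtr0_norm.
have inB z : enorm (z - c1) <= rho -> enorm (z - c0) <= 3 / 4 * D.
  move=> zr; have := enorm_tri z c1 c0; have := enorm_tri c1 y c0; rewrite (enormC c1 y) yc1.
  by clear -zr r8 yD x1; lra.
have inB' z : enorm (z - c1) <= rho -> enorm (z - c0) < D by move=> /inB; clear -D0; lra.
have up z : rho - enorm (z - c1) <= dot (z - c0) e.
  have -> : z - c0 = (z - c1) + (y - c0) + (rho - xi) *: e by rewrite /c1; vec.
  rewrite (dotDl (z - c1 + (y - c0))) (dotDl (z - c1)) dotZl (dot1 e1) -/xi; have := ler_dot (z - c1) e; rewrite e1 mulr1.
  by move=> /ler_normlP[h1 h2]; clear -h1; lra.
have {}hk := hk f g c1.
feed hk; first by move=> z /ltW/inB'/rg.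
feed hk.
  move=> z zr; apply: fg; first exact/inB'/ltW.
  by apply: le_trans (up z); rewrite subr_ge0 ltW.
feed hk.
  move=> z zr; apply: zmin; split; first by rewrite enorm_ge0 inB// zr; clear -rho0; lra.
  by apply: le_trans (up z); rewrite zr; clear -rho0; lra.
have := hk y; rewrite yc1 => /(_ _ _) h.
have {}h : k * (rho - (rho - xi)) <= f y - g y by apply: h; clear -xr x1; lra.
apply: le_trans h; rewrite opprB addrC subrK.
by rewrite ler_wpM2r// ge_min lexx.
Qed.

Lemma LA_outer p b q k : LA p b (q^T *m k) = dot q k + (p - 2) * (dot q b * dot k b / dot b b).
Proof.
rewrite /LA; have -> : \tr (q^T *m k) = dot q k.
  by have := tr_out q k 1%:M; rewrite mulmx1 bil1 dotC.
by rewrite quadbil bilout !(dotC b) .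
Qed.

(* The mixed second derivatives of the corner barrier see the two operators only
   through this combination, which vanishes on the mirror plane. *)
Lemma mirror_cross (b0 : R) b b' b1 e z : b1 = b' *m rt (-1) e -> 0 < b0 -> enorm e = 1 -> b0 <= enorm b -> b0 <= enorm b' ->
  enorm z <= 1 -> 0 <= dot z e ->
  `|dot e b * dot z b / dot b b + dot e b1 * dot z b1 / dot b1 b1|
    <= 4 / b0 * enorm (b - b') + 2 * dot z e.
Proof.
move=> bE b00 e1 B B' z1 ze.
have bn : b != 0 by rewrite -enorm_gt0; lra.
have bn' : b' != 0 by rewrite -enorm_gt0; lra.
have E1 : dot e b1 = - dot e b'.
  by rewrite bE dotC mirror_dot// (dotC e b') (dot1 e1); ring.
have E2 : dot z b1 = dot z b' - 2 * dot z e * dot e b'.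
  by rewrite bE dotC mirror_dot// (dotC z b') (dotC e b'); ring.
have E3 : dot b1 b1 = dot b' b' by rewrite bE -!enorm_sqr mirror_enorm.
have U (q : 'rV[R]_n) h k : q != 0 -> dot h q * dot k q / dot q q = dot h ((enorm q)^-1 *: q) * dot k ((enorm q)^-1 *: q).
  by move=> qn; rewrite !dotZr -enorm_sqr; field; rewrite enorm_eq0.
have F : dot e b1 * dot z b1 / dot b1 b1 = - (dot e b' * dot z b' / dot b' b') + 2 * dot z e * (dot e b' * dot e b' / dot b' b').
  by rewrite E1 E2 E3; field; rewrite gt_eqF// dot_gt0.
rewrite F !U//.
have := unit_lip bn bn'; have := unit_enorm bn; have := unit_enorm bn'.
set a := _ *: b; set a' := _ *: b' => a'1 a1 lip.
have i0 : (enorm b)^-1 <= b0^-1 by rewrite lef_pV2// posrE//; lra.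
have {}lip : enorm (a - a') <= 2 / b0 * enorm (b - b').
  by apply: le_trans lip _; rewrite ler_wpM2r ?enorm_ge0// ler_wpM2l.
have -> : dot e a * dot z a + (- (dot e a' * dot z a') + 2 * dot z e * (dot e a' * dot e a')) =
   dot e (a - a') * dot z a + dot e a' * dot z (a - a') + 2 * dot z e * (dot e a' * dot e a').
  by rewrite !dotBr; ring.
have P h k (x y : R) : enorm h <= x -> enorm k <= y -> `|dot h k| <= x * y.
  by move=> hx ky; apply: le_trans (ler_dot _ _) _; rewrite ler_pM ?enorm_ge0.
have h1 : `|dot e (a - a') * dot z a| <= 2 / b0 * enorm (b - b').
  rewrite normrM -[leRHS]mulr1; apply: ler_pM => //.
    by rewrite -[leRHS]mul1r; apply: P; rewrite ?e1.
  by rewrite -[leRHS]mulr1; apply: P; rewrite ?a1.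
have h2 : `|dot e a' * dot z (a - a')| <= 2 / b0 * enorm (b - b').
  rewrite normrM -[leRHS]mul1r; apply: ler_pM => //.
    by rewrite -[leRHS]mulr1; apply: P; rewrite ?e1 ?a'1.
  by rewrite -[leRHS]mul1r; apply: P.
have h3 : `|2 * dot z e * (dot e a' * dot e a')| <= 2 * dot z e.
  rewrite normrM ger0_norm ?mulr_ge0// ler_piMr ?mulr_ge0//.
  have : `|dot e a'| <= 1 by rewrite -[leRHS]mulr1; apply: P; rewrite ?e1 ?a'1.
  by rewrite normrM => h; rewrite mulr_ile1.
apply: le_trans (ler_normD _ _) _; have := ler_normD (dot e (a - a') * dot z a) (dot e a' * dot z (a - a')).
by clear -h1 h2 h3; lra.
Qed.

(** The barrier is the product of [P], zero on the mirror plane, and the radial [phi], zero on a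
    sphere. Its Hessian contains the mixed product of their gradients; summed over the operators at
    [u] and at the mirror image this is only a multiple of [xi], by [mirror_cross] and [grad_lip].
    The exponent, through [L], absorbs it, and the quadratic part of [P] absorbs the gradient error
    proportional to [phi]. *)
Lemma corner_barrier p (b0 K : R) : 1 < p -> (0 < n)%N -> 0 < b0 -> 0 <= K -> exists2 D0, 0 < D0 &
  forall D, 0 < D -> D <= D0 -> forall u c0 e, enorm e = 1 ->
  (forall y, enorm (y - c0) < D -> reg p b0 K u y) ->
  (forall y, enorm (y - c0) < D -> 0 <= dot (y - c0) e -> u y <= u (mir e (dot c0 e) y)) ->
  (forall y, enorm (y - c0) < D -> 0 < dot (y - c0) e -> u y < u (mir e (dot c0 e) y)) ->
  exists2 k, 0 < k & forall y, D / 2 <= enorm (y - c0) -> enorm (y - c0) < D -> 0 <= dot (y - c0) e ->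
    k * dot (y - c0) e * (D - enorm (y - c0)) <= u (mir e (dot c0 e) y) - u y.
Proof.
move=> p1 n0 b00 K0; have l0 := lmin_gt0 p1.
pose K1 := @mirror_bound R n * K; have KK1 : K <= K1 by rewrite /K1 ler_peMl// mirror_bound_ge1.
pose C := 8 * `|p - 2| / b0 * K1.
have C0 : 0 <= C by rewrite !mulr_ge0// ?invr_ge0 ?sqr_ge0// ltW.
pose C3 := `|p - 2| * (40 * K / b0 + 2).
have C30 : 0 <= C3 by rewrite mulr_ge0// addr_ge0// divr_ge0 ?mulr_ge0// ltW.
pose L := 3 * (2 + C3) + C + 1.
have [N [N1 hN]] := Hopf_exponent (n%:R + p - 2 + L) p1; have N0 : 0 < N by clear -N1; lra.
(* [4 * M * lmin p] exceeds by 1 the coefficient [3 * C] of [phi] in the error; requiring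
   [D <= M^-1] keeps [P] between [xi] and [2 * xi]. *)
pose M := (3 * C + 1) / (4 * lmin p).
have M0 : 0 < M by rewrite divr_gt0 ?mulr_gt0//; clear -C0; lra.
have ML : 4 * M * lmin p = 3 * C + 1 by rewrite /M; field; rewrite gt_eqF.
clearbody M.
exists (Num.min 1 M^-1); first by rewrite lt_min ltr01 invr_gt0.
move=> D D0; rewrite le_min => /andP[D1]; rewrite -[leRHS]mul1r ler_pdivlMr// => MD u c0 e e1 ru uv uv'.
set lam := dot c0 e in uv uv' *; pose v y := u (mir e lam y).
have mB y : enorm (y - c0) < D -> enorm (mir e lam y - c0) < D.
  by rewrite -{2}(_ : mir e lam c0 = c0) ?mir_isom// /mir subrr mulr0 scale0r addr0.
have rv y : enorm (y - c0) < D -> reg p b0 K1 v y.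
  by move=> /mB/ru r; exact: reg_mir.
have ru1 y : enorm (y - c0) < D -> reg p b0 K1 u y by move=> /ru; exact: reg_le.
have K10 : 0 <= K1 by exact: le_trans KK1.
have rg y : enorm (y - c0) < D -> reg p b0 K1 v y /\ reg p b0 K1 u y.
  by move=> h; split; [exact: rv|exact: ru1].
have [k1 k10 hk1] := Hopf_plane p1 n0 b00 K10 D0 e1 rg uv uv'.
pose k0 := k1 / 2 * ((D / 2) ^+ 2) `^ N.
have D2 : 0 < D / 2 by rewrite divr_gt0.
have k00 : 0 < k0 by rewrite mulr_gt0 ?divr_gt0// powR_gt0// exprn_gt0.
have Dp : 0 < (D ^+ 2) `^ (- N - 1) by rewrite powR_gt0// exprn_gt0.
exists (k0 * ((D ^+ 2) `^ (- N - 1) * (D / 2))); first by rewrite mulr_gt0// mulr_gt0.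
move=> y0 y1 y2 y3.
set t := enorm (y0 - c0) in y1 y2 *; pose D' := (t + D) / 2.
have [tD' D'D] : t < D' /\ D' < D by rewrite /D'; move: y2; clear; split; lra.
have D'0 : 0 < D' by clear -D2 y1 tD'; lra.
pose xi y := dot (y - c0) e.
pose phi y := dot (y - c0) (y - c0) `^ (- N) - (D' ^+ 2) `^ (- N).
pose P y := xi y * (1 + M * xi y).
have JP y : jet P y ((1 + 2 * M * xi y) *: e) ((2 * M) *: (e^T *m e)).
  have J : jet xi y e 0.
    have := jetD (jet_dot e y) (jet_cst (- dot c0 e) y); rewrite !addr0; apply: jet_ext => z.
    by rewrite /xi dotBl dotC.
  have := jetM J (jetD (jet_cst 1 y) (jetZ M J)); rewrite !scaler0 !add0r scaler0 addr0 add0r.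
  rewrite -scalemxAr [2 *: _]scalerA.
  by have -> : xi y *: (M *: e) + (1 + M * xi y) *: e = (1 + 2 * M * xi y) *: e by move: (xi y) => a; vec.
have Jphi y : y != c0 -> exists Y, jet phi y (pow_grad N (y - c0)) Y /\
    forall q, q != 0 -> L * (2 * N * dot (y - c0) (y - c0) `^ (- N - 1)) <= LA p q Y.
  move=> yx; have [Y [J LY]] := jet_pow_neg N yx; exists Y; split.
    by have := jetD J (jet_cst (- (D' ^+ 2) `^ (- N)) y); rewrite !addr0.
  by move=> q; apply: LY => //; exact: ltW.
have ne y : D / 2 <= enorm (y - c0) -> y != c0.
  by move=> h; rewrite -subr_eq0 -enorm_gt0; exact: lt_le_trans h.
have xiD y : enorm (y - c0) < D -> xi y <= D.
  by move=> h; have := dot_le (y - c0) e; rewrite e1 mulr1 -/(xi y); clear -h; lra.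
have Pb y : enorm (y - c0) < D -> 0 <= xi y -> M * xi y <= 1 /\ xi y <= P y <= 2 * xi y.
  move=> /xiD h x0; have h1 : M * xi y <= 1 by apply: le_trans MD; rewrite mulrC ler_wpM2r// ltW.
  split=> //; have := ler_wpM2l x0 h1; have : 0 <= xi y * (M * xi y) by rewrite !mulr_ge0// ltW.
  by rewrite /P; clear; lra.
have phi_ge0 y : 0 < enorm (y - c0) -> enorm (y - c0) <= D' -> 0 <= phi y.
  move=> z0 zD; rewrite /phi -enorm_sqr subr_ge0 !powRN lef_pV2 ?posrE ?powR_gt0 ?exprn_gt0//.
  by apply: ge0_ler_powR; rewrite ?nnegrE ?sqr_ge0 ?lerXn2r ?nnegrE ?(ltW D'0) ?(ltW N0) ?(ltW z0).
suff key y : D / 2 <= enorm (y - c0) <= D' /\ 0 <= dot (y - c0) e -> k0 * (P y * phi y) <= v y - u y.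
  have := key y0; rewrite -/t y1 y3 (ltW tD') => /(_ (conj isT isT)); apply: le_trans.
  have -> : k0 * ((D ^+ 2) `^ (- N - 1) * (D / 2)) * dot (y0 - c0) e * (D - t) =
    k0 * (dot (y0 - c0) e * ((D ^+ 2) `^ (- N - 1) * (D / 2 * (D - t)))) by ring.
  rewrite ler_pM2l//; have [_ /andP[h1 _]] := Pb y0 y2 y3; apply: ler_pM => //.
    by rewrite mulr_ge0 ?(ltW Dp)// mulr_ge0 ?(ltW D2)// subr_ge0 ltW.
  by rewrite /phi -enorm_sqr -/t pow_gap_annulus.
have inD z : D / 2 <= enorm (z - c0) <= D' /\ 0 <= dot (z - c0) e -> enorm (z - c0) < D.
  by move=> [/andP[_ h] _]; exact: le_lt_trans D'D.
have Jeta z : D / 2 <= enorm (z - c0) -> exists q Y, jet (fun y => P y * phi y) z q Y.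
  by move=> /ne/Jphi[Y [J _]]; do 2 eexists; exact: jetM (JP z) J.
move: y; apply: (@compact_barrier _ _ _ (fun y => v y - u y) (fun y => k0 * (P y * phi y))
  (@compact_halfball c0 e (D / 2) 0 D')).
- apply: cont_onW => z /inD zD; exact: continuousB (reg_cont (rv z zD)) (reg_cont (ru z zD)).
- by apply: cont_onW => z [/andP[/Jeta[q [Y J]] _] _]; exact: jet_cont (jetZ k0 J).
move=> z zA lt; have [/andP[z1 z2] z3] := zA; have zD := inD z zA.
have wz : 0 <= v z - u z by rewrite subr_ge0 uv.
have [Mx /andP[P1 P2]] := Pb z zD z3.
have {}z1 : D / 2 < enorm (z - c0).
  rewrite lt_neqAle z1 andbT; apply/eqP => E; have := hk1 z; rewrite -E lexx z3 => /(_ isT isT) h.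
  have : k0 * (P z * phi z) <= k1 * dot (z - c0) e.
    have pz : phi z <= ((D / 2) ^+ 2) `^ (- N) by rewrite /phi -enorm_sqr -E gerBl powR_ge0.
    have i1 : ((D / 2) ^+ 2) `^ N * ((D / 2) ^+ 2) `^ (- N) = 1.
      by rewrite -powRD ?subrr ?powRr0// (gt_eqF (exprn_gt0 2 D2)) implybT.
    have p0 : 0 <= phi z by apply: phi_ge0 => //; rewrite -E.
    have := ler_pM (le_trans z3 P1) p0 P2 pz; move=> /(ler_wpM2l (ltW k00)) => h2; apply: le_trans h2 _.
    have -> : k0 * (2 * xi z * ((D / 2) ^+ 2) `^ (- N)) = k1 * xi z * (((D / 2) ^+ 2) `^ N * ((D / 2) ^+ 2) `^ (- N)).
      by rewrite /k0; field.
    by rewrite i1 mulr1.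
  by move: lt h; rewrite -/lam -/(v z); clear; lra.
have {}z2 : enorm (z - c0) < D'.
  rewrite lt_neqAle z2 andbT; apply/eqP => E; move: lt wz.
  by rewrite /phi -enorm_sqr E subrr !mulr0; clear; lra.
have {}z3 : 0 < xi z.
  rewrite lt_neqAle z3 andbT; apply/eqP => E; move: lt wz.
  by rewrite /P -/(xi z) -E !mul0r mulr0; clear; lra.
pose s := Num.min (Num.min (enorm (z - c0) - D / 2) (D' - enorm (z - c0))) (xi z).
have s0 : 0 < s by rewrite !lt_min !subr_gt0 z1 z2.
exists s => //; split.
  move=> h; rewrite /s !lt_min => /andP[/andP[h1 h2] h3] /=.
  have E : z + h - c0 = (z - c0) + h by rewrite addrAC.
  have := ler_enormD (z - c0) h; rewrite -E => e2.
  have := ler_enormB (z + h - c0) h; rewrite {1}E addrK => e3.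
  have := ler_dot h e; rewrite e1 mulr1 => /ler_normlP[e4 _].
  split; first by apply/andP; split; clear -h1 h2 e2 e3; lra.
  by rewrite E dotDl -/(xi z); clear -e4 h3; lra.
have [b [X [J E B Mb]]] := ru z zD.
have [b' [X' [J' E' B' Mb']]] := ru _ (mB z zD).
have [Y [Jp LY]] := Jphi z (ne z (ltW z1)).
have Jv := mir_jet e1 J'.
have Ev : LA p (b' *m rt (-1) e) (rt (-1) e *m X' *m rt (-1) e) = - p by rewrite mirror_LA.
have Bv : b0 <= enorm (b' *m rt (-1) e) by rewrite mirror_enorm.
have Mv : mnorm (rt (-1) e *m X' *m rt (-1) e) <= K1.
  by apply: le_trans (mirror_mnorm _ e1) _; rewrite ler_wpM2l// sqr_ge0.
apply: (no_touch p1 b00 Jv Ev Bv Mv J E B (le_trans Mb KK1) (jetM (JP z) Jp) k00 s0).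
set b1 := b' *m rt (-1) e in Bv *.
have bn : b != 0 by rewrite -enorm_gt0; exact: lt_le_trans B.
have bn1 : b1 != 0 by rewrite -enorm_gt0; exact: lt_le_trans Bv.
set A := 2 * N * dot (z - c0) (z - c0) `^ (- N - 1).
have A0 : 0 < A by rewrite !mulr_gt0// powR_gt0// dot_gt0 subr_eq0 ne// ltW.
have kE : pow_grad N (z - c0) = (- A) *: (z - c0) by [].
have pz : 0 <= phi z by apply: phi_ge0; [clear -D2 z1; lra|exact: ltW].
have ee : dot e e = 1 by exact: dot1.
have LX q : q != 0 -> LA p q (P z *: Y + phi z *: ((2 * M) *: (e^T *m e)) +
    2 *: (((1 + 2 * M * xi z) *: e)^T *m pow_grad N (z - c0))) =
    P z * LA p q Y + phi z * (2 * M) * LA p q (e^T *m e) - 2 * (1 + 2 * M * xi z) * A * LA p q (e^T *m (z - c0)).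
  move=> qn; rewrite kE [(_ *: e)^T]linearZ/= -scalemxAl -scalemxAr !LAD !LAZ; ring.
rewrite !LX//.
have cross := @mirror_cross b0 b b' b1 e (z - c0) erefl b00 e1 B B' (le_trans (ltW zD) D1) (ltW z3).
rewrite -/(xi z) in cross.
have zm : z - mir e lam z = (2 * xi z) *: e.
  by rewrite /mir /xi dotBl -/lam; move: (dot z e) => a; vec.
have bb : enorm (b - b') <= 5 * K * (2 * xi z).
  have -> : 2 * xi z = enorm (z - mir e lam z) by rewrite zm enormZ e1 mulr1 ger0_norm// mulr_ge0// ltW.
  apply: (grad_lip D0 K0 _ zD (mB z zD) J Mb J' Mb') => y /ru[q1 [Y1 [? _ _ ?]]]; by exists q1, Y1.
have {}cross : `|LA p b1 (e^T *m (z - c0)) + LA p b (e^T *m (z - c0))| <= (2 + C3) * xi z.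
  rewrite !LA_outer (dotC e) -/(xi z).
  set c1 := dot e b * _ / _ in cross *; set c2 := dot e b1 * _ / _ in cross *.
  have -> : xi z + (p - 2) * c2 + (xi z + (p - 2) * c1) = 2 * xi z + (p - 2) * (c1 + c2) by ring.
  apply: le_trans (ler_normD _ _) _; rewrite [leRHS]mulrDl lerD//; first by rewrite ger0_norm// mulr_ge0// ltW.
  rewrite normrM /C3 -mulrA ler_wpM2l//; apply: le_trans cross _.
  rewrite [leRHS]mulrDl lerD2r; have : 0 <= 4 / b0 by rewrite divr_ge0// ltW.
  move=> b4; apply: le_trans (ler_wpM2l b4 bb) _.
  by apply: eq_ler; field; rewrite gt_eqF.
have l1 := lmin_LA_out e p1 bn; have l2 := lmin_LA_out e p1 bn1; rewrite ee mulr1 in l1 l2.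
have y11 := LY b bn; have y12 := LY b1 bn1; rewrite -/A in y11 y12; clearbody A.
have qn : enorm (P z *: pow_grad N (z - c0) + phi z *: ((1 + 2 * M * xi z) *: e)) <= 2 * xi z * A + 3 * phi z.
  apply: le_trans (ler_enormD _ _) _; rewrite kE !enormZ e1 mulr1 normrN (gtr0_norm A0) !ger0_norm//; last 2 first.
  - by rewrite addr_ge0// !mulr_ge0// ltW.
  - exact: le_trans (ltW z3) P1.
  have a1 : 1 + 2 * M * xi z <= 3 by clear -Mx; lra.
  have := ler_wpM2l pz a1.
  have a2 : A * enorm (z - c0) <= A by rewrite ler_piMr ?(ltW A0)//; clear -zD D1; lra.
  have a3 : 0 <= A * enorm (z - c0) by rewrite mulr_ge0 ?enorm_ge0// ltW.
  have := ler_pM (le_trans (ltW z3) P1) a3 P2 a2.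
  by clear; lra.
have Cq := ler_wpM2l C0 qn; rewrite -/C; apply: le_lt_trans Cq _.
move: cross y11 y12 l1 l2; set S1 := LA p b1 (e^T *m (z - c0)); set S2 := LA p b (e^T *m (z - c0)).
set Y1 := LA p b1 Y; set Y2 := LA p b Y; set Z1 := LA p b1 (e^T *m e); set Z2 := LA p b (e^T *m e).
move=> /ler_normlP[_ cr] y11 y12 l1 l2.
have L0 : 0 <= L by rewrite /L; clear -C0 C30; lra.
have t1 : xi z * (2 * (L * A)) <= P z * (Y1 + Y2).
  by apply: ler_pM => //; [exact: ltW|rewrite !mulr_ge0// ltW|clear -y11 y12; lra].
have t2 : phi z * (2 * M) * (2 * lmin p) <= phi z * (2 * M) * (Z1 + Z2).
  by apply: ler_wpM2l; [rewrite !mulr_ge0// ltW|clear -l1 l2; lra].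
have t3 : 2 * (1 + 2 * M * xi z) * A * (S1 + S2) <= 6 * A * ((2 + C3) * xi z).
  have a1 : 1 + 2 * M * xi z <= 3 by clear -Mx; lra.
  have a0 : 0 <= 1 + 2 * M * xi z by rewrite addr_ge0// !mulr_ge0// ltW.
  apply: (@le_trans _ _ (2 * (1 + 2 * M * xi z) * A * ((2 + C3) * xi z))).
    by apply: ler_wpM2l => //; rewrite !mulr_ge0// ltW.
  apply: ler_wpM2r; first by rewrite mulr_ge0 ?addr_ge0// ltW.
  by apply: ler_wpM2r; [exact: ltW|clear -a1; lra].
have t4 : phi z * (2 * M) * (2 * lmin p) = phi z * (3 * C + 1) by rewrite -ML; ring.
rewrite t4 in t2; have t5 : 0 < A * xi z by rewrite mulr_gt0.
by move: t1 t2 t3 t5 pz; rewrite /L; clear; lra.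
Qed.

End Corner.

(** * Jets in a collar of the boundary, weak comparison in caps, and the corner *)

Section Collar.
Context {R : realType} {n : nat} {p c r : R} {Om : set 'rV[R]_n} {u : 'rV[R]_n -> R}.
Context {nu : 'rV[R]_n -> 'rV[R]_n} (H : serrin p c r Om u nu).
Implicit Types (x y z w h k q e b : 'rV[R]_n) (X : 'M[R]_n) (lam : R).

Lemma near_pair_ex x : Om x -> exists z, @near_pair R n Om x z.
Proof. by move=> Ox; have [np hnp] := nearest_choice H; exists (np x); have [] := hnp x Ox. Qed.

Lemma near_pair_le x z y : @near_pair R n Om x z -> boundary Om y -> enorm (z - x) <= enorm (y - x).
Proof. by move=> [_ _ _ hb] by_; rewrite leNgt; apply/negP => /hb; exact: (boundary_out H by_). Qed.

(** At distance [2 s] from the boundary, scale by [s]. By [trap] and [dist_linear] the scaled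
    solution is within a multiple of [s] of an affine function whose gradient has length [c], and
    its right-hand side is [s * p]. [Schauder_jet] then gives a Hessian of order [s], hence a
    bounded one after scaling back. *)
Lemma collar_jets : exists K d0, [/\ 0 < K, 0 < d0 & forall x y, Om x -> boundary Om y ->
  enorm (x - y) < d0 -> reg p (c / 2) K u x].
Proof.
have c0 := sc0 H; have r0 := sr0 H; have p1 := sp1 H; have n0 := sn0 H.
have np := np_gt0 p1 n0.
have [K1 [d1 [K10 d10 tr]]] := trap H.
have c2 : 0 < c / 2 by rewrite divr_gt0.
have c2c : c / 2 <= c by clear -H c0; lra.
have [t [C [t0 C0 sj]]] := Schauder_jet p1 n0 c2 c2c.
(* The polynomial in [Schauder_jet] must solve the scaled equation exactly; [- (s * P0)] times the
   identity does so for any nonzero gradient. *)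
pose P0 := p / (n%:R + p - 2); have P00 : 0 < P0 by rewrite divr_gt0//; clear -H p1; lra.
pose G := 9 * K1 + 9 * c / (2 * r) + P0; pose G1 := n%:R * P0.
have G0 : 0 < G by rewrite /G; pos.
have G10 : 0 < G1 by rewrite mulr_gt0// ltr0n.
have GE : 9 * K1 + 9 * c / (2 * r) + P0 = G by [].
clearbody G.
have CG : 0 < C * G by rewrite mulr_gt0.
exists (G1 + C * G), (Num.min (Num.min (d1 / 2) (t / G)) (Num.min (t * G / (G1 + C * G) ^+ 2) (c / (2 * C * G)))).
split; first by rewrite addr_gt0.
  by rewrite !lt_min !divr_gt0 ?mulr_gt0 ?exprn_gt0 ?addr_gt0.
move=> x z' Ox bz'; rewrite !lt_min enormC => /andP[/andP[xz1 xz2] /andP[xz3 xz4]].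
have [z xz] := near_pair_ex Ox; have zz := near_pair_le xz bz'.
have [_ bz zx hb] := xz; set d := enorm (z - x) in hb zz.
have d0 : 0 < d by rewrite enorm_gt0 subr_eq0.
pose s := d / 2; have s0 : 0 < s by rewrite divr_gt0.
have sd : d = 2 * s by rewrite /s; field.
have s1 : 3 * s < d1 by move: zz xz1 d0; rewrite sd; clear -H; lra.
have s2 : s * G <= t.
  by rewrite -ler_pdivlMr//; move: zz xz2 s0; rewrite sd; clear -H; lra.
have s3 : s * (G1 + C * G) ^+ 2 <= t * G.
  by rewrite -ler_pdivlMr ?exprn_gt0 ?addr_gt0//; move: zz xz3 s0; rewrite sd; clear -H; lra.
have s4 : s * (C * G) <= c / 2.
  have : s <= c / (2 * C * G) by move: zz xz4 s0; rewrite sd; clear -H; lra.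
  by rewrite ler_pdivlMr ?mulr_gt0//; clear -H; lra.
clear xz1 xz2 xz3 xz4; clearbody s.
have n1 := nu1 H bz; have xE := near_pair_dir H xz; rewrite -/d in xE.
pose U y := s^-1 * u (x + s *: y).
have Ub y : enorm y < 1 -> Om (x + s *: y).
  move=> y1; apply: hb; rewrite addrC addKr enormZ gtr0_norm//.
  by have := enorm_ge0 y; rewrite sd; move: s0 y1; clear -H; nra.
have VU : visc_ball p (s * p) 0 1 U.
  apply: visc_scale => //; rewrite mulr1; apply: (sol_visc H) => y ys; apply: hb.
  by rewrite sd; clear -H ys s0; lra.
pose b := c *: nu z; have bE : enorm b = c by rewrite enormZ n1 mulr1 gtr0_norm.
pose X0 : 'M[R]_n := (- (s * P0))%:M.
have b0 : b != 0 by rewrite -enorm_gt0 bE.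
have mX : mnorm X0 = s * G1.
  by rewrite /X0 mnorm_scalar normrN (gtr0_norm (mulr_gt0 s0 P00)) /G1 mulrCA.
have [|||||||||b' [X' [J X'T B' M']]] := sj U (s * p) (s * G) (2 * c) b X0 VU.
- by rewrite bE; clear -H c0; lra.
- by rewrite bE.
- by rewrite mulr_gt0.
- exact: s2.
- by rewrite tr_scalar_mx.
- by rewrite LA1// /P0; field; rewrite gt_eqF.
- rewrite mX; have -> : (s * G1 + C * (s * G)) ^+ 2 = s * (s * (G1 + C * G) ^+ 2) by ring.
  by rewrite (mulrCA t) ler_pM2l.
- move=> xi xi1; set y := x + s *: xi; have Oy : Om y by exact: Ub.
  have [w yw] := near_pair_ex Oy; set dw := enorm (w - y).
  have zy : enorm (y - z) <= 3 * s.
    have -> : y - z = - (z - x) + s *: xi by rewrite /y; vec.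
    apply: le_trans (ler_enormD _ _) _; rewrite enormN -/d sd enormZ gtr0_norm//.
    by have := ler_wpM2l (ltW s0) (ltW xi1); clear -H; lra.
  have dw0 : 0 <= dw by exact: enorm_ge0.
  have wz : dw <= 3 * s by apply: le_trans (near_pair_le yw bz) _; rewrite enormC.
  have lin := dist_linear H yw bz; rewrite -/dw in lin.
  have nE : dot (nu z) (y - z) = d + s * dot (nu z) xi.
    have -> : y - z = d *: nu z + s *: xi by rewrite /y {1}xE; vec.
    by rewrite dotDr !dotZr dot1// mulr1.
  have lo := tr y w yw (le_lt_trans wz s1); rewrite -/dw in lo.
  have [_ bw _ _] := yw.
  have hi := sol_le_dist H (subset_closure Oy) bw; rewrite enormC -/dw in hi.
  have dy : dot (y - z) (y - z) / (2 * r) <= 9 * s ^+ 2 / (2 * r).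
    rewrite ler_pM2r ?invr_gt0 ?mulr_gt0//; have -> : 9 * s ^+ 2 = (3 * s) ^+ 2 by ring.
    by rewrite -enorm_le_sqr// mulr_ge0// ltW.
  have dw2 : dw ^+ 2 <= 9 * s ^+ 2.
    have -> : 9 * s ^+ 2 = (3 * s) ^+ 2 by ring.
    by rewrite lerXn2r ?nnegrE// mulr_ge0// ltW.
  have Kd := ler_wpM2l (ltW K10) dw2.
  have {}lin := le_trans lin dy; rewrite nE in lin.
  have xx : dot xi xi <= 1 by rewrite -[leRHS](expr1n _ 2) -enorm_le_sqr// ltW.
  have E : U xi - qpoly (2 * c) b X0 xi = s^-1 * (u y - c * (d + s * dot (nu z) xi) + s ^+ 2 * (P0 * dot xi xi / 2)).
    by rewrite /U /qpoly quadM1 dotZl -/y sd; field; rewrite gt_eqF.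
  rewrite E normrM gtr0_norm ?invr_gt0// ler_pdivrMl//.
  have q1 : c * (9 * s ^+ 2 / (2 * r)) = s ^+ 2 * (9 * c / (2 * r)) by field; rewrite gt_eqF.
  move: lin => /ler_normlP[l1 l2]; have := ler_wpM2l (ltW c0) l1; have := ler_wpM2l (ltW c0) l2; rewrite q1.
  have p0 : 0 <= s ^+ 2 * (P0 * dot xi xi) by rewrite mulr_ge0 ?sqr_ge0// mulr_ge0 ?dot_ge0// ltW.
  have p2 : s ^+ 2 * (P0 * dot xi xi) <= s ^+ 2 * P0 by rewrite ler_wpM2l ?sqr_ge0// ler_piMr// ltW.
  rewrite -GE; move: lo hi Kd p0 p2; set T := 9 * c / (2 * r); clear -H; move=> *.
  by apply/ler_normlP; split; lra.
- move=> y1 y2 h1 h2; rewrite /U -mulrBr normrM gtr0_norm ?invr_gt0// ler_pdivrMl//.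
  apply: le_trans (sol_lip H (subset_closure (Ub _ h1)) (subset_closure (Ub _ h2))) _.
  have -> : x + s *: y1 - (x + s *: y2) = s *: (y1 - y2) by vec.
  by rewrite enormZ gtr0_norm// mulrCA.
have Ju : jet u x b' (s^-1 *: X').
  have at0 : - s^-1 *: x + x *m (s^-1)%:M = 0 by rewrite mul_mx_scalar -scalerDl addNr scale0r.
  rewrite -at0 in J; have := jetZ s (jet_affine J).
  rewrite tr_scalar_mx !mul_mx_scalar mul_scalar_mx !scalerA.
  rewrite !divff ?gt_eqF// scale1r mul1r.
  apply: jet_ext => y; rewrite /U mulVKf ?gt_eqF//; congr (u _).
  rewrite mul_mx_scalar scalerDr !scalerA mulrN divff ?gt_eqF// scaleN1r scale1r addrA addrN add0r.
  by [].
have B : c / 2 <= enorm b'.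
  have := ler_enormB b' (b' - b); have -> : b' - (b' - b) = b by rewrite opprB addrC subrK.
  by move: B' s4; rewrite bE; clear -H; lra.
have b'0 : b' != 0 by rewrite -enorm_gt0; exact: lt_le_trans B.
exists b', (s^-1 *: X'); split=> //.
  by apply/eqP; rewrite eq_le (ssup H Ox b'0 Ju.2) (ssub H Ox b'0 Ju.1).
rewrite mnormZ gtr0_norm ?invr_gt0// ler_pdivrMl//.
have := mnormD (X' - X0) X0; rewrite subrK mX; clear -H M'; lra.
Qed.

Lemma ljet_mir f e lam z q X : enorm e = 1 -> ljet (fun y => f (mir e lam y)) z q X ->
  ljet f (mir e lam z) (q *m rt (-1) e) (rt (-1) e *m X *m rt (-1) e).
Proof.
move=> e1 J d d0; have [s s0 hs] := J d d0; exists s => // h hr.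
have := hs (h *m rt (-1) e); rewrite mirror_enorm// => /(_ hr).
have -> : mir e lam (z + h *m rt (-1) e) = mir e lam z + h.
  by rewrite !mirE// mulmxDl -mulmxA mirror_sqr// mulmx1 addrA.
have -> : dot q (h *m rt (-1) e) = dot (q *m rt (-1) e) h.
  by rewrite dot_mulr dot_mull -[in RHS](rtT (-1) e) bilT.
have -> : quad X (h *m rt (-1) e) = quad (rt (-1) e *m X *m rt (-1) e) h.
  by rewrite quadbil -bil_mul rtT.
have -> : dot (h *m rt (-1) e) (h *m rt (-1) e) = dot h h by rewrite -!enorm_sqr mirror_enorm.
by [].
Qed.

Lemma cap_closure e lam x : enorm e = 1 -> (forall y, Om y -> lam < dot y e -> Om (mir e lam y)) ->
  closure Om x -> lam <= dot x e -> closure Om (mir e lam x).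
Proof.
move=> e1 cap cx; rewrite le_eqVlt => /orP[/eqP E|lx].
  by rewrite /mir -E subrr mulr0 scale0r addr0.
apply/closure_enorm => s s0.
have [|y Oy yx] := (closure_enorm _ _).1 cx (Num.min s (dot x e - lam)).
  by rewrite lt_min s0 subr_gt0.
move: yx; rewrite lt_min => /andP[y1 y2]; exists (mir e lam y); last by rewrite mir_isom.
apply: cap => //; have := ler_dot (y - x) e; rewrite e1 mulr1 dotBl => /ler_normlP[h1 h2].
by clear -H y2 h1; lra.
Qed.

(** Doubling with a quartic penalty: at coinciding points its expansion is the zero jet, excluded by
    [ssup0]; at distinct points its gradient is nonzero and [doubling] applies, the factor [1 - th]
    making the inequality strict. *)
Lemma weak_comparison e lam : enorm e = 1 -> (forall y, Om y -> lam < dot y e -> Om (mir e lam y)) ->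
  forall x, Om x -> lam < dot x e -> u x <= u (mir e lam x).
Proof.
move=> e1 cap x0 Ox0 lx0; rewrite leNgt; apply/negP => lt.
have c0 := sc0 H; have p1 := sp1 H; have n0 := sn0 H.
pose v x := u (mir e lam x).
pose dl := (u x0 - v x0) / 2; have dl0 : 0 < dl by rewrite divr_gt0// subr_gt0.
have ux0 : 0 < u x0 by exact: (sol_gt0 H).
pose th := Num.min 2^-1 (dl / u x0).
have th0 : 0 < th by rewrite lt_min invr_gt0 ltr0n divr_gt0.
have th2 : th <= 2^-1 by rewrite ge_min lexx.
have thu : th * u x0 <= dl by rewrite -ler_pdivlMr// ge_min lexx orbT.
pose K := closure Om `&` [set x | lam <= dot x e].
have KM x : K x -> closure Om (mir e lam x) by move=> [cx lx]; exact: cap_closure.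
have cK : compact K.
  have [Mx _ hM] := bounded_closure (sbd H).
  apply: (@compact_enorm _ _ _ Mx) => [y [/hM]//|].
  apply: closedI2; first exact: closed_closure.
  have J y : jet (fun y => dot y e) y e 0 by apply: jet_ext (jet_dot e y) => z; exact: dotC.
  by apply: closed_le => y; [exact: cst_continuous|exact: jet_cont (J y)].
have KO x : Om x -> lam < dot x e -> K x by move=> Ox lx; split; [exact: subset_closure|exact: ltW].
have vl x y : K x -> K y -> `|v x - v y| <= c * enorm (x - y).
  by move=> /KM h1 /KM h2; rewrite -(mir_isom lam x y e1); exact: sol_lip H _ _ h1 h2.
have cv : cont_on K v.
  move=> x Kx e0 e00; exists (e0 / c); first by rewrite divr_gt0.
  move=> y Ky; rewrite ltr_pdivlMr// => yx; apply: le_lt_trans (vl _ _ Ky Kx) _; by rewrite mulrC.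
have cu : cont_on K (fun x => (1 - th) * u x).
  by apply: cont_onZ; apply: cont_onS (scont H) => x [].
(* Chosen so that [c * D < dl] at the maximum. Both functions being Lipschitz, neither point can
   then lie on the mirror plane or on the boundary. *)
pose M := 2 * c / (dl / c) ^+ 3; have M0 : 0 < M by rewrite /M; pos.
pose phi z := M * (dot (z - 0) (z - 0) * dot (z - 0) (z - 0)).
have Jphi z : jet phi z _ _ := jetZ M (jetM (jet_sqr 0 z) (jet_sqr 0 z)).
have phiE z : phi z = M * enorm z ^+ 4.
  by rewrite /phi subr0 -enorm_sqr; ring.
have [||||xh [yh [Kx Ky max]]] := @doubling_max R n K (fun x => (1 - th) * u x) v phi cK.
- by exists x0; exact: KO.
- exact: cu.
- exact: cv.
- by move=> z; exact: jet_cont (Jphi z).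
set D := enorm (xh - yh).
have D0 : 0 <= D by exact: enorm_ge0.
have ux : 0 <= u xh by apply: (sol_ge0 H); case: Kx.
have uy : 0 <= u yh by apply: (sol_ge0 H); case: Ky.
have vy : 0 <= v yh by apply: (sol_ge0 H); exact: KM.
have vx : 0 <= v xh by apply: (sol_ge0 H); exact: KM.
have uxy : `|u xh - u yh| <= c * D by apply: (sol_lip H); [case: Kx|case: Ky].
have vxy : `|v xh - v yh| <= c * D by exact: vl.
have thx : 0 <= th * u xh by rewrite mulr_ge0// ltW.
have thy : 0 <= th * u yh by rewrite mulr_ge0// ltW.
have pos : dl <= (1 - th) * u xh - v yh - M * D ^+ 4.
  have := max _ _ (KO _ Ox0 lx0) (KO _ Ox0 lx0); rewrite !phiE subrr enorm0 -/D expr0n/= mulr0 subr0.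
  by apply: le_trans; rewrite mulrBl mul1r; move: thu; rewrite /dl; clear -H; lra.
have cD : c * D < dl.
  rewrite ltNge; apply/negP => h.
  have h1 : dl / c <= D by rewrite ler_pdivrMr// mulrC.
  have dc : 0 < dl / c by rewrite divr_gt0.
  have := max _ _ Ky Ky; rewrite !phiE subrr enorm0 -/D expr0n/= mulr0 subr0 => h2.
  have h3 : M * (dl / c) ^+ 3 <= M * D ^+ 3 by rewrite ler_pM2l// lerXn2r ?nnegrE// ltW.
  have ME : M * (dl / c) ^+ 3 = 2 * c by rewrite /M divfK// gt_eqF// exprn_gt0.
  rewrite ME in h3.
  have Dp : 0 < D by exact: lt_le_trans h1.
  have h4 : 2 * c * D <= M * D ^+ 4 by rewrite (_ : M * D ^+ 4 = M * D ^+ 3 * D); [rewrite ler_pM2r|ring].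
  have cDp : 0 < c * D by rewrite mulr_gt0.
  move: uxy => /ler_normlP[_ h5]; have h6 : th * (u xh - u yh) <= 0 \/ 0 <= th * (u xh - u yh) by case: (leP (th * (u xh - u yh)) 0); [left|right; exact: ltW].
  have h7 : (1 - th) * (u xh - u yh) <= c * D.
    have [s0|s0] := leP (u xh - u yh) 0.
      apply: le_trans (ltW cDp); rewrite mulr_ge0_le0// subr_ge0; clear -H th2; lra.
    apply: le_trans h5; rewrite ler_piMl ?(ltW s0)//; clear -H th0; lra.
  by clear -H h2 h4 h7 cDp; lra.
have MD : 0 <= M * D ^+ 4 by rewrite mulr_ge0 ?exprn_ge0// ltW.
move: uxy vxy => /ler_normlP[u1 u2] /ler_normlP[v1 v2].
have fix_ z : lam = dot z e -> v z = u z.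
  by move=> E; rewrite /v /mir -E subrr mulr0 scale0r addr0.
have [Ox lx] : Om xh /\ lam < dot xh e.
  have [cx] := Kx; rewrite /= le_eqVlt => /orP[/eqP/fix_ E|->].
    by move: pos MD v2 cD thx; rewrite E; clear -H; lra.
  split=> //; have [//|/(sdir H) E] := closure_split (sopen H) cx; exfalso.
  by move: pos MD dl0; rewrite E; clear -H vy; lra.
have [Oy ly] : Om yh /\ lam < dot yh e.
  have [cy] := Ky; rewrite /= le_eqVlt => /orP[/eqP/fix_ E|->].
    by move: pos MD u2 cD thx; rewrite E; clear -H; lra.
  split=> //; have [//|/(sdir H) E] := closure_split (sopen H) cy; exfalso.
  by move: pos MD u2 cD thx; rewrite E; clear -H vy; lra.
have in_ z : Om z -> lam < dot z e -> exists2 s, 0 < s & forall w, enorm (w - z) < s -> Om w /\ lam < dot w e.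
  move=> Oz lz; have [s s0 hs] := open_enorm (sopen H) Oz.
  exists (Num.min s (dot z e - lam)); first by rewrite lt_min s0 subr_gt0.
  move=> w; rewrite lt_min => /andP[/hs Ow wz]; split=> //.
  have := ler_dot (w - z) e; rewrite e1 mulr1 dotBl => /ler_normlP[h1 h2].
  by clear -H wz h1; lra.
have [s1 s10 h1] := in_ _ Ox lx; have [s2 s20 h2] := in_ _ Oy ly.
have [E|xy] := eqVneq xh yh.
  have Om_ : Om (mir e lam yh) by exact: cap.
  have : ljet v yh 0 0.
    move=> d d0; exists (Num.min s2 (Num.min 1 (d / M))); first by rewrite !lt_min s20 ltr01 divr_gt0.
    move=> h; rewrite !lt_min => /andP[hs /andP[hd1 hd2]].
    have Kh : K (yh + h) by have [|O1 l1] := h2 (yh + h); [rewrite addrC addKr|exact: KO].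
    have := max _ _ Kx Kh; rewrite !phiE E subrr enorm0 opprD addrA subrr sub0r enormN expr0n/= mulr0 subr0.
    rewrite dot0l quadM0 mulr0 !addr0 => h3; have h0 := enorm_ge0 h.
    suff : M * enorm h ^+ 4 <= d * dot h h by clear -H h3; lra.
    rewrite -enorm_sqr (_ : M * _ = M * enorm h ^+ 2 * enorm h ^+ 2); last by ring.
    rewrite ler_wpM2r ?sqr_ge0//; rewrite ltr_pdivlMr// in hd2; apply: le_trans (ltW hd2).
    by rewrite mulrC ler_wpM2r ?(ltW M0)// expr2 ler_piMr// ltW.
  move=> /(ljet_mir e1); rewrite mul0mx mulmx0 mul0mx; exact: (ssup0 H).
have := doubling (u := fun x => (1 - th) * u x) (v := v) (x := xh) (y := yh) (phi := phi)
  (f := - p * (1 - th)) (g := - p) (r := Num.min s1 s2) p1 n0.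
have [q [Z [JZ qE]]] : exists q Z, jet phi (xh - yh) q Z /\ q = (M * (4 * dot (xh - yh) (xh - yh))) *: (xh - yh).
  do 2 eexists; split; first exact: Jphi.
  by rewrite subr0; move: (dot _ _) => a; vec.
move=> /(_ q Z) S; feed S; first by rewrite lt_min s10.
feed S.
  move=> z; rewrite lt_min => /andP[/h1[Oz _] _]; apply: continuousM; first exact: cst_continuous.
  exact: (sol_cont H).
feed S.
  move=> z; rewrite lt_min => /andP[_ /h2[Oz lz]]; apply/cont_enorm => d d0.
  have [s s0 hs] := (cont_enorm _ _).1 (sol_cont H (cap _ Oz lz)) d d0.
  by exists s => // y yz; apply: hs; rewrite mir_isom.
have t1 : 0 < 1 - th by clear -H th2; lra.
feed S.
  move=> z k X; rewrite lt_min => /andP[/h1[Oz _] _] k0 Jz.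
  have it : 0 < (1 - th)^-1 by rewrite invr_gt0.
  have := ujetZ it Jz; set f := (fun y => _); have -> : f = u.
    by apply/funext => w; rewrite /f mulKf// gt_eqF.
  move=> /(ssub H Oz); rewrite LAqZ ?gt_eqF// LAZ; move=> /(_ _).
  rewrite scaler_eq0 (gt_eqF it) (negPf k0) => /(_ isT).
  by rewrite mulrC ler_pdivlMr.
feed S.
  move=> z k X; rewrite lt_min => /andP[_ /h2[Oz lz]] k0 /(ljet_mir e1)/(ssup H (cap _ Oz lz)).
  by rewrite mirror_LA//; apply; rewrite -enorm_gt0 mirror_enorm// enorm_gt0.
have xy0 : 0 < dot (xh - yh) (xh - yh) by rewrite dot_gt0 subr_eq0.
feed S.
  by rewrite qE scaler_eq0 subr_eq0 (negPf xy) orbF gt_eqF// mulr_gt0// mulr_gt0.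
feed S; first exact: JZ.1.
feed S.
  move=> h k; rewrite !lt_min => /andP[hr _] /andP[_ kr]; apply: max.
    by have [|O1 l1] := h1 (xh + h); [rewrite addrC addKr|exact: KO].
  by have [|O1 l1] := h2 (yh + k); [rewrite addrC addKr|exact: KO].
have : 0 < p * th by rewrite mulr_gt0//; clear -H p1; lra.
by clear -H S; lra.
Qed.

Lemma boundary_between z k (a b : R) : b < a -> Om (z + a *: k) -> ~ Om (z + b *: k) ->
  exists s, [/\ b <= s, s <= a & boundary Om (z + s *: k)].
Proof.
move=> ba Oa nb; have [|t [t0 t1 bt _]] := @exit_point _ _ Om (z + a *: k) ((b - a) *: k) (sopen H) Oa.
  by have -> : z + a *: k + (b - a) *: k = z + b *: k by vec.
exists (a + t * (b - a)); split.
- have : 0 <= (1 - t) * (a - b) by rewrite mulr_ge0// subr_ge0 ?(ltW ba).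
  by clear -H; lra.
- by rewrite gerDl mulr_ge0_le0 ?(ltW t0)// subr_le0 ltW.
- by have <- : z + a *: k + t *: ((b - a) *: k) = z + (a + t * (b - a)) *: k by vec.
Qed.

(* Compares [k s t / 2 <= w] with [w <= 2 c a s^2 + O(t^2)] at
   [Q + t nu + s e], [s = L t], for [L] large and [a] small. *)
Lemma corner_contradiction Q e (k D : R) : boundary Om Q -> enorm e = 1 -> dot (nu Q) e = 0 ->
  0 < k -> 0 < D -> D <= r ->
  (forall y, D / 2 <= enorm (y - (Q + D *: nu Q)) -> enorm (y - (Q + D *: nu Q)) < D ->
    0 <= dot (y - (Q + D *: nu Q)) e ->
    k * dot (y - (Q + D *: nu Q)) e * (D - enorm (y - (Q + D *: nu Q))) <= u (mir e (dot Q e) y) - u y) -> False.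
Proof.
move=> bQ e1 ne k0 D0 Dr hk; have c0 := sc0 H; have r0 := sr0 H.
have n1 := nu1 H bQ; have nn := dot1 n1; have ee := dot1 e1.
have en : dot e (nu Q) = 0 by rewrite dotC.
have [K [d0 [K0 d00 tr]]] := trap H.
have [kk hkk] := boundary_expansion (sopen H) (sC2 H) r0 bQ (sball H bQ) e1 en.
pose B := 2 * c / r + 4 * K; have B0 : 0 < B by rewrite addr_gt0 ?divr_gt0 ?mulr_gt0.
pose L := 2 * (B + 2) / k; have L0 : 0 < L by rewrite divr_gt0// mulr_gt0// addr_gt0.
have Lk : k * L / 2 = B + 2 by rewrite /L; field; rewrite gt_eqF.
pose a := (2 * c * L ^+ 2)^-1; have a0 : 0 < a by rewrite /a; pos.
have aE : 2 * c * a * L ^+ 2 = 1.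
  by rewrite /a; field; rewrite !gt_eqF// exprn_gt0.
clearbody L a; have [d1 d10 hd] := hkk a a0.
pose KA := `|kk| + a; have KA0 : 0 < KA by rewrite ltr_wpDl.
pose t := Num.min (Num.min (d1 / (2 * L)) (d0 / 4))
   (Num.min (Num.min (D / (2 * (1 + L ^+ 2))) ((2 * KA * (L ^+ 2 + 1))^-1)) (Num.min (r ^+ 2 / (4 * c * (L ^+ 2 + 1))) (Num.min (r / (2 * (L + 1))) 1))).
have L20 : 0 < L ^+ 2 by rewrite exprn_gt0.
have L21 : 0 < L ^+ 2 + 1 by rewrite addr_gt0.
have L12 : 0 < 1 + L ^+ 2 by rewrite addr_gt0.
have L1 : 0 < L + 1 by rewrite addr_gt0.
have t0 : 0 < t.
  by rewrite /t; pos.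
have [tm1 tm2 tm3] : [/\ t * (2 * L) <= d1, t * 4 <= d0 & t * (2 * (1 + L ^+ 2)) <= D].
  by split; rewrite -ler_pdivlMr ?mulr_gt0//; rewrite /t !ge_min lexx ?orbT.
have [tm4 tm5 tm6] : [/\ t * (2 * KA * (L ^+ 2 + 1)) <= 1, t * (4 * c * (L ^+ 2 + 1)) <= r ^+ 2 & t * (2 * (L + 1)) <= r].
  split; rewrite -ler_pdivlMr ?mulr_gt0//; rewrite ?div1r /t !ge_min lexx ?orbT//.
have tm7 : t <= 1 by rewrite /t !ge_min lexx ?orbT.
clearbody t.
pose s := L * t; have s0 : 0 < s by rewrite mulr_gt0.
have sE : s ^+ 2 = L ^+ 2 * t * t by rewrite /s; ring.
have sd : s < d1 by move: tm1 s0; rewrite /s; clear -H; lra.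
have kap : `|kk| * s ^+ 2 + a * s ^+ 2 <= t / 2.
  rewrite -mulrDl -/KA sE; have := ler_wpM2r (ltW t0) tm4; rewrite mul1r.
  have : 0 <= KA * t * t by rewrite !mulr_ge0// ltW.
  by clear -H; lra.
have s20 : 0 < s ^+ 2 by rewrite exprn_gt0.
have kks : - (`|kk| * s ^+ 2) <= kk * s ^+ 2 <= `|kk| * s ^+ 2.
  by rewrite -mulNr !ler_pM2r// ler_norm andbT lerNl -normrN ler_norm.
have as0 : 0 < a * s ^+ 2 by rewrite mulr_gt0.
(* The boundary crosses the normal lines over [s] and [- s] at heights within [a * s ^+ 2] of the
   same [kk * s ^+ 2]; this common part cancels when the two sides are compared. *)
have sgn (x : R) : `|x| = s -> exists ka, [/\ (kk - a) * s ^+ 2 <= ka, ka <= (kk + a) * s ^+ 2, `|ka| <= t / 2 &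
    boundary Om (Q + x *: e + ka *: nu Q)].
  move=> xs; have x2 : x ^+ 2 = s ^+ 2 by rewrite -xs real_normK// num_real.
  have := hd x; rewrite xs s0 sd x2 => hdx; have [Oa Ob] := hdx isT isT.
  have [|ka [k1 k2 bk]] := boundary_between _ Oa Ob; first by rewrite ltr_pM2r//; clear -H a0; lra.
  exists ka; split=> //; move: kks k1 k2 kap => /andP[h1 h2]; move: as0; rewrite !mulrBl !mulrDl => h3 h4 h5 h6.
  by apply/ler_normlP; move: h1 h2 h3 h4 h5 h6; clear -H; split; lra.
have [|ka1 [_ k12 k13 bk1]] := sgn s; first by rewrite gtr0_norm.
have [|ka2 [k21 _ k23 bk2]] := sgn (- s); first by rewrite normrN gtr0_norm.
pose y := Q + t *: nu Q + s *: e.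
have xiE : dot (y - (Q + D *: nu Q)) e = s.
  have -> : y - (Q + D *: nu Q) = (t - D) *: nu Q + s *: e by rewrite /y; vec.
  by rewrite dotDl !dotZl ne ee; ring.
have dE : enorm (y - (Q + D *: nu Q)) ^+ 2 = (D - t) ^+ 2 + s ^+ 2.
  have -> : y - (Q + D *: nu Q) = (t - D) *: nu Q + s *: e by rewrite /y; vec.
  by rewrite enorm_sqr !dotDl !dotDr !dotZl !dotZr nn ee ne en; ring.
set E := enorm (y - (Q + D *: nu Q)) in dE.
have E0 : 0 <= E by exact: enorm_ge0.
have ts : t ^+ 2 + s ^+ 2 <= D * t / 2.
  rewrite sE; have := ler_wpM2r (ltW t0) tm3; clear -H; lra.
have tD : t <= D / 2.
  have : 0 <= t * L ^+ 2 by rewrite mulr_ge0 ?sqr_ge0// ltW.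
  by clear -H tm3; lra.
have ED : E <= D - t / 2.
  have D2 : 0 <= D - t / 2 by clear -H tD t0; lra.
  rewrite -(ler_pXn2r (_ : (0 < 2)%N)) ?nnegrE// dE; move: ts; have := sqr_ge0 t; have := mulr_gt0 D0 t0; clear -H; lra.
have ED2 : D / 2 <= E.
  have D2 : 0 <= D / 2 by rewrite divr_ge0// ltW.
  rewrite -(ler_pXn2r (_ : (0 < 2)%N)) ?nnegrE// dE.
  apply: (@le_trans _ _ ((D - t) ^+ 2)); last by rewrite lerDl ltW.
  by rewrite lerXn2r ?nnegrE//; clear -H tD t0 D0; lra.
have mE : mir e (dot Q e) y = Q + t *: nu Q - s *: e.
  by rewrite /mir /y !dotDl !dotZl ne ee; vec.
have EDl : E < D by clear -H ED t0; lra.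
have main := hk y; rewrite xiE -/E mE in main; have {}main := main ED2 EDl (ltW s0).
have main2 : k * s * (t / 2) <= k * s * (D - E).
  by apply: (ler_wpM2l (mulr_ge0 (ltW k0) (ltW s0))); clear -H ED; lra.
have [_ tI _] := tball_le D0 Dr (sball H bQ).
have Oy : Om y by apply: tI.
have Om_ : Om (Q + t *: nu Q - s *: e).
  apply: tI; rewrite enorm_lt_sqr ?(ltW D0)//.
  have -> : Q + t *: nu Q - s *: e - (Q + D *: nu Q) = (t - D) *: nu Q - s *: e by vec.
  have -> : dot ((t - D) *: nu Q - s *: e) ((t - D) *: nu Q - s *: e) = E ^+ 2.
    by rewrite dE !dotDl !dotDr !dotNl !dotNr !dotZl !dotZr nn ee ne en; ring.
  by rewrite ltrXn2r ?nnegrE// ltW.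
have up : u (Q + t *: nu Q - s *: e) <= c * (t - ka2).
  apply: le_trans (sol_le_dist H (subset_closure Om_) bk2) _; rewrite ler_pM2l//.
  have -> : Q + t *: nu Q - s *: e - (Q + (- s) *: e + ka2 *: nu Q) = (t - ka2) *: nu Q by vec.
  rewrite enormZ n1 mulr1 ger0_norm//; move: k23 => /ler_normlP[_]; clear -H t0; lra.
set bp := Q + s *: e + ka1 *: nu Q in bk1.
have yb : y - bp = (t - ka1) *: nu Q by rewrite /y /bp; vec.
have [w yw] := near_pair_ex Oy; set dw := enorm (w - y).
have tk0 : 0 <= t - ka1 by move: k13 => /ler_normlP[_]; clear -H t0; lra.
have tk2 : t - ka1 <= 2 * t by move: k13 => /ler_normlP[]; clear -H t0; lra.
have dw2 : dw <= 2 * t.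
  apply: le_trans (near_pair_le yw bk1) _.
  by rewrite enormC yb enormZ n1 mulr1 ger0_norm.
have dw0 : 0 <= dw by exact: enorm_ge0.
have lin := dist_linear H yw bk1; rewrite -/dw yb dotZr !dotZl dotZr nn mulr1 in lin.
have nb1 := nu1 H bk1.
have nb : 1 - (s ^+ 2 + t ^+ 2) / (2 * r ^+ 2) <= dot (nu bp) (nu Q).
  have T := tball_lip r0 (sball H bk1) (sball H bQ).
  have b2 : enorm (bp - Q) ^+ 2 <= s ^+ 2 + t ^+ 2.
    have -> : bp - Q = s *: e + ka1 *: nu Q by rewrite /bp; vec.
    rewrite enorm_sqr !dotDl !dotDr !dotZl !dotZr nn ee ne en.
    have : ka1 ^+ 2 <= t ^+ 2.
      rewrite -[ka1 ^+ 2]real_normK ?num_real// lerXn2r ?nnegrE ?(ltW t0)//.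
      by clear -H k13 t0; lra.
    by clear -H; lra.
  have rT : (r * enorm (nu bp - nu Q)) ^+ 2 <= s ^+ 2 + t ^+ 2.
    by apply: le_trans b2; rewrite lerXn2r ?nnegrE ?mulr_ge0 ?enorm_ge0// ltW.
  rewrite exprMn enorm_sqr dotBl !dotBr (dotC (nu Q)) (dot1 nb1) nn in rT.
  rewrite lerBlDr -lerBlDl ler_pdivlMr ?mulr_gt0 ?exprn_gt0//.
  by clear -H rT; lra.
have dlow : (t - ka1) - 2 * t * ((s ^+ 2 + t ^+ 2) / (2 * r ^+ 2)) - 2 * t ^+ 2 / r <= dw.
  set de := (_ + _) / _ in nb *.
  have de0 : 0 <= de by apply: divr_ge0; [apply: addr_ge0; exact: sqr_ge0|apply: mulr_ge0 => //; exact: sqr_ge0].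
  have h1 := ler_wpM2l tk0 nb; have h2 := ler_wpM2r de0 tk2.
  have h3 : (t - ka1) * (t - ka1) / (2 * r) <= 2 * t ^+ 2 / r.
    rewrite (_ : 2 * t ^+ 2 / r = 2 * t * (2 * t) / (2 * r)); last by field; rewrite gt_eqF.
    by rewrite ler_pM2r ?invr_gt0 ?mulr_gt0// ler_pM.
  by move: lin => /ler_normlP[h4 _]; clear -H h1 h2 h3 h4; lra.
have lo := tr y w yw; rewrite -/dw in lo.
have {}lo : c * dw - K * dw ^+ 2 <= u y by apply: lo; clear -H dw2 tm2 t0; lra.
have dwsq : K * dw ^+ 2 <= K * (2 * t) ^+ 2 by rewrite ler_pM2l// lerXn2r ?nnegrE ?mulr_ge0// ltW.
have tt0 : 0 < t ^+ 2 by rewrite exprn_gt0.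
have e1' : c * (2 * t * ((s ^+ 2 + t ^+ 2) / (2 * r ^+ 2))) <= t ^+ 2 / 4.
  rewrite sE (_ : c * _ = (t * (4 * c * (L ^+ 2 + 1))) * (t ^+ 2 / (4 * r ^+ 2))); last by field; rewrite gt_eqF.
  apply: (@le_trans _ _ (r ^+ 2 * (t ^+ 2 / (4 * r ^+ 2)))).
    by rewrite ler_wpM2r// divr_ge0 ?sqr_ge0// mulr_ge0 ?sqr_ge0.
  by apply: eq_ler; field; rewrite gt_eqF.
have e2 : k * s * (t / 2) = (B + 2) * t ^+ 2 by rewrite -Lk /s; field.
have e3 : 2 * c * a * s ^+ 2 = t ^+ 2 by rewrite /s exprMn mulrA aE mul1r.
have e4 : B * t ^+ 2 = c * (2 * t ^+ 2 / r) + K * (2 * t) ^+ 2 by rewrite /B; field; rewrite gt_eqF.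
have h1 := ler_wpM2l (ltW c0) dlow; have h2 := ler_wpM2l (ltW c0) k12; have h3 := ler_wpM2l (ltW c0) k21.
rewrite e2 in main2; clear -H main main2 lo dwsq up h1 h2 h3 e1' e3 e4 tt0; lra.
Qed.

End Collar.

(** * Contact of the reflected cap with the boundary spreads *)

Section Touching.
Context {R : realType} {n : nat} {p c r : R} {Om : set 'rV[R]_n} {u : 'rV[R]_n -> R}.
Context {nu : 'rV[R]_n -> 'rV[R]_n} (H : serrin p c r Om u nu).
Implicit Types (x y z w h k e b : 'rV[R]_n) (lam : R).

Lemma open_ball z (D : R) : open [set x | enorm (x - z) < D].
Proof.
apply: enorm_open => x /= xD; exists (D - enorm (x - z)); first by rewrite subr_gt0.
by move=> y yx; have := enorm_tri y x z; clear -H yx; lra.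
Qed.

Definition capped e lam := forall y, Om y -> lam < dot y e -> Om (mir e lam y).

(** Along the inner normal [u] tends to zero at [y], so by equality and continuity it vanishes at
    [mir e lam y], which is impossible inside. *)
Lemma touch_of_equal e lam y (s : R) : enorm e = 1 -> capped e lam -> boundary Om y -> 0 < s ->
  (forall t, 0 < t -> t < s -> [/\ Om (y + t *: nu y), lam < dot (y + t *: nu y) e &
     u (mir e lam (y + t *: nu y)) = u (y + t *: nu y)]) -> ~ Om (mir e lam y).
Proof.
move=> e1 cap by_ s0 h Oy; have c0 := sc0 H; have uy := sol_gt0 H Oy.
pose t := Num.min (s / 2) (u (mir e lam y) / (4 * c)).
have t0 : 0 < t by rewrite lt_min !divr_gt0// mulr_gt0.
have ts : t < s by apply: (@le_lt_trans _ _ (s / 2)); [rewrite ge_min lexx|clear -H s0; lra].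
have tu : t * (4 * c) <= u (mir e lam y) by rewrite -ler_pdivlMr ?mulr_gt0// ge_min lexx orbT.
clearbody t; have [Oxt lxt E] := h t t0 ts.
have dt : enorm (y + t *: nu y - y) = t by rewrite addrC addKr enormZ (nu1 H by_) mulr1 gtr0_norm.
have := sol_le_dist H (subset_closure Oxt) by_; rewrite dt => h1.
have := sol_lip H (subset_closure Oy) (subset_closure (cap _ Oxt lxt)).
rewrite mir_isom// (enormC y) dt E => /ler_normlP[_ h2].
have : 0 < c * t by rewrite mulr_gt0.
by clear -H h1 h2 tu; lra.
Qed.

Lemma reg_cap e lam : enorm e = 1 -> capped e lam -> exists K d0, [/\ 0 < K, 0 < d0,
  (forall x y, Om x -> boundary Om y -> enorm (x - y) < d0 -> reg p (c / 2) K u x) &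
  forall x y y', Om x -> lam < dot x e -> boundary Om y -> enorm (x - y) < d0 ->
  boundary Om y' -> enorm (mir e lam x - y') < d0 ->
  reg p (c / 2) (@mirror_bound R n * K) (fun z => u (mir e lam z)) x /\
  reg p (c / 2) (@mirror_bound R n * K) u x].
Proof.
move=> e1 cap; have [K [d0 [K0 d00 hK]]] := collar_jets H; exists K, d0; split=> //.
move=> x y y' Ox lx by_ xy by' xy'; split; first exact: reg_mir e1 (hK _ _ (cap _ Ox lx) by' xy').
by apply: reg_le (hK _ _ Ox by_ xy); rewrite ler_peMl ?mirror_bound_ge1 ?(sn0 H)// ltW.
Qed.

Lemma capped_boundary e lam z : enorm e = 1 -> capped e lam -> boundary Om z -> lam <= dot z e ->
  ~ Om (mir e lam z) -> boundary Om (mir e lam z).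
Proof.
move=> e1 cap [cz _] lz nO; apply/(boundaryE _ (sopen H)); split=> //.
exact: cap_closure e1 cap cz lz.
Qed.

(** Along the inner normal at a contact point [u] is at least [c t - O(t^2)] by [trap], and the
    mirror image is at most [c t] by the Lipschitz bound; a gap of [k t] does not fit between
    them. *)
Lemma Hopf_contradiction e lam z (k D : R) : enorm e = 1 -> capped e lam -> boundary Om z -> lam < dot z e ->
  ~ Om (mir e lam z) -> 0 < k -> 0 < D -> D <= r ->
  (forall t, 0 < t -> t <= D / 2 -> k * t <= u (mir e lam (z + t *: nu z)) - u (z + t *: nu z)) -> False.
Proof.
move=> e1 cap bz lz nO k0 D0 Dr hk; have c0 := sc0 H; have r0 := sr0 H.
have bm := capped_boundary e1 cap bz (ltW lz) nO.
have [K [d0 [K0 d00 tr]]] := trap H.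
have n1 := nu1 H bz.
pose B := c / (2 * r) + K; have B0 : 0 < B by rewrite /B; pos.
pose t := Num.min (Num.min (D / 2) (d0 / 2)) (Num.min (k / (2 * B)) ((dot z e - lam) / 2)).
have t0 : 0 < t by rewrite !lt_min !divr_gt0 ?mulr_gt0 ?subr_gt0.
have [tD td tl] : [/\ t <= D / 2, t <= d0 / 2 & t <= (dot z e - lam) / 2].
  by rewrite /t !ge_min !lexx ?orbT.
have tB : t * (2 * B) <= k by rewrite -ler_pdivlMr ?mulr_gt0// /t !ge_min lexx !orbT.
clearbody t; have := hk t t0 tD; set x := z + t *: nu z => h1.
have Ox : Om x.
  by apply: tball_in (tball_le D0 Dr (sball H bz)) t0 _; clear -H tD D0; lra.
have xz : x - z = t *: nu z by rewrite /x; vec.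
have xzE : enorm (x - z) = t by rewrite xz enormZ n1 mulr1 gtr0_norm.
have lx : lam < dot x e.
  have := ler_dot (x - z) e; rewrite xzE e1 mulr1 dotBl => /ler_normlP[h2 _].
  by clear -H h2 tl lz; lra.
have := sol_le_dist H (subset_closure (cap _ Ox lx)) bm; rewrite mir_isom// xzE => h2.
have [w xw] := near_pair_ex H Ox; set d := enorm (w - x).
have dt : d <= t by apply: le_trans (near_pair_le H xw bz) _; rewrite enormC xzE.
have dd : 0 <= d by exact: enorm_ge0.
have := dist_linear H xw bz; rewrite xz !dotZr dotZl dot1// !mulr1 -/d => /ler_normlP[h3 _].
have := tr x w xw; rewrite -/d => /(_ _) h4.
have {}h4 : c * d - K * d ^+ 2 <= u x by apply: h4; clear -H dt td d00; lra.
have h5 : K * d ^+ 2 <= K * t ^+ 2 by rewrite ler_pM2l// lerXn2r ?nnegrE// ltW.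
have h6 := ler_wpM2l (ltW c0) h3.
have E : B * t ^+ 2 = c * (t * t / (2 * r)) + K * t ^+ 2 by rewrite /B; field; rewrite gt_eqF.
have h7 : 2 * (B * t ^+ 2) <= k * t by rewrite (_ : 2 * _ = t * (2 * B) * t); [rewrite ler_pM2r|ring].
have : 0 < B * t ^+ 2 by rewrite mulr_gt0// exprn_gt0.
by clear -H h1 h2 h4 h5 h6 E h7; lra.
Qed.

(** By [Hopf_contradiction] the two functions agree somewhere in the tangent ball at [z], hence
    throughout it by [strong_max]. Tangent balls at nearby boundary points overlap this one, so
    agreement passes to them, and [touch_of_equal] turns it into contact. *)
Lemma touch_spread e lam z : enorm e = 1 -> capped e lam -> boundary Om z -> lam < dot z e ->
  ~ Om (mir e lam z) -> exists2 d, 0 < d & forall y, boundary Om y -> enorm (y - z) < d ->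
  lam < dot y e /\ ~ Om (mir e lam y).
Proof.
move=> e1 cap bz lz nO; have c0 := sc0 H; have r0 := sr0 H; have p1 := sp1 H; have n0 := sn0 H.
have bm := capped_boundary e1 cap bz (ltW lz) nO.
have [K [d0 [K0 d00 _ hK]]] := reg_cap e1 cap.
pose K1 := @mirror_bound R n * K; have K10 : 0 <= K1 by rewrite mulr_ge0 ?sqr_ge0// ltW.
have c2 : 0 < c / 2 by rewrite divr_gt0.
have [DH DH0 hopf] := Hopf_ball p1 n0 c2 K10.
pose D := Num.min (Num.min r (d0 / 4)) (Num.min DH ((dot z e - lam) / 8)).
have D0 : 0 < D by rewrite !lt_min r0 DH0 !divr_gt0// subr_gt0.
have [Dr Dd DDH Dl] : [/\ D <= r, D <= d0 / 4, D <= DH & D <= (dot z e - lam) / 8].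
  by rewrite /D !ge_min !lexx ?orbT.
clearbody D; pose B y := [set x | enorm (x - (y + D *: nu y)) < D].
pose v x := u (mir e lam x).
have inB y x : boundary Om y -> enorm (y - z) < D / 2 -> B y x ->
    [/\ Om x, lam < dot x e, reg p (c / 2) K1 v x, reg p (c / 2) K1 u x & u x <= v x].
  move=> by_ yz xB; have [n1 tI _] := tball_le D0 Dr (sball H by_).
  have Ox : Om x by exact: tI.
  have xy : enorm (x - y) < 2 * D.
    have := enorm_tri x (y + D *: nu y) y; rewrite [y + _ - y]addrC addKr enormZ n1 mulr1 gtr0_norm//.
    by move: (xB : enorm _ < D); clear -H; lra.
  have xz : enorm (x - z) < 5 / 2 * D by have := enorm_tri x y z; clear -H xy yz; lra.
  have lx : lam < dot x e.
    have := ler_dot (x - z) e; rewrite e1 mulr1 dotBl => /ler_normlP[h2 _].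
    by clear -H h2 xz Dl D0; lra.
  have [||R1 R2] := hK x y (mir e lam z) Ox lx by_ _ bm; [|by rewrite mir_isom//; clear -H xz Dd D0; lra|].
    by clear -H xy Dd D0; lra.
  by split=> //; exact: (weak_comparison H e1 cap Ox lx).
have same y x1 : boundary Om y -> enorm (y - z) < D / 2 -> B y x1 -> v x1 = u x1 ->
    forall x, B y x -> v x = u x.
  move=> by_ yz x1B E x xB; apply: (strong_max p1 n0 c2 K10 (@open_ball (y + D *: nu y) D) _ _ _ x1B E xB).
  - by move=> a b t ha hb t0 t1; exact: ball_convex.
  - by move=> a /(inB y a by_ yz)[].
  - by move=> a /(inB y a by_ yz)[].
have D2 : 0 < D / 2 by rewrite divr_gt0.
have zz : enorm (z - z) < D / 2 by rewrite subrr enorm0.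
have Bt y t : boundary Om y -> 0 < t -> t < 2 * D -> B y (y + t *: nu y).
  move=> by_ t0 tD; rewrite /B /=; have -> : y + t *: nu y - (y + D *: nu y) = (t - D) *: nu y by vec.
  by rewrite enormZ (nu1 H by_) mulr1; apply/ltr_normlP; move: t0 tD; clear -H; split; lra.
have [x1 x1B E1] : exists2 x1, B z x1 & v x1 = u x1.
  apply: contrapT => no.
  have pos_ x : B z x -> 0 < v x - u x.
    move=> xB; have [_ _ _ _ le] := inB z x bz zz xB; rewrite subr_gt0 lt_neqAle le andbT.
    by apply/eqP => E; apply: no; exists x.
  have [||w wA wmin] := @compact_min R n [set y | D / 2 <= enorm (y - (z + D *: nu z)) <= D / 2] (fun x => v x - u x)
    (@compact_annulus R n (z + D *: nu z) _ _).
  - exists (z + (D / 2) *: nu z) => /=; have -> : z + (D / 2) *: nu z - (z + D *: nu z) = (- (D / 2)) *: nu z.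
      by apply/rowP => j; rewrite !mxE; field.
    by rewrite enormZ (nu1 H bz) mulr1 normrN gtr0_norm// lexx.
  - apply: cont_onW => x /andP[_ xD]; have [|_ _ r1 r2 _] := inB z x bz zz.
      by rewrite /B /=; clear -H xD D0; lra.
    exact: continuousB (reg_cont r1) (reg_cont r2).
  have m0 : 0 < v w - u w by apply: pos_; rewrite /B /=; move: wA => /andP[_]; clear -H D0; lra.
  have [k k0 hk] := hopf D (v w - u w) D0 DDH m0.
  have {}hk := hk v u (z + D *: nu z).
  feed hk; first by move=> x xB; have [_ _ r1 r2 _] := inB z x bz zz xB.
  feed hk; first by move=> x xB; have [_ _ _ _ le] := inB z x bz zz xB.
  feed hk; first by move=> x xD; apply: wmin; rewrite /= xD lexx.
  apply: (@Hopf_contradiction e lam z k D) => // t t0 tD.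
  have E : enorm (z + t *: nu z - (z + D *: nu z)) = D - t.
    have -> : z + t *: nu z - (z + D *: nu z) = (- (D - t)) *: nu z by vec.
    by rewrite enormZ (nu1 H bz) mulr1 normrN gtr0_norm//; clear -H tD D0; lra.
  have := hk (z + t *: nu z); rewrite E => h.
  have -> : k * t = k * (D - (D - t)) by congr (_ * _); ring.
  by apply: h; clear -H t0 tD; lra.
exists (D / 2) => // y by_ yz.
have ly : lam < dot y e.
  have := ler_dot (y - z) e; rewrite e1 mulr1 dotBl => /ler_normlP[h2 _].
  by clear -H h2 yz Dl D0; lra.
split=> //.
(* The midpoint of the two centres lies in both balls. *)
pose x2 := 2^-1 *: ((y + D *: nu y) + (z + D *: nu z)).
have cc : enorm ((y + D *: nu y) - (z + D *: nu z)) < D.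
  have T := tball_lip r0 (sball H by_) (sball H bz).
  have -> : (y + D *: nu y) - (z + D *: nu z) = (y - z) + D *: (nu y - nu z) by vec.
  apply: le_lt_trans (ler_enormD _ _) _; rewrite enormZ gtr0_norm//.
  have := ler_wpM2r (enorm_ge0 (nu y - nu z)) Dr; clear -H T yz; lra.
have B1 : B y x2.
  rewrite /B /=; have -> : x2 - (y + D *: nu y) = (- 2^-1) *: ((y + D *: nu y) - (z + D *: nu z)).
    by apply/rowP => j; rewrite !mxE; field.
  by rewrite enormZ normrN ger0_norm ?invr_ge0//; clear -H cc D0; lra.
have B2 : B z x2.
  rewrite /B /=; have -> : x2 - (z + D *: nu z) = 2^-1 *: ((y + D *: nu y) - (z + D *: nu z)).
    by apply/rowP => j; rewrite !mxE; field.
  by rewrite enormZ ger0_norm ?invr_ge0//; clear -H cc D0; lra.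
have E2 := same z x1 bz zz x1B E1 x2 B2.
apply: (@touch_of_equal e lam y (2 * D)) => //; first by rewrite mulr_gt0.
move=> t t0 tD; have xB := Bt y t by_ t0 tD.
by have [? ? _ _ _] := inB y _ by_ yz xB; split=> //; exact: same by_ yz B1 E2 _ xB.
Qed.

(** The scheme of [touch_spread] in the part of the ball above the mirror plane; here agreement
    somewhere is forced by [corner_barrier] against [corner_contradiction]. *)
Lemma corner_spread e lam Q : enorm e = 1 -> capped e lam -> boundary Om Q -> dot Q e = lam ->
  dot (nu Q) e = 0 -> exists2 d, 0 < d & forall y, boundary Om y -> enorm (y - Q) < d ->
  lam < dot y e -> ~ Om (mir e lam y).
Proof.
move=> e1 cap bQ lQ ne; have c0 := sc0 H; have r0 := sr0 H; have p1 := sp1 H; have n0 := sn0 H.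
have [K [d0 [K0 d00 hK1 hK]]] := reg_cap e1 cap.
pose K1 := @mirror_bound R n * K; have K10 : 0 <= K1 by rewrite mulr_ge0 ?sqr_ge0// ltW.
have c2 : 0 < c / 2 by rewrite divr_gt0.
have [DC DC0 corner] := corner_barrier p1 n0 c2 (ltW K0).
pose D := Num.min (Num.min r (d0 / 4)) DC.
have D0 : 0 < D by rewrite !lt_min r0 DC0 !divr_gt0.
have [Dr Dd DDC] : [/\ D <= r, D <= d0 / 4 & D <= DC].
  by rewrite /D !ge_min !lexx ?orbT.
clearbody D; pose B y := [set x | enorm (x - (y + D *: nu y)) < D /\ lam < dot x e].
pose v x := u (mir e lam x).
have mQ : mir e lam Q = Q by rewrite /mir lQ subrr mulr0 scale0r addr0.
have inB' y x : boundary Om y -> enorm (x - (y + D *: nu y)) < D -> Om x /\ enorm (x - y) < 2 * D.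
  move=> by_ xB; have [n1 tI _] := tball_le D0 Dr (sball H by_).
  split; first exact: tI.
  have := enorm_tri x (y + D *: nu y) y; rewrite [y + _ - y]addrC addKr enormZ n1 mulr1 gtr0_norm//.
  by clear -H xB; lra.
have inB y x : boundary Om y -> enorm (y - Q) < D / 8 -> B y x ->
    [/\ Om x, reg p (c / 2) K1 v x, reg p (c / 2) K1 u x & u x <= v x].
  move=> by_ yz [xB lx]; have [Ox xy] := inB' y x by_ xB.
  have xz : enorm (x - Q) < 5 / 2 * D by have := enorm_tri x y Q; clear -H xy yz D0; lra.
  have [||R1 R2] := hK x y Q Ox lx by_ _ bQ; [|by rewrite -{1}mQ mir_isom//; clear -H xz Dd D0; lra|].
    by clear -H xy Dd D0; lra.
  by split=> //; exact: (weak_comparison H e1 cap Ox lx).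
have opB y : open (B y).
  apply: enorm_open => x [xB lx].
  exists (Num.min (D - enorm (x - (y + D *: nu y))) (dot x e - lam)); first by rewrite lt_min !subr_gt0 xB.
  move=> w; rewrite lt_min => /andP[h1 h2]; split.
    by have := enorm_tri w x (y + D *: nu y); clear -H h1; lra.
  have := ler_dot (w - x) e; rewrite e1 mulr1 dotBl => /ler_normlP[h3 _].
  by clear -H h3 h2; lra.
have same y x1 : boundary Om y -> enorm (y - Q) < D / 8 -> B y x1 -> v x1 = u x1 ->
    forall x, B y x -> v x = u x.
  move=> by_ yz x1B E x xB; apply: (strong_max p1 n0 c2 K10 (opB y) _ _ _ x1B E xB).
  - move=> a b t [ha la] [hb lb] t0 t1; split; first exact: ball_convex.
    rewrite dotDl dotZl dotBl; have : 0 <= (1 - t) * (dot a e - lam) by rewrite mulr_ge0 ?subr_ge0// ltW.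
    have : 0 <= t * (dot b e - lam) by rewrite mulr_ge0 ?subr_ge0// ltW.
    have [->|tn] := eqVneq t 0; first by clear -H la; lra.
    have : 0 < t * (dot b e - lam) by rewrite mulr_gt0 ?subr_gt0// lt_neqAle eq_sym tn.
    by clear -H; lra.
  - by move=> a /(inB y a by_ yz)[].
  - by move=> a /(inB y a by_ yz)[].
have QQ : enorm (Q - Q) < D / 8 by rewrite subrr enorm0 divr_gt0.
have cQ : dot (Q + D *: nu Q) e = lam by rewrite dotDl dotZl ne mulr0 addr0.
have xi x : dot (x - (Q + D *: nu Q)) e = dot x e - lam by rewrite dotBl cQ.
have [x1 x1B E1] : exists2 x1, B Q x1 & v x1 = u x1.
  apply: contrapT => no.
  have [|||k k0 hk] := corner D D0 DDC u (Q + D *: nu Q) e e1.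
  - move=> x /(inB' Q x bQ)[Ox xQ]; apply: hK1 Ox bQ _; clear -H xQ Dd D0; lra.
  - move=> x xB; rewrite xi subr_ge0 cQ le_eqVlt => /orP[/eqP E|lx].
      by rewrite /mir -E subrr mulr0 scale0r addr0.
    by have [|_ _ _] := inB Q x bQ QQ.
  - move=> x xB; rewrite xi subr_gt0 cQ => lx; have [//|_ _ _ le] := inB Q x bQ QQ.
    rewrite lt_neqAle le andbT; apply/eqP => E; apply: no; by exists x.
  apply: (corner_contradiction H bQ e1 ne k0 D0 Dr) => y y1 y2 y3.
  by have := hk y y1 y2 y3; rewrite cQ lQ.
exists (D / 8) => [|y by_ yz ly]; first by rewrite divr_gt0.
(* Strictly above the plane and in the tangent balls at [Q] and at every boundary point close to
   it. *)
pose x2 := Q + D *: nu Q + (D / 2) *: e.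
have lx2 : lam < dot x2 e by rewrite dotDl cQ dotZl dot1// mulr1 ltrDl divr_gt0.
have B2 : B Q x2.
  split=> //; rewrite /x2 addrC addKr enormZ e1 mulr1 gtr0_norm ?divr_gt0//.
  by clear -H D0; lra.
have B1 : B y x2.
  split=> //; have T := tball_lip r0 (sball H by_) (sball H bQ).
  have -> : x2 - (y + D *: nu y) = (D / 2) *: e - ((y - Q) + D *: (nu y - nu Q)) by rewrite /x2; vec.
  apply: le_lt_trans (ler_enormB _ _) _; rewrite enormZ e1 mulr1 gtr0_norm ?divr_gt0//.
  have := ler_enormD (y - Q) (D *: (nu y - nu Q)); rewrite enormZ gtr0_norm//.
  by have := ler_wpM2r (enorm_ge0 (nu y - nu Q)) Dr; clear -H T yz D0; lra.
have E2 := same Q x1 bQ QQ x1B E1 x2 B2.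
apply: (@touch_of_equal e lam y (Num.min D (dot y e - lam))) => //; first by rewrite lt_min D0 subr_gt0.
move=> t t0; rewrite lt_min => /andP[tD tl].
have lx : lam < dot (y + t *: nu y) e.
  have := ler_dot (t *: nu y) e; rewrite e1 mulr1 enormZ (nu1 H by_) mulr1 (gtr0_norm t0) => /ler_normlP[h _].
  by rewrite dotDl; clear -H h tl; lra.
have xB : B y (y + t *: nu y).
  split=> //; have -> : y + t *: nu y - (y + D *: nu y) = (- (D - t)) *: nu y by vec.
  rewrite enormZ (nu1 H by_) mulr1 normrN gtr0_norm ?subr_gt0//.
  by clear -H t0; lra.
by have [? _ _ _] := inB y _ by_ yz xB; split=> //; exact: same by_ yz B1 E2 _ xB.
Qed.

End Touching.

Lemma dot_sqrD {R : realType} {n : nat} (v w : 'rV[R]_n) :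
  dot (v + w) (v + w) = dot v v + 2 * dot v w + dot w w.
Proof. by rewrite dotDl !dotDr (dotC w v); ring. Qed.

Lemma dot_sqrB {R : realType} {n : nat} (v w : 'rV[R]_n) :
  dot (v - w) (v - w) = dot v v - 2 * dot v w + dot w w.
Proof. by rewrite dotBl !dotBr (dotC w v); ring. Qed.

(** * Critical planes and reflection symmetry *)

Section MovingPlanes.
Context {R : realType} {n : nat} {p c r : R} {Om : set 'rV[R]_n} {u : 'rV[R]_n -> R}.
Context {nu : 'rV[R]_n -> 'rV[R]_n} (H : serrin p c r Om u nu).
Implicit Types (x y z w h k q e : 'rV[R]_n) (lam mu : R).

(* The plane [dot x e = mu] is critical at [z]: the reflected cap touches the
   boundary from inside, or the plane is orthogonal to the boundary. *)
Definition touches e mu z :=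
  (mu < dot z e /\ ~ Om (mir e mu z)) \/ (dot z e = mu /\ 0 <= dot (nu z) e).

(** [s *: e] lies in the inner tangent ball as soon as [s < 2 r <nu z, e>], and [- s *: e] then lies
    in the exterior one. *)
Lemma cone_in z e (s a : R) : enorm e = 1 -> boundary Om z -> 0 < s -> s < 2 * r * a ->
  a <= dot (nu z) e -> Om (z + s *: e) /\ ~ Om (z - s *: e).
Proof.
move=> e1 bz s0 sr ae; have r0 := sr0 H; have [n1 hI hE] := sball H bz.
have key : enorm (s *: e - r *: nu z) < r.
  rewrite enorm_lt_sqr ?(ltW r0)// (dotBl (s *: e)) !(dotBr (_ *: _)) !dotZl !dotZr (dot1 e1) (dot1 n1) (dotC e (nu z)).
  have h1 : s * (s - 2 * r * a) < 0 by rewrite pmulr_rlt0// subr_lt0.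
  have h2 : s * (2 * r * a) <= s * (2 * r * dot (nu z) e) by rewrite ler_pM2l// ler_pM2l// mulr_gt0.
  by move: h1 h2; clear -H; nra.
split; [apply: hI|apply: hE].
  by have -> : z + s *: e - (z + r *: nu z) = s *: e - r *: nu z by vec.
have -> : z - s *: e - (z - r *: nu z) = - (s *: e - r *: nu z) by vec.
by rewrite enormN.
Qed.

Lemma mir_near e lam mu x y : enorm e = 1 -> enorm (mir e mu y - mir e lam x) <= enorm (y - x) + 2 * `|mu - lam|.
Proof.
move=> e1; have -> : mir e mu y - mir e lam x = (mir e lam y - mir e lam x) + (2 * (mu - lam)) *: e.
  by rewrite /mir; vec.
apply: le_trans (ler_enormD _ _) _; rewrite mir_isom// enormZ e1 mulr1 normrM ger0_norm//.
Qed.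

Lemma dot_near e x y : enorm e = 1 -> dot x e - enorm (y - x) <= dot y e.
Proof.
move=> e1; have := ler_dot (y - x) e; rewrite e1 mulr1 dotBl => /ler_normlP[h _].
by clear -H h; lra.
Qed.

(** Absence of contact persists when the plane is lowered slightly. For [z] above the plane this is
    openness of [Om]; for [z] below, nothing nearby is reached; for [z] on the plane the normals
    nearby have negative component along [e], and [cone_in] with direction [- e] puts the mirror
    images inside. *)
Lemma nontouch_near e lam z : enorm e = 1 -> boundary Om z -> ~ touches e lam z ->
  exists2 s, 0 < s & forall (w : R) y, 0 < w -> w < s -> enorm (y - z) < s -> boundary Om y -> ~ touches e (lam - w) y.
Proof.
move=> e1 bz nt; have r0 := sr0 H; have [lz|lz|lz] := ltgtP lam (dot z e).
- have Omz : Om (mir e lam z) by apply: contrapT => nO; apply: nt; left.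
  have [s s0 hs] := open_enorm (sopen H) Omz.
  exists (Num.min (s / 4) (dot z e - lam)); first by rewrite lt_min divr_gt0// subr_gt0.
  move=> w y w0; rewrite !lt_min => /andP[w1 w2] /andP[y1 y2] by_ [[_]|[E _]].
    apply; apply: hs; apply: le_lt_trans (mir_near _ _ _ _ e1) _.
    have -> : lam - w - lam = - w by ring.
    by rewrite normrN gtr0_norm//; clear -H w1 y1 s0; lra.
  by have := dot_near z y e1; clear -H E w0 y2; lra.
- exists ((lam - dot z e) / 2); first by rewrite divr_gt0// subr_gt0.
  move=> w y w0 w1 y1 by_ T; have : lam - w <= dot y e by case: T => [[/ltW]|[-> _]].
  by have := dot_near y z e1; rewrite enormC; clear -H w1 y1; lra.
have a0 : 0 < - dot (nu z) e.
  by rewrite oppr_gt0 ltNge; apply/negP => h; apply: nt; right; rewrite -lz.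
set a := - dot (nu z) e in a0.
exists (Num.min (r * a / 4) (r * a / 4)); first by rewrite lt_min andbb divr_gt0// mulr_gt0.
move=> w y w0; rewrite !lt_min !andbb => w1 y1 by_ T.
have na : dot (nu y) e <= - a / 2.
  have := tball_lip r0 (sball H by_) (sball H bz); have := ler_dot (nu y - nu z) e.
  rewrite e1 mulr1 dotBl => /ler_normlP[_ h1] h2.
  have : r * (dot (nu y) e - dot (nu z) e) <= r * (a / 2).
    by apply: le_trans (ler_wpM2l (ltW r0) h1) _; have := mulr_gt0 r0 a0; clear -H h2 y1; lra.
  by rewrite ler_pM2l// /a; clear -H; lra.
case: T => [[l1]|[_]]; last by clear -H na a0; lra.
apply; have -> : mir e (lam - w) y = y + (2 * (dot y e - (lam - w))) *: (- e) by rewrite /mir; vec.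
have [] // := @cone_in y (- e) (2 * (dot y e - (lam - w))) (a / 2) _ by_ _ _ _.
- by rewrite enormN.
- by rewrite mulr_gt0// subr_gt0.
- have := dot_near y z e1; rewrite enormC -lz; have := mulr_gt0 r0 a0; clear -H w1 y1; lra.
- by rewrite dotNr; clear -H na; lra.
Qed.

(** The plane is the supremum of the positions with contact. Were it not attained, [nontouch_near]
    and compactness of the boundary would exclude contact for all slightly lower planes. *)
Lemma critical_plane e : enorm e = 1 -> exists lam, (exists2 z, boundary Om z & touches e lam z) /\
  forall mu z, lam < mu -> boundary Om z -> ~ touches e mu z.
Proof.
move=> e1; have [M M0 hM] := bounded_closure (sbd H).
have eM z : closure Om z -> `|dot z e| <= M.
  by move=> /hM h; apply: le_trans (ler_dot _ _) _; rewrite e1 mulr1.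
pose S := [set mu | exists2 z, boundary Om z & touches e mu z].
have [x0 Ox0] := sne H.
have [z0 [bz0 _ _ _]] := nearest_boundary (sn0 H) (sopen H) (sbd H) Ox0.
(* A plane below the whole domain sends every point outside, so every boundary point is in
   contact. *)
have S0 : S !=set0.
  exists (- (M + 1)), z0 => //; left; have := eM z0 bz0.1 => /ler_normlP[h1 h2]; split.
    by clear -H h1; lra.
  move=> /subset_closure/eM/ler_normlP[h3 _]; move: h3; rewrite mir_dot//.
  by clear -H h1; lra.
have SM mu : S mu -> mu <= M.
  move=> [z bz T]; have := eM z bz.1 => /ler_normlP[_ h]; apply: le_trans h.
  by case: T => [[/ltW]|[-> _]].
have hS : has_sup S by split=> //; exists M => mu /SM.
exists (sup S); split; last first.
  move=> mu z lmu bz T; move: lmu; rewrite ltNge => /negP; apply; apply: ub_le_sup; first by case: hS.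
  by exists z.
apply: contrapT => nS.
have [z bz|s s0 hs] := compact_scale (compact_boundary (sbd H)) (P := fun (w : R) y => ~ touches e (sup S - w) y).
  have nt : ~ touches e (sup S) z by move=> T; apply: nS; exists z.
  by have [s s0 hs] := nontouch_near e1 bz nt; exists s => // w y w0 ws ys by_; exact: hs.
have [mu [z bz T] lmu] := sup_adherent s0 hS.
have mu_le : mu <= sup S by apply: ub_le_sup; [case: hS|exists z].
have mu_lt : mu < sup S.
  by rewrite lt_neqAle mu_le andbT; apply/eqP => E; apply: nS; exists z; rewrite // -E.
apply: (hs (sup S - mu) z) => //; first by rewrite subr_gt0.
  by clear -H lmu; lra.
by have -> : sup S - (sup S - mu) = mu by ring.
Qed.

(** Symmetry in the plane, which is the case [t = 1], together with presence of the whole segment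
    between mirror images; [symmetric_ball] uses the segments to fill spheres to a ball. *)
Definition folds e lam := forall x, Om x -> forall t, 0 <= t -> t <= 1 -> Om (x + t *: (mir e lam x - x)).

(** [A] is the union of the open chords from contact points to their mirror images. It is open
    because contact spreads, closed in [Om] because contact points form a compact set, and nonempty;
    connectedness of [Om] makes it all of [Om]. *)
Lemma symmetry e : enorm e = 1 -> exists lam, folds e lam.
Proof.
move=> e1; have [lam [[zt bzt Tt] nT]] := critical_plane e1; have r0 := sr0 H.
have [M M0 hM] := bounded_closure (sbd H).
(* Such a point is the mirror image of [z] in a plane strictly above the critical one, where contact
   is excluded. *)
have line z (s : R) : boundary Om z -> 0 < s -> s < 2 * (dot z e - lam) -> Om (z - s *: e).
  move=> bz s0 sl; apply: contrapT => nO; apply: (nT (dot z e - s / 2) z) => //.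
    by clear -H sl; lra.
  left; split; first by clear -H s0; lra.
  by rewrite /mir (_ : 2 * (dot z e - s / 2 - dot z e) = - s) ?scaleNr//; field.
have trans z : boundary Om z -> lam < dot z e -> dot (nu z) e < 0.
  by move=> bz lz; rewrite ltNge; apply/negP => h; apply: (nT _ _ lz bz); right.
(* The ray from [x] along [e] leaves [Om] at a boundary point, and the mirror image of [x] lies on
   the open chord that [line] provides below that point. *)
have cap : capped (Om := Om) e lam.
  move=> x Ox lx; pose B := M + enorm x + 1.
  have B0 : 0 < B by rewrite /B; have := enorm_ge0 x; clear -H M0; lra.
  have [|t [t0 t1 bt _]] := @exit_point _ _ Om x (B *: e) (sopen H) Ox.
    move=> /subset_closure/hM; have := ler_enormB (x + B *: e) x.
    by rewrite addrC addKr enormZ e1 mulr1 gtr0_norm// /B; clear -H; lra.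
  rewrite scalerA in bt; set T := t * B in bt; have T0 : 0 < T by rewrite mulr_gt0.
  have dz : dot (x + T *: e) e = dot x e + T by rewrite dotDl dotZl dot1// mulr1.
  have -> : mir e lam x = x + T *: e - (T + 2 * (dot x e - lam)) *: e by rewrite /mir; vec.
  by apply: line => //; rewrite ?dz; clear -H lx T0; lra.
(* If the contact at [zt] is a corner, [corner_spread] and the expansion of the boundary over [e]
   produce a contact point strictly above the plane. *)
have [z0 [bz0 lz0 nz0]] : exists z, [/\ boundary Om z, lam < dot z e & ~ Om (mir e lam z)].
  case: Tt => [[? ?]|[lQ nQ]]; first by exists zt.
  have {nQ} ne : dot (nu zt) e = 0.
    apply/eqP; rewrite eq_le nQ andbT leNgt; apply/negP => a0.
    set a := dot (nu zt) e in a0.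
    have s0 : 0 < r * a by rewrite mulr_gt0.
    have [||Oa Ob] := @cone_in zt e (r * a) a e1 bzt s0; [by clear -H s0; lra|exact: lexx|].
    apply: Ob; have -> : zt - (r * a) *: e = mir e lam (zt + (r * a) *: e).
      by rewrite /mir dotDl dotZl dot1// lQ; vec.
    by apply: cap => //; rewrite dotDl dotZl dot1// lQ mulr1 ltrDl.
  have [d d0 hd] := corner_spread H e1 cap bzt lQ ne.
  have en : dot e (nu zt) = 0 by rewrite dotC.
  have [k hk] := boundary_expansion (sopen H) (sC2 H) r0 bzt (sball H bzt) e1 en.
  have [d1 d10 h1] := hk 1 ltr01.
  pose C := `|k| + 1; have C0 : 0 < C by rewrite ltr_wpDl.
  pose s := Num.min (Num.min (d1 / 2) (d / 4)) (Num.min 1 (d / (4 * C))).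
  have s0 : 0 < s by rewrite !lt_min !divr_gt0 ?mulr_gt0// ltr01.
  have [sd1 sd s1] : [/\ s <= d1 / 2, s <= d / 4 & s <= 1] by rewrite /s !ge_min !lexx ?orbT.
  have sC : s * (4 * C) <= d by rewrite -ler_pdivlMr ?mulr_gt0// /s !ge_min lexx !orbT.
  clearbody s; have := h1 s; rewrite gtr0_norm// => /(_ s0) h2.
  have [|Oa Ob] := h2 _; first by clear -H sd1 d10; lra.
  have [|ka [k1 k2 bk]] := boundary_between H _ Oa Ob.
    by rewrite ltr_pM2r ?exprn_gt0//; clear -H; lra.
  have ly : dot (zt + s *: e + ka *: nu zt) e = lam + s.
    by rewrite !dotDl !dotZl ne dot1// lQ; ring.
  exists (zt + s *: e + ka *: nu zt); split=> //; first by rewrite ly ltrDl.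
  apply: hd => //; last by rewrite ly ltrDl.
  have -> : zt + s *: e + ka *: nu zt - zt = s *: e + ka *: nu zt by vec.
  apply: le_lt_trans (ler_enormD _ _) _; rewrite !enormZ e1 (nu1 H bzt) !mulr1 gtr0_norm//.
  have s20 : 0 < s ^+ 2 by rewrite exprn_gt0.
  have ka_le : `|ka| <= C * s ^+ 2.
    have := ler_wpM2r (ltW s20) (ler_norm k); have : - `|k| <= k by rewrite lerNl -normrN ler_norm.
    move=> /(ler_wpM2r (ltW s20)) h3 h4; apply/ler_normlP; rewrite /C.
    by move: k1 k2 h3 h4; clear -H; split; lra.
  have : C * s ^+ 2 <= C * s by rewrite ler_pM2l// expr2 ler_piMr// ltW.
  by clear -H ka_le sC sd d0; lra.
exists lam.
pose A := [set x | exists z (s : R), [/\ boundary Om z, ~ Om (mir e lam z), 0 < s, s < 2 * (dot z e - lam) & x = z - s *: e]].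
have AO : A `<=` Om by move=> x [z [s [bz _ s0 sl ->]]]; exact: line.
suff AE : A = Om.
  move=> x; rewrite -{1}AE => -[z [s [bz _ s0 sl xE]]] t t0 t1.
  have dx : dot x e = dot z e - s by rewrite xE dotBl dotZl dot1// mulr1.
  have -> : x + t *: (mir e lam x - x) = z - (s + t * (2 * (dot z e - lam) - 2 * s)) *: e.
    by rewrite /mir dx xE; vec.
  apply: line => //.
    have : 0 <= t * (2 * (dot z e - lam) - s) by rewrite mulr_ge0// subr_ge0 ltW.
    have : 0 <= (1 - t) * s by rewrite mulr_ge0 ?subr_ge0// ltW.
    have [->|tn] := eqVneq t 0; first by clear -H s0; lra.
    have : 0 < t * (2 * (dot z e - lam) - s) by rewrite mulr_gt0 ?subr_gt0// lt_neqAle eq_sym tn.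
    by clear -H; lra.
  have h0 : 0 <= t * s by rewrite mulr_ge0// ltW.
  have h1 : 0 <= (1 - t) * (2 * (dot z e - lam) - s) by rewrite mulr_ge0 ?subr_ge0// ltW.
  have [E|tn] := eqVneq t 0; first by rewrite E; clear -H sl; lra.
  have : 0 < t * s by rewrite mulr_gt0// lt_neqAle eq_sym tn.
  by clear -H h1; lra.
apply: (sconn H).
- exists (z0 - (dot z0 e - lam) *: e), z0, (dot z0 e - lam); split=> //; first by rewrite subr_gt0.
  by clear -H lz0; lra.
- exists A; last by apply/esym/setIidr.
  (* From a point near [x] go along [e] until the boundary is crossed. Since the normal at [z] is
     transversal to [e] by [trans], the crossing happens close to [z], and [touch_spread] makes it a
     contact point. *)
  apply: enorm_open => x [z [s [bz nz s0 sl xE]]].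
  have lz : lam < dot z e by clear -H s0 sl; lra.
  have [d d0 hd] := touch_spread H e1 cap bz lz nz.
  have a0 : 0 < - dot (nu z) e by rewrite oppr_gt0 trans.
  set a := - dot (nu z) e in a0.
  pose g := 2 * (dot z e - lam) - s; have g0 : 0 < g by rewrite subr_gt0.
  pose ep := Num.min (Num.min (d / 2) (s / 2)) (Num.min (g / 2) (r * a)).
  have ep0 : 0 < ep by rewrite !lt_min !divr_gt0// mulr_gt0.
  have [ed es eg ea] : [/\ ep <= d / 2, ep <= s / 2, ep <= g / 2 & ep <= r * a].
    by rewrite /ep !ge_min !lexx ?orbT.
  clearbody ep.
  have Oin : Om (z - ep *: e) by apply: line => //; move: es eg g0 s0; rewrite /g; clear -H; lra.
  have [r1 r10 h1] := open_enorm (sopen H) Oin.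
  have out : enorm (z + ep *: e - (z - r *: nu z)) < r.
    have [n1 _ _] := sball H bz.
    have -> : z + ep *: e - (z - r *: nu z) = ep *: e + r *: nu z by vec.
    rewrite enorm_lt_sqr ?(ltW r0)// (dotDl (ep *: e)) !(dotDr (_ *: _)) !dotZl !dotZr (dot1 e1) (dot1 n1) (dotC e (nu z)).
    have h2 : ep * (ep - 2 * r * a) < 0.
      by rewrite pmulr_rlt0// subr_lt0; have := mulr_gt0 r0 a0; clear -H ea; lra.
    by move: h2; rewrite /a; clear -H; lra.
  set q := z - r *: nu z in out.
  pose rho := Num.min (Num.min r1 (d / 2)) (Num.min (g / 4) (r - enorm (z + ep *: e - q))).
  have rho0 : 0 < rho by rewrite !lt_min r10 !divr_gt0// subr_gt0.
  exists rho => // x'; rewrite !lt_min => /andP[/andP[x1 x2] /andP[x3 x4]].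
  have Oi : Om (x' + (s - ep) *: e).
    by apply: h1; have -> : x' + (s - ep) *: e - (z - ep *: e) = x' - x by rewrite xE; vec.
  have [|t [t0 t1 bt _]] := @exit_point _ _ Om (x' + (s - ep) *: e) ((2 * ep) *: e) (sopen H) Oi.
    have [_ _ hE] := sball H bz; apply: hE; rewrite -/q.
    have -> : x' + (s - ep) *: e + (2 * ep) *: e - q = (x' - x) + (z + ep *: e - q) by rewrite xE; vec.
    by apply: le_lt_trans (ler_enormD _ _) _; clear -H x4; lra.
  set z' := _ + _ in bt; pose s' := s - ep + t * (2 * ep).
  have z'E : z' = x' + s' *: e by rewrite /z' /s'; vec.
  have te : 0 < t * ep by rewrite mulr_gt0.
  have te1 : t * ep <= ep by rewrite ler_piMl// ltW.
  have z'z : enorm (z' - z) < d.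
    have -> : z' - z = (x' - x) + ((2 * t - 1) * ep) *: e by rewrite z'E xE /s'; vec.
    apply: le_lt_trans (ler_enormD _ _) _; rewrite enormZ e1 mulr1.
    have : `|(2 * t - 1) * ep| <= ep by apply/ler_normlP; move: te te1; clear -H; split; lra.
    by clear -H x2 ed; lra.
  have [lz' nz'] := hd z' bt z'z.
  exists z', s'; split=> //.
  + by rewrite /s'; clear -H te es s0; lra.
  + have -> : dot z' e = dot x' e + s' by rewrite z'E dotDl dotZl dot1// mulr1.
    have := dot_near x x' e1; have -> : dot x e = dot z e - s by rewrite xE dotBl dotZl dot1// mulr1.
    by move: x3 eg te; rewrite /g /s'; clear -H; lra.
  + by rewrite z'E addrK.
exists (closure A); first exact: closed_closure.
apply/seteqP; split=> [x Ax|x [Ox cAx]]; first by split; [exact: AO|exact: subset_closure].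
pose Z := [set z | [/\ boundary Om z, lam <= dot z e & ~ Om (mir e lam z)]].
have bcl : closed (boundary Om).
  by apply: compact_closed; [exact: norm_hausdorff|exact: compact_boundary (sbd H)].
have cZ : compact Z.
  apply: (@compact_enorm _ _ _ M) => [z [[/hM]]//|].
  apply: closed_enorm => z hz; split.
  - apply: bcl => B /nbhs_enorm[s s0 hs]; have [y [by_ _ _] yz] := hz s s0.
    by exists y; split=> //; exact: hs.
  - apply/ler_addgt0Pr => s s0; have [y [_ ly _] yz] := hz s s0.
    have := dot_near y z e1; rewrite enormC.
    have := dot_near z y e1; move: ly yz; have := ler_dot (y - z) e.
    rewrite e1 mulr1 dotBl => /ler_normlP[_ h] ly yz _ _; clear -H h ly yz; lra.
  - move=> Oz; have [s s0 hs] := open_enorm (sopen H) Oz; have [y [_ _ ny] yz] := hz s s0.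
    by apply: ny; apply: hs; rewrite mir_isom.
(* The excess in the triangle inequality; it is zero exactly when [x] is on the segment from [z] to
   its mirror image. Minimizing it over the compact set [Z] takes the place of a convergent sequence
   of contact points. *)
pose f z := enorm (x - z) + enorm (x - mir e lam z) - enorm (z - mir e lam z).
have Z0 : Z !=set0 by exists z0; split=> //; exact: ltW.
have cf : cont_on Z f.
  move=> z _ s s0; exists (s / 8); first by rewrite divr_gt0.
  move=> y _ yz; have my := mir_isom lam y z e1.
  have h1 := ler_dist_enorm (x - y) (x - z).
  have h2 := ler_dist_enorm (x - mir e lam y) (x - mir e lam z).
  have h3 := ler_dist_enorm (y - mir e lam y) (z - mir e lam z).
  have E1 : x - y - (x - z) = - (y - z) by vec.
  have E2 : x - mir e lam y - (x - mir e lam z) = - (mir e lam y - mir e lam z) by vec.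
  have E3 : y - mir e lam y - (z - mir e lam z) = (y - z) - (mir e lam y - mir e lam z) by vec.
  rewrite E1 enormN in h1; rewrite E2 enormN my in h2; rewrite E3 in h3.
  have h4 := le_trans h3 (ler_enormB _ _); rewrite my in h4.
  move: h1 h2 h4 => /ler_normlP[a1 a2] /ler_normlP[a3 a4] /ler_normlP[a5 a6].
  rewrite /f; move: a1 a2 a3 a4 a5 a6 yz s0; move: (enorm (y - z)) (enorm (x - y)) (enorm (x - z)).
  move: (enorm (x - mir e lam y)) (enorm (x - mir e lam z)) (enorm (y - mir e lam y)) (enorm (z - mir e lam z)).
  by clear -H => *; apply/ltr_normlP; split; lra.
have [z [bz lz nz] zmin] := compact_min cZ Z0 cf.
have f0 : f z <= 0.
  apply/ler_addgt0Pr => d d0; rewrite add0r.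
  have [y [w [s [bw nw s0 sl yE]]] yx] := (closure_enorm _ _).1 cAx (d / 2) (divr_gt0 d0 (ltr0n R 2)).
  have lw : lam <= dot w e by clear -H s0 sl; lra.
  apply: le_trans (zmin w (And3 bw lw nw)) _; rewrite /f.
  have wm : w - mir e lam w = (2 * (dot w e - lam)) *: e by rewrite /mir; vec.
  have E1 : y - w = (- s) *: e by rewrite yE; vec.
  have E2 : y - mir e lam w = (2 * (dot w e - lam) - s) *: e.
    have -> : y - mir e lam w = (w - mir e lam w) - s *: e by rewrite yE; move: (mir e lam w) => m; vec.
    by rewrite wm scalerBl.
  have := enorm_tri x y w; have := enorm_tri x y (mir e lam w).
  rewrite wm E1 E2 !enormZ e1 !mulr1 normrN !gtr0_norm ?subr_gt0//; last by clear -H s0 sl; lra.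
  by rewrite (enormC x y); clear -H yx; lra.
pose t := dot z e - lam; have t0 : 0 <= t by rewrite subr_ge0.
have zm : z - mir e lam z = (2 * t) *: e by rewrite /mir /t; vec.
have h1 := dot_le (z - x) e; have h2 := dot_le (x - mir e lam z) e; rewrite e1 mulr1 in h1 h2.
have h3 : dot (z - x) e + dot (x - mir e lam z) e = 2 * t.
  rewrite -dotDl; have -> : z - x + (x - mir e lam z) = z - mir e lam z by vec.
  by rewrite zm dotZl dot1// mulr1.
rewrite /f zm enormZ e1 mulr1 ger0_norm ?mulr_ge0// (enormC x z) in f0.
have E : enorm (z - x) = dot (z - x) e by clear -H h1 h2 h3 f0; lra.
have E' : enorm (x - mir e lam z) = dot (x - mir e lam z) e by clear -H h1 h2 h3 f0; lra.
set s := enorm (z - x) in E.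
have zx : z - x = s *: e.
  apply/eqP; rewrite -subr_eq0 -dot_eq0; apply/eqP.
  rewrite dot_sqrB !dotZr !dotZl (dot1 e1) -E -enorm_sqr -/s.
  by ring.
have xz : x = z - s *: e by rewrite -zx; vec.
have s0 : 0 < s.
  rewrite enorm_gt0 subr_eq0; apply/eqP => zx'; apply: (boundary_out H bz); by rewrite zx'.
exists z, s; split=> //.
have : 0 < enorm (x - mir e lam z).
  by rewrite enorm_gt0 subr_eq0; apply/eqP => xm; apply: nz; rewrite -xm.
by rewrite E'; move: h3; rewrite -E /t; clear -H; lra.
Qed.

End MovingPlanes.

(** * From reflection symmetry in all directions to a ball *)

Section Ball.
Context {R : realType} {n : nat} {Om : set 'rV[R]_n}.
Implicit Types (x y h k e : 'rV[R]_n) (lam : R).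

(** The product of the coordinate reflections is the central symmetry at [c]. Combined with a mirror
    that misses [c] it yields a translation, impossible in a bounded set; so all mirrors pass
    through [c]. They then carry any point of a sphere around [c] to any other, and the segments of
    [folds] fill the inside. *)
Lemma symmetric_ball : (0 < n)%N -> open Om -> bounded_set Om -> Om !=set0 ->
  (forall e, enorm e = 1 -> exists lam, folds (Om := Om) e lam) -> exists x0 r, 0 < r /\ Om = eball x0 r.
Proof.
move=> n0 oO bO neO sym; have [M M0 hM] := bounded_closure bO.
have foldM e lam x : folds (Om := Om) e lam -> Om x -> Om (mir e lam x).
  by move=> F Ox; have := F x Ox 1 ler01 (lexx 1); rewrite scale1r addrC subrK.
pose ei i : 'rV[R]_n := delta_mx 0 i.
have ei1 i : enorm (ei i) = 1 by rewrite /enorm dot_delta mxE !eqxx sqrtr1.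
have /choice[l hl] : forall i, exists lam, folds (Om := Om) (ei i) lam by move=> i; exact: sym.
pose c := \row_i l i.
have central x : Om x -> Om (2 *: c - x).
  move=> Ox; pose xk (k : nat) := \row_j (if (j < k)%N then 2 * l j - x 0 j else x 0 j).
  have step (k : nat) : (k <= n)%N -> Om (xk k).
    elim: k => [_|k IH kn].
      by have -> : xk 0%N = x by apply/rowP => j; rewrite mxE.
    have := foldM _ _ _ (hl (Ordinal kn)) (IH (ltnW kn)); congr Om.
    apply/rowP => j; rewrite /mir dot_delta !mxE /= ltnn.
    case: (ltngtP j k) => [jk|jk|jk].
    - by rewrite ltnS (ltnW jk) (_ : (j == Ordinal kn) = false) ?mulr0 ?addr0//; apply/eqP => E; move: jk; rewrite E ltnn.
    - by rewrite ltnS leqNgt jk (_ : (j == Ordinal kn) = false) ?mulr0 ?addr0//; apply/eqP => E; move: jk; rewrite E ltnn.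
    - have -> : j = Ordinal kn by apply: val_inj.
      by rewrite eqxx /= ltnSn; ring.
  have := step n (leqnn n); congr Om; apply/rowP => j; rewrite !mxE ltn_ord; by [].
have through e lam : enorm e = 1 -> folds (Om := Om) e lam -> lam = dot c e.
  move=> e1 F; apply/eqP; rewrite -subr_eq0; apply/negPn/negP => dn.
  (* Applying mirror and central symmetry alternately, twice each, is the translation by
     [d *: e]. *)
  pose d := 4 * (dot c e - lam).
  have shift x : Om x -> Om (x + d *: e).
    move=> Ox; have := central _ (foldM _ _ _ F (central _ (foldM _ _ _ F Ox))); congr Om.
    rewrite /mir; have ee := dot1 e1; rewrite !dotBl !dotDl !dotZl ee /d.
    by apply/rowP => j; rewrite !mxE; ring.
  have [x0 Ox0] := neO.
  have many (k : nat) : Om (x0 + (k%:R * d) *: e).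
    elim: k => [|k IH]; first by rewrite mul0r scale0r addr0.
    have := shift _ IH; congr Om; rewrite -addrA -scalerDl; congr (_ + _ *: _).
    by rewrite -natr1; ring.
  have d0 : 0 < `|d| by rewrite normr_gt0 /d mulf_neq0// -oppr_eq0 opprB.
  pose k := Num.bound ((2 * M) / `|d|).
  have kd : 2 * M < k%:R * `|d|.
    by rewrite -ltr_pdivrMr//; apply: archi_boundP; rewrite divr_ge0 ?mulr_ge0 ?(ltW M0).
  have := hM _ (subset_closure (many k)); have := hM _ (subset_closure Ox0).
  have := ler_enormB (x0 + (k%:R * d) *: e) x0; rewrite addrC addKr enormZ e1 mulr1 normrM ger0_norm//.
  by clear -kd; lra.
have folds_c e : enorm e = 1 -> folds (Om := Om) e (dot c e).
  by move=> e1; have [lam F] := sym e e1; rewrite -(through e lam e1 F).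
have sphere x y : Om x -> enorm (y - c) = enorm (x - c) -> Om y.
  move=> Ox E; have [<-//|xy] := eqVneq x y.
  have xy0 : 0 < enorm (x - y) by rewrite enorm_gt0 subr_eq0.
  (* The mirror through [c] orthogonal to [x - y] exchanges [x] and [y], because they are
     equidistant from [c]. *)
  pose e := (enorm (x - y))^-1 *: (x - y).
  have e1 : enorm e = 1 by apply: unit_enorm; rewrite subr_eq0.
  have := foldM _ _ _ (folds_c e e1) Ox; congr Om.
  have K : 2 * dot (c - x) (x - y) = - enorm (x - y) ^+ 2.
    have E2 : dot (y - c) (y - c) = dot (x - c) (x - c) by rewrite -!enorm_sqr E.
    have h1 : y - c = (x - c) - (x - y) by vec.
    rewrite h1 in E2; have h2 : c - x = - (x - c) by vec.
    rewrite dot_sqrB in E2; rewrite h2 dotNl enorm_sqr; move: E2.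
    by clear; lra.
  rewrite /mir; have -> : (2 * (dot c e - dot x e)) *: e = - (x - y).
    have -> : 2 * (dot c e - dot x e) = (enorm (x - y))^-1 * (2 * dot (c - x) (x - y)).
      by rewrite /e !dotZr dotBl; ring.
    by rewrite K /e scalerA (_ : _ * _ = -1) ?scaleN1r//; field; rewrite gt_eqF.
  by vec.
have inner x y : Om x -> enorm (y - c) <= enorm (x - c) -> Om y.
  move=> Ox yx; have [E|xc] := eqVneq x c.
    by apply: (sphere x) => //; apply/eqP; rewrite eq_le yx E subrr enorm0 enorm_ge0.
  have xc0 : 0 < enorm (x - c) by rewrite enorm_gt0 subr_eq0.
  pose e := (enorm (x - c))^-1 *: (x - c).
  have e1 : enorm e = 1 by apply: unit_enorm; rewrite subr_eq0.
  pose s := enorm (y - c) / enorm (x - c).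
  have s0 : 0 <= s by rewrite divr_ge0 ?enorm_ge0.
  have s1 : s <= 1 by rewrite ler_pdivrMr// mul1r.
  have mx_ : mir e (dot c e) x - x = (-2) *: (x - c).
    rewrite /mir; have -> : 2 * (dot c e - dot x e) = - 2 * enorm (x - c).
      rewrite /e !dotZr -mulrBr -dotBl; have -> : c - x = - (x - c) by vec.
      by rewrite dotNl -enorm_sqr; field; rewrite gt_eqF.
    rewrite addrC addKr /e scalerA -mulrA divff ?gt_eqF// mulr1; by [].
  have := folds_c e e1 x Ox ((1 - s) / 2); rewrite mx_.
  have -> : x + ((1 - s) / 2) *: (- 2 *: (x - c)) = c + s *: (x - c).
    by apply/rowP => j; rewrite !mxE; field.
  move=> h; apply: (sphere (c + s *: (x - c))); first by apply: h; clear -s0 s1; lra.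
  have -> : c + s *: (x - c) - c = s *: (x - c) by move: (x - c) => v; vec.
  by rewrite enormZ ger0_norm// /s divfK// gt_eqF.
pose S := [set enorm (x - c) | x in Om].
have [x0 Ox0] := neO.
have hS : has_sup S.
  split; first by exists (enorm (x0 - c)), x0.
  exists (M + enorm c) => _ [x Ox <-]; apply: le_trans (ler_enormB _ _) _.
  by rewrite lerD2r hM//; exact: subset_closure.
have lt_sup x : Om x -> enorm (x - c) < sup S.
  move=> Ox; have [s s0 hs] := open_enorm oO Ox.
  (* A small step along [v] stays in [Om] and strictly increases the distance to [c]; so the
     supremum is not attained, and the ball obtained is the open one. *)
  have [v [v1 v0]] : exists v, enorm v = 1 /\ 0 <= dot (x - c) v.
    have [h|h] := leP 0 (dot (x - c) (ei (Ordinal n0))); first by exists (ei (Ordinal n0)).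
    by exists (- ei (Ordinal n0)); rewrite enormN dotNr oppr_ge0 ltW.
  pose y := x + (s / 2) *: v.
  have Oy : Om y.
    by apply: hs; rewrite addrC addKr enormZ v1 mulr1 gtr0_norm ?divr_gt0//; clear -s0; lra.
  apply: (@lt_le_trans _ _ (enorm (y - c))); last by apply: ub_le_sup; [case: hS|exists y].
  rewrite enorm_lt_sqr ?enorm_ge0// enorm_sqr.
  have -> : y - c = (x - c) + (s / 2) *: v by rewrite /y; vec.
  rewrite (dot_sqrD (x - c)) !dotZr !dotZl (dot1 v1).
  have : 0 < s / 2 * (s / 2) by rewrite mulr_gt0 ?divr_gt0.
  have : 0 <= s / 2 * dot (x - c) v by rewrite mulr_ge0// divr_ge0// ltW.
  by clear; lra.
exists c, (sup S); split; first by apply: le_lt_trans (lt_sup _ Ox0); exact: enorm_ge0.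
apply/seteqP; split=> [x /lt_sup//|y yS].
have d0 : 0 < sup S - enorm (y - c) by rewrite subr_gt0.
have [_ [x Ox <-] lt] := sup_adherent d0 hS.
by apply: (inner x) => //; clear -lt; lra.
Qed.

End Ball.

Theorem theorem1p1 (R : realType) (n : nat) (n_gt0 : (0 < n)%N) (p c : R)
    (Omega : set 'rV[R]_n) (u : 'rV[R]_n -> R)
    (p_gt1 : 1 < p) (c_lt0 : c < 0)
    (Omega_domain : bounded_domain Omega)
    (Omega_C2 : C2_boundary Omega)
    (u_cont : {within closure Omega, continuous u})
    (u_sol : viscosity_solution p Omega u)
    (u_dirichlet : dirichlet Omega u)
    (u_neumann : neumann c Omega u) :
  exists (x0 : 'rV[R]_n) (r : R), 0 < r /\ Omega = eball x0 r.
Proof.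
have [r [nu H]] := serrin_intro n_gt0 p_gt1 c_lt0 Omega_domain Omega_C2 u_cont u_sol u_dirichlet u_neumann.
apply: symmetric_ball n_gt0 (sopen H) (sbd H) (sne H) _ => e e1.
exact: (symmetry H e1).
Qed.
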